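(* Let $\Omega\subset\mathbb C^n$ be a bounded B-regular domain and let $f\in C(\overline\Omega)$, $f\ge 0$. Let $u\in\mathrm{PSH}(\Omega)\cap L^\infty(\Omega)$, and assume that $(dd^cu)^n\ge f\,dV$ in the Bedford--Taylor sense. Then there exists a decreasing sequence $u_j\in\mathrm{PSH}(\Omega)\cap C(\overline\Omega)$ such that $(dd^cu_j)^n\ge f\,dV$ for every $j$ and $u_j\searrow u^*$ pointwise on $\overline\Omega$.
   Context: $\mathrm{PSH}(\Omega)$ is the set of plurisubharmonic functions on $\Omega$; $dV$ is Lebesgue measure; $dd^c$ is a fixed positive multiple of $i\partial\bar\partial$; $(dd^cu)^n$ is the Bedford--Taylor Monge--Amp\`ere measure of a locally bounded plurisubharmonic function. A bounded domain $\Omega$ is B-regular (Sibony) if every $g\in C(\partial\Omega)$ is the boundary value of some function in $\mathrm{PSH}(\Omega)\cap C(\overline\Omega)$. For $u$ plurisubharmonic and bounded above on $\Omega$, $u^*(\zeta)=\limsup_{\Omega\ni z\to\zeta}u(z)$ for $\zeta\in\overline\Omega$ (so $u^*=u$ in $\Omega$). *)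

(* Defs.v *)
From HB Require Import structures.
From mathcomp Require Import all_boot all_order all_algebra.
From mathcomp.real_closed Require Import complex.
From mathcomp Require Import all_classical all_reals all_analysis.

Set Implicit Arguments.
Unset Strict Implicit.
Unset Printing Implicit Defensive.

Import Order.TTheory GRing.Theory Num.Theory.
Import numFieldNormedType.Exports.

Local Open Scope classical_set_scope.
Local Open Scope ring_scope.

(* A point z = x + iy of C^n is stored as the pair (x, y) of its real and
   imaginary parts, so that C^n is a normed space over R and the library's real
   derivatives apply.  The sup norm of R^n x R^n induces the usual topology. *)
Definition Cn (R : realType) (n : nat) := ('rV[R]_n * 'rV[R]_n)%type.

(* C^n with its Borel sigma-algebra. *)
Definition borelCn (R : realType) (n : nat) :=
  g_sigma_algebraType (@open (Cn R n)).

Section lebesgue.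
Variable R : realType.
Notation mR := (measurableTypeR R).

Definition image_measure d1 d2 (T1 : measurableType d1) (T2 : measurableType d2)
    (m : {measure set T1 -> \bar R}) (f : T1 -> T2)
    (mf : measurable_fun [set: T1] f) : {measure set T2 -> \bar R} :=
  measure_function_pushforward__canonical__measure_function_Measure m mf.

Definition cons_pair d (p : mR * d.-tuple mR) : d.+1.-tuple mR :=
  [tuple of p.1 :: p.2].

Lemma measurable_cons_pair d : measurable_fun [set: _] (@cons_pair d).
Proof. exact: measurable_cons. Qed.

(* The d-fold product of Lebesgue measure on the line. *)
Fixpoint lebesgue_tuple d : {measure set (d.-tuple mR) -> \bar R} :=
  match d with
  | 0 => \d_([tuple] : 0.-tuple mR)
  | d'.+1 =>
      @image_measure _ _ _ _ (@lebesgue_measure R \x^ lebesgue_tuple d')%E _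
        (@measurable_cons_pair d')
  end.

Definition Cn_of_tuple n (t : (n + n).-tuple mR) : borelCn R n :=
  (\row_i tnth t (lshift n i), \row_i tnth t (rshift n i)).

Lemma measurable_Cn_of_tuple n : measurable_fun [set: _] (@Cn_of_tuple n).
Proof.
pose rV_of (q : 'rV[rat]_n) : 'rV[R]_n := \row_i ratr (q ord0 i).
pose B (p : 'rV[rat]_n * 'rV[rat]_n * nat) : set (Cn R n) :=
  ball ((rV_of p.1.1, rV_of p.1.2) : Cn R n) p.2.+1%:R^-1.
have mB p : measurable ((@Cn_of_tuple n) @^-1` B p).
  have -> : (@Cn_of_tuple n) @^-1` B p = \bigcap_(i in [set: 'I_n])
      (((@tnth _ mR ^~ (lshift n i)) @^-1`
          ball (ratr (p.1.1 ord0 i) : R) p.2.+1%:R^-1) `&`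
       ((@tnth _ mR ^~ (rshift n i)) @^-1`
          ball (ratr (p.1.2 ord0 i) : R) p.2.+1%:R^-1)).
    apply/seteqP; split=> [t [/= [_ h1] [_ h2]] i _ /=|t h].
      by have := h1 ord0 i; have := h2 ord0 i; rewrite !mxE.
    by split; split=> //= j i; rewrite ord1 !mxE; have [] := h i I.
  apply: fin_bigcap_measurable => // i _.
  by apply: measurableI; rewrite -[X in measurable X]setTI;
    apply: measurable_tnth => //;
    rewrite ball_itv; exact: measurable_itv.
apply: (@measurability _ _ _ (borelCn R n) _ _ (@open (Cn R n))) => //.
move=> _ [U oU <-]; rewrite setTI.
have -> : (@Cn_of_tuple n) @^-1` U =
    \bigcup_(p in [set p | B p `<=` U]) ((@Cn_of_tuple n) @^-1` B p).
  apply/seteqP; split=> [t /= Ut|t [p Dp]/=]; last exact: Dp.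
  set z : Cn R n := Cn_of_tuple t.
  have : nbhs z U by exact: open_nbhs_nbhs.
  move=> /nbhs_ballP[e /= e0 zeU].
  have [k ke] : exists k : nat, k.+1%:R^-1 < e / 2.
    have e20 : 0 < e / 2 by rewrite divr_gt0.
    have [k _ /(_ k (leqnn k))] := near_infty_natSinv_lt (PosNum e20).
    by exists k.
  have approx (x : R) : {q : rat | ball (ratr q : R) k.+1%:R^-1 x}.
    apply: cid; have k0 : 0 < k.+1%:R^-1 :> R by rewrite invr_gt0.
    have : x - k.+1%:R^-1 < x + k.+1%:R^-1 by rewrite ltrBlDr -addrA ltrDl addr_gt0.
    move=> /rat_in_itvoo[q]; rewrite in_itv/= => /andP[q1 q2]; exists q.
    by rewrite /ball/= ltr_distlC; apply/andP; split; rewrite ?ltrBlDr // -?ltrBlDr.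
  pose q1 : 'rV[rat]_n := \row_i sval (approx (z.1 ord0 i)).
  pose q2 : 'rV[rat]_n := \row_i sval (approx (z.2 ord0 i)).
  have q1E i : rV_of q1 ord0 i = ratr (sval (approx (z.1 ord0 i))) by rewrite 2!mxE.
  have q2E i : rV_of q2 ord0 i = ratr (sval (approx (z.2 ord0 i))) by rewrite 2!mxE.
  have Bz : B (q1, q2, k) z.
    split; split=> //= j i; rewrite ord1 ?q1E ?q2E.
      exact: (svalP (approx (z.1 ord0 i))).
    exact: (svalP (approx (z.2 ord0 i))).
  exists (q1, q2, k) => //= w Bw; apply: zeU.
  have kk : k.+1%:R^-1 + k.+1%:R^-1 <= e :> R.
    by rewrite [leRHS]splitr lerD// ltW.
  by apply: le_ball kk _ _; apply: (ball_triangle _ Bw); exact: ball_sym.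
rewrite bigcup_mkcond; apply: countable_bigcupT_measurable.
  exact: countableP.
by move=> p; case: ifPn.
Qed.

(* Lebesgue measure dV on C^n = R^(2n). *)
Definition lebesgueCn n : {measure set (borelCn R n) -> \bar R} :=
  image_measure (lebesgue_tuple (n + n)) (@measurable_Cn_of_tuple n).

End lebesgue.

Section pluripotential.
Variables (R : realType) (n : nat).
Implicit Types (Omega : set (Cn R n)) (u f phi : Cn R n -> R).

Definition is_domain Omega := [/\ open Omega, connected Omega & Omega !=set0].

(* Multiplication of the vector b by the complex number s + it. *)
Definition cscale (s t : R) (b : Cn R n) : Cn R n :=
  (s *: b.1 - t *: b.2, s *: b.2 + t *: b.1).

(* For Omega open and connected: upper semicontinuous with values in
   [-oo, +oo[, not identically -oo, and satisfying the sub-mean value inequality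
   on every closed disc {a + zeta b : |zeta| <= 1} contained in Omega. *)
Definition psh Omega (u : Cn R n -> \bar R) :=
  [/\ forall z, Omega z -> (u z < +oo)%E,
      forall z, Omega z -> forall r : R, (u z < r%:E)%E ->
        \forall w \near z, (u w < r%:E)%E,
      exists2 z, Omega z & u z != -oo%E
    & forall a b : Cn R n,
        (forall s t : R, s ^+ 2 + t ^+ 2 <= 1 -> Omega (a + cscale s t b)) ->
        (u a <= ((2 * pi)^-1)%:E *
          \int[@lebesgue_measure R]_(theta in `[0%R, (2 * pi)%R]%classic)
            u (a + cscale (cos theta) (sin theta) b)%R)%E].

(* Only the values of u on Omega matter. *)
Definition usc_extension Omega u (zeta : Cn R n) : \bar R :=
  limf_esup (EFin \o u) (within Omega (nbhs zeta)).

Definition boundary Omega := closure Omega `\` Omega°.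

Definition B_regular Omega := forall g : Cn R n -> R,
  {within boundary Omega, continuous g} ->
  exists v : Cn R n -> R,
    [/\ psh Omega (EFin \o v),
        {within closure Omega, continuous v}
      & forall zeta, boundary Omega zeta -> v zeta = g zeta].

Definition iter_derive (vs : seq (Cn R n)) phi : Cn R n -> R :=
  foldr (fun v (g : Cn R n -> R) => 'D_v g) phi vs.

Definition smooth phi := forall vs z, differentiable (iter_derive vs phi) z.

Definition test_function Omega phi := smooth phi /\
  exists K : set (Cn R n),
    [/\ compact K, K `<=` Omega & forall z, ~ K z -> phi z = 0].

Definition dx (a : 'I_n) : Cn R n := (delta_mx 0 a, 0).
Definition dy (a : 'I_n) : Cn R n := (0, delta_mx 0 a).

(* d^2 phi / (dz_a dzbar_b), where d/dz = (d/dx - i d/dy) / 2 and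
   d/dzbar = (d/dx + i d/dy) / 2. *)
Definition ddbar (a b : 'I_n) phi (z : Cn R n) : R[i] :=
  Complex (('D_(dx a) ('D_(dx b) phi) z + 'D_(dy a) ('D_(dy b) phi) z) / 4)
          (('D_(dx a) ('D_(dy b) phi) z - 'D_(dy a) ('D_(dx b) phi) z) / 4).

(* A current T with measure coefficients is written sum_(I, J) T_IJ w_IJ, where,
   for I = {i1 < ... < ik} and J = {j1 < ... < jk},
     w_IJ = (i dz_i1 /\ dzbar_j1) /\ ... /\ (i dz_ik /\ dzbar_jk)
   and the complex measure T_IJ is given by a density T_IJ = coef I J * mass
   with respect to a common positive measure.  For a current of bidegree (k, k)
   only the coefficients with #|I| = #|J| = k are relevant. *)
Record current := Current {
  mass : {measure set (borelCn R n) -> \bar R} ;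
  coef : {set 'I_n} -> {set 'I_n} -> Cn R n -> R[i] }.

Definition radon_on Omega (mu : {measure set (borelCn R n) -> \bar R}) :=
  forall K : set (Cn R n), compact K -> K `<=` Omega -> (mu K < +oo)%E.

Definition current_on Omega (T : current) :=
  [/\ radon_on Omega (mass T),
      forall I J, @measurable_fun _ _ (borelCn R n) (measurableTypeR R) Omega
                    (fun z => complex.Re (coef T I J z)),
      forall I J, @measurable_fun _ _ (borelCn R n) (measurableTypeR R) Omega
                    (fun z => complex.Im (coef T I J z))
    & forall I J z, Omega z ->
        complex.Re (coef T I J z) ^+ 2 + complex.Im (coef T I J z) ^+ 2 <= 1].

(* The integral of psi over Omega against the complex measure T_IJ. *)
Definition pairing Omega (T : current) (I J : {set 'I_n})
    (psi : Cn R n -> R[i]) : R[i] :=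
  Complex (\int[mass T]_(z in Omega) complex.Re (coef T I J z * psi z))
          (\int[mass T]_(z in Omega) complex.Im (coef T I J z * psi z)).

(* dz_a /\ dz_(I \ a) = wedge_sign a I dz_I for a in I. *)
Definition wedge_sign (a : 'I_n) (I : {set 'I_n}) : R[i] :=
  (-1) ^+ #|[set i in I | (i < a)%N]%SET|.

(* T = (dd^c u)^k on Omega as currents, where dd^c = c i d dbar, by the
   Bedford-Taylor recursion (dd^c u)^(k+1) = dd^c (u (dd^c u)^k), the outer dd^c
   being taken in the sense of distributions coefficient by coefficient, using
     i d dbar (g w_IJ) = sum_(a, b) g_(a bbar) (i dz_a /\ dzbar_b) /\ w_IJ. *)
Fixpoint ddc_power (c : R) Omega u (k : nat) (T : current) : Prop :=
  current_on Omega T /\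
  match k with
  | 0 => forall phi, test_function Omega phi ->
      pairing Omega T finset.set0 finset.set0 (fun z => (phi z)%:C%C) =
      (\int[lebesgueCn R n]_(z in Omega) phi z)%:C%C
  | k'.+1 => exists2 S : current, ddc_power c Omega u k' S &
      forall I J : {set 'I_n}, #|I| = k'.+1 -> #|J| = k'.+1 ->
      forall phi, test_function Omega phi ->
        pairing Omega T I J (fun z => (phi z)%:C%C) =
        \sum_(a in I) \sum_(b in J)
          c%:C%C * wedge_sign a I * wedge_sign b J *
          pairing Omega S (I :\ a)%SET (J :\ b)%SET
            (fun z => (u z)%:C%C * ddbar a b phi z)
  end.

(* mu = (dd^c u)^n on Omega.  The factor 2^n comes from w_IJ = 2^n dV for
   I = J = {1, ..., n}, as i dz /\ dzbar = 2 dx /\ dy. *)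
Definition monge_ampere (c : R) Omega u
    (mu : {measure set (borelCn R n) -> \bar R}) :=
  radon_on Omega mu /\
  exists2 T : current, ddc_power c Omega u n T &
    forall phi, test_function Omega phi ->
      (\int[mu]_(z in Omega) phi z)%:C%C =
      2 ^+ n * pairing Omega T finset.setT finset.setT (fun z => (phi z)%:C%C).

(* (dd^c u)^n >= f dV as measures on Omega. *)
Definition monge_ampere_ge (c : R) Omega u f :=
  exists2 mu : {measure set (borelCn R n) -> \bar R}, monge_ampere c Omega u mu &
    forall A : set (borelCn R n), measurable A -> A `<=` Omega ->
      (\int[lebesgueCn R n]_(z in A) (f z)%:E <= mu A)%E.

End pluripotential.

(* Main.v *)
(* If a smooth p touches u from above at x, then the Levi forms of p along every
   unimodular basis of C^n sum to at least n lam, where n! (2c)^n lam^n is the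
   infimum of f near x: otherwise the Monge-Ampere energies of u and of p plus a
   small quadratic term, tested against flat' (u - p + s), would contradict each
   other.  Averaging over random walks along the basis, the same linear bound
   holds for the convolutions u * rho, and by the arithmetic-geometric inequality
   it says that their Hessian determinants dominate f; being linear, it survives smooth maxima.
   Given a continuous Phi > u, B-regularity yields v <= Phi, strictly
   plurisubharmonic and close to Phi at the boundary.  Gluing u * rho to
   convolutions of v by a locally finite sequence of smooth maxima produces a
   smooth plurisubharmonic function between u and Phi, continuous up to the
   boundary, with (dd^c)^n >= f dV.  Taking for Phi the minimum of the function
   found so far and of the k-Lipschitz envelope of u plus 1/(k+1) gives the sequence. *)
From HB Require Import structures.
From mathcomp Require Import all_boot all_order all_algebra.
From mathcomp.real_closed Require Import complex.
From mathcomp Require Import all_classical all_reals all_analysis.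
From mathcomp Require Import measurable_realfun.
From mathcomp Require Import ring lra.
Require Import Defs.

Set Implicit Arguments.
Unset Strict Implicit.
Unset Printing Implicit Defensive.

Import Order.TTheory GRing.Theory Num.Theory.
Import numFieldNormedType.Exports.

Local Open Scope classical_set_scope.
Local Open Scope ring_scope.

(** The Bedford-Taylor powers come as a recursion through distributions, so all that is known of
    them are iterated limits, one index per factor, of integrals of mixed Hessians of averages of u.
    The touching argument needs these indices equal. Integration by parts turns a change of one
    factor into a difference of energies with one factor fewer; such energies are nearly monotone in
    their indices, hence converge, and the iterated limit is bounded by a diagonal value. The
    touching inequality holds only at contact points, while the convolutions need it in the sense of
    distributions. The random walk bridges the two, since one step of it uses the inequality only at
    a maximum point. Unimodular bases B linearize the determinant: for H > 0, det(H)^(1/n) is the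
    least value of tr(B^* B H) / n. In n! (2c)^n, n! stems from the n-th exterior power, c^n from
    dd^c, and 2^n from i dz /\ dzbar = 2 dx /\ dy. As u is only upper semicontinuous, u < Phi is
    kept in the form u(y) <= Phi(z) - eta for y near z; every function constructed satisfies it
    again, which makes the induction possible. *)

Lemma dist_lt_half {R : realFieldType} (a b p e : R) : `|a - p| < e / 2 -> `|p - b| < e / 2 -> `|a - b| <= e.
Proof.
move=> h1 h2; rewrite -(subrK p a) -addrA [e]splitr.
by apply: le_trans (ler_normD _ _) _; rewrite lerD // ltW.
Qed.

(** * Smooth functions: stability under the usual operations, symmetry of second derivatives *)

Section line.
Context {R : realType} {V : normedModType R}.
Implicit Types (f : V -> R) (F : R -> R).

Lemma is_derive_line f (z v : V) (t : R) : differentiable f (z + t *: v) ->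
  is_derive t (1 : R) (fun s => f (z + s *: v)) ('D_v f (z + t *: v)).
Proof.
move=> df.
have d1 : differentiable (fun s : R => s *: v) t by exact: differentiableZl.
have dl : differentiable (fun s : R => z + s *: v) t by exact: differentiableD.
have dc : differentiable (fun s : R => f (z + s *: v)) t.
  exact: (@differentiable_comp _ R V R (fun s : R => z + s *: v) f t).
apply: DeriveDef; first exact/derivable1_diffP.
rewrite deriveE // (@diff_comp _ R V R (fun s : R => z + s *: v) f t) //=.
rewrite diffD // diff_cst diffZl // diff_val /=.
have -> : (0 : R -> V) 1 + 1 *: v = v by rewrite scale1r [LHS]add0r.
by rewrite deriveE.
Qed.

Lemma derive_compE F f (z v : V) : derivable F (f z) 1 -> differentiable f z ->
  'D_v (F \o f) z = derive1 F (f z) * 'D_v f z.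
Proof.
move=> dF df; have dF' : differentiable F (f z) by exact/derivable1_diffP.
rewrite !deriveE //; last exact: differentiable_comp.
by rewrite diff_comp //= deriv1E // /GRing.scale /= mulrC.
Qed.

End line.

Section smooth1.
Context {R : realType}.
Implicit Types F G : R -> R.

Definition smooth1 F := forall k x, derivable (derive1n k F) x 1.

Lemma smooth1_derive F : smooth1 F -> smooth1 (derive1 F).
Proof. by move=> sF k x; rewrite -derive1Sn. Qed.

Lemma smooth1_derivable F x : smooth1 F -> derivable F x 1.
Proof. by move=> /(_ 0%N x). Qed.

Lemma smooth1_continuous F : smooth1 F -> continuous F.
Proof.
move=> sF x; apply: differentiable_continuous.
exact/derivable1_diffP/smooth1_derivable.
Qed.

(** Coinduction on a class stable under derivation. It avoids any formula for the k-th derivative of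
    a product or of a composite. *)
Lemma smooth1_coind (P : (R -> R) -> Prop) : (forall F, P F -> (forall x, derivable F x 1) /\ P (derive1 F)) ->
  forall F, P F -> smooth1 F.
Proof.
move=> H F PF k x; suff : P (derive1n k F) by move=> /H[].
by elim: k => // k IH; rewrite derive1nS; have [] := H _ IH.
Qed.

End smooth1.

Section smooth.
Context {R : realType} {n : nat}.
Notation C := (Cn R n).
Implicit Types (f g k : C -> R) (F : R -> R) (z v w : C).

Lemma smooth_coind (P : (C -> R) -> Prop) :
  (forall f, P f -> (forall z, differentiable f z) /\ forall v, P ('D_v f)) -> forall f, P f -> smooth f.
Proof.
move=> H f Pf vs z; suff : P (iter_derive vs f) by move=> /H[].
by elim: vs => //= v vs IH; have [_] := H _ IH; apply.
Qed.

Lemma smooth_diff f z : smooth f -> differentiable f z.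
Proof. by move=> /(_ [::] z). Qed.

Lemma smooth_derivable f z v : smooth f -> derivable f z v.
Proof. by move=> /smooth_diff df; exact: diff_derivable. Qed.

Lemma smooth_derive f v : smooth f -> smooth ('D_v f).
Proof.
move=> sf vs z; have := sf (rcons vs v) z.
by rewrite /iter_derive foldr_rcons.
Qed.

Lemma smooth_cont f : smooth f -> continuous f.
Proof.
by move=> sf z; apply: differentiable_continuous; exact: smooth_diff.
Qed.

Lemma derive_translate f (a v z : C) : 'D_v (fun w => f (w + a)) z = 'D_v f (z + a).
Proof.
rewrite /derive /=.
by under eq_fun do rewrite -addrA.
Qed.

Lemma smooth_translate f (a : C) : smooth f -> smooth (fun w => f (w + a)).
Proof.
move=> sf.
apply: (@smooth_coind (fun g => exists2 h, smooth h & g = fun w => h (w + a))); last by exists f.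
move=> _ [h sh ->]; split=> [z|v]. apply: (@differentiable_comp _ C C R (fun w => w + a) h z).
      exact: differentiableD. exact: smooth_diff. exists ('D_v h); first exact: smooth_derive.
  by apply/funext => z; rewrite derive_translate.
Qed.

(** Products alone or compositions alone are not stable under derivation, since the Leibniz and
    chain rules mix them with sums; the class generated by all three is, so that [smooth_coind]
    applies to it. *)
Inductive smooth_gen : (C -> R) -> Prop :=
| smooth_gen_smooth f : smooth f -> smooth_gen f
| smooth_gen_add f g : smooth_gen f -> smooth_gen g -> smooth_gen (f \+ g)
| smooth_gen_mul f g : smooth_gen f -> smooth_gen g -> smooth_gen (f \* g)
| smooth_gen_comp F f : smooth1 F -> smooth f -> smooth_gen (F \o f).

Lemma smooth_gen_spec f : smooth_gen f -> (forall z, differentiable f z) /\ forall v, smooth_gen ('D_v f).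
Proof.
elim=> {f} [f sf|f g Gf [df IHf] Gg [dg IHg]|f g Gf [df IHf] Gg [dg IHg]|F f sF sf].
- split=> [z|v]; first exact: smooth_diff. by apply: smooth_gen_smooth; exact: smooth_derive.
- split=> [z|v]; first exact: differentiableD. have -> : 'D_v (f \+ g) = 'D_v f \+ 'D_v g.
    by apply/funext => z; apply: deriveD; exact: diff_derivable. exact: smooth_gen_add.
- split=> [z|v]; first exact: differentiableM. have -> : 'D_v (f \* g) = (f \* 'D_v g) \+ (g \* 'D_v f).
    by apply/funext => z; apply: deriveM; exact: diff_derivable. by apply: smooth_gen_add; exact: smooth_gen_mul.
- split=> [z|v]. apply: differentiable_comp; first exact: smooth_diff. exact/derivable1_diffP/smooth1_derivable.
  have -> : 'D_v (F \o f) = ((derive1 F) \o f) \* 'D_v f.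
    apply/funext => z; apply: derive_compE; first exact: smooth1_derivable. exact: smooth_diff.
  apply: smooth_gen_mul; last exact/smooth_gen_smooth/smooth_derive. exact/smooth_gen_comp/sf/smooth1_derive.
Qed.

Lemma smooth_genP f : smooth_gen f -> smooth f.
Proof. by apply: smooth_coind f => f /smooth_gen_spec. Qed.

Lemma smoothD f g : smooth f -> smooth g -> smooth (fun z => f z + g z).
Proof. by move=> sf sg; apply: (@smooth_genP (f \+ g)); apply: smooth_gen_add; exact: smooth_gen_smooth. Qed.

Lemma smoothM f g : smooth f -> smooth g -> smooth (fun z => f z * g z).
Proof. by move=> sf sg; apply: (@smooth_genP (f \* g)); apply: smooth_gen_mul; exact: smooth_gen_smooth. Qed.

Lemma smooth_comp F f : smooth1 F -> smooth f -> smooth (fun z => F (f z)).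
Proof. by move=> sF sf; apply: (@smooth_genP (F \o f)); exact: smooth_gen_comp. Qed.

Lemma smooth_cst (a : R) : smooth (fun _ : C => a).
Proof.
apply: (@smooth_coind (fun f => exists c, f = cst c)); last by exists a.
move=> f [c ->]; split=> [z|v]; first exact: differentiable_cst.
by exists 0; apply/funext => z; rewrite derive_cst.
Qed.

Lemma smoothN f : smooth f -> smooth (fun z => - f z).
Proof.
move=> sf; have := smoothM (smooth_cst (-1)) sf.
by congr smooth; apply/funext => z; rewrite mulN1r.
Qed.

Lemma smoothB f g : smooth f -> smooth g -> smooth (fun z => f z - g z).
Proof. by move=> sf sg; apply: smoothD => //; exact: smoothN. Qed.

Lemma smooth_sum (I : Type) (r : seq I) (P : pred I) (f : I -> C -> R) :
  (forall i, P i -> smooth (f i)) -> smooth (fun z => \sum_(i <- r | P i) f i z).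
Proof.
move=> sf; elim: r => [|i r IH]. have -> : (fun z : C => \sum_(i <- [::] | P i) f i z) = (fun=> 0).
    by apply/funext => z; rewrite big_nil. exact: smooth_cst.
case: (boolP (P i)) => Pi. have -> : (fun z : C => \sum_(i <- i :: r | P i) f i z) =
      (fun z => f i z + \sum_(i <- r | P i) f i z). by apply/funext => z; rewrite big_cons Pi.
  by apply: smoothD => //; exact: sf.
have -> // : (fun z : C => \sum_(i <- i :: r | P i) f i z) = (fun z => \sum_(i <- r | P i) f i z).
by apply/funext => z; rewrite big_cons (negbTE Pi).
Qed.

Lemma smooth_linear (f : {linear C -> R}) : continuous f -> smooth f.
Proof.
move=> cf; apply: (@smooth_coind (fun g => g = f \/ smooth g)); last by left.
move=> g [->|sg]. split=> [z|v]; first exact: linear_differentiable. right; have -> : 'D_v f = cst (f v).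
    apply/funext => z; rewrite deriveE; last exact: linear_differentiable. by rewrite diff_lin. exact: smooth_cst.
split=> [z|v]; first exact: smooth_diff.
by right; exact: smooth_derive.
Qed.

Lemma derive_near_eq f g (A : set C) z v : open A -> A z -> {in A, f =1 g} -> 'D_v f z = 'D_v g z.
Proof.
move=> oA Az fg; apply: near_eq_derive.
near=> w; apply: fg; rewrite inE; near: w.
exact: open_nbhs_nbhs.
Unshelve. all: by end_near. Qed.

Lemma smooth_line f z v : smooth f -> forall t : R,
  is_derive t (1 : R) (fun s => f (z + s *: v)) ('D_v f (z + t *: v)).
Proof. by move=> sf t; apply: is_derive_line; exact: smooth_diff. Qed.

Lemma smooth_line_continuous f z v : smooth f -> continuous (fun s : R => f (z + s *: v)).
Proof.
move=> sf s; apply: differentiable_continuous; apply/derivable1_diffP.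
by have [] := smooth_line z v sf s.
Qed.

Lemma smooth_MVT f z v (t : R) : smooth f -> 0 < t ->
  exists2 s : R, 0 < s < t & f (z + t *: v) - f z = t * 'D_v f (z + s *: v).
Proof.
move=> sf t0; have [|s] := MVT t0 (fun s _ => smooth_line z v sf s).
  by apply: continuous_subspaceT; exact: smooth_line_continuous.
rewrite in_itv /= scale0r addr0 subr0 => st ->.
by exists s => //; rewrite mulrC.
Qed.

Lemma continuous_ball f z (e : R) : {for z, continuous f} -> 0 < e ->
  exists2 d : R, 0 < d & forall w, ball z d w -> `|f z - f w| < e.
Proof.
by move=> /cvgrPdist_lt/[apply] /nbhs_ballP[d /= d0 H]; exists d.
Qed.

Lemma ball_line z v w (e : R) : 0 < e -> exists2 d : R, 0 < d & forall s t : R, 0 <= s <= d -> 0 <= t <= d ->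
    ball z e (z + s *: v + t *: w).
Proof.
move=> e0; exists (e / 2 / (`|v| + `|w| + 1)). by rewrite !divr_gt0 // ltr_wpDl ?addr_ge0.
move=> s t /andP[s0 sd] /andP[t0 td].
rewrite -ball_normE /= -addrA opprD addNKr normrN.
have N0 : 0 < `|v| + `|w| + 1 by rewrite ltr_wpDl ?addr_ge0.
apply: le_lt_trans (ler_normD _ _) _; rewrite !normrZ !ger0_norm //.
have := ler_pM s0 (normr_ge0 v) sd (lexx _) => h1.
have := ler_pM t0 (normr_ge0 w) td (lexx _) => h2.
apply: le_lt_trans (lerD h1 h2) _; rewrite -mulrDr mulrAC ltr_pdivrMr //.
have : 0 <= `|v| + `|w| by exact: addr_ge0.
by nra.
Qed.

(* Both mixed second derivatives are values, at points close to z, of the same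
   second difference quotient. *)
Lemma smooth_schwarz f u v : smooth f -> 'D_u ('D_v f) = 'D_v ('D_u f).
Proof.
move=> sf; apply/funext => z; apply/eqP; rewrite -subr_eq0 -normr_le0.
apply/ler_addgt0Pl => e e0; rewrite addr0.
have key (a b : C) : forall t : R, 0 < t -> exists s r : R,
    [/\ 0 <= s <= t, 0 <= r <= t & f (z + t *: a + t *: b) - f (z + t *: a)
      - (f (z + t *: b) - f z) = t * (t * 'D_b ('D_a f) (z + s *: a + r *: b))]. move=> t t0.
  pose g w := f (w + t *: b) - f w. have sg : smooth g. by apply: smoothB => //; exact: smooth_translate.
  have [s /andP[s0 st] gE] := smooth_MVT z a sg t0. have DgE : 'D_a g (z + s *: a) =
      'D_a f (z + s *: a + t *: b) - 'D_a f (z + s *: a). rewrite /g deriveB; last exact: smooth_derivable.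
      by rewrite derive_translate. exact/smooth_derivable/smooth_translate.
  have [r /andP[r0 rt] DE] := smooth_MVT (z + s *: a) b (smooth_derive a sf) t0.
  exists s, r; rewrite (ltW s0) (ltW st) (ltW r0) (ltW rt); split=> //. by rewrite -DE -DgE -gE.
have cuv := smooth_cont (smooth_derive u (smooth_derive v sf)).
have cvu := smooth_cont (smooth_derive v (smooth_derive u sf)).
have e20 : 0 < e / 2 by rewrite divr_gt0.
have [d1 d10 H1] := continuous_ball (cuv z) e20.
have [d2 d20 H2] := continuous_ball (cvu z) e20.
have [m1 m10 M1] := ball_line z v u d10.
have [m2 m20 M2] := ball_line z u v d20.
pose t := Num.min m1 m2.
have t0 : 0 < t by rewrite lt_min m10.
have tm1 : t <= m1 by rewrite ge_min lexx.
have tm2 : t <= m2 by rewrite ge_min lexx orbT.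
have [s [r [/andP[s0 st] /andP[r0 rt] E1]]] := key v u t t0.
have [s' [r' [/andP[s'0 s't] /andP[r'0 r't] E2]]] := key u v t t0.
have E : 'D_u ('D_v f) (z + s *: v + r *: u) = 'D_v ('D_u f) (z + s' *: u + r' *: v).
  have tn0 : t != 0 by rewrite gt_eqF. apply: (mulfI tn0); apply: (mulfI tn0).
  have sw (a b c d : R) : a - b - (c - d) = a - c - (b - d) by ring. rewrite sw (addrAC z (t *: v)) in E1.
  exact: etrans (esym E1) E2.
have h1 : `|'D_u ('D_v f) z - 'D_u ('D_v f) (z + s *: v + r *: u)| < e / 2.
  by apply: (H1 _ (M1 s r _ _)); rewrite ?s0 ?r0 /= (le_trans _ tm1).
have h2 : `|'D_v ('D_u f) z - 'D_v ('D_u f) (z + s' *: u + r' *: v)| < e / 2.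
  by apply: (H2 _ (M2 s' r' _ _)); rewrite ?s'0 ?r'0 /= (le_trans _ tm2).
rewrite -E distrC in h2; exact: dist_lt_half h1 h2.
Qed.

End smooth.

Section smooth1_closure.
Context {R : realType}.
Implicit Types F G : R -> R.

Inductive smooth1_gen : (R -> R) -> Prop :=
| smooth1_gen_smooth F : smooth1 F -> smooth1_gen F
| smooth1_gen_add F G : smooth1_gen F -> smooth1_gen G -> smooth1_gen (F \+ G)
| smooth1_gen_mul F G : smooth1_gen F -> smooth1_gen G -> smooth1_gen (F \* G)
| smooth1_gen_comp F G : smooth1 F -> smooth1 G -> smooth1_gen (F \o G)
| smooth1_gen_inv F : smooth1 F -> (forall x, F x != 0) -> smooth1_gen (fun x => (F x)^-1).

Lemma smooth1_opp F : smooth1 F -> smooth1 (fun x => - F x).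
Proof.
move=> sF.
apply: (@smooth1_coind _ (fun G => exists2 F', smooth1 F' & G = fun x => - F' x)); last by exists F.
move=> _ [G sG ->]; split=> [x|]. exact/derivableN/smooth1_derivable.
  exists (derive1 G); first exact: smooth1_derive. apply/funext => x; rewrite !derive1E; apply: deriveN.
  exact: smooth1_derivable.
Qed.

Lemma smooth1_gen_spec F : smooth1_gen F -> (forall x, derivable F x 1) /\ smooth1_gen (derive1 F).
Proof.
elim=> {F} [F sF|F G _ [dF HF] _ [dG HG]|F G GF [dF HF] GG [dG HG]|F G sF sG|F sF F0].
- split=> [x|]; first exact: smooth1_derivable. exact/smooth1_gen_smooth/smooth1_derive.
- split=> [x|]; first exact: derivableD. have -> : derive1 (F \+ G) = derive1 F \+ derive1 G.
    by apply/funext => x; rewrite /= !derive1E; exact: deriveD. exact: smooth1_gen_add.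
- split=> [x|]; first exact: derivableM. have -> : derive1 (F \* G) = (F \* derive1 G) \+ (G \* derive1 F).
    by apply/funext => x; rewrite /= !derive1E; exact: deriveM. by apply: smooth1_gen_add; exact: smooth1_gen_mul.
- have dFG x : derivable (F \o G) x 1. apply/derivable1_diffP/differentiable_comp;
    exact/derivable1_diffP/smooth1_derivable.
  split=> //; have -> : derive1 (F \o G) = (derive1 F \o G) \* derive1 G.
    by apply/funext => x; rewrite /= derive1_comp //; exact: smooth1_derivable.
  apply: smooth1_gen_mul; last exact/smooth1_gen_smooth/smooth1_derive. exact/smooth1_gen_comp/sG/smooth1_derive.
- split=> [x|]; first exact/derivableV/smooth1_derivable. have -> : derive1 (fun x => (F x)^-1) =
      (fun x => (F x)^-1) \* ((fun x => (F x)^-1) \* (fun x => - derive1 F x)).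
    apply/funext => x; rewrite /= !derive1E deriveV //; last exact: smooth1_derivable.
    by rewrite /GRing.scale /= expr2 invfM; ring.
  have gi : smooth1_gen (fun x => (F x)^-1) by exact: smooth1_gen_inv.
  apply: smooth1_gen_mul => //; apply: smooth1_gen_mul => //. exact/smooth1_gen_smooth/smooth1_opp/smooth1_derive.
Qed.

Lemma smooth1_genP F : smooth1_gen F -> smooth1 F.
Proof. by apply: smooth1_coind F => F /smooth1_gen_spec. Qed.

Lemma smooth1D F G : smooth1 F -> smooth1 G -> smooth1 (fun x => F x + G x).
Proof. by move=> sF sG; apply: (@smooth1_genP (F \+ G)); apply: smooth1_gen_add; exact: smooth1_gen_smooth. Qed.

Lemma smooth1M F G : smooth1 F -> smooth1 G -> smooth1 (fun x => F x * G x).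
Proof. by move=> sF sG; apply: (@smooth1_genP (F \* G)); apply: smooth1_gen_mul; exact: smooth1_gen_smooth. Qed.

Lemma smooth1_comp F G : smooth1 F -> smooth1 G -> smooth1 (fun x => F (G x)).
Proof. by move=> sF sG; apply: (@smooth1_genP (F \o G)); exact: smooth1_gen_comp. Qed.

Lemma smooth1V F : smooth1 F -> (forall x, F x != 0) -> smooth1 (fun x => (F x)^-1).
Proof. by move=> sF F0; apply: smooth1_genP; exact: smooth1_gen_inv. Qed.

Lemma smooth1_cst (a : R) : smooth1 (fun=> a).
Proof.
apply: (@smooth1_coind _ (fun f => exists c, f = cst c)); last by exists a.
move=> f [c ->]; split=> [x|]; first exact: derivable_cst.
by exists 0; apply/funext => x; rewrite derive1_cst.
Qed.

Lemma smooth1_id : smooth1 (@id R).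
Proof.
move=> [|k] x; first exact: derivable_id.
rewrite derive1Sn; have -> : derive1 (@id R) = cst 1 by apply/funext => y; rewrite derive1_id.
exact: smooth1_cst.
Qed.

Lemma smooth1_affine (a b : R) : smooth1 (fun x => a * x + b).
Proof.
by apply: smooth1D; [apply: smooth1M; [exact: smooth1_cst|exact: smooth1_id]|exact: smooth1_cst].
Qed.

Lemma smooth1_antideriv F G : smooth1 G -> (forall x, is_derive x (1 : R) F (G x)) -> smooth1 F.
Proof.
move=> sG dF [|k] x; first by case: (dF x).
rewrite derive1Sn; have -> : derive1 F = G by apply/funext => y; rewrite derive1E; case: (dF y).
exact: sG.
Qed.

End smooth1_closure.

(** Serves at the origin for [flat_poly], which is O(t^2) there: one quadratic remainder bound
    replaces two one-sided limits. *)
Lemma is_derive_quadratic {R : realType} (F : R -> R) (x a C : R) :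
  (forall s, `|F s - F x - (s - x) * a| <= C * `|s - x| ^+ 2) -> is_derive x (1 : R) F a.
Proof.
move=> H.
have cv : (fun h => h^-1 *: ((F \o shift x) (h *: (1 : R)) - F x)) @ 0^' --> a. apply/cvgrPdist_le => e e0.
  have C0 : 0 < `|C| + 1 by rewrite ltr_wpDl. near=> h. have h0 : h != 0 by near: h; exact: nbhs_dnbhs_neq.
  have he : `|h| <= e / (`|C| + 1). near: h; apply: dnbhs0_le; exact: divr_gt0. rewrite /= distrC.
  have := H (h + x); rewrite addrK => Hh; rewrite /GRing.scale /= mulr1.
  have -> : h^-1 * (F (h + x) - F x) - a = h^-1 * (F (h + x) - F x - h * a). by rewrite [RHS]mulrBr mulKf.
  rewrite normrM normfV -ler_pdivlMl ?invr_gt0 ?normr_gt0 // invrK.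
  apply: le_trans Hh _; rewrite expr2 mulrCA ler_wpM2l //.
  move: he; rewrite ler_pdivlMr // mulrC => /(le_trans _); apply.
  by rewrite ler_wpM2r // (le_trans (ler_norm _)) // lerDl.
apply: DeriveDef; first by apply/cvg_ex; exists a.
exact: cvg_lim cv.
Unshelve. all: by end_near. Qed.

(** * The flat function exp(-1/t) and the signs of its derivatives *)

Section flat.
Context {R : realType}.

(** The inequality x / k <= exp(x / k), raised to the power k. *)
Lemma expr_expRN_le (k : nat) (x : R) : 0 <= x -> x ^+ k * expR (- x) <= k%:R ^+ k.
Proof.
move=> x0; have [->|k0] := posnP k; first by rewrite !expr0 mul1r -expR0 ler_expR oppr_le0.
rewrite expRN -ler_pdivlMr ?invr_gt0 ?expR_gt0 // invrK.
have -> : x = k%:R * (x / k%:R) by rewrite mulrCA divff ?mulr1 // pnatr_eq0 -lt0n.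
rewrite expRM_natl -exprMn lerXn2r ?nnegrE ?mulr_ge0 ?expR_ge0 ?divr_ge0 ?ler0n // .
rewrite ler_wpM2l ?ler0n //.
by apply: le_trans (expR_ge1Dx _); rewrite lerDr.
Qed.

Lemma horner_expRN_bounded (q : {poly R}) : exists C, forall x, 0 <= x -> `|q.[x] * expR (- x)| <= C.
Proof.
exists (\sum_(i < size q) `|q`_i| * i%:R ^+ i) => x x0.
rewrite horner_coef mulr_suml; apply: le_trans (ler_norm_sum _ _ _) _.
apply: ler_sum => i _; rewrite -mulrA normrM ler_wpM2l //.
rewrite ger0_norm; first exact: expr_expRN_le.
by rewrite mulr_ge0 ?exprn_ge0 ?expR_ge0.
Qed.

(** The functions p(1/t) exp(-1/t), extended by 0 to t <= 0, form a family stable under derivation,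
    p being replaced by (p - p') X^2; hence all of them are smooth. *)
Definition flat_poly (p : {poly R}) (t : R) : R := if t <= 0 then 0 else p.[t^-1] * expR (- t^-1).

Lemma is_derive_flat_poly p t : is_derive t (1 : R) (flat_poly p) (flat_poly ((p - p^`()) * 'X^2) t).
Proof.
have [t0|t0|->] := ltgtP t 0.
- rewrite {2}/flat_poly (ltW t0) /=. apply: (@near_eq_is_derive _ _ _ (cst 0)).
  near=> s; rewrite /flat_poly ifT //; apply: ltW; near: s; exact: lt_nbhsl.
- rewrite {2}/flat_poly leNgt t0 /=. have tn0 : t != 0 by rewrite gt_eqF.
  have di : is_derive t (1 : R) (fun s : R => s^-1) (- t^-2).
    have := is_deriveV (f := @id R) tn0 (is_derive_id t (1 : R)). by rewrite /GRing.scale /= mulr1.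
  have dp : is_derive t (1 : R) (fun s => p.[s^-1]) ((p^`()).[t^-1] * - t^-2).
    have dh : is_derive t^-1 (1 : R) (horner p) (deriv p).[t^-1].
      have h : derivable (horner p) t^-1 1 by exact: derivable_horner. apply: (DeriveDef h).
      by rewrite -derive1E -derivE. exact: (@is_derive1_comp _ (horner p) (fun s => s^-1) t _ _ dh di).
  have de : is_derive t (1 : R) (fun s => expR (- s^-1)) (expR (- t^-1) * - - t^-2).
    exact: (@is_derive1_comp _ expR (fun s => - s^-1)).
  have dpe : is_derive t (1 : R) (fun s => p.[s^-1] * expR (- s^-1))
      (((p - p^`()) * 'X^2).[t^-1] * expR (- t^-1)). have := is_deriveM dp de. move/is_derive_eq; apply.
    by rewrite hornerM hornerD hornerN hornerXn /GRing.scale /=; field. apply: near_eq_is_derive dpe.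
  near=> s; rewrite /flat_poly leNgt ifF //; apply/negbTE; rewrite negbK. near: s; exact: lt_nbhsr.
- rewrite {2}/flat_poly lexx. have [C HC] := horner_expRN_bounded (p * 'X^2).
  have C0 : 0 <= C by apply: le_trans (HC 0 (lexx _)). have fl s : `|flat_poly p s| <= C * `|s| ^+ 2.
    rewrite /flat_poly; case: (lerP s 0) => s0; first by rewrite normr0 mulr_ge0 // exprn_ge0.
    have si : 0 <= s^-1 by rewrite invr_ge0 ltW.
    have := HC _ si; rewrite hornerM hornerXn mulrAC normrM [`|s^-1 ^+ 2|]ger0_norm ?exprn_ge0 //.
    rewrite -ler_pdivlMr ?exprn_gt0 ?invr_gt0 // -exprVn invrK => /le_trans; apply. by rewrite gtr0_norm.
  by apply: (is_derive_quadratic (C := C)) => s; rewrite {2}/flat_poly lexx !subr0 mulr0 subr0.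
Unshelve. all: by end_near. Qed.

End flat.

Section flat_function.
Context {R : realType}.
Implicit Types (p : {poly R}) (t : R).

Lemma smooth1_flat_poly p : smooth1 (flat_poly p).
Proof.
apply: (@smooth1_coind _ (fun F => exists p, F = flat_poly p)); last by exists p.
move=> _ [q ->]; split=> [x|]; first by have [] := is_derive_flat_poly q x.
exists ((q - q^`()) * 'X^2); apply/funext => x; rewrite derive1E.
by have [] := is_derive_flat_poly q x.
Qed.

Lemma derive1_flat_poly p : derive1 (flat_poly p) = flat_poly ((p - p^`()) * 'X^2).
Proof.
by apply/funext => x; rewrite derive1E; have [] := is_derive_flat_poly p x.
Qed.

Definition flat : R -> R := flat_poly 1.

Lemma smooth1_flat : smooth1 flat. Proof. exact: smooth1_flat_poly. Qed.

Lemma flat0 t : t <= 0 -> flat t = 0.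
Proof. by rewrite /flat /flat_poly => ->. Qed.

Lemma flat_gt0 t : 0 < t -> 0 < flat t.
Proof. by move=> t0; rewrite /flat /flat_poly leNgt t0 /= hornerC mul1r expR_gt0. Qed.

Lemma flat_ge0 t : 0 <= flat t.
Proof. by have [/flat0 ->|/flat_gt0/ltW] := leP t 0. Qed.

Lemma derive1_flatE : derive1 flat = flat_poly 'X^2.
Proof. by rewrite /flat derive1_flat_poly derivC subr0 mul1r. Qed.

Lemma derive1_flat_eq0 t : t <= 0 -> derive1 flat t = 0.
Proof. by rewrite derive1_flatE /flat_poly => ->. Qed.

Lemma derive1_flat_gt0 t : 0 < t -> 0 < derive1 flat t.
Proof.
move=> t0; rewrite derive1_flatE /flat_poly leNgt t0 /= hornerXn.
by rewrite mulr_gt0 ?expR_gt0 // exprn_gt0 // invr_gt0.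
Qed.

Lemma derive1_flat_ge0 t : 0 <= derive1 flat t.
Proof. by have [/derive1_flat_eq0 ->|/derive1_flat_gt0/ltW] := leP t 0. Qed.

(** With x = 1/t the polynomial factor is x^3 (x - 2) here and x^4 (x^2 - 6 x + 6) for the third
    derivative; both are nonnegative for x >= 8, and 1/8 serves as common threshold. *)
Lemma derive2_flat_ge0 t : t <= 8^-1 -> 0 <= derive1 (derive1 flat) t.
Proof.
move=> t8; rewrite derive1_flatE derive1_flat_poly /flat_poly.
case: (leP t 0) => // t0; apply: mulr_ge0; last exact: expR_ge0.
rewrite derivXn !(hornerM, hornerD, hornerN, hornerMn, hornerXn, hornerX); set x := t^-1.
have x8 : 8 <= x by rewrite /x -[leLHS]invrK lef_pV2 ?posrE ?invr_gt0.
rewrite [leRHS](_ : _ = x ^+ 3 * (x - 2)); last by ring.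
by rewrite mulr_ge0 ?exprn_ge0 //; lra.
Qed.

Lemma derive3_flat_ge0 t : t <= 8^-1 -> 0 <= derive1 (derive1 (derive1 flat)) t.
Proof.
move=> t8; rewrite derive1_flatE !derive1_flat_poly /flat_poly.
case: (leP t 0) => // t0; apply: mulr_ge0; last exact: expR_ge0.
rewrite !(derivXn, derivM, derivB, derivMn, derivX, derivC) !(hornerM, hornerD, hornerN, hornerD, hornerMn, hornerXn, hornerX); set x := t^-1.
have x8 : 8 <= x by rewrite /x -[leLHS]invrK lef_pV2 ?posrE ?invr_gt0.
rewrite /= [leRHS](_ : _ = x ^+ 4 * (x ^+ 2 - 6 * x + 6)); last by ring.
by rewrite mulr_ge0 ?exprn_ge0 //; nra.
Qed.

End flat_function.

(** * A smooth convex version of max(t, 0) *)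

Section smooth_max.
Context {R : realType}.
Implicit Types t a b : R.

Lemma MVT_le (F f : R -> R) a b : (forall x, is_derive x (1 : R) F (f x)) -> a <= b ->
  exists2 c, a <= c <= b & F b - F a = f c * (b - a).
Proof.
move=> dF; rewrite le_eqVlt => /predU1P[->|ab]. by exists b; rewrite ?lexx // !subrr mulr0.
have [|c] := MVT ab (fun x _ => dF x). apply: continuous_subspaceT => x; apply: differentiable_continuous.
  by apply/derivable1_diffP; case: (dF x).
rewrite in_itv /= => /andP[ac cb] ->; exists c => //.
by rewrite (ltW ac) (ltW cb).
Qed.

Definition sstep t : R := flat t / (flat t + flat (1 - t)).

Let den_gt0 t : 0 < flat t + flat (1 - t).
Proof.
have [t0|t0] := leP t 0. by rewrite ltr_wpDl ?flat_ge0 // flat_gt0 // subr_gt0 (le_lt_trans t0).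
by rewrite ltr_pwDl ?flat_ge0 // flat_gt0.
Qed.
Let smooth1_flat1B : smooth1 (fun t : R => flat (1 - t)).
Proof.
have -> : (fun t : R => flat (1 - t)) = (fun t => flat (-1 * t + 1)). by apply/funext => t; rewrite mulN1r addrC.
exact/smooth1_comp/smooth1_affine/smooth1_flat.
Qed.

Lemma smooth1_sstep : smooth1 sstep.
Proof.
apply: smooth1M; first exact: smooth1_flat.
apply: smooth1V => [|x]; last by rewrite gt_eqF.
by apply: smooth1D; first exact: smooth1_flat.
Qed.

Lemma sstep0 t : t <= 0 -> sstep t = 0.
Proof. by move=> t0; rewrite /sstep flat0 // mul0r. Qed.

Lemma sstep1 t : 1 <= t -> sstep t = 1.
Proof.
move=> t1; rewrite /sstep (@flat0 _ (1 - t)) ?subr_le0 // addr0 divff //.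
by rewrite gt_eqF // flat_gt0 // (lt_le_trans _ t1).
Qed.

Lemma sstep_ge0 t : 0 <= sstep t.
Proof. by rewrite divr_ge0 ?flat_ge0 // ltW. Qed.

Lemma sstep_le1 t : sstep t <= 1.
Proof. by rewrite ler_pdivrMr // mul1r lerDl flat_ge0. Qed.

Lemma derive1_sstep_ge0 t : 0 <= derive1 sstep t.
Proof.
have df s : is_derive s (1 : R) flat (derive1 flat s).
  by rewrite derive1E; apply/derivableP/smooth1_derivable/smooth1_flat.
have dg : is_derive t (1 : R) (fun t : R => flat (1 - t)) (derive1 flat (1 - t) * -1).
  apply: (@is_derive1_comp _ flat (fun t => 1 - t)).
  have := is_deriveB (is_derive_cst (1 : R) t (1 : R)) (is_derive_id t (1 : R)). by rewrite sub0r.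
have d0 : flat t + flat (1 - t) != 0 by rewrite gt_eqF.
have dV := is_deriveV (f := fun t : R => flat t + flat (1 - t)) d0 (is_deriveD (df t) dg).
have dS := is_deriveM (df t) dV.
have {dS} [_ dS] := dS; rewrite derive1E.
have -> : sstep = (flat * (fun t : R => (flat t + flat (1 - t))^-1)) by [].
rewrite dS /GRing.scale /= {dV dS}.
have := derive1_flat_ge0 t; have := derive1_flat_ge0 (1 - t).
have := @flat_ge0 R t; have := @flat_ge0 R (1 - t); move: d0.
move: (derive1 flat t) (derive1 flat (1 - t)) (flat t) (flat (1 - t)) => a b x y d0 y0 x0 b0 a0.
have -> : x * (- (x + y) ^- 2 * (a + b * -1)) + (x + y)^-1 * a = (y * a + x * b) / (x + y) ^+ 2 by field.
by rewrite divr_ge0 ?sqr_ge0 // addr_ge0 ?mulr_ge0.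
Qed.

Notation mu := (@lebesgue_measure R).

Lemma exists_primitive_sstep : exists2 F : R -> R, F 0 = 0 & forall x, is_derive x (1 : R) F (sstep x).
Proof.
have csb x : {for x, continuous sstep} by exact/smooth1_continuous/smooth1_sstep.
(* The step vanishes for t <= 0, so integrability on a half-line reduces to a compact interval;
   integrating from -oo makes the fundamental theorem of calculus available at every point, 0
   included. *)
have ib u : mu.-integrable `]-oo, u] (EFin \o sstep).
  apply/(proj2 (integrable_mkcond (mu := mu) (D := `]-oo, u]%classic) (EFin \o sstep) (measurable_itv _))).
  have : mu.-integrable `[0, u] (EFin \o sstep).
    apply: continuous_compact_integrable; first exact: segment_compact. exact/continuous_subspaceT/csb.
  move/(proj1 (integrable_mkcond (mu := mu) (D := `[0, u]%classic) (EFin \o sstep) (measurable_itv _))).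
  congr (mu.-integrable _ _); apply/funext => t; rewrite !patchE !mem_setE !in_itv /=.
  by have [t0|t0] := leP 0 t; rewrite //= sstep0 ?(ltW t0) //; case: ifP.
pose F y := \int[mu]_(t in `]-oo, y]) sstep t.
exists (fun y => F y - F 0); first by rewrite subrr.
move=> x; have xx1 : x < x + 1 by rewrite ltrDl.
have /= := continuous_FTC1 (f := sstep) (a := -oo%O) xx1 (ib _).
move=> /(_ (ltNyr _) (csb x))[dF FE].
have dFx : is_derive x (1 : R) F (sstep x). apply: DeriveDef; first exact: dF. by rewrite -derive1E FE.
have := is_deriveB dFx (is_derive_cst (F 0) x (1 : R)).
by rewrite subr0.
Qed.

(** The primitive F of the smooth step is 0 for t <= 0 and t - c1 for t >= 1, with c1 = 1 - F 1 in
    [0, 1]. The translate F (t + c1) is therefore exactly t for t >= 1, and it is convex because the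
    step increases. *)
Lemma exists_smooth_max : exists G : R -> R, [/\ smooth1 G,
      [/\ forall t, t <= -1 -> G t = 0, forall t, 1 <= t -> G t = t,
          forall t, Num.max t 0 <= G t & forall t, G t <= Num.max t 0 + 1],
      [/\ forall t, 0 <= derive1 G t, forall t, derive1 G t <= 1,
          forall t, t <= -1 -> derive1 G t = 0 & forall t, 1 <= t -> derive1 G t = 1]
    & forall t, 0 <= derive1 (derive1 G) t].
Proof.
have [F F0 dF] := exists_primitive_sstep.
have sF := smooth1_antideriv smooth1_sstep dF.
have F_ge0 t : 0 <= t -> 0 <= F t. move=> t0; have [c _] := MVT_le dF t0; rewrite F0 !subr0 => ->.
  by rewrite mulr_ge0 ?sstep_ge0.
have F_le t : 0 <= t -> F t <= t. move=> t0; have [c _] := MVT_le dF t0; rewrite F0 !subr0 => ->.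
  by rewrite ler_piMl ?sstep_le1.
have F_eq0 t : t <= 0 -> F t = 0. move=> t0; have [c /andP[_ c0]] := MVT_le dF t0.
  by rewrite F0 sstep0 // mul0r => /eqP; rewrite sub0r oppr_eq0 => /eqP.
pose c1 := 1 - F 1.
have c10 : 0 <= c1 by rewrite subr_ge0 F_le.
have c11 : c1 <= 1 by rewrite gerBl F_ge0.
have F_aff t : 1 <= t -> F t = t - c1. move=> t1; have [c /andP[c1' _]] := MVT_le dF t1.
  by rewrite sstep1 // mul1r /c1 => /eqP; rewrite subr_eq => /eqP ->; ring.
have F_ge t : t - c1 <= F t. have [t1|/ltW/F_aff -> //] := leP t 1. have [c _] := MVT_le dF t1; rewrite /c1 => FE.
  have : F 1 - F t <= 1 - t by rewrite FE ler_piMl ?sstep_le1 ?subr_ge0. by lra.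
pose G t := F (t + c1).
have dG x : is_derive x (1 : R) G (sstep (x + c1)).
  have := @is_derive1_comp _ F (fun t => t + c1) x (sstep (x + c1)) 1 (dF _). rewrite mulr1; apply.
  have := is_deriveD (is_derive_id x (1 : R)) (is_derive_cst c1 x (1 : R)). by rewrite addr0.
have G'E : derive1 G = fun x => sstep (x + c1). by apply/funext => x; rewrite derive1E; case: (dG x).
have G''E x : derive1 (derive1 G) x = derive1 sstep (x + c1).
  rewrite G'E (_ : (fun x => sstep (x + c1)) = sstep \o (fun x => x + c1)) //.
  rewrite derive1_comp; [|exact: derivableD|exact/smooth1_derivable/smooth1_sstep].
  rewrite [X in _ * X](_ : _ = 1) ?mulr1 // derive1E.
  have := is_deriveD (is_derive_id x (1 : R)) (is_derive_cst c1 x (1 : R)). by rewrite addr0 => -[_].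
exists G; split.
- have -> : G = fun t => F (1 * t + c1) by apply/funext => t; rewrite mul1r. exact/smooth1_comp/smooth1_affine.
- split=> t.
  + by move=> t1; rewrite /G F_eq0 //; lra.
  + by move=> t1; rewrite /G F_aff ?addrK //; lra.
  + rewrite ge_max /G; apply/andP; split; first by have := F_ge (t + c1); rewrite addrK.
    by have [/F_eq0 ->|/ltW/F_ge0] := leP (t + c1) 0.
  + have t0 : t <= Num.max t 0 by rewrite le_max lexx. have m0 : 0 <= Num.max t 0 by rewrite le_max lexx orbT.
    rewrite /G; have [/F_eq0 ->|/ltW/F_le] := leP (t + c1) 0; lra.
- split=> t; rewrite G'E; [exact: sstep_ge0|exact: sstep_le1| |].
  + by move=> t1; rewrite sstep0 //; lra.
  + by move=> t1; rewrite sstep1 //; lra.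
- by move=> t; rewrite G''E derive1_sstep_ge0.
Qed.

Definition smax : R -> R := projT1 (cid exists_smooth_max).

Lemma smaxP : let G := smax in [/\ smooth1 G, [/\ forall t, t <= -1 -> G t = 0, forall t, 1 <= t -> G t = t,
          forall t, Num.max t 0 <= G t & forall t, G t <= Num.max t 0 + 1],
      [/\ forall t, 0 <= derive1 G t, forall t, derive1 G t <= 1,
          forall t, t <= -1 -> derive1 G t = 0 & forall t, 1 <= t -> derive1 G t = 1]
    & forall t, 0 <= derive1 (derive1 G) t].
Proof. exact: projT2 (cid exists_smooth_max). Qed.

End smooth_max.

(** * The product Lebesgue measure: invariance under affine maps and shears *)

Section tuple_measure.
Context {R : realType}.
Notation mR := (measurableTypeR R).
Notation mu := (@lebesgue_measure R).
Local Open Scope ereal_scope.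

(** A named copy of [lebesgue_tuple], to carry the sigma-finite structure that Fubini's theorem asks
    for. *)
Definition ltup d : set (d.-tuple mR) -> \bar R := lebesgue_tuple R d.
HB.instance Definition _ d := Measure.on (@ltup d).

Definition cube d (k : nat) : set (d.-tuple mR) := [set t | forall i, tnth t i \in `[- k%:R, k%:R]%R].

Lemma measurable_cube d k : measurable (@cube d k).
Proof.
have -> : @cube d k = \bigcap_(i in [set: 'I_d]) ((@tnth _ mR ^~ i) @^-1` `[(- k%:R)%R, k%:R%R]%classic).
  by apply/seteqP; split=> [t h i _|t h i]; [exact: h|exact: h].
apply: fin_bigcap_measurable => // i _.
rewrite -[X in measurable X]setTI; apply: measurable_tnth => //; exact: measurable_itv.
Qed.

Lemma ltup_cube_lty d k : ltup (@cube d k) < +oo.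
Proof.
elim: d => [|d IH]; first by rewrite /ltup /= diracE ltry.
rewrite /ltup /= /image_measure /= /pushforward.
have -> : @cons_pair R d @^-1` cube k = `[(- k%:R)%R, k%:R%R]%classic `*` @cube d k.
  apply/seteqP; split=> [[x t] /= h|[x t] /= [h1 h2] i]. split=> [|i]; first by have := h ord0; rewrite tnth0.
    by have := h (lift ord0 i); rewrite tnthS.
  by case: (unliftP ord0 i) => [j|] ->; rewrite ?tnth0 // tnthS; exact: h2.
rewrite product_measure2E; [|exact: measurable_itv|exact: measurable_cube].
rewrite lte_mul_pinfty //. rewrite ge0_fin_numE //.
  change (lebesgue_measure ([set` `[(- k%:R)%R, k%:R%R]] : set R) < +oo).
  by rewrite lebesgue_measure_itv /=; case: ifP => _; rewrite ltry.
Qed.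

Lemma ltup_sigma_finite d : sigma_finite [set: d.-tuple mR] (@ltup d).
Proof.
exists (@cube d) => [|k]; last by split; [exact: measurable_cube|exact: ltup_cube_lty].
apply/seteqP; split=> // t _; exists (Num.bound (\sum_i `|tnth t i|)%R) => // i.
have h : (`|tnth t i| <= (Num.bound (\sum_i `|tnth t i|)%R)%:R)%R.
  apply: le_trans (ltW (archi_boundP (sumr_ge0 _ _))) => //. by rewrite (bigD1 i) //= lerDl sumr_ge0.
by rewrite in_itv /= -ler_norml.
Qed.

HB.instance Definition _ d := Measure_isSigmaFinite.Build _ _ _ (@ltup d) (@ltup_sigma_finite d).

Lemma measurable_cons_pair1 d (x : mR) : measurable_fun [set: d.-tuple mR] (fun t => [tuple of x :: t]).
Proof. by apply: measurable_cons => //; exact: measurable_id. Qed.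

Lemma ltupS_integral d (F : d.+1.-tuple mR -> \bar R) :
  measurable_fun [set: _.-tuple mR] F -> (forall t, 0 <= F t) ->
  \int[@ltup d.+1]_t F t = \int[@ltup d]_t \int[mu]_x F [tuple of x :: t] /\
  \int[@ltup d.+1]_t F t = \int[mu]_x \int[@ltup d]_t F [tuple of x :: t].
Proof.
move=> mF F0.
have E : \int[@ltup d.+1]_t F t = \int[mu \x (@ltup d)]_p F (cons_pair p).
  transitivity (\int[(mu \x^ lebesgue_tuple R d)]_p F (cons_pair p)). rewrite /ltup /= /image_measure /=.
    by rewrite (ge0_integral_pushforward (@measurable_cons_pair R d)).
  apply: eq_measure_integral => A mA _; apply/esym.
  apply: (@product_measure_unique _ _ _ _ _ mu (@ltup d) (mu \x^ lebesgue_tuple R d)) => //.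
  by move=> X Y mX mY; exact: product_measure2E.
have mFc : measurable_fun setT (F \o @cons_pair R d).
  by apply: measurableT_comp => //; exact: measurable_cons_pair.
split; rewrite E. exact: (fubini_tonelli2 (F \o @cons_pair R d) mFc (fun p => F0 _)).
exact: (fubini_tonelli1 (F \o @cons_pair R d) mFc (fun p => F0 _)).
Qed.

Definition tset d (t : d.-tuple mR) (i : 'I_d) (x : R) : d.-tuple mR :=
  [tuple if j == i then x else tnth t j | j < d].

Lemma tnth_tset d (t : d.-tuple mR) i x j : tnth (tset t i x) j = if j == i then x else tnth t j.
Proof. by rewrite tnth_mktuple. Qed.

Lemma tset_tset d (t : d.-tuple mR) i x y : tset (tset t i x) i y = tset t i y.
Proof. by apply: eq_from_tnth => j; rewrite !tnth_tset; case: eqP. Qed.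

Lemma tset_cons0 d (t : d.-tuple mR) x y : tset [tuple of x :: t] ord0 y = [tuple of y :: t].
Proof.
apply: eq_from_tnth => j; rewrite tnth_tset.
case: (unliftP ord0 j) => [i|] ->; last by rewrite eqxx tnth0.
by rewrite eq_sym (negbTE (neq_lift _ _)) !tnthS.
Qed.

Lemma tset_consS d (t : d.-tuple mR) x i y : tset [tuple of x :: t] (lift ord0 i) y = [tuple of x :: tset t i y].
Proof.
apply: eq_from_tnth => j; rewrite tnth_tset.
case: (unliftP ord0 j) => [k|] ->; last by rewrite !tnth0.
by rewrite !tnthS tnth_tset (inj_eq (@lift_inj _ ord0)).
Qed.

Lemma measurable_tset d d' (T : measurableType d') (t : T -> d.-tuple mR) i (h : T -> mR) :
  measurable_fun setT t -> measurable_fun setT h -> measurable_fun setT (fun x => tset (t x) i (h x)).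
Proof.
move=> mt mh; apply/measurable_fun_tnthP => j /=.
rewrite (_ : _ \o _ = if j == i then h else (@tnth d mR ^~ j) \o t); last first.
  by apply/funext => x /=; rewrite tnth_tset; case: eqP.
by case: eqP => // _; apply: (measurableT_comp _ mt); exact: measurable_tnth.
Qed.

(* Two nonnegative functions with the same integrals along the i-th axis have
   the same integral: this yields every invariance of the product measure. *)
Lemma ltup_slice d (F G : d.-tuple mR -> \bar R) (i : 'I_d) :
  measurable_fun [set: _.-tuple mR] F -> measurable_fun [set: _.-tuple mR] G ->
  (forall t, 0 <= F t) -> (forall t, 0 <= G t) ->
  (forall t, \int[mu]_x F (tset t i x) = \int[mu]_x G (tset t i x)) -> \int[@ltup d]_t F t = \int[@ltup d]_t G t.
Proof.
elim: d F G i => [|d IH] F G i mF mG F0 G0 FG; first by case: i FG.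
case: (unliftP ord0 i) FG => [j|] -> FG. rewrite (ltupS_integral mF F0).2 (ltupS_integral mG G0).2.
  apply: eq_integral => x _; apply: (IH _ _ j) => //.
  - by apply: measurableT_comp => //; exact: measurable_cons_pair1.
  - by apply: measurableT_comp => //; exact: measurable_cons_pair1.
  - by move=> t; have := FG [tuple of x :: t]; under eq_integral do rewrite tset_consS;
    under [X in _ = X -> _]eq_integral do rewrite tset_consS.
rewrite (ltupS_integral mF F0).1 (ltupS_integral mG G0).1.
apply: eq_integral => t _; have := FG [tuple of 0%R :: t].
by under eq_integral do rewrite tset_cons0; under [X in _ = X -> _]eq_integral do rewrite tset_cons0.
Qed.

(** Uniqueness of Lebesgue measure: c times the image measure under x -> c x + a gives every
    interval its length. *)
Lemma lebesgue_affine (c a : R) (f : mR -> \bar R) : (0 < c)%R ->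
  measurable_fun [set: mR] f -> (forall x, 0 <= f x) -> \int[mu]_x f (c * x + a)%R = c^-1%:E * \int[mu]_x f x.
Proof.
move=> c0 mf f0.
pose phi (x : mR) : mR := (c * x + a)%R.
have mphi : measurable_fun setT phi. by apply: measurable_funD => //; apply: measurable_funM.
have ci : (0 <= c^-1)%R by rewrite invr_ge0 ltW.
pose k : {nonneg R} := NngNum (ltW c0).
pose k' : {nonneg R} := NngNum ci.
pose m1 := image_measure mu mphi.
have E A : measurable A -> mu A = mscale k m1 A.
  move=> mA; apply: (lebesgue_measure_unique (mu := mscale k m1)) => // X [[x y] _ <-] /=.
  rewrite /mscale /= /pushforward.
  have -> : phi @^-1` `]x, y] = `](c^-1 * (x - a))%R, (c^-1 * (y - a))%R]%classic.
    apply/seteqP; split=> z /=; rewrite !in_itv /= /phi => /andP[h1 h2]; apply/andP; split.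
    - by rewrite ltr_pdivrMl // ltrBlDr.
    - by rewrite ler_pdivlMl // lerBrDr.
    - by move: h1; rewrite ltr_pdivrMl // ltrBlDr.
    - by move: h2; rewrite ler_pdivlMl // lerBrDr.
  rewrite !lebesgue_measure_itv /= !lte_fin ltr_pM2l ?invr_gt0 // ltrBlDr subrK.
  case: ifP => _; last by rewrite mule0.
  rewrite -!EFinD -EFinM; congr EFin; rewrite mulrBr !mulrA divff ?gt_eqF // !mul1r; ring.
have Ei : \int[mu]_x f x = c%:E * \int[m1]_x f x. rewrite -(ge0_integral_mscale m1 measurableT k mf) //.
  by apply: eq_measure_integral => A mA _; exact: E.
rewrite Ei muleA -EFinM mulVf ?gt_eqF // mul1e.
by rewrite /m1 /image_measure /= (ge0_integral_pushforward mphi).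
Qed.

Lemma ltup_affine1 d (i : 'I_d) (c : R) (a : d.-tuple mR -> mR) (F : d.-tuple mR -> \bar R) :
  (0 < c)%R -> @measurable_fun _ _ (_.-tuple mR) mR setT a -> (forall t x, a (tset t i x) = a t) ->
  measurable_fun [set: _.-tuple mR] F -> (forall t, 0 <= F t) ->
  \int[@ltup d]_t F (tset t i (c * tnth t i + a t)%R) = c^-1%:E * \int[@ltup d]_t F t.
Proof.
move=> c0 ma ai mF F0.
have ci : (0 <= c^-1)%R by rewrite invr_ge0 ltW.
have mt : measurable_fun setT (fun t : d.-tuple mR => tset t i (c * tnth t i + a t)%R).
  apply: measurable_tset; first exact: measurable_id.
  by apply: measurable_funD => //; apply: measurable_funM => //; exact: measurable_tnth.
rewrite -ge0_integralZl_EFin //; apply: (ltup_slice (i := i)).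
- exact: measurableT_comp.
- exact: emeasurable_funM.
- by [].
- by move=> t; rewrite mule_ge0.
move=> t; rewrite ge0_integralZl_EFin //; last first.
  by apply: measurableT_comp => //; apply: measurable_tset => //; exact: measurable_id.
rewrite -(lebesgue_affine (a t) (f := fun x => F (tset t i x))) //; last first.
  by apply: measurableT_comp => //; apply: measurable_tset => //; exact: measurable_id.
by apply: eq_integral => x _; rewrite tset_tset tnth_tset eqxx ai.
Qed.

Definition affs d (c : R) (a : 'I_d -> R) (s : seq 'I_d) (t : d.-tuple mR) : d.-tuple mR :=
  foldr (fun i t => tset t i (c * tnth t i + a i)%R) t s.

Lemma ltup_affs d (c : R) (a : 'I_d -> R) s (F : d.-tuple mR -> \bar R) : (0 < c)%R ->
  measurable_fun [set: _.-tuple mR] F -> (forall t, 0 <= F t) ->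
  \int[@ltup d]_t F (affs c a s t) = (c^-1 ^+ size s)%:E * \int[@ltup d]_t F t.
Proof.
move=> c0; elim: s F => [|i s IH] F mF F0; first by rewrite /= expr0 mul1e.
rewrite /= (IH (fun t => F (tset t i (c * tnth t i + a i)%R))) //; last first.
  apply: measurableT_comp => //; apply: measurable_tset; first exact: measurable_id.
  by apply: measurable_funD => //; apply: measurable_funM => //; exact: measurable_tnth.
rewrite (ltup_affine1 (a := fun=> a i)) // muleA -EFinM exprS mulrC //.
Qed.

Lemma tnth_affs d (c : R) (a : 'I_d -> R) s (t : d.-tuple mR) j : uniq s ->
  tnth (affs c a s t) j = (if j \in s then c * tnth t j + a j else tnth t j)%R.
Proof.
elim: s => //= i s IH /andP[si us]; rewrite tnth_tset inE.
case: eqVneq => [ji|_] /=; first by rewrite -ji IH // ji (negbTE si).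
exact: IH.
Qed.

Lemma ltup_affine d (c : R) (a : 'I_d -> R) (F : d.-tuple mR -> \bar R) : (0 < c)%R ->
  measurable_fun [set: _.-tuple mR] F -> (forall t, 0 <= F t) ->
  \int[@ltup d]_t F [tuple (c * tnth t j + a j)%R | j < d] = (c^-1 ^+ d)%:E * \int[@ltup d]_t F t.
Proof.
move=> c0 mF F0; have := ltup_affs a (enum 'I_d) c0 mF F0; rewrite size_enum_ord => <-.
apply: eq_integral => t _; congr F; apply: eq_from_tnth => j.
by rewrite tnth_mktuple tnth_affs ?enum_uniq // mem_enum.
Qed.

(** A shear of one block of coordinates along another, done one coordinate at a time: each step is a
    translation along an axis by an amount that does not depend on that axis. *)
Definition shears d n (p q : 'I_n -> 'I_d) (r : R) (s : seq 'I_n) (t : d.-tuple mR) : d.-tuple mR :=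
  foldr (fun i t => tset t (p i) (1 * tnth t (p i) + r * tnth t (q i))%R) t s.

Lemma ltup_shears d n (p q : 'I_n -> 'I_d) (r : R) s (F : d.-tuple mR -> \bar R) : (forall i j, q i != p j) ->
  measurable_fun [set: _.-tuple mR] F -> (forall t, 0 <= F t) ->
  \int[@ltup d]_t F (shears p q r s t) = \int[@ltup d]_t F t.
Proof.
move=> qp; elim: s F => [|i s IH] F mF F0 //=.
have ms : measurable_fun setT (fun t : d.-tuple mR => (r * tnth t (q i))%R : mR).
  by apply: measurable_funM => //; exact: measurable_tnth.
rewrite (IH (fun t => F (tset t (p i) (1 * tnth t (p i) + r * tnth t (q i))%R))) //; last first.
  apply: measurableT_comp => //; apply: measurable_tset; first exact: measurable_id.
  by apply: measurable_funD => //; apply: measurable_funM => //; exact: measurable_tnth.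
rewrite (ltup_affine1 (a := fun t => r * tnth t (q i))%R) ?ltr01 // ?invr1 ?mul1e //.
by move=> t x; rewrite tnth_tset (negbTE (qp _ _)).
Qed.

Lemma tnth_shears d n (p q : 'I_n -> 'I_d) (r : R) s (t : d.-tuple mR) : injective p ->
  (forall i j, q i != p j) -> uniq s -> (forall i, tnth (shears p q r s t) (q i) = tnth t (q i)) /\
  (forall i, tnth (shears p q r s t) (p i) =
     if i \in s then (tnth t (p i) + r * tnth t (q i))%R else tnth t (p i)).
Proof.
move=> pI qp; elim: s => //= k s IH /andP[ks us]; have [IH1 IH2] := IH us.
split=> i; rewrite tnth_tset; first by rewrite (negbTE (qp _ _)).
rewrite inE (inj_eq pI); case: eqVneq => [->|_] /=; last exact: IH2.
by rewrite IH2 (negbTE ks) IH1 mul1r.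
Qed.

End tuple_measure.

(** * Exterior products of (1,1)-forms in coordinates *)

Section mixed_minor.
Variables (K : comNzRingType) (n : nat).
Implicit Types (A B : 'M[K]_n) (I J : {set 'I_n}) (l : seq 'M[K]_n).
Local Open Scope ring_scope.

(** The sign of [wedge_sign], over an arbitrary commutative ring. *)
Definition wsgn (a : 'I_n) I : K := (-1) ^+ #|[set i in I | (i < a)%N]%SET|.

(* mixed [:: A1; ...; Ak] I J is the coefficient of w_IJ in A1 /\ ... /\ Ak,
   where each Ai is read as the (1,1)-form sum_(a,b) (Ai a b) w_ab. *)
Fixpoint mixed l I J : K := if l is A :: l' then \sum_(a in I) \sum_(b in J)
      wsgn a I * wsgn b J * A a b * mixed l' (I :\ a)%SET (J :\ b)%SET else 1.

Lemma wsgnD1 (a a' : 'I_n) I : a \in I -> wsgn a' (I :\ a)%SET = (if (a < a')%N then -1 else 1) * wsgn a' I.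
Proof.
move=> aI; rewrite /wsgn.
have -> : [set i in (I :\ a)%SET | (i < a')%N]%SET = ([set i in I | (i < a')%N] :\ a)%SET.
  by apply/finset.setP => i; rewrite !finset.inE andbA.
rewrite (cardsD1 a [set i in I | (i < a')%N]%SET) finset.inE aI /=.
case: (a < a')%N; rewrite ?add0n ?mul1r // add1n exprS mulrA mulN1r opprK mul1r //.
Qed.

Lemma wsgn_swap (a a' : 'I_n) I : a \in I -> a' \in I -> a != a' ->
  wsgn a I * wsgn a' (I :\ a)%SET = - (wsgn a' I * wsgn a (I :\ a')%SET).
Proof.
move=> aI a'I aa'; rewrite !wsgnD1 //.
have : (a < a')%N = ~~ (a' < a)%N. by rewrite -leqNgt [RHS]leq_eqVlt val_eqE (negbTE aa').
move=> ->; case: (a' < a)%N => /=; ring.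
Qed.

Lemma sum_setD1_swap (V : nmodType) I (F : 'I_n -> 'I_n -> V) : \sum_(a in I) \sum_(a' in (I :\ a)%SET) F a a' =
  \sum_(a in I) \sum_(a' in (I :\ a)%SET) F a' a.
Proof.
rewrite (exchange_big_dep (mem I)) /=; last by move=> a a' _; rewrite finset.inE => /andP[].
apply: eq_bigr => a aI; apply: eq_bigl => a'.
by rewrite !finset.inE eq_sym aI andbT andbC.
Qed.

Lemma setD1C I (a a' : 'I_n) : (I :\ a :\ a' = I :\ a' :\ a)%SET.
Proof. by apply/finset.setP => i; rewrite !finset.inE andbCA. Qed.

(** Forms of even degree commute: exchanging the order in which two factors extract their indices
    changes the row sign and the column sign, and the two changes cancel. *)
Lemma mixed_swap A B l I J : mixed (A :: B :: l) I J = mixed (B :: A :: l) I J.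
Proof.
rewrite /=.
pose F (X Y : 'M[K]_n) a b a' b' := wsgn a I * wsgn b J * X a b *
  (wsgn a' (I :\ a)%SET * wsgn b' (J :\ b)%SET * Y a' b' * mixed l (I :\ a :\ a')%SET (J :\ b :\ b')%SET).
have E (X Y : 'M[K]_n) : \sum_(a in I) \sum_(b in J) wsgn a I * wsgn b J * X a b *
    (\sum_(a' in (I :\ a)%SET) \sum_(b' in (J :\ b)%SET) wsgn a' (I :\ a)%SET * wsgn b' (J :\ b)%SET * Y a' b' *
      mixed l (I :\ a :\ a')%SET (J :\ b :\ b')%SET) =
   \sum_(a in I) \sum_(a' in (I :\ a)%SET) \sum_(b in J) \sum_(b' in (J :\ b)%SET) F X Y a b a' b'.
  apply: eq_bigr => a _; rewrite exchange_big /=; apply: eq_bigr => b _.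
  rewrite mulr_sumr; apply: eq_bigr => a' _. by rewrite mulr_sumr.
rewrite !E sum_setD1_swap; apply: eq_bigr => a aI; apply: eq_bigr => a' a'I.
rewrite sum_setD1_swap; apply: eq_bigr => b bJ; apply: eq_bigr => b' b'J.
move: a'I b'J; rewrite !finset.inE => /andP[aa' a'I] /andP[bb' b'J].
rewrite /F (setD1C I a' a) (setD1C J b' b).
have s1 := wsgn_swap aI a'I; rewrite eq_sym aa' in s1; have {}s1 := s1 isT.
have s2 := wsgn_swap bJ b'J; rewrite eq_sym bb' in s2; have {}s2 := s2 isT.
transitivity ((wsgn a' I * wsgn a (I :\ a')%SET) * (wsgn b' J * wsgn b (J :\ b')%SET) *
   (A a' b' * B a b * mixed l (I :\ a :\ a')%SET (J :\ b :\ b')%SET)); first by ring.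
transitivity ((wsgn a I * wsgn a' (I :\ a)%SET) * (wsgn b J * wsgn b' (J :\ b)%SET) *
   (A a' b' * B a b * mixed l (I :\ a :\ a')%SET (J :\ b :\ b')%SET)); last by ring.
by rewrite s1 s2 mulrNN.
Qed.

Lemma eq_mixed_cons A l l' I J : (forall I J, mixed l I J = mixed l' I J) ->
  mixed (A :: l) I J = mixed (A :: l') I J.
Proof. by move=> E /=; do 2!apply: eq_bigr => ? _; rewrite E. Qed.

Lemma mixed_move l1 A l2 I J : mixed (l1 ++ A :: l2) I J = mixed (A :: l1 ++ l2) I J.
Proof.
elim: l1 I J => //= B l1 IH I J.
by rewrite -[RHS]mixed_swap; apply: eq_mixed_cons => I' J'; rewrite IH.
Qed.

Lemma mixed_sum (T : finType) (F : T -> 'M[K]_n) l I J :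
  mixed ((\sum_t F t) :: l) I J = \sum_t mixed (F t :: l) I J.
Proof.
rewrite /= [RHS]exchange_big; apply: eq_bigr => a _; rewrite [RHS]exchange_big; apply: eq_bigr => b _.
by rewrite summxE mulr_sumr mulr_suml.
Qed.

Lemma mixedD A B l I J : mixed ((A + B) :: l) I J = mixed (A :: l) I J + mixed (B :: l) I J.
Proof.
rewrite /= -big_split; apply: eq_bigr => a _; rewrite -big_split; apply: eq_bigr => b _.
by rewrite mxE mulrDr mulrDl.
Qed.

Lemma mixedZ (c : K) A l I J : mixed ((c *: A) :: l) I J = c * mixed (A :: l) I J.
Proof.
rewrite /= mulr_sumr; apply: eq_bigr => a _; rewrite mulr_sumr; apply: eq_bigr => b _.
by rewrite mxE; ring.
Qed.

Lemma nth_enum_rem (a0 : 'I_n) I i j : (i < #|I|)%N ->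
  nth a0 (enum (I :\ nth a0 (enum I) i)%SET) j = nth a0 (enum I) (bump i j).
Proof.
move=> iI; set a := nth a0 (enum I) i.
have iz : (i < size (enum I))%N by rewrite -cardE.
have aI : a \in enum I by rewrite mem_nth.
have -> : enum (I :\ a)%SET = rem a (enum I).
  rewrite rem_filter ?enum_uniq // /enum_mem -filter_predI; apply: eq_filter => x. exact: finset.in_setD1.
have -> : rem a (enum I) = take i (enum I) ++ drop i.+1 (enum I). by rewrite remE index_uniq ?enum_uniq.
rewrite nth_cat size_take iz /bump; case: ltnP => ji. by rewrite add0n nth_take.
by rewrite nth_drop add1n addSn subnKC.
Qed.

Lemma wsgn_nth (a0 : 'I_n) I i : (i < #|I|)%N -> wsgn (nth a0 (enum I) i) I = (-1) ^+ i.
Proof.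
move=> iI; have iz : (i < size (enum I))%N by rewrite -cardE.
have srt : sorted <%O (enum I). have : sorted ltn (map val (enum 'I_n)) by rewrite val_enum_ord iota_ltn_sorted.
  rewrite sorted_map => s. rewrite {1}/enum_mem; apply: sorted_filter; first exact: lt_trans.
  by move: s; rewrite -enumT; apply: sub_sorted => x y; rewrite /relpre /= ltEord.
rewrite /wsgn; congr (_ ^+ _); rewrite -[RHS](count_lt_nth a0 srt iz).
rewrite cardE /enum_mem -size_filter -filter_predI; congr size.
by apply: eq_filter => x; rewrite /= finset.inE ltEord andbC.
Qed.

Definition minor (a0 : 'I_n) k A I J : K :=
  \det (\matrix_(i < k, j < k) A (nth a0 (enum I) i) (nth a0 (enum J) j)).

Lemma sum_in_nth (V : nmodType) (a0 : 'I_n) k I (F : 'I_n -> V) : #|I| = k ->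
  \sum_(a in I) F a = \sum_(i < k) F (nth a0 (enum I) i).
Proof. by move=> Ik; rewrite -big_enum (big_nth a0) -cardE Ik big_mkord. Qed.

Lemma card_setD1_nth (a : 'I_n) I k : a \in I -> #|I| = k.+1 -> #|(I :\ a)%SET| = k.
Proof. by move=> aI; rewrite (cardsD1 a I) aI add1n => -[]. Qed.

(** For each fixed row the sum over the columns is the Laplace expansion of one and the same minor;
    the k + 1 possible first rows produce the factorial. *)
Lemma mixed_nseq_minor (a0 : 'I_n) k A I J : #|I| = k -> #|J| = k ->
  mixed (nseq k A) I J = k`!%:R * minor a0 k A I J.
Proof.
elim: k I J => [|k IH] I J Ik Jk; first by rewrite /= /minor det_mx00 mul1r.
rewrite /= (sum_in_nth a0 _ Ik).
have H (i : 'I_k.+1) : \sum_(b in J) wsgn (nth a0 (enum I) i) I * wsgn b J * A (nth a0 (enum I) i) b *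
     mixed (nseq k A) (I :\ nth a0 (enum I) i)%SET (J :\ b)%SET = k`!%:R * minor a0 k.+1 A I J.
  rewrite (sum_in_nth a0 _ Jk) /minor (expand_det_row _ i) mulr_sumr. apply: eq_bigr => j _.
  have iI : (i < #|I|)%N by rewrite Ik. have jJ : (j < #|J|)%N by rewrite Jk.
  have aI : nth a0 (enum I) i \in I by rewrite -mem_enum mem_nth // -cardE.
  have bJ : nth a0 (enum J) j \in J by rewrite -mem_enum mem_nth // -cardE. rewrite IH; last 2 first.
  - exact: card_setD1_nth.
  - exact: card_setD1_nth. rewrite !wsgn_nth // mxE /cofactor exprD /minor.
  have -> : row' i (col' j (\matrix_(i, j) A (nth a0 (enum I) i) (nth a0 (enum J) j))) =
     \matrix_(i1 < k, j1 < k) A (nth a0 (enum (I :\ nth a0 (enum I) i)%SET) i1)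
                   (nth a0 (enum (J :\ nth a0 (enum J) j)%SET) j1).
    by apply/matrixP => i1 j1; rewrite !mxE !nth_enum_rem. by ring.
transitivity (\sum_(i < k.+1) k`!%:R * minor a0 k.+1 A I J); first exact: eq_bigr.
by rewrite sumr_const card_ord -[LHS]mulr_natl factS natrM mulrA.
Qed.

End mixed_minor.

Lemma mixed_det (K : comNzRingType) n (A : 'M[K]_n) : mixed (nseq n A) finset.setT finset.setT = n`!%:R * \det A.
Proof.
case: n A => [|m] A; first by rewrite /= det_mx00 mul1r.
rewrite (mixed_nseq_minor ord0); [|by rewrite cardsT card_ord..].
congr (_ * \det _); apply/matrixP => i j; rewrite mxE.
by rewrite enum_setT -enumT !nth_ord_enum.
Qed.

(** * Positivity of mixed products; the arithmetic-geometric inequality for hermitian matrices *)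

Section psd.
Variable (C : numClosedFieldType) (n : nat).
Implicit Types (A B H : 'M[C]_n) (v w : 'rV[C]_n).
Local Open Scope sesquilinear_scope.

Definition quad A v : C := \sum_a \sum_b v 0 a * A a b * (v 0 b)^*.

Definition herm A := forall a b, A b a = (A a b)^*.

Definition psd A := herm A /\ forall v, 0 <= quad A v.

Definition rk1 v : 'M[C]_n := \matrix_(a, b) (v 0 a * (v 0 b)^*).

Lemma quadE A v : quad A v = (v *m A *m v ^t*) 0 0.
Proof.
rewrite mxE /quad exchange_big; apply: eq_bigr => b _.
by rewrite !mxE mulr_suml; apply: eq_bigr => a _.
Qed.

Lemma quad_row A B j : quad A (row j B) = (B *m A *m B ^t*) j j.
Proof.
by rewrite quadE -!row_mul !mxE; apply: eq_bigr => k _; rewrite !mxE.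
Qed.

Lemma herm_hermsymmx A : herm A -> A \is hermsymmx.
Proof.
move=> hA; apply/is_hermitianmxP; rewrite expr0 scale1r.
by apply/matrixP => a b; rewrite !mxE hA.
Qed.

Lemma spectral_decomp A : herm A -> exists (P : 'M[C]_n) (D : 'rV[C]_n),
  [/\ P *m P ^t* = 1%:M, P ^t* *m P = 1%:M & A = P ^t* *m diag_mx D *m P].
Proof.
move=> /herm_hermsymmx/hermitian_normalmx/orthomx_spectralP AE.
exists (spectralmx A), (spectral_diag A); have uP := spectral_unitarymx A.
have h := unitarymxP uP.
split=> //; last by rewrite -invmx_unitary.
by rewrite -invmx_unitary // mulVmx // spectral_unit.
Qed.

Lemma spectral_diagE A P (D : 'rV[C]_n) : P *m P ^t* = 1%:M ->
  A = P ^t* *m diag_mx D *m P -> forall k, D 0 k = quad A (row k P).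
Proof.
move=> PP AE k; rewrite quad_row AE !mulmxA PP mul1mx -mulmxA PP mulmx1.
by rewrite mxE eqxx mulr1n.
Qed.

Lemma psd_rk1_sum A : psd A -> exists F : 'I_n -> 'rV[C]_n, A = \sum_k rk1 (F k).
Proof.
move=> [hA pA]; have [P [D [PP _ AE]]] := spectral_decomp hA.
have D0 k : 0 <= D 0 k by rewrite (spectral_diagE PP AE).
exists (fun k => sqrtC (D 0 k) *: map_mx Num.conj (row k P)).
apply/matrixP => a b; rewrite summxE [in LHS]AE mxE; apply: eq_bigr => k _.
rewrite mul_mx_diag !mxE rmorphM /= conjCK.
rewrite (conj_Creal (ger0_real (_ : 0 <= sqrtC (D 0 k)))) ?sqrtC_ge0 //.
have := sqrtCK (D 0 k); move: (sqrtC _) => s <-; ring.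
Qed.

(** The coefficient of dz_I in the product of the linear forms sum_a v_a dz_a. A mixed product of
    rank-one matrices factors through it. *)
Fixpoint wedge (vs : seq 'rV[C]_n) (I : {set 'I_n}) : C :=
  if vs is v :: vs' then \sum_(a in I) wsgn C a I * v 0 a * wedge vs' (I :\ a)%SET else 1.

Lemma conj_wsgn a (I : {set 'I_n}) : (wsgn C a I)^* = wsgn C a I.
Proof. by rewrite /wsgn rmorphXn rmorphN rmorph1. Qed.

Lemma mixed_rk1 vs I J : mixed (map rk1 vs) I J = wedge vs I * (wedge vs J)^*.
Proof.
elim: vs I J => [|v vs IH] I J; first by rewrite /= rmorph1 mulr1.
rewrite /= mulr_suml; apply: eq_bigr => a _; rewrite rmorph_sum mulr_sumr.
apply: eq_bigr => b _; rewrite IH mxE !rmorphM /= conj_wsgn; ring.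
Qed.

(** By multilinearity a mixed product of positive matrices is a sum of mixed products of rank-one
    matrices, each of which is the squared modulus of a product of linear forms. The list [vs]
    collects the vectors of the factors already decomposed. *)
Lemma mixed_psd_ge0 l I : (forall A, A \in l -> psd A) -> 0 <= mixed l I I.
Proof.
suff H vs : (forall A, A \in l -> psd A) -> 0 <= mixed (l ++ map rk1 vs) I I. by move/(H [::]); rewrite cats0.
elim: l vs => [|A l IH] vs pl; first by rewrite /= mixed_rk1 mul_conjC_ge0.
have [F AE] := psd_rk1_sum (pl A (mem_head _ _)).
rewrite cat_cons {1}AE mixed_sum sumr_ge0 // => k _.
rewrite -mixed_move -[rk1 (F k) :: _]/(map rk1 (F k :: vs)); apply: IH => B Bl.
by apply: pl; rewrite inE Bl orbT.
Qed.

Lemma det_conj B : \det (B ^t*) = (\det B)^*.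
Proof. by rewrite -det_tr -det_map_mx; congr (\det _); apply/matrixP => i j; rewrite !mxE. Qed.

Lemma det_unitary B : B *m B ^t* = 1%:M -> \det B * (\det B)^* = 1.
Proof. by move=> BB; rewrite -det_conj -det_mulmx BB det1. Qed.

(** The trace of B A B^* is the sum of its eigenvalues, its determinant is their product, and the
    latter equals that of A since B is unimodular. *)
Lemma psd_AGM A B (lam : C) : psd A -> 0 <= lam -> lam ^+ n <= \det A ->
  `|\det B| = 1 -> n%:R * lam <= \sum_j quad A (row j B).
Proof.
move=> pA l0 lA dB.
pose K := B *m A *m B ^t*.
have [hA pA'] := pA.
have KE j : K j j = quad A (row j B) by rewrite quad_row.
have hK : herm K. move=> a b; rewrite /K !mxE rmorph_sum /=. under eq_bigr do rewrite !mxE mulr_suml.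
  under [RHS]eq_bigr do rewrite !mxE rmorphM /= rmorph_sum mulr_suml /=.
  rewrite exchange_big; apply: eq_bigr => i _; apply: eq_bigr => j _. by rewrite rmorphM /= conjCK (hA j i); ring.
have [P [D [PP P'P EK]]] := spectral_decomp hK.
have D0 k : 0 <= D 0 k. rewrite (spectral_diagE PP EK) /K.
  have -> : quad (B *m A *m B ^t*) (row k P) = quad A (row k (P *m B)).
    by rewrite !quad_row trmx_mul map_mxM !mulmxA. exact: pA'.
have detK : \det K = \prod_k D 0 k.
  by rewrite EK !det_mulmx det_conj mulrAC [_^* * _]mulrC det_unitary // mul1r det_diag.
have detK2 : \det K = \det A. rewrite /K !det_mulmx det_conj mulrAC -normCK dB expr1n mul1r //.
have trK : \sum_j K j j = \sum_k D 0 k. rewrite -/(mxtrace K) EK mxtrace_mulC mulmxA PP mul1mx /mxtrace.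
  by apply: eq_bigr => k _; rewrite mxE eqxx mulr1n.
rewrite (eq_bigr _ (fun j _ => esym (KE j))) trK.
have [n0|n0] := posnP n. by rewrite (_ : n%:R = 0) ?mul0r ?sumr_ge0 //; apply/eqP; rewrite pnatr_eq0; apply/eqP.
have := leif_AGM (I := 'I_n) (A := predT) (E := fun k => D 0 k) (fun k _ => D0 k).
rewrite card_ord => -[+ _]; rewrite -detK detK2 => /(le_trans lA).
have S0 : 0 <= \sum_k D 0 k by rewrite sumr_ge0.
rewrite (ler_pXn2r n0) ?nnegrE ?divr_ge0 //.
by rewrite ler_pdivlMr ?ltr0n // mulrC.
Qed.

(** Equality is attained in [psd_AGM]: if g is the geometric mean of the eigenvalues D_k, scaling
    the k-th unit eigenvector by the square root of g / D_k gives a unimodular B all of whose terms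
    equal g. Strict positivity allows these quotients. *)
Lemma psd_AGM_conv A (lam : C) : (0 < n)%N -> herm A -> (forall v, v != 0 -> 0 < quad A v) -> 0 <= lam ->
  (forall B, `|\det B| = 1 -> n%:R * lam <= \sum_j quad A (row j B)) -> lam ^+ n <= \det A.
Proof.
move=> n0 hA pA l0 H.
have [P [D [PP P'P EA]]] := spectral_decomp hA.
have D0 k : 0 < D 0 k. rewrite (spectral_diagE PP EA); apply: pA; apply/eqP => rk0.
  have Pk b : P k b = 0 by have := congr1 (fun M : 'rV[C]_n => M 0 b) rk0; rewrite !mxE.
  have : (P *m P ^t*) k k = 0 by rewrite mxE big1 // => b _; rewrite Pk mul0r.
  by rewrite PP mxE eqxx => /eqP; rewrite oner_eq0.
have detA : \det A = \prod_k D 0 k.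
  by rewrite EA !det_mulmx det_conj mulrAC [_^* * _]mulrC det_unitary // mul1r det_diag.
have Dp : 0 < \prod_k D 0 k by rewrite prodr_gt0.
pose g := n.-root (\prod_k D 0 k).
have gE : g ^+ n = \prod_k D 0 k by rewrite rootCK.
have g0 : 0 < g by rewrite rootC_gt0.
pose e k := sqrtC (g / D 0 k).
have e0 k : 0 <= e k by rewrite sqrtC_ge0 divr_ge0 // ltW.
pose B := diag_mx (\row_k e k) *m P.
have dB : `|\det B| = 1. have : `|\det B| ^+ 2 = 1.
    rewrite normCK /B det_mulmx rmorphM mulrACA (det_unitary PP) mulr1 det_diag.
    rewrite rmorph_prod -big_split /=. under eq_bigr do rewrite mxE conj_Creal ?ger0_real // -expr2 sqrtCK.
    by rewrite big_split /= prodr_const card_ord gE prodfV divff // gt_eqF.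
  by move/eqP; rewrite sqrf_eq1 => /orP[/eqP // |/eqP h]; have := normr_ge0 (\det B); rewrite h oppr_ge0 ler10.
have := H B dB.
have -> : \sum_j quad A (row j B) = n%:R * g.
  rewrite (eq_bigr (fun=> g)) ?sumr_const ?card_ord ?mulr_natl // => j _. rewrite quad_row EA /B trmx_mul map_mxM.
  have -> : diag_mx (\row_k e k) *m P *m (P ^t* *m diag_mx D *m P) *m
     (P ^t* *m (diag_mx (\row_k e k)) ^t*) = diag_mx (\row_k e k) *m diag_mx D *m (diag_mx (\row_k e k)) ^t*.
    by rewrite !mulmxA -[_ *m P *m P ^t*]mulmxA PP mulmx1 -[_ *m P *m P ^t*]mulmxA PP mulmx1.
  have -> : (diag_mx (\row_k e k)) ^t* = diag_mx (\row_k e k).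
    apply/matrixP => a b; rewrite !mxE; case: eqVneq => [->|]; rewrite ?eqxx.
      by rewrite !mulr1n conj_Creal // ger0_real. by move=> _; rewrite !mulr0n rmorph0.
  rewrite !mulmx_diag mxE eqxx mulr1n !mxE. by rewrite mulrAC -expr2 sqrtCK divfK // gt_eqF.
rewrite ler_pM2l ?ltr0n // => lg.
by rewrite detA -gE lerXn2r ?nnegrE // ltW.
Qed.

End psd.

Notation mfun g := (measurable_fun [set: borelCn _ _] (g : borelCn _ _ -> measurableTypeR _)).
Notation mfun_on A g := (measurable_fun (A : set (borelCn _ _)) (g : borelCn _ _ -> measurableTypeR _)).

(** * Lebesgue measure on C^n: changes of variables, integration of bounded functions of bounded
    support *)

Section Cn_measure.
Context {R : realType} {n : nat}.
Notation mR := (measurableTypeR R).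
Notation mu := (@lebesgue_measure R).
Notation C := (Cn R n).
Notation bC := (borelCn R n).
Notation V := (lebesgueCn R n).
Implicit Types (f g : C -> R) (z w v a : C) (c r : R).

Definition tuple_of_Cn (z : bC) : (n + n).-tuple mR := [tuple row_mx z.1 z.2 0 j | j < n + n].

Lemma tuple_of_CnK : cancel tuple_of_Cn (@Cn_of_tuple R n).
Proof.
move=> [x y]; congr pair; apply/rowP => i; rewrite !mxE tnth_mktuple /=. by rewrite row_mxEl.
by rewrite row_mxEr.
Qed.

Lemma measurable_to_Cn d (T : measurableType d) (h : T -> bC) :
  (forall i, measurable_fun [set: T] (fun x => (h x).1 0 i : mR)) ->
  (forall i, measurable_fun [set: T] (fun x => (h x).2 0 i : mR)) -> measurable_fun [set: T] h.
Proof.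
move=> m1 m2.
rewrite (_ : h = @Cn_of_tuple R n \o (tuple_of_Cn \o h)); last first.
  by apply/funext => x; rewrite /= tuple_of_CnK.
apply: measurableT_comp; first exact: measurable_Cn_of_tuple.
apply/measurable_fun_tnthP => j.
case: (split_ordP j) => i ->. rewrite (_ : _ \o _ = (fun x => (h x).1 0 i)) //.
  by apply/funext => x /=; rewrite tnth_mktuple row_mxEl.
rewrite (_ : _ \o _ = (fun x => (h x).2 0 i)) //.
by apply/funext => x /=; rewrite tnth_mktuple row_mxEr.
Qed.

Lemma measurable_coord1 i : measurable_fun [set: bC] (fun z : bC => z.1 0 i : mR).
Proof.
apply: (measurability _ (RGenOpens.measurableE R)).
move=> _ [_ [x [y ->]] <-]; rewrite setTI; apply: sub_sigma_algebra.
apply: open_comp; last exact: interval_open.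
move=> z _; apply: (@continuous_comp _ _ _ fst (fun u : 'rV[R]_n => u 0 i)). exact: cvg_fst.
exact: coord_continuous.
Qed.

Lemma measurable_coord2 i : measurable_fun [set: bC] (fun z : bC => z.2 0 i : mR).
Proof.
apply: (measurability _ (RGenOpens.measurableE R)).
move=> _ [_ [x [y ->]] <-]; rewrite setTI; apply: sub_sigma_algebra.
apply: open_comp; last exact: interval_open.
move=> z _; apply: (@continuous_comp _ _ _ snd (fun u : 'rV[R]_n => u 0 i)). exact: cvg_snd.
exact: coord_continuous.
Qed.

Lemma open_measurableCn (U : set C) : open U -> measurable (U : set bC).
Proof. by move=> oU; exact: sub_sigma_algebra. Qed.

Lemma closed_measurableCn (U : set C) : closed U -> measurable (U : set bC).
Proof.
move=> cU; rewrite -[U]setCK; apply: measurableC.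
by apply: open_measurableCn; rewrite openC.
Qed.

Lemma usc_measurable (D : set C) f : measurable (D : set bC) ->
  (forall r, exists2 U : set C, open U & D `&` [set z | f z < r] = D `&` U) -> mfun_on D f.
Proof.
move=> mD H; apply: (measurability _ (RGenInftyO.measurableE R)).
move=> _ [_ [r ->] <-].
have -> : (D : set bC) `&` f @^-1` `]-oo, r[%classic = D `&` [set z | f z < r].
  by apply/seteqP; split=> z [Dz] /=; rewrite in_itv.
have [U oU ->] := H r; apply: measurableI => //; exact: open_measurableCn.
Qed.

Lemma continuous_measurableCn f : continuous f -> mfun f.
Proof.
move=> cf; apply: usc_measurable => // r.
exists [set z | f z < r] => //.
by apply: (@open_comp _ _ f [set x | x < r]); [move=> z _; exact: cf|exact: open_lt].
Qed.

Local Open Scope ereal_scope.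

Lemma Cn_integral (F : bC -> \bar R) : measurable_fun [set: bC] F -> (forall z, 0 <= F z) ->
  \int[V]_z F z = \int[@ltup R (n + n)]_t F (Cn_of_tuple t).
Proof.
move=> mF F0; rewrite /lebesgueCn /image_measure /=.
by rewrite (ge0_integral_pushforward (@measurable_Cn_of_tuple R n)).
Qed.

Lemma measurable_tuple_Cn (F : bC -> \bar R) : measurable_fun [set: bC] F ->
  measurable_fun [set: (n + n).-tuple mR] (F \o @Cn_of_tuple R n).
Proof. by move=> mF; apply: measurableT_comp => //; exact: measurable_Cn_of_tuple. Qed.

Lemma measurable_affine_Cn c a : measurable_fun [set: bC] (fun z : bC => (c *: z + a)%R : bC).
Proof.
apply: measurable_to_Cn => i.
  rewrite (_ : (fun x : bC => _) = (fun x : bC => c * x.1 0 i + a.1 0 i : mR)%R); last first.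
    by apply/funext => x; rewrite !mxE.
  apply: measurable_funD => //; apply: measurable_funM => //; exact: measurable_coord1.
rewrite (_ : (fun x : bC => _) = (fun x : bC => c * x.2 0 i + a.2 0 i : mR)%R); last first.
  by apply/funext => x; rewrite !mxE.
apply: measurable_funD => //; apply: measurable_funM => //; exact: measurable_coord2.
Qed.

Lemma ge0_integral_affine c a (F : bC -> \bar R) : (0 < c)%R ->
  measurable_fun [set: bC] F -> (forall z, 0 <= F z) ->
  \int[V]_z F (c *: z + a)%R = (c^-1 ^+ (n + n))%:E * \int[V]_z F z.
Proof.
move=> c0 mF F0; rewrite !Cn_integral //; last first. exact: (measurableT_comp mF (measurable_affine_Cn c a)).
have mF' := measurable_tuple_Cn mF.
rewrite -(ltup_affine (fun j => row_mx a.1 a.2 ord0 j) c0 mF'); last by move=> t; exact: F0.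
apply: eq_integral => t _; congr F; congr pair; apply/rowP => i; by rewrite !mxE tnth_mktuple ?row_mxEl ?row_mxEr.
Qed.

Lemma measurable_shear1 r : measurable_fun [set: bC] (fun z : bC => (z.1 + r *: z.2, z.2)%R : bC).
Proof.
apply: measurable_to_Cn => i /=; last exact: measurable_coord2.
rewrite (_ : (fun x : bC => _) = (fun x : bC => x.1 0 i + r * x.2 0 i : mR)%R); last first.
  by apply/funext => x; rewrite !mxE.
apply: measurable_funD; first exact: measurable_coord1.
by apply: measurable_funM => //; exact: measurable_coord2.
Qed.

Lemma measurable_shear2 r : measurable_fun [set: bC] (fun z : bC => (z.1, z.2 + r *: z.1)%R : bC).
Proof.
apply: measurable_to_Cn => i /=; first exact: measurable_coord1.
rewrite (_ : (fun x : bC => _) = (fun x : bC => x.2 0 i + r * x.1 0 i : mR)%R); last first.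
  by apply/funext => x; rewrite !mxE.
apply: measurable_funD; first exact: measurable_coord2.
by apply: measurable_funM => //; exact: measurable_coord1.
Qed.

Lemma ge0_integral_shear1 r (F : bC -> \bar R) : measurable_fun [set: bC] F -> (forall z, 0 <= F z) ->
  \int[V]_z F (z.1 + r *: z.2, z.2)%R = \int[V]_z F z.
Proof.
move=> mF F0; rewrite !Cn_integral //; last first. exact: (measurableT_comp mF (measurable_shear1 r)).
have mF' := measurable_tuple_Cn mF.
have rl (i j : 'I_n) : rshift n i != lshift n j by rewrite eq_rlshift.
rewrite -(ltup_shears (p := lshift n) (q := @rshift n n) r (enum 'I_n) rl mF'); last by move=> t; exact: F0.
apply: eq_integral => t _; congr F.
have [H1 H2] := tnth_shears r t (@lshift_inj n n) rl (enum_uniq 'I_n).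
by congr pair; apply/rowP => i; rewrite !mxE ?H1 // H2 mem_enum.
Qed.

Lemma ge0_integral_shear2 r (F : bC -> \bar R) : measurable_fun [set: bC] F -> (forall z, 0 <= F z) ->
  \int[V]_z F (z.1, z.2 + r *: z.1)%R = \int[V]_z F z.
Proof.
move=> mF F0; rewrite !Cn_integral //; last first. exact: (measurableT_comp mF (measurable_shear2 r)).
have mF' := measurable_tuple_Cn mF.
have lr (i j : 'I_n) : lshift n i != rshift n j by rewrite eq_lrshift.
rewrite -(ltup_shears (p := @rshift n n) (q := lshift n) r (enum 'I_n) lr mF'); last by move=> t; exact: F0.
apply: eq_integral => t _; congr F.
have [H1 H2] := tnth_shears r t (@rshift_inj n n) lr (enum_uniq 'I_n).
by congr pair; apply/rowP => i; rewrite !mxE ?H1 // H2 mem_enum.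
Qed.

Lemma measurable_cscale p q : measurable_fun [set: bC] (fun z : bC => cscale p q z : bC).
Proof.
apply: measurable_to_Cn => i.
  rewrite (_ : (fun x : bC => _) = (fun x : bC => p * x.1 0 i - q * x.2 0 i : mR)%R); last first.
    by apply/funext => x; rewrite !mxE. apply: measurable_funB; apply: measurable_funM => //;
    [exact: measurable_coord1|exact: measurable_coord2].
rewrite (_ : (fun x : bC => _) = (fun x : bC => p * x.2 0 i + q * x.1 0 i : mR)%R); last first.
  by apply/funext => x; rewrite !mxE.
apply: measurable_funD; apply: measurable_funM => //; [exact: measurable_coord2|exact: measurable_coord1].
Qed.

(* A plane rotation other than the half turn is a product of three shears. *)
Lemma ge0_integral_rot p q (F : bC -> \bar R) : (p ^+ 2 + q ^+ 2 = 1)%R ->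
  measurable_fun [set: bC] F -> (forall z, 0 <= F z) -> \int[V]_z F (cscale p q z) = \int[V]_z F z.
Proof.
move=> pq mF F0.
have shear (p' q' : R) (G : bC -> \bar R) : (p' ^+ 2 + q' ^+ 2 = 1)%R -> (p' != -1)%R ->
    measurable_fun [set: bC] G -> (forall z, 0 <= G z) -> \int[V]_z G (cscale p' q' z) = \int[V]_z G z.
  move=> pq' p1 mG G0. have p10 : (1 + p' != 0)%R by rewrite addrC addr_eq0. pose t := (- q' / (1 + p'))%R.
  have tq : (1 + t * q' = p')%R. rewrite /t; apply: (mulIf p10); rewrite mulrDl mul1r mulrAC divfK //.
    have -> : (- q' * q' = p' ^+ 2 - 1)%R by rewrite -pq'; ring. by ring.
  have tt : (t * (1 + p') = - q')%R by rewrite /t divfK.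
  have mS1 := measurable_shear1 t; have mS2 := measurable_shear2 q'.
  rewrite -(ge0_integral_shear1 t mG); last by move=> z; exact: G0.
  rewrite -(ge0_integral_shear2 q' (measurableT_comp mG mS1)); last by move=> z; exact: G0.
  rewrite -(ge0_integral_shear1 t (measurableT_comp (measurableT_comp mG mS1) mS2)); last by move=> z; exact: G0.
  apply: eq_integral => -[x y] _ /=; congr G; congr pair; apply/rowP => i; rewrite !mxE.
    rewrite -[in LHS]tq; have -> : (- (q' * y 0 i) = t * (1 + p') * y 0 i)%R by rewrite tt; ring.
    have -> : (t * (1 + p') = t * (1 + (1 + t * q')))%R by rewrite tq. by rewrite /=; ring.
  by rewrite -[in LHS]tq /=; ring.
have [p1|p1] := eqVneq p (-1)%R; last exact: (shear p q F pq p1 mF F0).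
have q0 : q = 0%R. have q2 : (q ^+ 2 = 0)%R.
    by move: pq; rewrite p1 sqrrN expr1n => /(canRL (addKr _)); rewrite addNr. by apply/eqP; rewrite -sqrf_eq0 q2.
have n1 : (0 != -1 :> R)%R by rewrite eq_sym oppr_eq0 oner_eq0.
have e1 : (0 ^+ 2 + 1 ^+ 2 = 1 :> R)%R by rewrite expr0n expr1n add0r.
rewrite -(shear 0%R 1%R F e1 n1 mF F0).
rewrite -(shear 0%R 1%R _ e1 n1 (measurableT_comp mF (measurable_cscale 0 1))); last by move=> z; exact: F0.
apply: eq_integral => -[x y] _ /=; congr F; rewrite p1 q0; congr pair; apply/rowP => i; rewrite !mxE /=; ring.
Qed.

Local Close Scope ereal_scope.

Lemma closed_normle r : closed [set z : C | `|z| <= r].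
Proof. by apply: (@closed_comp C R (fun z => `|z|) [set x | x <= r]); [move=> z _; exact: norm_continuous|exact: closed_le]. Qed.

Lemma open_normgt r : open [set z : C | r < `|z|].
Proof. by apply: (@open_comp C R (fun z => `|z|) [set x | r < x]); [move=> z _; exact: norm_continuous|exact: open_gt]. Qed.

Lemma normle_compact r : compact [set z : C | `|z| <= r].
Proof.
have -> : [set z : C | `|z| <= r] = [set x : 'rV[R]_n | `|x| <= r] `*` [set x : 'rV[R]_n | `|x| <= r].
  apply/seteqP; split=> [[x y]|[x y] [/= h1 h2]] /=. by rewrite prod_normE ge_max => /andP.
  by rewrite prod_normE ge_max h1.
have K : compact [set x : 'rV[R]_n | `|x| <= r]. apply: bounded_closed_compact.
    by exists r; split; [exact: num_real|move=> x /ltW rx y /= /le_trans; apply].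
  have cn : continuous (fun x : 'rV[R]_n => `|x|) by exact: norm_continuous.
  have h := @closed_comp 'rV[R]_n R (fun x => `|x|) [set y | y <= r] (fun t _ => cn t) (@closed_le R r). exact: h.
exact: compact_setX.
Qed.

Lemma le_coord_norm (x : 'rV[R]_n) i : `|x 0 i| <= `|x|.
Proof.
rewrite {2}/Num.norm /= mx_normrE.
exact: (le_bigmax 0 (fun ij : 'I_1 * 'I_n => `|x ij.1 ij.2|) (0, i)).
Qed.

Lemma volume_normle_lty r : (V [set z : C | (`|z| <= r)%R] < +oo)%E.
Proof.
rewrite /lebesgueCn /image_measure /= /pushforward.
pose k := Num.bound `|r|.
apply: le_lt_trans (ltup_cube_lty (R := R) (n + n) k).
apply: le_measure; rewrite ?inE.
- rewrite -[X in measurable X]setTI; apply: measurable_Cn_of_tuple => //.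
  apply: closed_measurableCn; exact: closed_normle.
- exact: measurable_cube.
- move=> t /=; rewrite prod_normE ge_max => /andP[h1 h2] j.
  have rk : r <= k%:R by apply: le_trans (ler_norm _) (ltW (archi_boundP (normr_ge0 _))).
  rewrite in_itv /= -ler_norml; apply: le_trans rk. case: (split_ordP j) => i ->.
    have := le_trans (le_coord_norm _ i) h1; by rewrite mxE.
  have := le_trans (le_coord_norm _ i) h2; by rewrite mxE.
Qed.

Definition VC : set bC -> \bar R := V.
HB.instance Definition _ := Measure.on VC.

Lemma VC_sigma_finite : sigma_finite [set: bC] VC.
Proof.
exists (fun k : nat => [set z : C | (`|z| <= k%:R)%R]) => [|k]; last first.
  by split; [apply: closed_measurableCn; exact: closed_normle|exact: volume_normle_lty].
apply/seteqP; split=> // z _; exists (Num.bound `|z|) => //=.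
exact: ltW (archi_boundP (normr_ge0 _)).
Qed.

HB.instance Definition _ := Measure_isSigmaFinite.Build _ _ _ VC VC_sigma_finite.

(** A class on which [I] is linear, monotone and invariant, with integrability automatic: bounded
    Borel functions vanishing outside a ball. *)
Definition nice f := mfun f /\ exists c r, forall z, `|f z| <= c /\ (r < `|z| -> f z = 0).

Lemma nice_integrable f : nice f -> V.-integrable setT (EFin \o f).
Proof.
move=> [mf [c [r H]]].
pose B : set bC := [set z : C | `|z| <= r].
have mB : measurable B by apply: closed_measurableCn; exact: closed_normle.
have : V.-integrable B (EFin \o f). apply: measurable_bounded_integrable => //; first exact: volume_normle_lty.
    by apply: measurable_funTS. exists c; split; first exact: num_real.
  by move=> x cx z _; apply: le_trans (H z).1 (ltW cx).
move/(proj1 (integrable_mkcond (mu := V) (EFin \o f) mB)).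
congr (_.-integrable _ _); apply/funext => z; rewrite patchE.
case: ifPn => //; rewrite notin_setE /= => /negP; rewrite -ltNge => /(H z).2.
by rewrite /= => ->.
Qed.

Definition I f : R := \int[V]_z f z.

Lemma niceD f g : nice f -> nice g -> nice (fun z => f z + g z).
Proof.
move=> [mf [c [r H]]] [mg [c' [r' H']]]; split; first exact: measurable_funD.
exists (c + c'), (Num.max r r') => z; split.
  by apply: le_trans (ler_normD _ _) _; rewrite lerD // ?(H z).1 ?(H' z).1.
by rewrite gt_max => /andP[h h']; rewrite (H z).2 // (H' z).2 // addr0.
Qed.

Lemma niceM f g : nice f -> mfun g -> (exists c, forall z, `|g z| <= c) -> nice (fun z => f z * g z).
Proof.
move=> [mf [c [r H]]] mg [c' H']; split; first exact: measurable_funM.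
exists (c * c'), r => z; split; last by move=> h; rewrite (H z).2 // mul0r.
by rewrite normrM ler_pM // (H z).1.
Qed.

Lemma niceZ c f : nice f -> nice (fun z => c * f z).
Proof.
move=> nf; under [X in nice X]eq_fun do rewrite mulrC.
by apply: niceM => //; exists `|c|.
Qed.

Lemma niceN f : nice f -> nice (fun z => - f z).
Proof.
move=> nf; rewrite (_ : (fun z => - f z) = (fun z => -1 * f z)); first exact: niceZ.
by apply/funext => z; rewrite mulN1r.
Qed.

Lemma niceB f g : nice f -> nice g -> nice (fun z => f z - g z).
Proof. by move=> nf ng; apply: niceD => //; exact: niceN. Qed.

Lemma nice0 : nice (fun=> 0).
Proof. by split=> //; exists 0, 0 => z; rewrite normr0. Qed.

Lemma nice_sum (J : Type) (s : seq J) (P : pred J) (F : J -> C -> R) :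
  (forall i, P i -> nice (F i)) -> nice (fun z => \sum_(i <- s | P i) F i z).
Proof.
move=> nF; elim: s => [|i s IH]. rewrite (_ : (fun z => _) = (fun=> 0)); first exact: nice0.
  by apply/funext => z; rewrite big_nil.
case: (boolP (P i)) => Pi. rewrite (_ : (fun z => _) = (fun z => F i z + \sum_(i <- s | P i) F i z)).
    by apply: niceD => //; exact: nF. by apply/funext => z; rewrite big_cons Pi.
rewrite (_ : (fun z => _) = (fun z => \sum_(i <- s | P i) F i z)) //.
by apply/funext => z; rewrite big_cons (negbTE Pi).
Qed.

Lemma ID f g : nice f -> nice g -> I (fun z => f z + g z) = I f + I g.
Proof. by move=> nf ng; apply: RintegralD => //; exact: nice_integrable. Qed.

Lemma IB f g : nice f -> nice g -> I (fun z => f z - g z) = I f - I g.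
Proof. by move=> nf ng; apply: RintegralB => //; exact: nice_integrable. Qed.

Lemma IZ c f : nice f -> I (fun z => c * f z) = c * I f.
Proof. by move=> nf; apply: RintegralZl => //; exact: nice_integrable. Qed.

Lemma I0 : I (fun=> 0) = 0.
Proof. by rewrite /I Rintegral_cst // mul0r. Qed.

Lemma I_ext f g : f =1 g -> I f = I g.
Proof. by move=> fg; congr I; exact/funext. Qed.

Lemma I_ge0 f : (forall z, 0 <= f z) -> 0 <= I f.
Proof. by move=> f0; apply: Rintegral_ge0. Qed.

Lemma le_I f g : nice f -> nice g -> (forall z, f z <= g z) -> I f <= I g.
Proof. by move=> nf ng fg; apply: le_Rintegral => //; exact: nice_integrable. Qed.

Lemma I_sum (J : Type) (s : seq J) (P : pred J) (F : J -> C -> R) : (forall i, P i -> nice (F i)) ->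
  I (fun z => \sum_(i <- s | P i) F i z) = \sum_(i <- s | P i) I (F i).
Proof.
move=> nF; elim: s => [|i s IH]. by rewrite big_nil -[RHS]I0; apply: I_ext => z; rewrite big_nil.
rewrite big_cons; case: (boolP (P i)) => Pi. rewrite -IH -ID; [|exact: nF|exact: nice_sum].
  by apply: I_ext => z; rewrite big_cons Pi.
by rewrite -IH; apply: I_ext => z; rewrite big_cons (negbTE Pi).
Qed.

(** Changes of variables are proved for nonnegative integrands; splitting f into positive and
    negative parts carries them over to signed ones. *)
Lemma I_change (phi : bC -> bC) k f : 0 <= k -> measurable_fun setT phi ->
  (forall F : bC -> \bar R, measurable_fun [set: bC] F -> (forall z, 0 <= F z)%E ->
    (\int[V]_z F (phi z) = k%:E * \int[V]_z F z)%E) -> nice f -> I (fun z => f (phi z)) = k * I f.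
Proof.
move=> k0 mphi H nf; have intf := nice_integrable nf.
have mf : measurable_fun [set: bC] (EFin \o f) by apply/measurable_EFinP; case: nf.
rewrite /I /Rintegral integralE [in RHS]integralE.
have Ep : (\int[V]_z ((fun x => (f (phi x))%:E)^\+) z = k%:E * \int[V]_z ((EFin \o f)^\+) z)%E.
  have <- := H _ (measurable_funepos mf) (fun z => funepos_ge0 _ _).
  by apply: eq_integral => z _; rewrite ?funeposE ?funenegE.
have En : (\int[V]_z ((fun x => (f (phi x))%:E)^\-) z = k%:E * \int[V]_z ((EFin \o f)^\-) z)%E.
  have <- := H _ (measurable_funeneg mf) (fun z => funeneg_ge0 _ _).
  by apply: eq_integral => z _; rewrite ?funeposE ?funenegE.
have fp := integrable_pos_fin_num measurableT intf.
have fn := integrable_neg_fin_num measurableT intf.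
by rewrite Ep En -(fineK fp) -(fineK fn) -!EFinM -!EFinB /= mulrBr.
Qed.

Lemma I_affine c a f : 0 < c -> nice f -> I (fun z => f (c *: z + a)) = c^-1 ^+ (n + n) * I f.
Proof.
move=> c0; apply: (I_change (phi := fun z : bC => c *: z + a : bC)).
- by rewrite exprn_ge0 // invr_ge0 ltW.
- exact: measurable_affine_Cn.
- by move=> F mF F0; exact: ge0_integral_affine.
Qed.

Lemma I_translate a f : nice f -> I (fun z => f (z + a)) = I f.
Proof.
move=> nf; have := I_affine a ltr01 nf; rewrite invr1 expr1n mul1r => <-.
by apply: I_ext => z; rewrite scale1r.
Qed.

Lemma I_rot p q f : p ^+ 2 + q ^+ 2 = 1 -> nice f -> I (fun z => f (cscale p q z)) = I f.
Proof.
move=> pq nf; rewrite -[RHS]mul1r; apply: (I_change (phi := fun z : bC => cscale p q z : bC)) nf => //.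
- exact: measurable_cscale.
- by move=> F mF F0; rewrite mul1e; exact: ge0_integral_rot.
Qed.

(** Dominated convergence with majorant c on the ball of radius r. *)
Lemma I_cvg (f_ : nat -> C -> R) f c r : (forall k, mfun (f_ k)) ->
  (forall k z, `|f_ k z| <= c) -> (forall k z, r < `|z| -> f_ k z = 0) ->
  (forall z, f_ k z @[k --> \oo] --> f z) -> nice f /\ I (f_ k) @[k --> \oo] --> I f.
Proof.
move=> mf_ fc fr ff.
have mf : mfun f. by apply: (measurable_fun_cvg mf_) => z _; exact: ff.
have nf : nice f. split=> //; exists c, r => z; split.
    apply/ler_addgt0Pr => e e0; have /cvgrPdist_le/(_ e e0)[N _ h] := ff z.
    rewrite -(subrK (f_ N z) (f z)) addrC; apply: le_trans (ler_normD _ _) _.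
    by rewrite lerD //; exact: (h N (leqnn N)).
  move=> rz; apply/eqP; rewrite -normr_le0; apply/ler_addgt0Pr => e e0; rewrite add0r.
  have /cvgrPdist_le/(_ e e0)[N _ h] := ff z. by have := h N (leqnn N); rewrite /= fr // subr0.
split=> //.
have nk k : nice (f_ k). by split; [exact: mf_|exists c, r => z; split; [exact: fc|exact: fr]].
pose B : set bC := [set z : C | `|z| <= r].
have mB : measurable B by apply: closed_measurableCn; exact: closed_normle.
pose g (z : bC) : mR := c * \1_B z.
have mg : measurable_fun [set: bC] g. by apply: measurable_funM => //; exact: measurable_indic.
have ng : nice g. split=> //; exists `|c|, r => z; split.
    by rewrite normrM ler_piMr // indicE; case: (_ \in _); rewrite ?normr1 ?normr0.
  move=> rz; rewrite /g indicE memNset ?mulr0 // /B /= => /le_lt_trans/(_ rz). by rewrite ltxx.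
have fg k z : `|f_ k z| <= g z. rewrite /g indicE; case: (boolP (z \in B)) => [_|]; first by rewrite mulr1.
  by rewrite notin_setE /= => /negP; rewrite -ltNge => /fr ->; rewrite normr0 mulr0.
have := @dominated_convergence _ _ R V setT measurableT (fun k z => (f_ k z)%:E) (fun z => (f z)%:E) (EFin \o g).
case=> //.
- by move=> k; apply/measurable_EFinP; exact: mf_.
- by apply/measurable_EFinP.
- by apply: aeW => z _; apply: cvg_EFin; [exact: nearW|exact: ff].
- exact: nice_integrable.
- by apply: aeW => z k _; rewrite lee_fin.
move=> _ _ h; apply: fine_cvg; rewrite /I /Rintegral fineK //.
by apply: integrable_fin_num => //; exact: nice_integrable.
Qed.

End Cn_measure.

(** * Test functions on C^n and the vanishing integral of a derivative *)

Section test_functions.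
Context {R : realType} {n : nat}.
Notation C := (Cn R n).
Implicit Types (f g h phi psi : C -> R) (z w v a : C) (r : R).

(** Unlike in [test_function], the support is merely bounded; where a support inside the domain
    matters, a compact set is carried separately. *)
Definition tst phi := smooth phi /\ exists r, forall z, r < `|z| -> phi z = 0.

Lemma smooth_measurable f : smooth f -> mfun f.
Proof. by move=> sf; apply: continuous_measurableCn; exact: smooth_cont. Qed.

Lemma continuous_bounded_ball f r : continuous f -> exists c, forall z, `|z| <= r -> `|f z| <= c.
Proof.
move=> cf.
have K : compact (f @` [set z : C | `|z| <= r]). apply: continuous_compact; last exact: normle_compact.
  by apply: continuous_subspaceT.
have [M [_ H]] := compact_bounded K.
exists (M + 1) => z zr; apply: H; first by rewrite ltrDl.
by exists z.
Qed.

Lemma tst_smooth phi : tst phi -> smooth phi.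
Proof. by case. Qed.

Lemma tst_nice phi : tst phi -> nice phi.
Proof.
move=> [sp [r pr]]; split; first exact: smooth_measurable.
have [c H] := continuous_bounded_ball r (smooth_cont sp).
exists `|c|, r => z; split; last exact: pr.
have [zr|zr] := leP `|z| r; first exact: le_trans (H _ zr) (ler_norm _).
by rewrite pr // normr0.
Qed.

Lemma tst_bounded phi : tst phi -> exists c, forall z, `|phi z| <= c.
Proof. by move=> /tst_nice[_ [c [r H]]]; exists c => z; case: (H z). Qed.

Lemma tst_derive phi v : tst phi -> tst ('D_v phi).
Proof.
move=> [sp [r pr]]; split; first exact: smooth_derive.
exists r => z rz; rewrite (@derive_near_eq _ _ phi (cst 0) [set w | r < `|w|]) //.
- by rewrite derive_cst.
- exact: open_normgt.
- by move=> w; rewrite inE /= => /pr.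
Qed.

Lemma tstM phi g : tst phi -> smooth g -> tst (fun z => phi z * g z).
Proof.
move=> [sp [r pr]] sg; split; first exact: smoothM.
by exists r => z /pr ->; rewrite mul0r.
Qed.

Lemma tstD phi psi : tst phi -> tst psi -> tst (fun z => phi z + psi z).
Proof.
move=> [sp [r pr]] [sq [r' pr']]; split; first exact: smoothD.
by exists (Num.max r r') => z; rewrite gt_max => /andP[/pr -> /pr' ->]; rewrite addr0.
Qed.

Lemma tstZ (c : R) phi : tst phi -> tst (fun z => c * phi z).
Proof.
move=> [sp [r pr]]; split; first by apply: smoothM => //; exact: smooth_cst.
by exists r => z /pr ->; rewrite mulr0.
Qed.

Lemma tstN phi : tst phi -> tst (fun z => - phi z).
Proof.
by move=> [sp [r pr]]; split; [exact: smoothN|exists r => z /pr ->; rewrite oppr0].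
Qed.

Lemma tstB phi psi : tst phi -> tst psi -> tst (fun z => phi z - psi z).
Proof. by move=> tp tq; apply: tstD => //; exact: tstN. Qed.

Lemma tst_translate a phi : tst phi -> tst (fun z => phi (z + a)).
Proof.
move=> [sp [r pr]]; split; first exact: smooth_translate.
exists (r + `|a|) => z rz; apply: pr; rewrite -(addrK a z) in rz.
by have := lt_le_trans rz (ler_normB _ _); rewrite ltrD2r.
Qed.

Lemma harmonic_dnbhs : (fun k : nat => k.+1%:R^-1 : R) @ \oo --> (0 : R)^'.
Proof.
move=> A HA; have H := @cvg_harmonic R _ HA.
have {}H : \forall k \near \oo, (k.+1%:R^-1 : R) != 0 -> A (k.+1%:R^-1 : R) by exact: H.
by apply: filterS H => k /=; apply; rewrite invr_eq0 pnatr_eq0.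
Qed.

(** Difference quotients have integral 0 by translation invariance, and by the mean value theorem
    they converge boundedly to the derivative. *)
Lemma I_derive phi v : tst phi -> I ('D_v phi) = 0.
Proof.
move=> tp; have [sp [r pr]] := tp.
pose p (k : nat) z := k.+1%:R * (phi (z + k.+1%:R^-1 *: v) - phi z).
have k0 (k : nat) : 0 < k.+1%:R^-1 :> R by rewrite invr_gt0.
have k1 (k : nat) : k.+1%:R^-1 <= 1 :> R by rewrite invf_le1 // ler1n.
have tpk k : tst (p k). by apply: tstZ; apply: tstB => //; exact: tst_translate.
have [c cP] := tst_bounded (tst_derive v tp).
have pE k z : exists2 s, 0 < s < k.+1%:R^-1 & p k z = 'D_v phi (z + s *: v).
  have [s s01 E] := smooth_MVT z v sp (k0 k). by exists s => //; rewrite /p E mulVKf // gt_eqF.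
have [||||_] := @I_cvg R n p ('D_v phi) c (r + `|v|).
- by move=> k; apply: smooth_measurable; case: (tpk k).
- by move=> k z; have [s _ ->] := pE k z.
- move=> k z rz; rewrite /p pr; last first. rewrite -(addrK (k.+1%:R^-1 *: v) z) in rz.
    have := lt_le_trans rz (ler_normB _ _) => /lt_le_trans h. have : r + `|v| < `|z + k.+1%:R^-1 *: v| + `|v|.
      by apply: h; rewrite lerD2l normrZ gtr0_norm // ler_piMl. by rewrite ltrD2r.
  rewrite pr ?subr0 ?mulr0 //; apply: le_lt_trans rz; by rewrite lerDl.
- move=> z; have dz : derivable phi z v by exact: smooth_derivable. have := cvg_comp _ _ harmonic_dnbhs dz.
  apply: cvg_trans; apply: near_eq_cvg; apply: nearW => k /=.
  by rewrite /p invrK; congr (_ * (phi _ - _)); exact: addrC.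
rewrite (_ : (fun k => I (p k)) = fun=> 0); last first. apply/funext => k; rewrite /p IZ; last first.
    by apply: niceB; apply: tst_nice => //; exact: tst_translate.
  rewrite IB ?I_translate ?subrr ?mulr0 //; apply: tst_nice => //; exact: tst_translate.
by move=> h; rewrite -(cvg_lim _ h) ?lim_cst.
Qed.

End test_functions.

(** * Complex-valued calculus and the Wirtinger derivatives *)

Section ring_identities.

Lemma op_leibniz (K : comNzRingType) (al be a b c d f g : K) :
  al * (a * g + f * b) + be * (c * g + f * d) = (al * a + be * c) * g + f * (al * b + be * d).
Proof. ring. Qed.

Lemma op_additive (K : comNzRingType) (al be a b c d : K) :
  al * (a + b) + be * (c + d) = (al * a + be * c) + (al * b + be * d).
Proof. ring. Qed.

Lemma op_commute (K : comNzRingType) (al be al' be' p q r s : K) :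
  al * (al' * p + be' * q) + be * (al' * r + be' * s) = al' * (al * p + be * r) + be' * (al * q + be * s).
Proof. ring. Qed.

Lemma complex_half (R : realType) (e p q r s : R) :
  (Complex 2^-1 0) * (Complex p q) + (Complex 0 e) * (Complex r s) =
  Complex (2^-1 * p - e * s) (2^-1 * q + e * r).
Proof. by congr Complex; ring. Qed.

End ring_identities.

Opaque derive.

Section complex_calculus.
Context {R : realType} {n : nat}.
Notation C := (Cn R n).
Notation K := (R[i]).
Implicit Types (f g h phi psi : C -> R) (F G : C -> K) (z u v : C) (al be : K) (I J : {set 'I_n}).

(* Typed with codomain [R] itself, so that directional derivatives of real and
   imaginary parts use the same instances as for real functions. *)
Definition cre (x : K) : R := complex.Re x.
Definition cim (x : K) : R := complex.Im x.

Definition csm F := smooth (fun z => cre (F z)) /\ smooth (fun z => cim (F z)).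
Definition ctst F := tst (fun z => cre (F z)) /\ tst (fun z => cim (F z)).
Definition cD v F z : K := Complex ('D_v (fun z => cre (F z)) z) ('D_v (fun z => cim (F z)) z).
Definition cI F : K := Complex (I (fun z => cre (F z))) (I (fun z => cim (F z))).

Lemma ReM (x y : K) : cre (x * y) = cre x * cre y - cim x * cim y.
Proof. by case: x => a b; case: y. Qed.

Lemma ImM (x y : K) : cim (x * y) = cre x * cim y + cim x * cre y.
Proof. by case: x => a b; case: y. Qed.

Lemma ReD (x y : K) : cre (x + y) = cre x + cre y.
Proof. by case: x => a b; case: y. Qed.

Lemma ImD (x y : K) : cim (x + y) = cim x + cim y.
Proof. by case: x => a b; case: y. Qed.

Lemma creim_eq (x y : K) : cre x = cre y -> cim x = cim y -> x = y.
Proof. by case: x => a b; case: y => c d /= -> ->. Qed.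

Lemma csmM F G : csm F -> csm G -> csm (fun z => F z * G z).
Proof.
move=> [F1 F2] [G1 G2]; split. under [X in smooth X]eq_fun do rewrite ReM. by apply: smoothB; exact: smoothM.
under [X in smooth X]eq_fun do rewrite ImM.
by apply: smoothD; exact: smoothM.
Qed.

Lemma csmD F G : csm F -> csm G -> csm (fun z => F z + G z).
Proof.
move=> [F1 F2] [G1 G2]; split. under [X in smooth X]eq_fun do rewrite ReD. exact: smoothD.
under [X in smooth X]eq_fun do rewrite ImD.
exact: smoothD.
Qed.

Lemma csm_cst al : csm (fun=> al).
Proof. by split; exact: smooth_cst. Qed.

Lemma csmZ al F : csm F -> csm (fun z => al * F z).
Proof. by move=> sF; apply: csmM => //; exact: csm_cst. Qed.

Lemma csm_sum (T : Type) (s : seq T) (P : pred T) (F : T -> C -> K) :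
  (forall i, P i -> csm (F i)) -> csm (fun z => \sum_(i <- s | P i) F i z).
Proof.
move=> sF; elim: s => [|i s IH]. under [X in csm X]eq_fun do rewrite big_nil; exact: csm_cst.
under [X in csm X]eq_fun do rewrite big_cons.
by case: (boolP (P i)) => // Pi; apply: csmD => //; exact: sF.
Qed.

Lemma csm_real f : smooth f -> csm (fun z => (f z)%:C%C).
Proof. by move=> sf; split => //=; exact: smooth_cst. Qed.

Lemma csm_cD v F : csm F -> csm (cD v F).
Proof. by move=> [F1 F2]; split => /=; exact: smooth_derive. Qed.

Lemma ctst_csm F : ctst F -> csm F.
Proof. by move=> [[F1 _] [F2 _]]. Qed.

Lemma ctstM F G : ctst F -> csm G -> ctst (fun z => F z * G z).
Proof.
move=> [F1 F2] [G1 G2]; split. under [X in tst X]eq_fun do rewrite ReM. by apply: tstB; exact: tstM.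
under [X in tst X]eq_fun do rewrite ImM.
by apply: tstD; exact: tstM.
Qed.

Lemma ctstMr F G : csm F -> ctst G -> ctst (fun z => F z * G z).
Proof.
move=> sF tG; under [X in ctst X]eq_fun do rewrite mulrC; exact: ctstM.
Qed.

Lemma ctstD F G : ctst F -> ctst G -> ctst (fun z => F z + G z).
Proof.
move=> [F1 F2] [G1 G2]; split. under [X in tst X]eq_fun do rewrite ReD. exact: tstD.
under [X in tst X]eq_fun do rewrite ImD.
exact: tstD.
Qed.

Lemma ctstZ al F : ctst F -> ctst (fun z => al * F z).
Proof. by move=> tF; apply: ctstMr => //; exact: csm_cst. Qed.

Lemma tst0 : tst (fun _ : C => 0 : R).
Proof. by split; [exact: smooth_cst|exists 0]. Qed.

Lemma ctst_real f : tst f -> ctst (fun z => (f z)%:C%C).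
Proof. by move=> sf; split => //=; exact: tst0. Qed.

Lemma ctst_sum (T : Type) (s : seq T) (P : pred T) (F : T -> C -> K) :
  (forall i, P i -> ctst (F i)) -> ctst (fun z => \sum_(i <- s | P i) F i z).
Proof.
move=> sF; elim: s => [|i s IH]. under [X in ctst X]eq_fun do rewrite big_nil; exact: ctst_real tst0.
under [X in ctst X]eq_fun do rewrite big_cons.
by case: (boolP (P i)) => // Pi; apply: ctstD => //; exact: sF.
Qed.

Lemma ctst_cD v F : ctst F -> ctst (cD v F).
Proof. by move=> [F1 F2]; split => /=; exact: tst_derive. Qed.

Lemma cDM v F G z : csm F -> csm G -> cD v (fun z => F z * G z) z = cD v F z * G z + F z * cD v G z.
Proof.
move=> [F1 F2] [G1 G2].
have dM (p q : C -> R) : smooth p -> smooth q -> 'D_v (fun z => p z * q z) z = p z * 'D_v q z + q z * 'D_v p z.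
  by move=> sp sq; rewrite [LHS]deriveM //; exact: smooth_derivable.
apply: creim_eq. rewrite ReD !ReM /=; under eq_fun do rewrite ReM.
  rewrite deriveB; [|exact/smooth_derivable/smoothM..]. by rewrite !dM //; ring.
rewrite ImD !ImM /=; under eq_fun do rewrite ImM.
rewrite deriveD; [|exact/smooth_derivable/smoothM..].
by rewrite !dM //; ring.
Qed.

Lemma cDD v F G z : csm F -> csm G -> cD v (fun z => F z + G z) z = cD v F z + cD v G z.
Proof.
move=> [F1 F2] [G1 G2].
apply: creim_eq. rewrite ReD /=; under eq_fun do rewrite ReD. by rewrite deriveD //; exact/smooth_derivable.
rewrite ImD /=; under eq_fun do rewrite ImD.
by rewrite deriveD //; exact/smooth_derivable.
Qed.

Lemma cD_cst v al z : cD v (fun=> al) z = 0.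
Proof. by rewrite /cD !derive_cst. Qed.

Lemma smooth_schwarzE f u v z : smooth f -> 'D_u ('D_v f) z = 'D_v ('D_u f) z.
Proof. by move=> sf; exact: (congr1 (fun h => h z) (smooth_schwarz u v sf)). Qed.

Lemma cDC u v F z : csm F -> cD u (cD v F) z = cD v (cD u F) z.
Proof. 
move=> [F1 F2].
change (Complex ('D_u ('D_v (fun z => cre (F z))) z) ('D_u ('D_v (fun z => cim (F z))) z) =
  Complex ('D_v ('D_u (fun z => cre (F z))) z) ('D_v ('D_u (fun z => cim (F z))) z)).
exact: (f_equal2 (@Complex R) (smooth_schwarzE u v z F1) (smooth_schwarzE u v z F2)).
Qed.

Lemma cI_ext F G : F =1 G -> cI F = cI G.
Proof. by move=> /funext ->. Qed.

Lemma cID F G : ctst F -> ctst G -> cI (fun z => F z + G z) = cI F + cI G.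
Proof.
move=> [F1 F2] [G1 G2].
apply: creim_eq. rewrite ReD /= -ID; [|exact: tst_nice..]. by apply: I_ext => z; rewrite ReD.
rewrite ImD /= -ID; [|exact: tst_nice..].
by apply: I_ext => z; rewrite ImD.
Qed.

Lemma cIZ al F : ctst F -> cI (fun z => al * F z) = al * cI F.
Proof.
move=> [/tst_nice F1 /tst_nice F2].
apply: creim_eq. rewrite ReM /= -!IZ // -IB; [|exact: niceZ..]. by apply: I_ext => z; rewrite ReM.
rewrite ImM /= -!IZ // -ID; [|exact: niceZ..].
by apply: I_ext => z; rewrite ImM.
Qed.

Lemma cI0 : cI (fun=> 0) = 0.
Proof. by rewrite /cI /= I0. Qed.

Lemma cI_sum (T : Type) (s : seq T) (P : pred T) (F : T -> C -> K) : (forall i, P i -> ctst (F i)) ->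
  cI (fun z => \sum_(i <- s | P i) F i z) = \sum_(i <- s | P i) cI (F i).
Proof.
move=> tF; elim: s => [|i s IH]. by rewrite big_nil -[RHS]cI0; apply: cI_ext => z; rewrite big_nil.
rewrite big_cons; case: (boolP (P i)) => Pi. rewrite -IH -cID; [|exact: tF|exact: ctst_sum].
  by apply: cI_ext => z; rewrite big_cons Pi.
by rewrite -IH; apply: cI_ext => z; rewrite big_cons (negbTE Pi).
Qed.

Lemma cI_cD v F : ctst F -> cI (cD v F) = 0.
Proof. by move=> [F1 F2]; rewrite /cI /= !I_derive. Qed.

(** Both d/dz and d/dzbar have the form al D_u + be D_v; treating this form gives Leibniz rule,
    commutation and integration by parts for both at once. *)
Definition cop al be u v F z : K := al * cD u F z + be * cD v F z.

Section cop.
Variables (al be : K) (u v : C).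
Notation d := (cop al be u v).

Lemma csm_cop F : csm F -> csm (d F).
Proof. by move=> sF; apply: csmD; apply: csmZ; exact: csm_cD. Qed.

Lemma ctst_cop F : ctst F -> ctst (d F).
Proof. by move=> sF; apply: ctstD; apply: ctstZ; exact: ctst_cD. Qed.

Lemma copM F G z : csm F -> csm G -> d (fun z => F z * G z) z = d F z * G z + F z * d G z.
Proof. by move=> sF sG; rewrite /cop (cDM u z sF sG) (cDM v z sF sG); exact: op_leibniz. Qed.

Lemma copD F G z : csm F -> csm G -> d (fun z => F z + G z) z = d F z + d G z.
Proof. by move=> sF sG; rewrite /cop (cDD u z sF sG) (cDD v z sF sG); exact: op_additive. Qed.

Lemma cop_cst a z : d (fun=> a) z = 0.
Proof. by rewrite /cop !cD_cst !mulr0 addr0. Qed.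

Lemma copZ a F z : csm F -> d (fun z => a * F z) z = a * d F z.
Proof. by move=> sF; rewrite copM //; [rewrite cop_cst mul0r add0r|exact: csm_cst]. Qed.

Lemma cop_sum (T : Type) (s : seq T) (P : pred T) (F : T -> C -> K) z : (forall i, P i -> csm (F i)) ->
  d (fun z => \sum_(i <- s | P i) F i z) z = \sum_(i <- s | P i) d (F i) z.
Proof.
move=> sF; elim: s => [|i s IH]. rewrite big_nil -[RHS](cop_cst 0 z); congr (d _ z).
  by apply/funext => w; rewrite big_nil.
rewrite big_cons; case: (boolP (P i)) => Pi. rewrite -IH -copD; [|exact: sF|exact: csm_sum].
  by congr (d _ z); apply/funext => w; rewrite big_cons Pi.
by rewrite -IH; congr (d _ z); apply/funext => w; rewrite big_cons (negbTE Pi).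
Qed.

Lemma cI_cop F : ctst F -> cI (d F) = 0.
Proof.
move=> tF; rewrite /cop cID; [|exact/ctstZ/ctst_cD..].
by rewrite (cIZ al (ctst_cD u tF)) (cIZ be (ctst_cD v tF)) (cI_cD u tF) (cI_cD v tF) !mulr0 addr0.
Qed.

Lemma cI_byparts F G : ctst F -> csm G -> cI (fun z => F z * d G z) = - cI (fun z => d F z * G z).
Proof.
move=> tF sG; apply/eqP; rewrite -addr_eq0 -cID; first last.
- by apply: ctstM => //; exact: ctst_cop.
- by apply: ctstM => //; exact: csm_cop.
rewrite -(cI_cop (ctstM tF sG)); apply/eqP; apply: cI_ext => z.
by rewrite copM 1?addrC //; exact: ctst_csm.
Qed.

End cop.

Lemma copC al be u v al' be' u' v' F z : csm F ->
  cop al be u v (cop al' be' u' v' F) z = cop al' be' u' v' (cop al be u v F) z.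
Proof.
move=> sF.
have DD w w' w'' (a b : K) : cD w (fun z => a * cD w' F z + b * cD w'' F z) z =
    a * cD w (cD w' F) z + b * cD w (cD w'' F) z.
  rewrite (cDD w z (csmZ a (csm_cD w' sF)) (csmZ b (csm_cD w'' sF))).
  have E x (k : K) : cD w (fun z => k * cD x F z) z = k * cD w (cD x F) z.
    by rewrite (cDM w z (csm_cst k) (csm_cD x sF)) cD_cst mul0r add0r. by rewrite (E w' a) (E w'' b).
rewrite /cop !DD (cDC u u' z sF) (cDC u v' z sF) (cDC v u' z sF) (cDC v v' z sF).
exact: op_commute.
Qed.

Definition pd (a : 'I_n) := cop (Complex 2^-1 0) (Complex 0 (- 2^-1)) (dx R a) (dy R a).
Definition pdb (a : 'I_n) := cop (Complex 2^-1 0) (Complex 0 2^-1) (dx R a) (dy R a).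

Lemma pdbM (a : 'I_n) F G z : csm F -> csm G -> pdb a (fun z => F z * G z) z = pdb a F z * G z + F z * pdb a G z.
Proof. exact: copM. Qed.

Lemma pdC (a b : 'I_n) F z : csm F -> pdb b (pd a F) z = pd a (pdb b F) z.
Proof. exact: copC. Qed.

Lemma ddbarE a b f z : smooth f -> ddbar a b f z = pd a (pdb b (fun z => (f z)%:C%C)) z.
Proof.
move=> sf.
have E w : pdb b (fun z => (f z)%:C%C) w = Complex (2^-1 * 'D_(dx R b) f w) (2^-1 * 'D_(dy R b) f w).
  transitivity (Complex (2^-1 * 'D_(dx R b) f w - 2^-1 * 'D_(dy R b) (fun=> 0 : R) w)
      (2^-1 * 'D_(dx R b) (fun=> 0 : R) w + 2^-1 * 'D_(dy R b) f w)). exact: complex_half.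
  have D0 v : 'D_v (fun _ : C => 0 : R) w = 0 by exact: derive_cst.
  by rewrite (D0 (dx R b)) (D0 (dy R b)) !mulr0 subr0 add0r.
have Dz w (c : R) (g : C -> R) : smooth g -> 'D_w (fun z => c * g z) z = c * 'D_w g z.
  by move=> sg; rewrite [LHS]deriveZ //; exact: smooth_derivable.
rewrite (funext E) /pd /cop complex_half.
rewrite (Dz _ _ _ (smooth_derive (dx R b) sf)) (Dz _ _ _ (smooth_derive (dy R b) sf)).
rewrite (Dz _ _ _ (smooth_derive (dx R b) sf)) (Dz _ _ _ (smooth_derive (dy R b) sf)).
rewrite /ddbar; move: ('D_(dx R a) ('D_(dx R b) f) z) ('D_(dx R a) ('D_(dy R b) f) z)
  ('D_(dy R a) ('D_(dx R b) f) z) ('D_(dy R a) ('D_(dy R b) f) z) => p q s t.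
by congr Complex; field.
Qed.

Lemma csm_ddbar a b f : smooth f -> csm (ddbar a b f).
Proof.
move=> sf; rewrite (_ : ddbar a b f = pd a (pdb b (fun z => (f z)%:C%C))); last first.
  by apply/funext => z; exact: ddbarE.
by apply/csm_cop/csm_cop/csm_real.
Qed.

Lemma ctst_ddbar a b f : tst f -> ctst (ddbar a b f).
Proof.
move=> tf; have sf := tst_smooth tf.
rewrite (_ : ddbar a b f = pd a (pdb b (fun z => (f z)%:C%C))); last first. by apply/funext => z; exact: ddbarE.
by apply/ctst_cop/ctst_cop/ctst_real.
Qed.

End complex_calculus.

HB.lock Definition Hess {R : realType} {n : nat} (f : Cn R n -> R) (z : Cn R n) : 'M[R[i]]_n :=
  \matrix_(a, b) ddbar a b f z.

(** * Mixed Hessians: closedness and integration by parts *)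

Section mixed_calculus.
Context {R : realType} {n : nat}.
Notation C := (Cn R n).
Notation K := (R[i]).
Implicit Types (f g h phi psi : C -> R) (F G : C -> K) (z u v : C) (al be : K) (I J : {set 'I_n}).

Lemma Hess_entry f z (a c : 'I_n) : Hess f z a c = ddbar a c f z.
Proof. by rewrite Hess.unlock mxE. Qed.

(** The coefficient of w_IJ in the exterior product of the forms i d dbar h, for h in [hs]. *)
Definition hmix (hs : seq (C -> R)) (I J : {set 'I_n}) z : K := mixed [seq Hess h z | h <- hs] I J.

Lemma hmix_cons h hs I J z : hmix (h :: hs) I J z = \sum_(a in I) \sum_(b in J)
  wsgn K a I * wsgn K b J * ddbar a b h z * hmix hs (I :\ a)%SET (J :\ b)%SET z.
Proof. by apply: eq_bigr => a _; apply: eq_bigr => b _; rewrite Hess_entry. Qed.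

Definition smooths (hs : seq (C -> R)) := forall i, smooth (nth (fun=> 0) hs i).

Lemma smooths_cons h hs : smooths (h :: hs) -> smooth h /\ smooths hs.
Proof. by move=> H; split=> [|i]; [exact: (H 0%N)|exact: (H i.+1)]. Qed.

Lemma csm_hmix hs I J : smooths hs -> csm (hmix hs I J).
Proof.
elim: hs I J => [|h hs IH] I J; first by move=> _; exact: csm_cst.
move=> /smooths_cons[sh shs]; rewrite (funext (hmix_cons h hs I J)).
apply: csm_sum => a _; apply: csm_sum => b _; apply: csmM; last exact: IH.
by apply: csmZ; exact: csm_ddbar.
Qed.

Lemma antisym_sum0 (V : zmodType) (I : {set 'I_n}) (F : 'I_n -> 'I_n -> V) :
  (forall a b, a \in I -> b \in I -> a != b -> F a b = - F b a) -> (forall x : V, x + x = 0 -> x = 0) ->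
  \sum_(a in I) \sum_(b in (I :\ a)%SET) F a b = 0.
Proof.
move=> FE V2; apply: V2; rewrite {2}sum_setD1_swap -big_split big1 // => a aI.
rewrite -big_split big1 // => b; rewrite finset.in_setD1 => /andP[ba bI].
by rewrite /= [F a b]FE ?addNr // eq_sym.
Qed.

Lemma double0 (x : K) : x + x = 0 -> x = 0.
Proof. by move/eqP; rewrite -mulr2n mulrn_eq0 /= => /eqP. Qed.

(** A product of closed forms is closed. In the Leibniz expansion, the terms where d_a falls on the
    first Hessian cancel in pairs, as d_a d_a' is symmetric and the signs are antisymmetric; the
    others are the same statement with one form fewer. Leaving d and e general covers d-closedness
    and, with I and J exchanged, dbar-closedness. *)
Lemma mix_closed (al be al' be' : K) (m : seq (C -> R) -> {set 'I_n} -> {set 'I_n} -> C -> K) hs I J z :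
  let d a := cop al be (dx R a) (dy R a) in let e b := cop al' be' (dx R b) (dy R b) in
  (forall I J, m [::] I J = fun=> 1) -> (forall hs I J, smooths hs -> csm (m hs I J)) ->
  (forall h hs I J z, smooth h -> m (h :: hs) I J z = \sum_(a in I) \sum_(b in J)
    wsgn K a I * wsgn K b J * d a (e b (fun z => (h z)%:C%C)) z * m hs (I :\ a)%SET (J :\ b)%SET z) ->
  smooths hs -> \sum_(a in I) wsgn K a I * d a (m hs (I :\ a)%SET J) z = 0.
Proof.
move=> d e m0 csm_m m_cons; elim: hs I J => [|h hs IH] I J.
  by move=> _; apply: big1 => a _; rewrite m0 /d cop_cst mulr0.
move=> /smooths_cons[sh shs].
pose g b := e b (fun z => (h z)%:C%C).
have sg b : csm (g b) by apply/csm_cop/csm_real.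
have E a : d a (m (h :: hs) (I :\ a)%SET J) z = \sum_(a' in (I :\ a)%SET) \sum_(b in J)
   (wsgn K a' (I :\ a)%SET * wsgn K b J * d a (d a' (g b)) z * m hs (I :\ a :\ a')%SET (J :\ b)%SET z
   + wsgn K a' (I :\ a)%SET * wsgn K b J * d a' (g b) z * d a (m hs (I :\ a :\ a')%SET (J :\ b)%SET) z).
  rewrite (_ : m _ (I :\ a)%SET J = fun w => \sum_(a' in (I :\ a)%SET) \sum_(b in J)
    wsgn K a' (I :\ a)%SET * wsgn K b J * d a' (g b) w * m hs (I :\ a :\ a')%SET (J :\ b)%SET w); last first.
    by apply/funext => w; rewrite m_cons.
  have sm a' b : csm (fun w => wsgn K a' (I :\ a)%SET * wsgn K b J * d a' (g b) w).
    by apply: csmZ; exact: csm_cop.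
  have sm2 a' b : csm (fun w => wsgn K a' (I :\ a)%SET * wsgn K b J * d a' (g b) w *
      m hs (I :\ a :\ a')%SET (J :\ b)%SET w). by apply: csmM => //; exact: csm_m.
  rewrite {1}/d cop_sum; last by move=> a' _; apply: csm_sum. apply: eq_bigr => a' _; rewrite cop_sum; last by [].
  apply: eq_bigr => b _; rewrite copM //; last exact: csm_m. by rewrite copZ; last exact: csm_cop.
under eq_bigr => a _ do rewrite E big_distrr /=.
under eq_bigr => a _ do under eq_bigr => a' _ do rewrite big_split /= mulrDr.
under eq_bigr => a _ do rewrite big_split /=.
rewrite big_split /= [X in X + _]antisym_sum0; first last.
- exact: double0.
- move=> a a' aI a'I aa'; rewrite !big_distrr -sumrN; apply: eq_bigr => b _ /=.
  rewrite !mulrA wsgn_swap // setD1C [d a (d a' _) z]copC // -/(d a' (d a (g b)) z). by rewrite !mulNr.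
rewrite add0r sum_setD1_swap big1 // => a aI.
rewrite [LHS](_ : _ = \sum_(b in J) - (wsgn K a I * wsgn K b J * d a (g b) z) *
   \sum_(a' in (I :\ a)%SET) wsgn K a' (I :\ a)%SET * d a' (m hs (I :\ a :\ a')%SET (J :\ b)%SET) z).
  by apply: big1 => b _; rewrite IH // mulr0.
under eq_bigr => a' _ do rewrite big_distrr /=.
rewrite exchange_big /=; apply: eq_bigr => b _; rewrite big_distrr /=.
apply: eq_bigr => a'; rewrite finset.in_setD1 => /andP[a'a a'I].
have := wsgn_swap K a'I aI a'a; rewrite (setD1C I a' a).
move: (d a (g b) z) (d a' _ z) (wsgn K a (I :\ a')%SET) (wsgn K a' (I :\ a)%SET) => x y s t E'.
rewrite !mulrA E'; ring.
Qed.

Lemma hmix_closed hs I J z : smooths hs -> \sum_(a in I) wsgn K a I * pd a (hmix hs (I :\ a)%SET J) z = 0.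
Proof.
apply: mix_closed => [//|hs' I' J'|h hs' I' J' w sh]; first exact: csm_hmix.
by rewrite hmix_cons; apply: eq_bigr => a _; apply: eq_bigr => b _; rewrite ddbarE.
Qed.

Lemma hmix_closed_bar hs I J z : smooths hs -> \sum_(b in J) wsgn K b J * pdb b (hmix hs I (J :\ b)%SET) z = 0.
Proof.
apply: (@mix_closed _ _ (Complex 2^-1 0) (Complex 0 (- 2^-1)) (fun hs I J => hmix hs J I)) => [//|hs' I' J'|h hs' I' J' w sh].
  exact: csm_hmix.
rewrite hmix_cons exchange_big; apply: eq_bigr => a _; apply: eq_bigr => b _.
have -> : ddbar b a h w = pdb a (pd b (fun z => (h z)%:C%C)) w.
  by rewrite (ddbarE b a w sh) pdC //; exact: csm_real.
by rewrite [wsgn K b J' * _]mulrC.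
Qed.

(* Both sums telescope because the mixed Hessians are d-closed and dbar-closed. *)
Lemma cI_hmix phi (u : C -> R) hs I J : tst phi -> smooth u -> smooths hs ->
  cI (fun z => (phi z)%:C%C * hmix (u :: hs) I J z) = \sum_(a in I) \sum_(b in J) wsgn K a I * wsgn K b J *
    cI (fun z => (u z)%:C%C * ddbar a b phi z * hmix hs (I :\ a)%SET (J :\ b)%SET z).
Proof.
move=> tp su shs; have sp := tst_smooth tp.
pose M a b := hmix hs (I :\ a)%SET (J :\ b)%SET.
pose cu z : K := (u z)%:C%C; pose cp z : K := (phi z)%:C%C.
have sM a b : csm (M a b) by exact: csm_hmix.
have scu : csm cu by exact: csm_real.
have tcp : ctst cp by exact: ctst_real.
have scp := ctst_csm tcp.
transitivity (\sum_(b in J) \sum_(a in I) wsgn K a I * wsgn K b J *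
   cI (fun z => cp z * M a b z * pd a (pdb b cu) z)). rewrite exchange_big /=.
  have tt a b : ctst (fun z => wsgn K a I * wsgn K b J * (cp z * M a b z * pd a (pdb b cu) z)).
    by apply/ctstZ/ctstM; [exact: ctstM|exact/csm_cop/csm_cop].
  have EE (p s t d m : K) : p * (s * t * d * m) = s * t * (p * m * d) by ring. under [LHS]cI_ext => z.
    rewrite hmix_cons big_distrr /=. under eq_bigr => a _ do rewrite big_distrr /=.
    under eq_bigr => a _ do under eq_bigr => b _ do rewrite ddbarE // EE. over.
  rewrite cI_sum; last by move=> a _; exact: ctst_sum.
  apply: eq_bigr => a _; rewrite cI_sum //; apply: eq_bigr => b _.
  by rewrite cIZ //; apply: ctstM; [exact: (ctstM tcp (sM a b))|exact/csm_cop/csm_cop].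
have step1 b : \sum_(a in I) wsgn K a I * wsgn K b J * cI (fun z => cp z * M a b z * pd a (pdb b cu) z) =
   \sum_(a in I) wsgn K a I * wsgn K b J *
   - cI (fun z => pd a cp z * M a b z * pdb b cu z).
  have tt a : ctst (fun z => cp z * pd a (M a b) z * pdb b cu z).
    by apply: ctstM; [apply: ctstM => //; exact: csm_cop|exact: csm_cop].
  have tt' a : ctst (fun z => pd a cp z * M a b z * pdb b cu z).
    by apply: ctstM; [apply: ctstM => //; exact: ctst_cop|exact: csm_cop].
  have bp a : cI (fun z => cp z * M a b z * pd a (pdb b cu) z) =
     - (cI (fun z => pd a cp z * M a b z * pdb b cu z) + cI (fun z => cp z * pd a (M a b) z * pdb b cu z)).
    rewrite cI_byparts; [|exact: ctstM|exact: csm_cop].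
    rewrite -cID //; congr (- _); apply: cI_ext => z; rewrite copM // mulrDl. by rewrite -mulrA.
  under eq_bigr => a _ do rewrite bp opprD mulrDr. rewrite big_split /= -[RHS]addr0; congr (_ + _).
  rewrite (_ : (\sum_(a in I) _) = \sum_(a in I) cI (fun z => (- wsgn K b J) * (wsgn K a I * (cp z * pd a (M a b) z * pdb b cu z)))); last first.
    apply: eq_bigr => a _; rewrite cIZ; last exact: ctstZ. by rewrite cIZ // mulrN mulNr mulrCA mulrA.
  rewrite -cI_sum; last by move=> a _; do 2 apply: ctstZ. rewrite -[RHS](@cI0 R n); apply: cI_ext => z.
  rewrite (_ : \sum_(a in I) _ = (- wsgn K b J * cp z * pdb b cu z) *
     \sum_(a in I) wsgn K a I * pd a (M a b) z); last first.
    by rewrite big_distrr; apply: eq_bigr => a _ /=; ring. by rewrite /M hmix_closed // mulr0.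
under eq_bigr => b _ do rewrite step1.
rewrite exchange_big /=; apply: eq_bigr => a aI.
have tt b : ctst (fun z => cu z * pd a cp z * pdb b (M a b) z).
  by apply: ctstM; [apply: ctstMr => //; exact: ctst_cop|exact: csm_cop].
have tt' b : ctst (fun z => cu z * pdb b (pd a cp) z * M a b z).
  by apply: ctstM => //; apply: ctstMr => //; apply/ctst_cop/ctst_cop.
have bp b : - cI (fun z => pd a cp z * M a b z * pdb b cu z) =
    cI (fun z => cu z * pdb b (pd a cp) z * M a b z) + cI (fun z => cu z * pd a cp z * pdb b (M a b) z).
  rewrite cI_byparts //; last by apply: ctstM => //; exact: ctst_cop. rewrite opprK -cID //; apply: cI_ext => z.
  rewrite -[X in X * _ = _]/(pdb b (fun z => pd a cp z * M a b z) z).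
  have -> := pdbM b z (csm_cop _ _ _ _ scp : csm (pd a cp)) (sM a b).
  by move: (pdb b _ z) (pdb b _ z) (pd a _ z) (M _ _ z) (cu z) => p q t m c0; ring.
under eq_bigr => b _ do rewrite bp mulrDr.
rewrite big_split /= -[RHS]addr0; congr (_ + _). apply: eq_bigr => b _; congr (_ * _); apply: cI_ext => z.
  by rewrite (ddbarE a b z sp) (pdC _ _ _ scp).
rewrite (_ : (\sum_(b in J) _) = \sum_(b in J) cI (fun z => wsgn K a I * (wsgn K b J * (cu z * pd a cp z * pdb b (M a b) z)))); last first.
  by apply: eq_bigr => b _; rewrite cIZ ?cIZ ?mulrA //; exact: ctstZ.
rewrite -cI_sum; last by move=> b _; do 2 apply: ctstZ.
rewrite -[RHS](@cI0 R n); apply: cI_ext => z.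
rewrite (_ : \sum_(b in J) _ = (wsgn K a I * (cu z * pd a cp z)) *
   \sum_(b in J) wsgn K b J * pdb b (M a b) z); last first. by rewrite big_distrr; apply: eq_bigr => b _ /=; ring.
by rewrite /M hmix_closed_bar // mulr0.
Qed.

(** The right side of [cI_hmix] is the integral of u against the expansion of [hmix (phi :: hs)]:
    both derivatives have moved from u to phi. *)
Lemma cI_hmix_sym phi (u : C -> R) hs I J : tst phi -> smooth u -> smooths hs ->
  cI (fun z => (phi z)%:C%C * hmix (u :: hs) I J z) = cI (fun z => (u z)%:C%C * hmix (phi :: hs) I J z).
Proof.
move=> tp su shs; apply: (etrans (cI_hmix I J tp su shs)); have sp := tst_smooth tp.
have scu : csm (fun z => (u z)%:C%C : K) by exact: csm_real.
have tt a b : ctst (fun z => (u z)%:C%C * ddbar a b phi z * hmix hs (I :\ a)%SET (J :\ b)%SET z).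
  by apply: ctstM; [apply: ctstMr => //; exact: ctst_ddbar|exact: csm_hmix].
have -> : (fun z => (u z)%:C%C * hmix (phi :: hs) I J z) = fun z => \sum_(a in I) \sum_(b in J)
   wsgn K a I * wsgn K b J * ((u z)%:C%C * ddbar a b phi z * hmix hs (I :\ a)%SET (J :\ b)%SET z).
  apply/funext => z; rewrite hmix_cons big_distrr; apply: eq_bigr => a _ /=.
  by rewrite big_distrr; apply: eq_bigr => b _ /=; ring.
rewrite cI_sum; last by move=> a _; apply: ctst_sum => b _; exact: ctstZ.
apply: eq_bigr => a _; rewrite cI_sum; last by move=> b _; exact: ctstZ.
by apply: eq_bigr => b _; rewrite cIZ.
Qed.

End mixed_calculus.

(* The directional derivative, sealed so that unification never unfolds it. *)
HB.lock Definition dd {R : realType} {n : nat} (v : Cn R n) (f : Cn R n -> R) (z : Cn R n) : R := 'D_v f z.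

Definition Jc {R : realType} {n : nat} (b : Cn R n) : Cn R n := cscale 0 1 b.

(* Four times the Levi form in the direction [b]: the Laplacian of
   [zeta |-> f (z + zeta b)] at [zeta = 0]. *)
HB.lock Definition Lap {R : realType} {n : nat} (b : Cn R n) (f : Cn R n -> R) (z : Cn R n) : R :=
  dd b (dd b f) z + dd (Jc b) (dd (Jc b) f) z.

(** * Directional Laplacians, the Levi form, the Euclidean norm *)

Section levi.
Context {R : realType} {n : nat}.
Notation C := (Cn R n).
Notation K := (R[i]).
Implicit Types (f g : C -> R) (z b v : C).

Lemma Cn_basis b : b = \sum_a (b.1 0 a *: dx R a + b.2 0 a *: dy R a).
Proof.
have fE (F : 'I_n -> C) : \sum_a F a = (\sum_a (F a).1, \sum_a (F a).2).
  by elim/big_rec3: _ => //= a x y _ _ -> ; case: (F a).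
rewrite fE; case: b => x y; congr pair => /=. rewrite [LHS]row_sum_delta; apply: eq_bigr => a _.
  by rewrite /= scaler0 addr0.
rewrite [LHS]row_sum_delta; apply: eq_bigr => a _.
by rewrite /= scaler0 add0r.
Qed.

Lemma ddE v f z : 'D_v f z = dd v f z.
Proof. by rewrite dd.unlock. Qed.

Lemma ddEf v f : 'D_v f = dd v f.
Proof. by rewrite dd.unlock. Qed.

Lemma smooth_dd v f : smooth f -> smooth (dd v f).
Proof. by rewrite -ddEf; exact: smooth_derive. Qed.

Lemma dd_sumv (T : Type) (s : seq T) (b : T -> C) f z : smooth f ->
  dd (\sum_(a <- s) b a) f z = \sum_(a <- s) dd (b a) f z.
Proof.
move=> sf; have df := smooth_diff z sf.
rewrite dd.unlock deriveE // linear_sum; apply: eq_bigr => a _; by rewrite deriveE.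
Qed.

Lemma ddDv f z (u v : C) : smooth f -> dd (u + v) f z = dd u f z + dd v f z.
Proof. by move=> sf; have df := smooth_diff z sf; rewrite dd.unlock !deriveE // linearD. Qed.

Lemma ddZv f z (c : R) (u : C) : smooth f -> dd (c *: u) f z = c * dd u f z.
Proof. by move=> sf; have df := smooth_diff z sf; rewrite dd.unlock !deriveE // linearZ. Qed.

Lemma dd_basis f z b : smooth f -> dd b f z = \sum_a (b.1 0 a * dd (dx R a) f z + b.2 0 a * dd (dy R a) f z).
Proof.
move=> sf; rewrite [in LHS](Cn_basis b) dd_sumv //; apply: eq_bigr => a _.
by rewrite ddDv // !ddZv.
Qed.

Lemma ddD f g v z : smooth f -> smooth g -> dd v (fun z => f z + g z) z = dd v f z + dd v g z.
Proof. by rewrite dd.unlock => sf sg; apply: deriveD; exact: smooth_derivable. Qed.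

Lemma ddZ f (c : R) v z : smooth f -> dd v (fun z => c * f z) z = c * dd v f z.
Proof. by rewrite dd.unlock => sf; apply: deriveZ; exact: smooth_derivable. Qed.

Lemma ddDf f g v : smooth f -> smooth g -> dd v (fun z => f z + g z) = fun z => dd v f z + dd v g z.
Proof. by move=> sf sg; apply/funext => z; exact: ddD. Qed.

Lemma ddZf f (c : R) v : smooth f -> dd v (fun z => c * f z) = fun z => c * dd v f z.
Proof. by move=> sf; apply/funext => z; exact: ddZ. Qed.

Lemma ddM f g v z : smooth f -> smooth g -> dd v (fun z => f z * g z) z = dd v f z * g z + f z * dd v g z.
Proof.
rewrite dd.unlock => sf sg; rewrite addrC ['D_v f z * _]mulrC; apply: deriveM; exact: smooth_derivable.
Qed.

Lemma dd_cst v (c : R) z : dd v (fun=> c) z = 0.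
Proof. rewrite dd.unlock; exact: derive_cst. Qed.

Lemma dd_comp (F : R -> R) f v z : smooth1 F -> smooth f ->
  dd v (fun z => F (f z)) z = derive1 F (f z) * dd v f z.
Proof.
by rewrite dd.unlock => sF sf; apply: derive_compE; [exact: smooth1_derivable|exact: smooth_diff].
Qed.

Lemma dd_near f g (A : set C) v z : open A -> A z -> {in A, f =1 g} -> dd v f z = dd v g z.
Proof. rewrite dd.unlock; exact: derive_near_eq. Qed.

Lemma ddC f u v z : smooth f -> dd u (dd v f) z = dd v (dd u f) z.
Proof. rewrite dd.unlock; exact: smooth_schwarzE. Qed.

Lemma dd_ext f g v z : f =1 g -> dd v f z = dd v g z.
Proof. by move=> /funext ->. Qed.

Lemma ddbar_dd (a b : 'I_n) f z : ddbar a b f z =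
  Complex ((dd (dx R a) (dd (dx R b) f) z + dd (dy R a) (dd (dy R b) f) z) / 4)
          ((dd (dx R a) (dd (dy R b) f) z - dd (dy R a) (dd (dx R b) f) z) / 4).
Proof. by rewrite /ddbar dd.unlock. Qed.

Lemma dd_diff v f z : smooth f -> dd v f z = 'd f z v.
Proof. by rewrite dd.unlock => sf; apply: deriveE; exact: smooth_diff. Qed.

Lemma dd_sum (T : Type) (s : seq T) (F : T -> C -> R) v z : (forall i, smooth (F i)) ->
  dd v (fun z => \sum_(i <- s) F i z) z = \sum_(i <- s) dd v (F i) z.
Proof.
move=> sF; elim: s => [|i s IH]. by rewrite big_nil -[RHS](dd_cst v 0 z); apply: dd_ext => w; rewrite big_nil.
rewrite big_cons -IH -ddD //; last by apply: smooth_sum => j _; exact: sF.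
by apply: dd_ext => w; rewrite big_cons.
Qed.

Lemma Lap_def b f z : Lap b f z = dd b (dd b f) z + dd (Jc b) (dd (Jc b) f) z.
Proof. by rewrite Lap.unlock. Qed.

Definition cvec b : 'rV[K]_n := \row_a Complex (b.1 0 a) (b.2 0 a).

Lemma dd2_basis f z (b v : C) : smooth f -> dd b (dd v f) z = \sum_a \sum_c
   (b.1 0 a * v.1 0 c * dd (dx R a) (dd (dx R c) f) z + b.1 0 a * v.2 0 c * dd (dx R a) (dd (dy R c) f) z
   + b.2 0 a * v.1 0 c * dd (dy R a) (dd (dx R c) f) z + b.2 0 a * v.2 0 c * dd (dy R a) (dd (dy R c) f) z).
Proof.
move=> sf; rewrite dd_basis; last exact: smooth_dd.
have sD w : smooth (dd w f) by exact: smooth_dd.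
have E w : dd w (dd v f) z = \sum_c (v.1 0 c * dd w (dd (dx R c) f) z + v.2 0 c * dd w (dd (dy R c) f) z).
  rewrite (_ : dd v f = fun z => \sum_c (v.1 0 c * dd (dx R c) f z + v.2 0 c * dd (dy R c) f z)); last first.
    by apply/funext => y; exact: dd_basis.
  have sZ (k : R) u : smooth (fun z => k * dd u f z) by apply: smoothM => //; exact: smooth_cst.
  rewrite dd_sum; last by move=> c; apply: smoothD; exact: sZ. by apply: eq_bigr => c _; rewrite ddD ?ddZ.
apply: eq_bigr => a _; rewrite !E !big_distrr -big_split; apply: eq_bigr => c _ /=.
by move: (dd (dx R a) (dd (dx R c) f) z) (dd (dx R a) (dd (dy R c) f) z)
  (dd (dy R a) (dd (dx R c) f) z) (dd (dy R a) (dd (dy R c) f) z) => p q s t; ring.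
Qed.

Lemma LapE b f z : smooth f -> Lap b f z = \sum_a \sum_c
  ((b.1 0 a * b.1 0 c + b.2 0 a * b.2 0 c) * (dd (dx R a) (dd (dx R c) f) z + dd (dy R a) (dd (dy R c) f) z)
  + (b.1 0 a * b.2 0 c - b.2 0 a * b.1 0 c) * (dd (dx R a) (dd (dy R c) f) z - dd (dy R a) (dd (dx R c) f) z)).
Proof.
move=> sf; rewrite Lap_def !dd2_basis // -big_split; apply: eq_bigr => a _.
rewrite -big_split; apply: eq_bigr => c _ /=; rewrite !mxE.
by move: (dd (dx R a) (dd (dx R c) f) z) (dd (dx R a) (dd (dy R c) f) z)
  (dd (dy R a) (dd (dx R c) f) z) (dd (dy R a) (dd (dy R c) f) z) => p q s t; ring.
Qed.

Lemma conj_Complex (x y : R) : (Complex x y : K)^* = Complex x (- y).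
Proof. by []. Qed.

Lemma ddbar_conj a c f z : smooth f -> ddbar c a f z = (ddbar a c f z)^*.
Proof.
move=> sf; rewrite !ddbar_dd conj_Complex.
rewrite (ddC (dx R c) (dx R a) z sf) (ddC (dy R c) (dy R a) z sf).
rewrite (ddC (dx R c) (dy R a) z sf) (ddC (dy R c) (dx R a) z sf).
by rewrite -mulNr opprB.
Qed.

Lemma herm_Hess f z : smooth f -> herm (Hess f z).
Proof. by move=> sf a b; rewrite !Hess_entry; exact: ddbar_conj. Qed.

(** Hermitian symmetry removes the imaginary part; the real parts agree term by term once both sides
    are expanded in real second derivatives. *)
Lemma quad_Hess f z b : smooth f -> quad (Hess f z) (cvec b) = (Lap b f z / 4)%:C%C.
Proof.
move=> sf.
have qre : (quad (Hess f z) (cvec b))^* = quad (Hess f z) (cvec b).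
  rewrite /quad rmorph_sum exchange_big /=; apply: eq_bigr => a _; rewrite rmorph_sum.
  apply: eq_bigr => c _; rewrite !rmorphM /= conjCK (herm_Hess z sf) conjCK; ring.
have qim : cim (quad (Hess f z) (cvec b)) = 0. have := congr1 cim qre; case: (quad _ _) => x y /= /eqP.
  by rewrite eq_sym -addr_eq0 -mulr2n mulrn_eq0 /= => /eqP.
apply: creim_eq => //=.
have re_sum (T : finType) (F : T -> K) : cre (\sum_i F i) = \sum_i cre (F i).
  by elim/big_rec2: _ => // i x y _ <-; rewrite ReD.
rewrite re_sum LapE // mulr_suml; apply: eq_bigr => a _; rewrite re_sum mulr_suml.
apply: eq_bigr => c _; rewrite Hess_entry !mxE ddbar_dd.
move: (dd (dx R a) (dd (dx R c) f) z) (dd (dx R a) (dd (dy R c) f) z)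
  (dd (dy R a) (dd (dx R c) f) z) (dd (dy R a) (dd (dy R c) f) z) => p q s t.
rewrite conj_Complex.
by rewrite /=; field.
Qed.

Lemma cvec_surj (v : 'rV[K]_n) : exists b, v = cvec b.
Proof.
exists (\row_a cre (v 0 a), \row_a cim (v 0 a)); apply/rowP => a; rewrite !mxE /=.
by case: (v 0 a).
Qed.

Lemma cvec_eq0 b : (cvec b == 0) = (b == 0).
Proof.
apply/eqP/eqP => [h|->]; last by apply/rowP => a; rewrite !mxE.
case: b h => x y h; congr pair; apply/rowP => a; have /rowP/(_ a) := h; by rewrite !mxE => -[].
Qed.

Lemma real_ge0 (x : R) : (0 <= (x%:C%C : K)) = (0 <= x).
Proof. by rewrite lecR. Qed.

Lemma psd_Hess f z : smooth f -> (forall b, 0 <= Lap b f z) -> psd (Hess f z).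
Proof.
move=> sf H; split; first exact: herm_Hess.
by move=> v; have [b ->] := cvec_surj v; rewrite quad_Hess // lecR divr_ge0.
Qed.

Lemma LapD b f g z : smooth f -> smooth g -> Lap b (fun z => f z + g z) z = Lap b f z + Lap b g z.
Proof.
move=> sf sg; rewrite !Lap_def !(ddDf _ sf sg) !(ddD _ _ (smooth_dd _ sf) (smooth_dd _ sg)).
by move: (dd b (dd b f) z) (dd b (dd b g) z) => p q; rewrite addrACA.
Qed.

Lemma LapZ b (c : R) f z : smooth f -> Lap b (fun z => c * f z) z = c * Lap b f z.
Proof. by move=> sf; rewrite !Lap_def !ddZf /= ?mulrDr //; exact: smooth_dd. Qed.

Lemma LapB b f g z : smooth f -> smooth g -> Lap b (fun z => f z - g z) z = Lap b f z - Lap b g z.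
Proof.
move=> sf sg; rewrite -mulN1r -(LapZ b (-1) z sg) -LapD //; last first.
  by apply: smoothM => //; exact: smooth_cst.
by congr (Lap _ _ z); apply/funext => y; rewrite mulN1r.
Qed.

Lemma Lap_cst b (c : R) z : Lap b (fun=> c) z = 0.
Proof.
have E v : dd v (fun _ : C => c) = (fun=> 0) by apply/funext => y; exact: dd_cst.
by rewrite !Lap_def !E !dd_cst addr0.
Qed.

Lemma Lap_near f g (A : set C) b z : open A -> A z -> {in A, f =1 g} -> Lap b f z = Lap b g z.
Proof.
move=> oA Az fg.
have E v : dd v (dd v f) z = dd v (dd v g) z. apply: (dd_near v oA Az) => y yA; apply: (dd_near v oA) fg.
  by rewrite inE in yA.
by rewrite !Lap_def !E.
Qed.

Lemma Hess_near f g (A : set C) z : open A -> A z -> {in A, f =1 g} -> Hess f z = Hess g z.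
Proof.
move=> oA Az fg.
have E u v : dd u (dd v f) z = dd u (dd v g) z. apply: (dd_near u oA Az) => y yA; apply: (dd_near v oA) fg.
  by rewrite inE in yA.
have e (s : R) u v u' v' : (dd u (dd v f) z + s * dd u' (dd v' f) z) / 4 =
    (dd u (dd v g) z + s * dd u' (dd v' g) z) / 4 by rewrite (E u v) (E u' v').
have F h (a b : 'I_n) : Hess h z a b =
    Complex ((dd (dx R a) (dd (dx R b) h) z + 1 * dd (dy R a) (dd (dy R b) h) z) / 4)
          ((dd (dx R a) (dd (dy R b) h) z + (-1) * dd (dy R a) (dd (dx R b) h) z) / 4).
  by rewrite Hess_entry ddbar_dd mul1r mulN1r.
apply/matrixP => a b; apply: (etrans (F f a b)); apply: (etrans _ (esym (F g a b))).
by congr Complex; exact: e.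
Qed.

Lemma Lap_comp b (F : R -> R) f z : smooth1 F -> smooth f ->
  Lap b (fun z => F (f z)) z = derive1 F (f z) * Lap b f z +
    derive1 (derive1 F) (f z) * (dd b f z ^+ 2 + dd (Jc b) f z ^+ 2).
Proof.
move=> sF sf; have sF' := smooth1_derive sF.
have E v : dd v (dd v (fun z => F (f z))) z =
    derive1 F (f z) * dd v (dd v f) z + derive1 (derive1 F) (f z) * dd v f z ^+ 2.
  rewrite (_ : dd v (fun z => F (f z)) = fun z => derive1 F (f z) * dd v f z); last first.
    by apply/funext => y; rewrite dd_comp. rewrite ddM; [|exact: smooth_comp|exact: smooth_dd].
  rewrite dd_comp //. by move: (dd v (dd v f) z) (dd v f z) => p q; ring.
rewrite !Lap_def !E.
by move: (dd b (dd b f) z) (dd (Jc b) (dd (Jc b) f) z) (dd b f z) (dd (Jc b) f z) => p q s t; ring.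
Qed.

Lemma smooth_Lap b f : smooth f -> smooth (Lap b f).
Proof.
move=> sf; rewrite (_ : Lap b f = fun z => dd b (dd b f) z + dd (Jc b) (dd (Jc b) f) z).
  by apply: smoothD; apply/smooth_dd/smooth_dd.
by apply/funext => z; exact: Lap_def.
Qed.

Lemma Lap_continuous b f : smooth f -> continuous (Lap b f).
Proof. by move=> sf; apply: smooth_cont; exact: smooth_Lap. Qed.

Lemma smoothZ (c : R) f : smooth f -> smooth (fun z => c * f z).
Proof. by move=> sf; apply: smoothM => //; exact: smooth_cst. Qed.

Lemma LapZdir (c : R) b f z : smooth f -> Lap (c *: b) f z = c ^+ 2 * Lap b f z.
Proof.
move=> sf; rewrite !LapE // big_distrr; apply: eq_bigr => a _; rewrite big_distrr.
apply: eq_bigr => d _; rewrite !mxE /=.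
move: (dd (dx R a) (dd (dx R d) f) z + _) (dd (dx R a) (dd (dy R d) f) z - _) => S T; ring.
Qed.

Definition coordx (a : 'I_n) z : R := z.1 0 a.
Definition coordy (a : 'I_n) z : R := z.2 0 a.

Lemma coordx_smooth a : smooth (coordx a).
Proof.
pose h : C -> R := coordx a.
have lh : linear h by move=> c x y; rewrite /h /coordx !mxE.
pose L : {linear C -> R} := HB.pack h (GRing.isLinear.Build _ _ _ _ h lh).
apply: (smooth_linear (f := L)) => z /=.
apply: (@continuous_comp _ _ _ fst (fun u : 'rV[R]_n => u 0 a)); first exact: cvg_fst.
exact: coord_continuous.
Qed.

Lemma coordy_smooth a : smooth (coordy a).
Proof.
pose h : C -> R := coordy a.
have lh : linear h by move=> c x y; rewrite /h /coordy !mxE.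
pose L : {linear C -> R} := HB.pack h (GRing.isLinear.Build _ _ _ _ h lh).
apply: (smooth_linear (f := L)) => z /=.
apply: (@continuous_comp _ _ _ snd (fun u : 'rV[R]_n => u 0 a)); first exact: cvg_snd.
exact: coord_continuous.
Qed.

(** The squared Euclidean norm. In contrast to the sup norm of the ambient space it is smooth,
    invariant under the rotations exp(i t), and strictly plurisubharmonic. *)
Definition eucl z : R := \sum_a (coordx a z ^+ 2 + coordy a z ^+ 2).

Lemma smooth_eucl : smooth eucl.
Proof.
apply: smooth_sum => a _; under eq_fun do rewrite !expr2.
by apply: smoothD; apply: smoothM; (exact: coordx_smooth || exact: coordy_smooth).
Qed.

Lemma eucl_ge0 z : 0 <= eucl z.
Proof. by apply: sumr_ge0 => a _; rewrite addr_ge0 // sqr_ge0. Qed.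

Lemma eucl0 : eucl 0 = 0.
Proof. by apply: big1 => a _; rewrite /coordx /coordy !mxE expr0n addr0. Qed.

Lemma eucl_cscale p q z : eucl (cscale p q z) = (p ^+ 2 + q ^+ 2) * eucl z.
Proof. by rewrite /eucl big_distrr; apply: eq_bigr => a _; rewrite /coordx /coordy !mxE /=; ring. Qed.

Lemma euclZ (c : R) z : eucl (c *: z) = c ^+ 2 * eucl z.
Proof. by rewrite /eucl big_distrr; apply: eq_bigr => a _; rewrite /coordx /coordy !mxE /=; ring. Qed.

Lemma normle_coord z (r : R) : 0 <= r -> (forall a, `|z.1 0 a| <= r) -> (forall a, `|z.2 0 a| <= r) -> `|z| <= r.
Proof.
move=> r0 h1 h2; rewrite prod_normE ge_max; apply/andP; split.
  by rewrite [leLHS]mx_normrE; apply/bigmax_leP; split=> // -[i j] _; rewrite ord1; exact: h1.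
by rewrite [leLHS]mx_normrE; apply/bigmax_leP; split=> // -[i j] _; rewrite ord1; exact: h2.
Qed.

Lemma norm_coord z : (forall a, `|z.1 0 a| <= `|z|) /\ (forall a, `|z.2 0 a| <= `|z|).
Proof.
split=> a; rewrite [leRHS]prod_normE le_max le_coord_norm ?orbT //.
Qed.

Lemma eucl_norm z : `|z| ^+ 2 <= eucl z.
Proof.
have e0 := eucl_ge0 z.
have cl (x : R) : x ^+ 2 <= eucl z -> `|x| <= Num.sqrt (eucl z). by move=> h; rewrite -sqrtr_sqr ler_wsqrtr.
have H : `|z| <= Num.sqrt (eucl z). apply: normle_coord; first exact: sqrtr_ge0.
    move=> a; apply: cl; rewrite /eucl (bigD1 a) //= -addrA lerDl addr_ge0 ?sqr_ge0 //.
    by apply: sumr_ge0 => c _; rewrite addr_ge0 // sqr_ge0.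
  move=> a; apply: cl; rewrite /eucl (bigD1 a) //= [X in X + _]addrC -addrA lerDl addr_ge0 ?sqr_ge0 //.
  by apply: sumr_ge0 => c _; rewrite addr_ge0 // sqr_ge0.
by rewrite -[leRHS]sqr_sqrtr // lerXn2r ?nnegrE ?sqrtr_ge0.
Qed.

Lemma eucl_gt0 z : z != 0 -> 0 < eucl z.
Proof. by move=> z0; apply: lt_le_trans (eucl_norm z); rewrite exprn_gt0 // normr_gt0. Qed.

Lemma norm_cscale p q z : p ^+ 2 + q ^+ 2 <= 1 -> `|cscale p q z| ^+ 2 <= eucl z.
Proof.
move=> pq; apply: le_trans (eucl_norm _) _; rewrite eucl_cscale ler_piMl //.
exact: eucl_ge0.
Qed.

Lemma derive_coordx a v z : dd v (coordx a) z = v.1 0 a.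
Proof.
pose h : C -> R := coordx a.
have lh : linear h by move=> c x y; rewrite /h /coordx !mxE.
pose L : {linear C -> R} := HB.pack h (GRing.isLinear.Build _ _ _ _ h lh).
rewrite (dd_diff v z (coordx_smooth a)) (_ : coordx a = L) // diff_lin //.
exact/smooth_cont/coordx_smooth.
Qed.

Lemma derive_coordy a v z : dd v (coordy a) z = v.2 0 a.
Proof.
pose h : C -> R := coordy a.
have lh : linear h by move=> c x y; rewrite /h /coordy !mxE.
pose L : {linear C -> R} := HB.pack h (GRing.isLinear.Build _ _ _ _ h lh).
rewrite (dd_diff v z (coordy_smooth a)) (_ : coordy a = L) // diff_lin //.
exact/smooth_cont/coordy_smooth.
Qed.

Lemma derive_eucl v z : dd v eucl z = 2 * \sum_a (v.1 0 a * coordx a z + v.2 0 a * coordy a z).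
Proof.
rewrite /eucl; under eq_fun do under eq_bigr do rewrite !expr2.
rewrite dd_sum; last first.
  by move=> a; apply: smoothD; apply: smoothM; (exact: coordx_smooth || exact: coordy_smooth).
rewrite big_distrr; apply: eq_bigr => a _ /=; have sx := coordx_smooth a; have sy := coordy_smooth a.
rewrite ddD; [|exact: smoothM..].
by rewrite !ddM // derive_coordx derive_coordy; ring.
Qed.

Lemma Lap_eucl b z : Lap b eucl z = 4 * eucl b.
Proof.
have E v : dd v (dd v eucl) z = 2 * eucl v.
  rewrite (_ : dd v eucl = fun z => 2 * \sum_a (v.1 0 a * coordx a z + v.2 0 a * coordy a z)); last first.
    by apply/funext => y; exact: derive_eucl.
  have s1 a : smooth (fun z => v.1 0 a * coordx a z) by exact/smoothZ/coordx_smooth.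
  have s2 a : smooth (fun z => v.2 0 a * coordy a z) by exact/smoothZ/coordy_smooth.
  rewrite ddZ; last by apply: smooth_sum => a _; exact: smoothD. rewrite dd_sum; last by move=> a; exact: smoothD.
  congr (_ * _); apply: eq_bigr => a _; rewrite ddD // ddZ; last exact: coordx_smooth.
  rewrite ddZ; last exact: coordy_smooth. by rewrite derive_coordx derive_coordy -!expr2.
by rewrite !Lap_def !E /Jc eucl_cscale expr0n expr1n add0r mul1r; ring.
Qed.

(** The difference is hermitian with zero quadratic form, so all its eigenvalues vanish. Identities
    between complex Hessians thus reduce to identities between directional Laplacians. *)
Lemma quad_ext (A B : 'M[K]_n) : herm A -> herm B -> (forall v : 'rV[K]_n, quad A v = quad B v) -> A = B.
Proof.
move=> hA hB H.
suff E (D : 'M[K]_n) : herm D -> (forall v : 'rV[K]_n, quad D v = 0) -> D = 0.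
  apply/eqP; rewrite -subr_eq0; apply/eqP; apply: E. by move=> a b; rewrite !mxE rmorphB /= hA hB.
  move=> v; rewrite -[RHS](subrr (quad A v)) {2}H /quad -sumrB; apply: eq_bigr => a _.
  by rewrite -sumrB; apply: eq_bigr => b _; rewrite !mxE; ring.
move=> hD D0; have [P [e [PP _ DE]]] := spectral_decomp hD.
have e0 k : e 0 k = 0 by rewrite (spectral_diagE PP DE) D0.
have e00 : e = 0 by apply/rowP => k; rewrite e0 mxE.
by rewrite DE e00 linear0 mulmx0 mul0mx.
Qed.

End levi.

(** * Circle means and Fubini's theorem for them *)

Section circle.
Context {R : realType} {n : nat}.
Notation mR := (measurableTypeR R).
Notation mu := (@lebesgue_measure R).
Notation C := (Cn R n).
Notation bC := (borelCn R n).
Implicit Types (f g h : C -> R) (z w b : C) (r s t c : R) (F G : R -> R).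

Definition circ : set mR := `[0%R, (2 * pi)%R]%classic.
Definition Jint F : R := \int[mu]_(t in circ) F t.

Let twopi_gt0 : 0 < 2 * pi :> R.
Proof. by rewrite mulr_gt0 ?pi_gt0. Qed.

Lemma measurable_circ : measurable circ.
Proof. exact: measurable_itv. Qed.

Lemma volume_circ : mu circ = (2 * pi)%:E.
Proof. by rewrite /circ lebesgue_measure_itv /= lte_fin twopi_gt0 sube0. Qed.

Definition bdm F := measurable_fun [set: mR] (F : mR -> mR) /\ exists c, forall t, `|F t| <= c.

Lemma bdm_integrable F : bdm F -> mu.-integrable circ (EFin \o F).
Proof.
move=> [mF [c H]]; apply: measurable_bounded_integrable.
- exact: measurable_circ.
- by change (mu circ < +oo)%E; rewrite volume_circ ltry.
- exact: measurable_funTS.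
- by exists c; split; [exact: num_real|move=> x cx t _; apply: le_trans (H t) (ltW cx)].
Qed.

Lemma bdm_cst c : bdm (fun=> c).
Proof. by split=> //; exists `|c|. Qed.

Lemma bdmD F G : bdm F -> bdm G -> bdm (fun t => F t + G t).
Proof.
move=> [mF [c H]] [mG [c' H']]; split; first exact: measurable_funD.
by exists (c + c') => t; apply: le_trans (ler_normD _ _) (lerD (H t) (H' t)).
Qed.

Lemma bdmM F G : bdm F -> bdm G -> bdm (fun t => F t * G t).
Proof.
move=> [mF [c H]] [mG [c' H']]; split; first exact: measurable_funM.
by exists (c * c') => t; rewrite normrM ler_pM.
Qed.

Lemma bdmZ c F : bdm F -> bdm (fun t => c * F t).
Proof. by move=> bF; apply: bdmM => //; exact: bdm_cst. Qed.

Lemma bdmN F : bdm F -> bdm (fun t => - F t).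
Proof. by move=> bF; under [X in bdm X]eq_fun do rewrite -mulN1r; exact: bdmZ. Qed.

Lemma JD F G : bdm F -> bdm G -> Jint (fun t => F t + G t) = Jint F + Jint G.
Proof. by move=> bF bG; apply: RintegralD; [exact: measurable_circ|exact: bdm_integrable..]. Qed.

Lemma JZ c F : bdm F -> Jint (fun t => c * F t) = c * Jint F.
Proof. by move=> bF; apply: RintegralZl; [exact: measurable_circ|exact: bdm_integrable]. Qed.

Lemma J_ext F G : F =1 G -> Jint F = Jint G.
Proof. by move=> /funext ->. Qed.

Lemma J_cst c : Jint (fun=> c) = 2 * pi * c.
Proof.
transitivity (c * fine (mu circ)); first by apply: Rintegral_cst; exact: measurable_circ.
by rewrite volume_circ mulrC.
Qed.

Lemma le_J F G : bdm F -> bdm G -> (forall t, F t <= G t) -> Jint F <= Jint G.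
Proof.
move=> bF bG H; apply: le_Rintegral;
  [exact: measurable_circ|exact: bdm_integrable|exact: bdm_integrable|by move=> t _; exact: H].
Qed.

Lemma J_bound F c : bdm F -> (forall t, `|F t| <= c) -> `|Jint F| <= 2 * pi * c.
Proof.
move=> bF H; apply: le_trans (le_normr_Rintegral measurable_circ (bdm_integrable bF)) _.
rewrite -J_cst; apply: le_J => //; last exact: bdm_cst.
split; first by apply: measurableT_comp => //; case: bF.
by exists c => t; rewrite normr_id.
Qed.

Lemma J_cvg (F_ : nat -> R -> R) F c : (forall k, measurable_fun [set: mR] (F_ k : mR -> mR)) ->
  (forall k t, `|F_ k t| <= c) -> (forall t, F_ k t @[k --> \oo] --> F t) ->
  bdm F /\ Jint (F_ k) @[k --> \oo] --> Jint F.
Proof.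
move=> mF_ Fc FF.
have mF : measurable_fun [set: mR] (F : mR -> mR). by apply: (measurable_fun_cvg mF_) => z _; exact: FF.
have bF : bdm F. split=> //; exists c => t.
  apply/ler_addgt0Pr => e e0; have /cvgrPdist_le/(_ e e0)[N _ h] := FF t.
  rewrite -(subrK (F_ N t) (F t)) addrC; apply: le_trans (ler_normD _ _) _.
  by rewrite lerD //; exact: (h N (leqnn N)).
split=> //.
have := @dominated_convergence _ _ R mu circ measurable_circ (fun k t => (F_ k t)%:E)
  (fun t => (F t)%:E) (EFin \o cst c).
case=> //.
- by move=> k; apply/measurable_EFinP; apply: measurable_funTS; exact: mF_.
- by apply/measurable_EFinP; exact: measurable_funTS.
- by apply: aeW => z _; apply: cvg_EFin; [exact: nearW|exact: FF].
- exact: (bdm_integrable (bdm_cst c)).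
- by apply: aeW => z k _; rewrite lee_fin.
move=> _ _ H; apply: fine_cvg; rewrite /Jint /Rintegral fineK //.
by apply: integrable_fin_num; [exact: measurable_circ|exact: bdm_integrable].
Qed.

Definition rot t b : C := cscale (cos t) (sin t) b.

Lemma cos2sin2 t : cos t ^+ 2 + sin t ^+ 2 = 1.
Proof. exact: cos2Dsin2. Qed.

Definition bbm g := mfun g /\ exists c, forall z, `|g z| <= c.

Lemma nice_bbm g : nice g -> bbm g.
Proof. by move=> [mg [c [r H]]]; split=> //; exists c => z; case: (H z). Qed.

Lemma measurable_circle d (T : measurableType d) (p q : T -> mR) (z x : T -> bC) :
  measurable_fun setT p -> measurable_fun setT q -> measurable_fun setT z -> measurable_fun setT x ->
  measurable_fun setT (fun y => z y + cscale (p y) (q y) (x y) : bC).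
Proof.
move=> mp mq mz mx.
have m1 i (y : T -> bC) : measurable_fun setT y -> measurable_fun setT (fun t : T => (y t).1 0 i : mR).
  exact: (measurableT_comp (measurable_coord1 i)).
have m2 i (y : T -> bC) : measurable_fun setT y -> measurable_fun setT (fun t : T => (y t).2 0 i : mR).
  exact: (measurableT_comp (measurable_coord2 i)).
apply: measurable_to_Cn => i.
  rewrite (_ : (fun _ => _) = (fun y => (z y).1 0 i + (p y * (x y).1 0 i - q y * (x y).2 0 i)));
    last by apply/funext => y; rewrite !mxE.
  by apply: measurable_funD; [exact: m1|apply: measurable_funB; apply: measurable_funM => //; [exact: m1|exact: m2]].
rewrite (_ : (fun _ => _) = (fun y => (z y).2 0 i + (p y * (x y).2 0 i + q y * (x y).1 0 i)));
  last by apply/funext => y; rewrite !mxE.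
by apply: measurable_funD; [exact: m2|apply: measurable_funD; apply: measurable_funM => //; [exact: m2|exact: m1]].
Qed.

Lemma measurable_cosR : measurable_fun [set: mR] (@cos R : mR -> mR).
Proof. by apply: continuous_measurable_fun; exact: continuous_cos. Qed.

Lemma measurable_sinR : measurable_fun [set: mR] (@sin R : mR -> mR).
Proof. by apply: continuous_measurable_fun; exact: continuous_sin. Qed.

Lemma bdm_circle g z b : bbm g -> bdm (fun t => g (z + rot t b)).
Proof.
move=> [mg [c H]]; split; last by exists c => t.
apply: (measurableT_comp mg); apply: (@measurable_circle _ _ _ _ (fun=> z) (fun=> b)) => //.
  exact: measurable_cosR.
exact: measurable_sinR.
Qed.

Definition cmean g z b : R := (2 * pi)^-1 * Jint (fun t => g (z + rot t b)).

Lemma cmean_cst c z b : cmean (fun=> c) z b = c.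
Proof. by rewrite /cmean J_cst mulKf // gt_eqF. Qed.

Lemma le_cmean g h z b : bbm g -> bbm h -> (forall t, g (z + rot t b) <= h (z + rot t b)) ->
  cmean g z b <= cmean h z b.
Proof.
move=> bg bh H; rewrite ler_wpM2l //; first by rewrite invr_ge0 ltW.
by apply: le_J => //; exact: bdm_circle.
Qed.

(** Fubini for the product of the interval [0, 2 pi] with C^n: the integrand, cut off outside the
    interval, is bounded and carried by a set of finite measure. *)
Lemma J_I_fubini (F : R -> C -> R) c r : @measurable_fun _ _ (mR * bC)%type mR setT (fun p => F p.1 p.2) ->
  (forall t w, `|F t w| <= c) -> (forall t w, r < `|w| -> F t w = 0) ->
  nice (fun w => Jint (F^~ w)) /\ I (fun w => Jint (F^~ w)) = Jint (fun t => I (F t)).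
Proof.
move=> mF Fc Fr.
have mFt t : mfun (F t) by exact: (measurableT_comp mF (measurable_pair1 t)).
have mFw w : measurable_fun [set: mR] (F^~ w : mR -> mR) by exact: (measurableT_comp mF (measurable_pair2 (w : bC))).
have nF t : nice (F t) by split=> //; exists c, r => w; split=> [//|]; exact: Fr.
have bF w : bdm (F^~ w) by split=> //; exists c.
pose f (p : mR * bC) : \bar R := ((fun p : mR * bC => F p.1 p.2) \_ (circ `*` setT) p)%:E.
have in1 (p : mR * bC) : (p \in circ `*` setT) = (p.1 \in circ).
  by apply/idP/idP; rewrite !inE /=; [case|move=> h; split].
have mcirc : measurable (circ `*` [set: bC]) by apply: measurableX => //; exact: measurable_circ.
have intf : (mu \x @VC R n)%E.-integrable setT f. pose B : set bC := [set z : C | `|z| <= r].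
  have mB : measurable B by apply: closed_measurableCn; exact: closed_normle.
  have mX : measurable (circ `*` B) by apply: measurableX => //; exact: measurable_circ.
  have : (mu \x @VC R n)%E.-integrable (circ `*` B) (EFin \o (fun p : mR * bC => F p.1 p.2)).
    apply: measurable_bounded_integrable => //.
    - change ((mu \x @VC R n)%E (circ `*` B) < +oo)%E. rewrite product_measure1E //; last exact: measurable_circ.
      rewrite lte_mul_pinfty //; first by have fc : (mu circ \is a fin_num)%E by rewrite volume_circ.
      exact: volume_normle_lty.
    - exact: measurable_funTS.
    - by exists c; split; [exact: num_real|move=> x cx p _; apply: le_trans (Fc _ _) (ltW cx)].
  move/(proj1 (integrable_mkcond _ mX)); congr (_.-integrable _ _). apply/funext => p; rewrite /f !patchE in1.
  have -> : (p \in circ `*` B) = (p.1 \in circ) && (`|p.2| <= r).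
    apply/idP/andP; rewrite !inE /=; first by move=> []. by move=> [? ?].
  case: (p.1 \in circ) => //=; case: leP => // rp; by rewrite /= Fr.
have E1 t : (\int[@VC R n]_w f (t, w))%E = ((fun t => I (F t)) \_ circ t)%:E.
  rewrite patchE; have [tc|tc] := boolP (t \in circ).
    rewrite /I /Rintegral fineK; last by apply: integrable_fin_num => //; exact: nice_integrable.
    by apply: eq_integral => w _; rewrite /f patchE in1 tc.
  by apply: integral0_eq => w _; rewrite /f patchE in1 (negbTE tc).
have E2 w : (\int[mu]_t f (t, w))%E = (Jint (F^~ w))%:E. rewrite /Jint /Rintegral fineK; last first.
    by apply: integrable_fin_num; [exact: measurable_circ|exact: bdm_integrable].
  rewrite [RHS]integral_mkcond; apply: eq_integral => t _; rewrite /f !patchE in1 /=. by case: (t \in circ).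
split. split. apply/measurable_EFinP; apply: (eq_measurable_fun _ _ (measurable_fubini_G intf)) => w _. exact: E2.
  exists (2 * pi * c), r => w; split; first by apply: J_bound.
  move=> rw; rewrite -[RHS](mulr0 (2 * pi)) -J_cst; apply: J_ext => t; exact: Fr.
have e : (\int[mu]_t (((fun t => I (F t)) \_ circ) t)%:E = \int[@VC R n]_w (Jint (F^~ w))%:E)%E.
  transitivity (\int[mu]_t \int[@VC R n]_w f (t, w))%E. by apply: eq_integral => t _; exact: (esym (E1 t)).
  transitivity (\int[@VC R n]_w \int[mu]_t f (t, w))%E; first exact: Fubini.
  by apply: eq_integral => w _; exact: E2.
rewrite [RHS]/Jint Rintegral_mkcond; exact: (congr1 fine (esym e)).
Qed.

Lemma cmean_fubini g (k : C -> R) (x : R -> C -> C) : bbm g -> nice k ->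
  @measurable_fun _ _ (mR * bC)%type bC setT (fun p => x p.1 p.2) ->
  nice (fun w => (2 * pi)^-1 * Jint (fun t => g (x t w)) * k w) /\
  I (fun w => (2 * pi)^-1 * Jint (fun t => g (x t w)) * k w) =
    (2 * pi)^-1 * Jint (fun t => I (fun w => g (x t w) * k w)).
Proof.
move=> [mg [c gc]] nk mx; have [mk [ck [r kP]]] := nk.
pose F t w := g (x t w) * k w.
have [nJ EJ] : nice (fun w => Jint (F^~ w)) /\ I (fun w => Jint (F^~ w)) = Jint (fun t => I (F t)).
  apply: (@J_I_fubini F (`|c| * `|ck|) r).
  - apply: measurable_funM; first exact: (measurableT_comp mg mx). exact: (measurableT_comp mk).
  - move=> t w; rewrite normrM ler_pM //; first exact: le_trans (gc _) (ler_norm _).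
    exact: le_trans (proj1 (kP _)) (ler_norm _).
  - by move=> t w rw; rewrite /F (proj2 (kP w)) // mulr0.
have bF w : bdm (fun t => g (x t w)). split; last by exists c.
  exact: (measurableT_comp mg (measurableT_comp mx (measurable_pair2 (w : bC)))).
have E w : (2 * pi)^-1 * Jint (fun t => g (x t w)) * k w = (2 * pi)^-1 * Jint (F^~ w).
  by rewrite -mulrA; congr (_ * _); rewrite mulrC -JZ //; apply: J_ext => t; rewrite mulrC.
by rewrite (funext E); split; [exact: niceZ|rewrite IZ // EJ].
Qed.

(** A rotation of w changes neither Lebesgue measure nor the kernel k, so all angles contribute the
    same integral. *)
Lemma I_cmean g z d (k : C -> R) : bbm g -> nice k -> (forall t w, k (rot t w) = k w) ->
  nice (fun w => cmean g z (d *: w) * k w) /\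
  I (fun w => cmean g z (d *: w) * k w) = I (fun w => g (z + d *: w) * k w).
Proof.
move=> bg nk kinv; have [mg [c gc]] := bg.
have mrot : @measurable_fun _ _ (mR * bC)%type bC setT (fun p => z + rot p.1 (d *: p.2)).
  apply: (@measurable_circle _ _ _ _ (fun=> z)) => //.
  - by apply: measurableT_comp => //; exact: measurable_cosR.
  - by apply: measurableT_comp => //; exact: measurable_sinR.
  - have := measurable_affine_Cn d (0 : C) => h.
    rewrite (_ : (fun _ => _) = (fun z : bC => d *: z + 0 : bC) \o snd); last first.
      by apply/funext => p /=; rewrite addr0. exact: measurableT_comp.
have [nJ EJ] := cmean_fubini (x := fun t w => z + rot t (d *: w)) bg nk mrot; split; first exact: nJ.
apply: etrans EJ _.
have rotZ t w : rot t (d *: w) = d *: rot t w. by congr pair; apply/rowP => i; rewrite !mxE; ring.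
rewrite (_ : (fun t => I _) = fun=> I (fun w => g (z + d *: w) * k w)); last first.
  apply/funext => t; rewrite -[RHS](I_rot (cos2sin2 t)). by apply: I_ext => w; rewrite rotZ -/(rot t w) kinv.
  under [X in nice X]eq_fun do rewrite mulrC. apply: niceM => //; last by exists c.
  have := measurable_affine_Cn d z => h.
  rewrite (_ : (fun _ => _) = g \o (fun w : bC => d *: w + z : bC)); last first.
    by apply/funext => w /=; rewrite addrC. exact: (measurableT_comp mg h).
by rewrite J_cst mulKf // gt_eqF.
Qed.

Lemma cmean_I g z b d (k : C -> R) : bbm g -> nice k -> cmean (fun y => I (fun w => g (y + d *: w) * k w)) z b =
  I (fun w => cmean (fun y => g (y + d *: w)) z b * k w) /\
  nice (fun w => cmean (fun y => g (y + d *: w)) z b * k w).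
Proof.
move=> bg nk.
have mrot : @measurable_fun _ _ (mR * bC)%type bC setT (fun p => z + rot p.1 b + d *: p.2).
  rewrite (_ : (fun _ => _) = fun p : mR * bC => (d *: p.2 + z) + rot p.1 b); last first.
    by apply/funext => p; rewrite addrC addrA.
  apply: (@measurable_circle _ _ _ _ (fun p : mR * bC => d *: p.2 + z) (fun=> b)) => //.
  - by apply: measurableT_comp => //; exact: measurable_cosR.
  - by apply: measurableT_comp => //; exact: measurable_sinR.
  - exact: (measurableT_comp (measurable_affine_Cn d z) measurable_snd).
by have [nJ EJ] := cmean_fubini (x := fun t w => z + rot t b + d *: w) bg nk mrot; split; [exact: (esym EJ)|exact: nJ].
Qed.

End circle.

(** * Circle means of smooth functions and the sign of the Laplacian *)

Section polar.
Context {R : realType} {n : nat}.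
Notation mR := (measurableTypeR R).
Notation mu := (@lebesgue_measure R).
Notation C := (Cn R n).
Implicit Types (f g h : C -> R) (z w b : C) (r s t c : R).

Lemma is_derive_scalel (p : R -> R) t dp b : is_derive t (1 : R) p dp ->
  differentiable (fun s => p s *: b) t /\ 'D_1 (fun s : R => p s *: b) t = dp *: b.
Proof.
move=> pd; have dfp : differentiable p t by apply/derivable1_diffP; case: pd.
have dl : differentiable (fun x : R => x *: b) (p t) by apply: ex_diff.
have dc : differentiable ((fun x : R => x *: b) \o p) t by exact: differentiable_comp.
split; first exact: dc.
rewrite deriveE // -/((fun x : R => x *: b) \o p) diff_comp //=.
rewrite (_ : 'd (fun x : R => x *: b) (p t) = (fun x : R => x *: b) :> (R -> C)); last first. exact: diff_val.
by rewrite /= -deriveE //; case: pd => _ ->.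
Qed.

Lemma smooth_curve h (p q : R -> R) z b (c : C) t dp dq : smooth h ->
  is_derive t (1 : R) p dp -> is_derive t (1 : R) q dq ->
  is_derive t (1 : R) (fun s => h (z + p s *: b + q s *: c))
    (dp * dd b h (z + p t *: b + q t *: c) + dq * dd c h (z + p t *: b + q t *: c)).
Proof.
move=> sh dP dQ.
have [d1 e1] := is_derive_scalel b dP; have [d2 e2] := is_derive_scalel c dQ.
pose ga (s : R) : C := z + p s *: b + q s *: c.
have d3 : differentiable (fun s : R => z + p s *: b) t by apply: differentiableD.
have dga : differentiable ga t by apply: differentiableD.
have dh := smooth_diff (ga t) sh.
have dc : differentiable (h \o ga) t by exact: differentiable_comp.
have E : 'D_1 ga t = dp *: b + dq *: c. rewrite /ga deriveD; [|exact: diff_derivable..].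
  rewrite e2 deriveD; [|exact: diff_derivable..]. by rewrite e1 derive_cst add0r.
apply: DeriveDef; first exact: (diff_derivable dc).
rewrite -[LHS]/('D_1 (h \o ga) t) deriveE // diff_comp //= -(deriveE _ dga) E.
by rewrite -(dd_diff _ _ sh) ddDv // !ddZv.
Qed.

Definition P z b h r t := h (z + (r * cos t) *: b + (r * sin t) *: Jc b).

Lemma P_rot z b h r t : h (z + rot t (r *: b)) = P z b h r t.
Proof. by congr h; congr pair; apply/rowP => i; rewrite !mxE; ring. Qed.

Lemma P_derive_r z b h r t : smooth h -> is_derive r (1 : R) (fun r => P z b h r t)
    (cos t * P z b (dd b h) r t + sin t * P z b (dd (Jc b) h) r t).
Proof.
move=> sh; apply: (smooth_curve (p := fun r => r * cos t) (q := fun r => r * sin t)) => //.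
  by apply: is_derive_eq; rewrite /GRing.scale /=; ring.
by apply: is_derive_eq; rewrite /GRing.scale /=; ring.
Qed.

Lemma P_derive_t z b h r t : smooth h -> is_derive t (1 : R) (P z b h r)
    (- (r * sin t) * P z b (dd b h) r t + (r * cos t) * P z b (dd (Jc b) h) r t).
Proof.
move=> sh; apply: (smooth_curve (p := fun t => r * cos t) (q := fun t => r * sin t)) => //.
by apply: is_derive_eq; rewrite /GRing.scale /=; ring.
Qed.

Lemma P_continuous z b h r : smooth h -> continuous (P z b h r).
Proof.
move=> sh t; have [/derivable1_diffP d _] := P_derive_t z b r t sh.
exact: differentiable_continuous.
Qed.

Lemma P_bounded z b h B : smooth h -> exists c, forall r t, `|r| <= B -> `|P z b h r t| <= c.
Proof.
move=> sh; have [c H] := continuous_bounded_ball (`|z| + B * `|b| + B * `|Jc b|) (smooth_cont sh).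
exists c => r t rB; apply: H.
have sc (x : R) v : `|x| <= 1 -> `|(r * x) *: v| <= B * `|v|.
  move=> x1; rewrite normrZ ler_wpM2r // normrM; apply: le_trans rB. by rewrite ler_piMr.
apply: le_trans (ler_normD _ _) _; apply: lerD; last first. by apply: sc; rewrite ler_norml sin_geN1 sin_le1.
apply: le_trans (ler_normD _ _) _; apply: lerD => //.
by apply: sc; rewrite ler_norml cos_geN1 cos_le1.
Qed.

Lemma bdm_cos : bdm (@cos R).
Proof. by split; [exact: measurable_cosR|exists 1 => t; rewrite ler_norml cos_geN1 cos_le1]. Qed.

Lemma bdm_sin : bdm (@sin R).
Proof. by split; [exact: measurable_sinR|exists 1 => t; rewrite ler_norml sin_geN1 sin_le1]. Qed.

Lemma bdm_P z b h r : smooth h -> bdm (P z b h r).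
Proof.
move=> sh; split; first by apply: continuous_measurable_fun; exact: P_continuous.
by have [c H] := P_bounded z b `|r| sh; exists c => t; exact: H.
Qed.

Lemma derive_J (F F' : R -> R -> R) :
  (forall r, bdm (F r)) -> (forall r t, is_derive r (1 : R) (F^~ t) (F' r t)) ->
  (forall B, exists c, forall r t, `|r| <= B -> `|F' r t| <= c) ->
  forall r, is_derive r (1 : R) (fun r => Jint (F r)) (Jint (F' r)).
Proof.
move=> bF dF bF' r.
have [c H] := bF' (`|r| + 1).
have E x y : partial1of2 F x y = F' x y. by rewrite partial1of2E; have [_ ->] := dF x y.
have rI : `]r - 1, r + 1[%classic r by rewrite /= in_itv /= ltrBlDr ltrDl ltr01.
have bd x y : `]r - 1, r + 1[%classic x -> circ y -> `|partial1of2 F x y| <= cst `|c| y.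
  rewrite /= in_itv /= => /andP[x1 x2] _; rewrite E; apply: le_trans (H _ _ _) (ler_norm _).
  rewrite -(subrK r x) addrC; apply: le_trans (ler_normD _ _) _; rewrite lerD2l.
  by rewrite ler_norml; apply/andP; split; apply: ltW; lra.
have iF x : `]r - 1, r + 1[%classic x -> mu.-integrable circ (EFin \o F x) by move=> _; exact: bdm_integrable.
have dF' x y : `]r - 1, r + 1[%classic x -> circ y -> derivable (F^~ y) x 1. by move=> _ _; case: (dF x y).
have ic : mu.-integrable circ (EFin \o cst `|c|) by exact: (bdm_integrable (bdm_cst _)).
have c0 (y : mR) : 0 <= cst `|c| y :> R by exact: normr_ge0.
apply: DeriveDef. have D := @derivable_under_integral R _ mR mu F circ measurable_circ r _ _ rI iF dF' _ c0 ic bd.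
  exact: D.
have := @differentiation_under_integral R _ mR mu F circ measurable_circ r _ _ rI iF dF' _ c0 ic bd.
rewrite derive1E => ->; apply: J_ext => t; exact: E.
Qed.

Lemma JB (F G : R -> R) : bdm F -> bdm G -> Jint (fun t => F t - G t) = Jint F - Jint G.
Proof.
move=> bF bG; rewrite (JD bF (bdmN bG)); congr (_ + _); rewrite -mulN1r -(JZ (-1) bG).
by apply: J_ext => t; rewrite mulN1r.
Qed.

(* [r m' = N] and [(r m')' = r int Lap], for the circle integrals [m]. *)
Lemma polar z b g : smooth g -> exists N M1 : R -> R,
  [/\ forall r, is_derive r (1 : R) (fun r => Jint (P z b g r)) (M1 r), forall r, N r = r * M1 r, continuous N
    & forall r, 0 < r -> is_derive r (1 : R) N (r * Jint (P z b (Lap b g) r))].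
Proof.
move=> sg; pose J := Jc b.
have s1 := smooth_dd b sg; have s2 := smooth_dd J sg.
have s11 := smooth_dd b s1; have s12 := smooth_dd J s1.
have s21 := smooth_dd b s2; have s22 := smooth_dd J s2.
pose f1 r t := cos t * P z b (dd b g) r t + sin t * P z b (dd J g) r t.
pose f2 r t := cos t * (cos t * P z b (dd b (dd b g)) r t + sin t * P z b (dd J (dd b g)) r t)
  + sin t * (cos t * P z b (dd b (dd J g)) r t + sin t * P z b (dd J (dd J g)) r t).
have bf1 r : bdm (f1 r). by apply: bdmD; apply: bdmM; (exact: bdm_cos || exact: bdm_sin || exact: bdm_P).
have bf2 r : bdm (f2 r). apply: bdmD; apply: bdmM; try (exact: bdm_cos || exact: bdm_sin);
  by apply: bdmD; apply: bdmM; (exact: bdm_cos || exact: bdm_sin || exact: bdm_P).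
have d1 r t : is_derive r (1 : R) (fun r => P z b g r t) (f1 r t) by exact: P_derive_r.
have d2 r t : is_derive r (1 : R) (f1^~ t) (f2 r t). apply: is_deriveD; apply: is_deriveZ; exact: P_derive_r.
have bnd2 (x y c1 c2 : R) t : `|x| <= c1 -> `|y| <= c2 -> `|cos t * x + sin t * y| <= c1 + c2.
  move=> xc yc; apply: le_trans (ler_normD _ _) _; apply: lerD; rewrite normrM.
    by apply: le_trans xc; rewrite ler_piMl // ler_norml cos_geN1 cos_le1.
  by apply: le_trans yc; rewrite ler_piMl // ler_norml sin_geN1 sin_le1.
have bd1 B : exists c, forall r t, `|r| <= B -> `|f1 r t| <= c.
  have [c1 h1] := P_bounded z b B s1; have [c2 h2] := P_bounded z b B s2.
  by exists (c1 + c2) => r t rB; apply: bnd2; [exact: h1|exact: h2].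
have bd2 B : exists c, forall r t, `|r| <= B -> `|f2 r t| <= c.
  have [c1 h1] := P_bounded z b B s11; have [c2 h2] := P_bounded z b B s12.
  have [c3 h3] := P_bounded z b B s21; have [c4 h4] := P_bounded z b B s22.
  exists ((c1 + c2) + (c3 + c4)) => r t rB; apply: (bnd2 _ _ _ _ t); apply: (bnd2 _ _ _ _ t);
    by [exact: h1|exact: h2|exact: h3|exact: h4].
pose M1 r := Jint (f1 r).
have dM r : is_derive r (1 : R) M1 (Jint (f2 r)) by exact: (derive_J (F' := f2)).
exists (fun r => r * M1 r), M1; split => //.
- by move=> r; apply: (derive_J (F' := f1)) => // r'; exact: bdm_P.
- move=> r; apply: (@continuousM _ _ id M1); first exact: cvg_id.
  by apply: differentiable_continuous; apply/derivable1_diffP; case: (dM r).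
move=> r r0; have dM1 := dM r.
(* [Gt] is the angular derivative of g along the circle, and the formula for [Gtt] is the Laplacian
   in polar coordinates, with f1 = g_r and f2 = g_rr. Its integral vanishes by periodicity. *)
pose Gt t := r * (- sin t * P z b (dd b g) r t + cos t * P z b (dd J g) r t).
pose Gtt t := r ^+ 2 * P z b (Lap b g) r t - r * f1 r t - r ^+ 2 * f2 r t.
have sL := smooth_Lap b sg.
have PL t : P z b (Lap b g) r t = P z b (dd b (dd b g)) r t + P z b (dd J (dd J g)) r t. by rewrite /P Lap_def.
have dGt t : is_derive t (1 : R) Gt (Gtt t). have e1 := P_derive_t z b r t s1; have e2 := P_derive_t z b r t s2.
  rewrite /Gt; apply: is_derive_eq; rewrite /Gtt PL /f1 /f2 /GRing.scale /=.
  have -> : P z b (dd b (dd J g)) r t = P z b (dd J (dd b g)) r t by exact: ddC.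
  rewrite -/J; move: (P z b (dd b g) r t) (P z b (dd J g) r t) (P z b (dd b (dd b g)) r t)
    (P z b (dd J (dd b g)) r t) (P z b (dd J (dd J g)) r t) (cos2sin2 t) => p1 p2 p3 p4 p5.
  move: (cos t) (sin t) => x y E. have -> : p3 + p5 = (x ^+ 2 + y ^+ 2) * (p3 + p5) by rewrite E mul1r. by ring.
have bGtt : bdm Gtt. apply: bdmD; last by apply: bdmN; exact: bdmZ.
  by apply: bdmD; [apply: bdmZ; exact: bdm_P|apply: bdmN; exact: bdmZ].
have JG : Jint Gtt = 0. have cG t : {for t, continuous Gtt}.
    have cP h : smooth h -> {for t, continuous (P z b h r)} by move=> sh; exact: P_continuous.
    have cc : {for t, continuous (@cos R)} by exact: continuous_cos.
    have cs : {for t, continuous (@sin R)} by exact: continuous_sin.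
    have cM (p q : R -> R) : {for t, continuous p} -> {for t, continuous q} ->
        {for t, continuous (fun x => p x * q x)} by exact: continuousM.
    have cD (p q : R -> R) : {for t, continuous p} -> {for t, continuous q} ->
        {for t, continuous (fun x => p x + q x)} by exact: continuousD.
    have cB (p q : R -> R) : {for t, continuous p} -> {for t, continuous q} ->
        {for t, continuous (fun x => p x - q x)} by exact: continuousB.
    have ck (k : R) : {for t, continuous (fun _ : R => k)} by exact: cst_continuous.
    have cf1 : {for t, continuous (f1 r)}. exact: (cD _ _ (cM _ _ cc (cP _ s1)) (cM _ _ cs (cP _ s2))).
    have cf2 : {for t, continuous (f2 r)}.
      exact: (cD _ _ (cM _ _ cc (cD _ _ (cM _ _ cc (cP _ s11)) (cM _ _ cs (cP _ s12))))
        (cM _ _ cs (cD _ _ (cM _ _ cc (cP _ s21)) (cM _ _ cs (cP _ s22))))).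
    exact: (cB _ _ (cB _ _ (cM _ _ (ck _) (cP _ sL)) (cM _ _ (ck _) cf1)) (cM _ _ (ck _) cf2)).
  have dG t : derivable Gt t 1 by case: (dGt t). have cGt t : {for t, continuous Gt}.
    by apply: differentiable_continuous; apply/derivable1_diffP.
  have p0 : 0 < 2 * pi :> R by rewrite mulr_gt0 ?pi_gt0. rewrite /Jint /Rintegral (@continuous_FTC2 _ _ Gt) //.
  - have -> : Gt (2 * pi) = Gt 0 by rewrite /Gt /P mulr_natl sin2pi cos2pi sin0 cos0. by rewrite subee.
  - by apply: continuous_in_subspaceT => t _; exact: cG.
  - split; first by move=> t _; exact: dG. by apply: cvg_at_right_filter; exact: cGt.
    by apply: cvg_at_left_filter; exact: cGt.
  - by move=> t _; rewrite derive1E; case: (dGt t).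
have E : r * (M1 r + r * Jint (f2 r)) = r * (r * Jint (P z b (Lap b g) r)).
  have bPL : bdm (P z b (Lap b g) r) by exact: bdm_P.
  have : Jint Gtt = r ^+ 2 * Jint (P z b (Lap b g) r) - r * M1 r - r ^+ 2 * Jint (f2 r).
    have b1 := bdmZ (r ^+ 2) bPL; have b2 := bdmZ r (bf1 r); have b3 := bdmZ (r ^+ 2) (bf2 r).
    rewrite -(JZ (r ^+ 2) bPL) -(JZ r (bf1 r)) -(JZ (r ^+ 2) (bf2 r)).
    by rewrite -(JB b1 b2) -(JB (bdmD b1 (bdmN b2)) b3).
  by rewrite JG => /eqP; rewrite eq_sym subr_eq0 subr_eq => /eqP; rewrite mulrA -expr2 => ->; ring.
have {}E := mulfI (lt0r_neq0 r0) E.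
rewrite -E; apply: is_derive_eq; rewrite /GRing.scale /=; ring.
Qed.

Lemma twopi_gt0 : 0 < 2 * pi :> R.
Proof. by rewrite mulr_gt0 ?pi_gt0. Qed.

Lemma J_P0 z b g : Jint (P z b g 0) = 2 * pi * g z.
Proof. by rewrite -J_cst; apply: J_ext => t; rewrite /P !mul0r !scale0r !addr0. Qed.

Lemma J_ge0 (F : R -> R) : bdm F -> (forall t, 0 <= F t) -> 0 <= Jint F.
Proof.
by move=> bF F0; rewrite -[leLHS](mulr0 (2 * pi)) -J_cst; apply: le_J => //; exact: bdm_cst.
Qed.

(** The function r m'(r) vanishes at 0 and has a nonnegative derivative, so the mean m increases. *)
Lemma polar_mono z b g r : smooth g -> (forall s t, 0 < s < r -> 0 <= Lap b g (z + rot t (s *: b))) ->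
  forall s, 0 <= s <= r -> Jint (P z b g s) <= Jint (P z b g r).
Proof.
move=> sg H s /andP[s0]; rewrite le_eqVlt => /predU1P[->//|sr].
have [N [M1 [dm NE cN dN]]] := polar z b sg.
have N00 : N 0 = 0 by rewrite NE mul0r.
have N0 x : 0 < x < r -> 0 <= N x. move=> /andP[x0 xr].
  have [|y] := MVT x0 (f := N) (df := fun r => r * Jint (P z b (Lap b g) r)) _ (continuous_subspaceT cN).
    by move=> y; rewrite in_itv /= => /andP[y0 _]; exact: dN.
  rewrite in_itv /= => /andP[y0 yx]; rewrite N00 !subr0 => ->. apply: mulr_ge0; last exact: ltW.
  apply: mulr_ge0; first exact: ltW. apply: J_ge0; first exact/bdm_P/smooth_Lap.
  by move=> t; rewrite -P_rot; apply: H; rewrite y0 (lt_trans yx).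
have cm : continuous (fun r => Jint (P z b g r)).
  by move=> x; apply: differentiable_continuous; apply/derivable1_diffP; case: (dm x).
have [y] := MVT sr (f := fun r => Jint (P z b g r)) (df := M1) _ (continuous_subspaceT cm).
rewrite in_itv /= => /andP[sy yr] E; rewrite -subr_ge0 E mulr_ge0 // ?subr_ge0 ?(ltW sr) //.
have y0 : 0 < y by exact: le_lt_trans sy.
by rewrite -(pmulr_rge0 _ y0) -NE N0 // y0.
Qed.

Lemma polar_strict z b g r : smooth g -> 0 < r -> (forall s t, 0 < s < r -> Lap b g (z + rot t (s *: b)) < 0) ->
  Jint (P z b g r) < 2 * pi * g z.
Proof.
move=> sg r0 H; rewrite -(J_P0 z b).
have [N [M1 [dm NE cN dN]]] := polar z b sg.
have N00 : N 0 = 0 by rewrite NE mul0r.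
have N0 x : 0 < x < r -> N x < 0. move=> /andP[x0 xr].
  have [|y] := MVT x0 (f := N) (df := fun r => r * Jint (P z b (Lap b g) r)) _ (continuous_subspaceT cN).
    by move=> y; rewrite in_itv /= => /andP[y0 _]; exact: dN.
  rewrite in_itv /= => /andP[y0 yx]; rewrite N00 !subr0 => ->. rewrite pmulr_llt0 // pmulr_rlt0 //.
  have yr : 0 < y < r by rewrite y0 (lt_trans yx). have sL := smooth_Lap b sg; have bP := bdm_P z b y sL.
  have cPL : continuous (P z b (Lap b g) y) by exact: P_continuous.
  have [t0 [_ tmax]] : exists t0, circ t0 /\ forall t, circ t -> P z b (Lap b g) y t <= P z b (Lap b g) y t0.
    have [c cI cmax] := EVT_max (f := P z b (Lap b g) y) (ltW twopi_gt0) (continuous_subspaceT cPL).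
    by exists c; split=> // t tI; exact: cmax. set k := P z b (Lap b g) y t0 in tmax.
  have k0 : k < 0 by rewrite /k -P_rot; exact: H.
  apply: (@le_lt_trans _ _ (2 * pi * k)); last by rewrite pmulr_rlt0 ?twopi_gt0.
  rewrite -J_cst; apply: le_Rintegral; [exact: measurable_circ|exact: bdm_integrable| |exact: tmax].
  exact: (bdm_integrable (bdm_cst k)).
have cm : continuous (fun r => Jint (P z b g r)).
  by move=> x; apply: differentiable_continuous; apply/derivable1_diffP; case: (dm x).
have [y] := MVT r0 (f := fun r => Jint (P z b g r)) (df := M1) _ (continuous_subspaceT cm).
rewrite in_itv /= => /andP[y0 yr] E; rewrite -subr_lt0 E subr0 pmulr_llt0 //.
by rewrite -(pmulr_rlt0 _ y0) -NE N0 // y0.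
Qed.

Lemma cmean_P g z b r : cmean g z (r *: b) = (2 * pi)^-1 * Jint (P z b g r).
Proof. by congr (_ * _); apply: J_ext => t; rewrite P_rot. Qed.

Lemma smooth_cmean_mono g z b s r : smooth g -> 0 <= s <= r ->
  (forall s t, 0 < s < r -> 0 <= Lap b g (z + rot t (s *: b))) -> cmean g z (s *: b) <= cmean g z (r *: b).
Proof.
move=> sg sr H; rewrite !cmean_P; apply: ler_wpM2l; first by rewrite invr_ge0 ltW // twopi_gt0.
exact: polar_mono.
Qed.

Lemma cmean0 g z : cmean g z 0 = g z.
Proof.
by rewrite -(scale0r (0 : C)) cmean_P J_P0 mulKf // gt_eqF // twopi_gt0.
Qed.

Lemma norm_rot t b r : 0 <= r -> `|rot t (r *: b)| <= r * (`|b| + `|Jc b|).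
Proof.
move=> r0; rewrite (_ : rot t (r *: b) = (r * cos t) *: b + (r * sin t) *: Jc b); last first.
  by congr pair; apply/rowP => i; rewrite !mxE; ring.
have sc (x : R) (v : C) : `|x| <= 1 -> `|(r * x) *: v| <= r * `|v|.
  by move=> x1; rewrite normrZ ler_wpM2r // normrM ger0_norm // ler_piMr.
apply: le_trans (ler_normD _ _) _; rewrite mulrDr; apply: lerD; apply: sc; rewrite ler_norml.
  by rewrite cos_geN1 cos_le1.
by rewrite sin_geN1 sin_le1.
Qed.

(** A negative Laplacian at z would remain negative on a small disc, where [polar_strict] makes the
    circle means smaller than g z. *)
Lemma submean_Lap_ge0 g z b e : smooth g -> 0 < e ->
  (forall r, 0 < r < e -> g z <= cmean g z (r *: b)) -> 0 <= Lap b g z.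
Proof.
move=> sg e0 H; rewrite leNgt; apply/negP => L0.
have Ln : 0 < - Lap b g z by rewrite oppr_gt0.
have [d d0 dP] := continuous_ball (@Lap_continuous _ _ b g sg z) Ln.
(* The disc of radius s in the direction b stays within s k of its centre; the summand 1 keeps k
   positive when b = 0. *)
pose k := `|b| + `|Jc b| + 1.
have k0 : 0 < k by rewrite ltr_wpDl // addr_ge0.
pose r := Num.min (e / 2) (d / k).
have r0 : 0 < r by rewrite lt_min !divr_gt0.
have := @polar_strict z b g r sg r0 => /(_ _)/wrap[]. move=> s t /andP[s0 sr].
  have := dP (z + rot t (s *: b)) => /(_ _)/wrap[].
    rewrite -ball_normE /= opprD addNKr normrN; apply: le_lt_trans (norm_rot t b (ltW s0)) _.
    have : s < d / k by apply: lt_le_trans sr _; rewrite ge_min lexx orbT.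
    rewrite ltr_pdivlMr //; apply: le_lt_trans; rewrite ler_pM2l // lerDl. exact: ler01.
  rewrite ltr_norml => /andP[h _]; move: h; rewrite opprK; lra.
have re : 0 < r < e. by rewrite r0 /= (@le_lt_trans _ _ (e / 2)) ?ge_min ?lexx // ltr_pdivrMr // ltr_pMr // ltr1n.
have := H r re; rewrite cmean_P ler_pdivlMl ?twopi_gt0 // => /le_lt_trans h /h.
by rewrite ltxx.
Qed.

End polar.

(** * Smooth averages of bounded plurisubharmonic functions *)

Section convolution.
Context {R : realType} {n : nat}.
Notation mR := (measurableTypeR R).
Notation C := (Cn R n).
Notation bC := (borelCn R n).
Notation V := (lebesgueCn R n).
Implicit Types (f g h u phi : C -> R) (z w b v : C) (r s t c d : R).

Lemma tst_sup_bound phi : tst phi -> exists2 c, 0 <= c & forall z, `|phi z| <= c.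
Proof.
move=> tp; have [c H] := tst_bounded tp; exists `|c| => // z.
exact: le_trans (H z) (ler_norm _).
Qed.

Lemma tst_dd v phi : tst phi -> tst (dd v phi).
Proof. by move=> tp; rewrite -ddEf; exact: tst_derive. Qed.

Definition conv phi u z : R := I (fun y => phi (z - y) * u y).

Lemma measurable_opp_translate z : measurable_fun [set: bC] (fun y : bC => z - y : bC).
Proof.
apply: measurable_to_Cn => i. rewrite (_ : (fun _ => _) = (fun y : bC => z.1 0 i - y.1 0 i : mR)); last first.
    by apply/funext => y; rewrite !mxE. by apply: measurable_funB => //; exact: measurable_coord1.
rewrite (_ : (fun _ => _) = (fun y : bC => z.2 0 i - y.2 0 i : mR)); last first.
  by apply/funext => y; rewrite !mxE.
by apply: measurable_funB => //; exact: measurable_coord2.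
Qed.

Lemma nice_reflect phi z : nice phi -> nice (fun y => phi (z - y)).
Proof.
move=> [mp [c [r H]]]; split; first exact: (measurableT_comp mp (measurable_opp_translate z)).
exists c, (`|z| + r) => y; split; first by case: (H (z - y)).
move=> zy; apply: (H _).2; rewrite distrC.
by apply: lt_le_trans (lerB_dist _ _); rewrite ltrBrDl.
Qed.

Lemma nice_conv phi u z : nice phi -> bbm u -> nice (fun y => phi (z - y) * u y).
Proof. by move=> np [mu1 mu2]; apply: niceM => //; exact: nice_reflect. Qed.

Lemma conv_bound u c' (K : R) z : bbm u -> (forall w, `|u w| <= c') -> 0 <= K ->
  forall (F : C -> R), nice F -> (forall w, `|F w| <= K) -> forall r, (forall w, r < `|w| -> F w = 0) ->
  `|I (fun y => F (z - y) * u y)| <= K * c' * I (\1_[set w : C | `|w| <= `|z| + r]).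
Proof.
move=> bu uc K0 F nF FK r Fr.
have mB : measurable ([set w : C | `|w| <= `|z| + r] : set bC) by apply: closed_measurableCn; exact: closed_normle.
have ni : nice (\1_[set w : C | `|w| <= `|z| + r]). split; first exact: measurable_indic.
  exists 1, (`|z| + r) => w; split. by rewrite indicE; case: (_ \in _); rewrite ?normr1 ?normr0.
  by move=> rw; rewrite indicE memNset //= => /le_lt_trans/(_ rw); rewrite ltxx.
have c0 : 0 <= c' by apply: le_trans (uc 0).
have H y : `|F (z - y) * u y| <= K * c' * \1_[set w : C | `|w| <= `|z| + r] y.
  have [yr|yr] := leP `|y| (`|z| + r). by rewrite indicE mem_set // mulr1 normrM ler_pM.
  rewrite Fr ?mul0r ?normr0 ?mulr_ge0 // ?indicE //.
  by rewrite distrC; apply: lt_le_trans (lerB_dist _ _); rewrite ltrBrDl.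
have nFu := nice_conv z nF bu; have nK := niceZ (K * c') ni.
rewrite ler_norml -IZ // -mulN1r -IZ //; apply/andP; split. apply: le_I => //; first exact: niceZ.
  by move=> y; rewrite mulN1r lerNl; have := H y; rewrite ler_norml lerNl => /andP[].
by apply: le_I => // y; have := H y; rewrite ler_norml => /andP[].
Qed.

Lemma taylor2 phi z v : smooth phi ->
  exists s, [/\ 0 <= s, s <= 1 & `|phi (z + v) - phi z - dd v phi z| <= `|dd v (dd v phi) (z + s *: v)|].
Proof.
move=> sp.
have [s /andP[s0 s1]] := smooth_MVT z v sp ltr01; rewrite !mul1r scale1r ddE => E.
have [r /andP[r0 rs]] := smooth_MVT z v (smooth_dd v sp) s0; rewrite ddE => E2.
exists r; split; [exact: ltW|exact: ltW (lt_trans rs s1)|].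
by rewrite E E2 normrM ger0_norm ?(ltW s0) // ler_piMl // ltW.
Qed.

Lemma tst_family_bound (I : finType) (F : I -> C -> R) : (forall i, tst (F i)) ->
  exists2 K, 0 <= K & forall i z, `|F i z| <= K.
Proof.
move=> tF; have H i : exists K, 0 <= K /\ forall z, `|F i z| <= K.
  by have [K K0 KP] := tst_sup_bound (tF i); exists K.
have [K KP] := choice H; have K0 i := (KP i).1.
exists (\sum_i K i); first exact: sumr_ge0.
by move=> i z; rewrite (bigD1 i) //= ler_wpDr ?(KP i).2 // sumr_ge0.
Qed.

Lemma dd2_bound phi : tst phi -> exists2 K, 0 <= K & forall v z, `|dd v (dd v phi) z| <= K * `|v| ^+ 2.
Proof.
move=> tp; have sp := tst_smooth tp.
pose bv (p : bool * 'I_n) := if p.1 then dx R p.2 else dy R p.2.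
have [K K0 KP] := tst_family_bound (fun p : (bool * 'I_n) * (bool * 'I_n) => tst_dd (bv p.1) (tst_dd (bv p.2) tp)).
exists (\sum_(a < n) \sum_(c < n) 4 * K); first by do 2 apply: sumr_ge0 => ? _; rewrite mulr_ge0.
move=> v z; rewrite dd2_basis // mulr_suml; apply: le_trans (ler_norm_sum _ _ _) _.
apply: ler_sum => a _; rewrite mulr_suml; apply: le_trans (ler_norm_sum _ _ _) _.
apply: ler_sum => c _; have [v1 v2] := norm_coord v.
have B x y (e : R) : `|x| <= `|v| -> `|y| <= `|v| -> `|e| <= K -> `|x * y * e| <= K * `|v| ^+ 2.
  by move=> xv yv ek; rewrite !normrM mulrC expr2 ler_pM ?mulr_ge0 // ler_pM.
have /= k1 := KP ((true, a), (true, c)) z; have /= k2 := KP ((true, a), (false, c)) z.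
have /= k3 := KP ((false, a), (true, c)) z; have /= k4 := KP ((false, a), (false, c)) z.
apply: le_trans (ler_normD _ _) _.
rewrite (_ : 4 * K * `|v| ^+ 2 = K * `|v| ^+ 2 + K * `|v| ^+ 2 + K * `|v| ^+ 2 + K * `|v| ^+ 2); last by ring.
apply: lerD; last exact: B.
apply: le_trans (ler_normD _ _) _; apply: lerD; last exact: B.
by apply: le_trans (ler_normD _ _) _; apply: lerD; exact: B.
Qed.

Lemma differentiable_quadratic f z (L : {linear C -> R}) (K : R) : continuous L ->
  (forall v, `|v| <= 1 -> `|f (z + v) - f z - L v| <= K * `|v| ^+ 2) ->
  differentiable f z /\ 'd f z = L :> (C -> R).
Proof.
move=> cL H.
have E : f \o shift z = cst (f z) + L +o_ (0 : C) id. apply/eqaddoP => e e0.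
  have k0 : 0 < `|K| + 1 by rewrite ltr_wpDl.
  have m0 : 0 < Num.min 1 (e / (`|K| + 1)) by rewrite lt_min ltr01 divr_gt0.
  apply: filterS (nbhs0_le (V := C) m0) => v; rewrite le_min => /andP[v1 v2].
  rewrite -[(f \o shift z - (cst (f z) + L)) v]/(f (v + z) - (f z + L v)) opprD addrA addrC.
  rewrite addrC [v + z]addrC; apply: le_trans (H v v1) _.
  rewrite expr2 mulrA ler_wpM2r // -[leRHS](divfK (lt0r_neq0 k0)) [leRHS]mulrC.
  have e0' : 0 <= e / (`|K| + 1) by rewrite ltW // divr_gt0.
  apply: (@le_trans _ _ ((`|K| + 1) * (e / (`|K| + 1)))); last by [].
  apply: le_trans (_ : `|K| * `|v| <= _); first by rewrite ler_wpM2r // ler_norm.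
  by apply: ler_pM => //; rewrite lerDl.
have dE : 'd f z = L :> (C -> R) by exact: diff_unique.
by split=> //; apply/diff_locallyP; rewrite dE; split.
Qed.

Lemma dd_supp v phi r w : (forall z, r < `|z| -> phi z = 0) -> r < `|w| -> dd v phi w = 0.
Proof.
move=> H rw; rewrite (@dd_near _ _ phi (fun=> 0) [set y : C | r < `|y|] v w) ?dd_cst //. exact: open_normgt.
by move=> y; rewrite inE /= => /H.
Qed.

(** The Taylor remainder of phi is at most K |h|^2 everywhere and has its support in a fixed ball
    for |h| <= 1; integrated against the bounded u, it is a quadratic remainder for the
    convolution. *)
Lemma conv_smooth_step phi u : tst phi -> bbm u ->
  (forall z, differentiable (conv phi u) z) /\ forall v, 'D_v (conv phi u) = conv (dd v phi) u.
Proof.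
move=> tp bu; have sp := tst_smooth tp; have [_ [cu uc]] := bu.
have nc (p : C -> R) z : tst p -> nice (fun y => p (z - y) * u y).
  by move=> tp'; apply: nice_conv => //; exact: tst_nice.
have tdd v := tst_dd v tp.
pose L z (h : C) := \sum_a (h.1 0 a * conv (dd (dx R a) phi) u z + h.2 0 a * conv (dd (dy R a) phi) u z).
have LE z (h : C) : L z h = conv (dd h phi) u z.
  rewrite /L /conv; transitivity (\sum_a (I (fun y => h.1 0 a * (dd (dx R a) phi (z - y) * u y)
     + h.2 0 a * (dd (dy R a) phi (z - y) * u y)))).
    apply: eq_bigr => a _; have n1 := nc _ z (tdd (dx R a)); have n2 := nc _ z (tdd (dy R a)).
    by rewrite ID ?IZ //; exact: niceZ. rewrite -I_sum; last first.
    by move=> a _; apply: niceD; apply: niceZ; apply: nc.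
  apply: I_ext => y; rewrite dd_basis // mulr_suml; apply: eq_bigr => a _; by rewrite mulrDl !mulrA.
have lL z : linear (L z). move=> k x y; rewrite /L scaler_sumr -big_split; apply: eq_bigr => a _.
  by rewrite !mxE /GRing.scale /=; ring.
pose LL z : {linear C -> R} := HB.pack (L z) (GRing.isLinear.Build _ _ _ _ (L z) (lL z)).
have cL z : continuous (LL z). have sL : smooth (L z).
    apply: smooth_sum => a _; apply: smoothD; under eq_fun do rewrite mulrC; apply: smoothZ. exact: coordx_smooth.
    exact: coordy_smooth. exact: smooth_cont sL.
have [K K0 KP] := dd2_bound tp.
have [r rP] := tp.2.
have bound z : exists K', forall h : C, `|h| <= 1 ->
    `|conv phi u (z + h) - conv phi u z - LL z h| <= K' * `|h| ^+ 2.
  exists (K * cu * I (\1_[set w : C | `|w| <= `|z| + (r + 1)])) => h h1.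
  pose F w := phi (w + h) - phi w - dd h phi w.
  have tF : tst F by apply: tstB => //; apply: tstB => //; exact: tst_translate.
  have -> : conv phi u (z + h) - conv phi u z - LL z h = I (fun y => F (z - y) * u y).
    rewrite [LL z h]LE /conv -IB; [|exact: nc..]. rewrite -IB; [|by apply: niceB; exact: nc|exact: nc].
    by apply: I_ext => y; rewrite /F [z + h - y]addrAC !mulrBl. rewrite mulrAC.
  rewrite (_ : K * cu * `|h| ^+ 2 = K * `|h| ^+ 2 * cu); last by ring.
  apply: (@conv_bound u cu (K * `|h| ^+ 2) z bu uc _ F _ _ (r + 1)).
  - by rewrite mulr_ge0 // exprn_ge0.
  - exact: tst_nice.
  - by move=> w; have [s [_ _ /le_trans]] := taylor2 w h sp; apply.
  - move=> w rw; have rw' : r < `|w| by apply: lt_trans rw; rewrite ltrDl.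
    rewrite /F (dd_supp h rP rw') !rP ?subrr //.
    have := ler_normB (w + h) h; rewrite addrK => /(lt_le_trans rw) hh.
    by rewrite -(ltrD2r 1); apply: lt_le_trans hh _; rewrite lerD2l.
have D z : differentiable (conv phi u) z /\ 'd (conv phi u) z = LL z :> (C -> R).
  by have [K' H] := bound z; exact: (differentiable_quadratic (cL z) H).
split=> [z|v]; first by case: (D z).
by apply/funext => z; have [d1 d2] := D z; rewrite deriveE // d2 -LE.
Qed.

Lemma smooth_conv phi u : tst phi -> bbm u -> smooth (conv phi u).
Proof.
move=> tp bu; apply: (@smooth_coind _ _ (fun f => exists2 p, tst p & f = conv p u)); last by exists phi.
move=> _ [p tp' ->]; have [h1 h2] := conv_smooth_step tp' bu.
by split=> // v; exists (dd v p); [exact: tst_dd|].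
Qed.

Lemma ltup_cube_gt0 (d : nat) : (0 < @ltup R d (cube 1))%E.
Proof.
elim: d => [|d IH]; first by rewrite /ltup /= diracE mem_set ?lte01 // => -[].
rewrite /ltup /= /image_measure /= /pushforward.
have -> : @cons_pair R d @^-1` cube 1 = `[(- 1%:R)%R, 1%:R%R]%classic `*` @cube R d 1.
  apply/seteqP; split=> [[x t] /= h|[x t] /= [h1 h2] i]. split=> [|i]; first by have := h ord0; rewrite tnth0.
    by have := h (lift ord0 i); rewrite tnthS.
  by case: (unliftP ord0 i) => [j|] ->; rewrite ?tnth0 // tnthS; exact: h2.
rewrite product_measure2E; [|exact: measurable_itv|exact: measurable_cube].
rewrite mule_gt0 //.
change (0 < lebesgue_measure ([set` `[(- 1%:R)%R, 1%:R%R]] : set R))%E.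
have h : (- 1 < 1 :> R)%R by lra.
by rewrite lebesgue_measure_itv /= lte_fin h -EFinD lte_fin; lra.
Qed.

Lemma volume_unit_gt0 : (0 < V [set z : C | (`|z| <= 1)%R])%E.
Proof.
apply: lt_le_trans (ltup_cube_gt0 (n + n)) _.
rewrite /lebesgueCn /image_measure /= /pushforward; apply: le_measure; rewrite ?inE.
- exact: measurable_cube.
- rewrite -[X in measurable X]setTI; apply: measurable_Cn_of_tuple => //.
  apply: closed_measurableCn; exact: closed_normle.
- move=> t /= H; apply: normle_coord => // a; rewrite mxE.
    by have := H (lshift n a); rewrite in_itv /= -ler_norml.
  by have := H (rshift n a); rewrite in_itv /= -ler_norml.
Qed.

Definition ind_unit : C -> R := \1_[set z : C | `|z| <= 1].

Lemma nice_ind_unit : nice ind_unit.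
Proof.
have mB : measurable ([set w : C | `|w| <= 1] : set bC) by apply: closed_measurableCn; exact: closed_normle.
split; first exact: measurable_indic.
exists 1, 1 => w; split; first by rewrite /ind_unit indicE; case: (_ \in _); rewrite ?normr1 ?normr0.
by move=> rw; rewrite /ind_unit indicE memNset //= => /le_lt_trans/(_ rw); rewrite ltxx.
Qed.

Lemma I_ind_unit_gt0 : 0 < I ind_unit.
Proof.
have mB : measurable ([set w : C | `|w| <= 1] : set bC) by apply: closed_measurableCn; exact: closed_normle.
rewrite /I /Rintegral /ind_unit integral_indic // setIT fine_gt0 //.
by rewrite volume_unit_gt0 volume_normle_lty.
Qed.

(** The kernel depends on [eucl] alone, hence is rotation invariant; it is carried by [eucl w] <=
    1/4, so that averages at scale d stay within distance d / 2. *)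
Definition rho0 w : R := flat (4^-1 - eucl w).

Lemma smooth_flat_eucl (k e : R) : smooth (fun w : C => flat (k - e * eucl w)).
Proof.
apply: smooth_comp; first exact: smooth1_flat.
by apply: smoothB; [exact: smooth_cst|apply: smoothZ; exact: smooth_eucl].
Qed.

Lemma tst_flat_eucl (k e : R) : 0 < e -> tst (fun w : C => flat (k - e * eucl w)).
Proof.
move=> e0; split; first exact: smooth_flat_eucl.
exists (Num.max 1 (k / e)) => w; rewrite gt_max => /andP[w1 wk].
rewrite flat0 // subr_le0 mulrC -ler_pdivrMr //.
apply: le_trans (ltW wk) _; apply: le_trans (eucl_norm w); rewrite expr2 ler_peMl //.
exact: ltW.
Qed.

Lemma tst_rho0 : tst rho0.
Proof.
have := tst_flat_eucl 4^-1 ltr01; congr tst; apply/funext => w.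
by rewrite mul1r.
Qed.

Lemma I_rho0_gt0 : 0 < I rho0.
Proof.
have r0 : 0 < rho0 0 by rewrite /rho0 eucl0 subr0 flat_gt0.
have r02 : 0 < rho0 0 / 2 by rewrite divr_gt0.
have [d d0 dP] := continuous_ball (smooth_cont (tst_smooth tst_rho0) (x := 0)) r02.
pose s := d / 2.
have s0 : 0 < s by rewrite divr_gt0.
have si : 0 < s^-1 by rewrite invr_gt0.
have nu := nice_ind_unit.
have ns : nice (fun w => ind_unit (s^-1 *: w + 0)).
  have [mi _] := nu; split; first exact: (measurableT_comp mi (measurable_affine_Cn _ _)).
  exists 1, s => w; split; first by rewrite /ind_unit indicE; case: (_ \in _); rewrite ?normr1 ?normr0.
  move=> sw; rewrite /ind_unit indicE memNset //= addr0 normrZ gtr0_norm // mulrC ler_pdivrMr // mul1r.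
  by move=> /le_lt_trans/(_ sw); rewrite ltxx.
apply: (@lt_le_trans _ _ (rho0 0 / 2 * (s^-1^-1 ^+ (n + n) * I ind_unit))).
  by rewrite !mulr_gt0 ?exprn_gt0 ?invr_gt0 // I_ind_unit_gt0.
rewrite -(I_affine 0 si nu) -IZ //; apply: le_I; [exact: niceZ|exact/tst_nice/tst_rho0|].
move=> w; rewrite /ind_unit indicE; case: (boolP (_ \in _)); last by rewrite mulr0 flat_ge0.
rewrite inE /= addr0 normrZ gtr0_norm // mulrC ler_pdivrMr // mul1r mulr1 => ws.
have := dP w => /(_ _)/wrap[]. rewrite -ball_normE /= sub0r normrN; apply: le_lt_trans ws _.
  by rewrite /s ltr_pdivrMr // ltr_pMr // ltr1n.
by rewrite ltr_norml => /andP[_]; lra.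
Qed.

Definition rho w : R := rho0 w / I rho0.

Lemma tst_rho : tst rho.
Proof.
have := tstZ (I rho0)^-1 tst_rho0; congr tst; apply/funext => w.
by rewrite mulrC.
Qed.

Lemma nice_rho : nice rho.
Proof. exact: tst_nice tst_rho. Qed.

Lemma rho_ge0 w : 0 <= rho w.
Proof. by rewrite divr_ge0 ?flat_ge0 // ltW // I_rho0_gt0. Qed.

Lemma I_rho : I rho = 1.
Proof.
rewrite (_ : rho = fun w => (I rho0)^-1 * rho0 w); last by apply/funext => w; rewrite mulrC.
by rewrite IZ ?mulVf ?gt_eqF ?I_rho0_gt0 //; exact/tst_nice/tst_rho0.
Qed.

Lemma rho_eucl w w' : eucl w = eucl w' -> rho w = rho w'.
Proof. by rewrite /rho /rho0 => ->. Qed.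

Lemma rho_rot t w : rho (rot t w) = rho w.
Proof. by apply: rho_eucl; rewrite eucl_cscale cos2sin2 mul1r. Qed.

Lemma rho_supp w : rho w = 0 \/ eucl w <= 4^-1.
Proof.
have [h|h] := leP (eucl w) 4^-1; [by right|left].
by rewrite /rho /rho0 flat0 ?mul0r // subr_le0 ltW.
Qed.

Lemma rho_le_mul w r s : (eucl w <= 4^-1 -> r <= s) -> r * rho w <= s * rho w.
Proof.
move=> H; have [->|ew] := rho_supp w; first by rewrite !mulr0.
by rewrite ler_wpM2r ?rho_ge0 // H.
Qed.

Lemma eucl_quarter p q w : eucl w <= 4^-1 -> p ^+ 2 + q ^+ 2 <= 1 -> `|cscale p q w| <= 2^-1.
Proof.
move=> ew pq; have := le_trans (norm_cscale w pq) ew.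
rewrite (_ : 4^-1 = 2^-1 ^+ 2 :> R); last by rewrite expr2; field.
by rewrite ler_sqr ?nnegrE // invr_ge0.
Qed.

Lemma cscale10 w : cscale 1 0 w = w.
Proof. by case: w => x y; congr pair; apply/rowP => i; rewrite !mxE /=; ring. Qed.

Lemma norm_quarter w : eucl w <= 4^-1 -> `|w| <= 2^-1.
Proof. by move=> ew; rewrite -(cscale10 w); apply: eucl_quarter => //; rewrite expr1n expr0n addr0. Qed.

(** This is a convolution with a rescaled kernel ([A_conv]); the present form displays the points at
    which g is evaluated, as comparisons of values need. *)
Definition A d g z : R := I (fun w => g (z + d *: w) * rho w).

Lemma bbm_affine d g z : bbm g -> bbm (fun w => g (z + d *: w)).
Proof.
move=> [mg [c H]]; split; last by exists c.
have := measurableT_comp mg (measurable_affine_Cn d z); congr measurable_fun.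
by apply/funext => w /=; rewrite addrC.
Qed.

Lemma nice_A d g z : bbm g -> nice (fun w => g (z + d *: w) * rho w).
Proof.
move=> bg; under [X in nice X]eq_fun do rewrite mulrC.
by have [m1 m2] := bbm_affine d z bg; apply: niceM nice_rho m1 m2.
Qed.

Lemma A_near_le d g z c : 0 <= d -> bbm g -> (forall y, `|y - z| <= d -> g y <= c) -> A d g z <= c.
Proof.
move=> d0 bg H; rewrite -[leRHS]mulr1 -I_rho -IZ; last exact: nice_rho.
apply: le_I; [exact: nice_A|exact: niceZ nice_rho|] => w.
have [->|ew] := rho_supp w; first by rewrite !mulr0.
rewrite ler_wpM2r ?rho_ge0 // H // addrC addKr normrZ ger0_norm // ler_piMr //.
by apply: le_trans (norm_quarter ew) _; rewrite invf_le1 // ler1n.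
Qed.

Lemma A_opp d g z : bbm g -> A d (fun z => - g z) z = - A d g z.
Proof.
move=> bg; rewrite /A -mulN1r -IZ; last exact: nice_A.
by apply: I_ext => w; rewrite mulN1r mulNr.
Qed.

Lemma bbmN g : bbm g -> bbm (fun z => - g z).
Proof.
move=> [mg [c H]]; split; last by exists c => z; rewrite normrN.
exact: measurableT_comp.
Qed.

Lemma A_near_ge d g z c : 0 <= d -> bbm g -> (forall y, `|y - z| <= d -> c <= g y) -> c <= A d g z.
Proof.
move=> d0 bg H; rewrite -lerN2 -A_opp //; apply: A_near_le => //; first exact: bbmN.
by move=> y yz; rewrite lerN2 H.
Qed.

Lemma A_bound d g c : 0 <= d -> bbm g -> (forall z, `|g z| <= c) -> forall z, `|A d g z| <= c.
Proof.
move=> d0 bg H z; rewrite ler_norml; apply/andP; split.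
  by apply: A_near_ge => // y _; have := H y; rewrite ler_norml => /andP[].
by apply: A_near_le => // y _; have := H y; rewrite ler_norml => /andP[].
Qed.

Lemma A_conv d g : 0 < d -> bbm g -> A d g =
  conv (fun x => d^-1 ^+ (n + n) * (I rho0)^-1 * flat (4^-1 - d^-1 ^+ 2 * eucl x)) g.
Proof.
move=> d0 bg; apply/funext => z.
pose k := d^-1 ^+ (n + n); pose psi (x : C) := flat (4^-1 - d^-1 ^+ 2 * eucl x).
have tp : tst psi by apply: tst_flat_eucl; rewrite exprn_gt0 // invr_gt0.
pose F (y : C) := (I rho0)^-1 * (psi (z - y) * g y).
have nF : nice F by apply: niceZ; apply: nice_conv => //; exact: tst_nice.
transitivity (I (fun w => F (d *: w + z))).
  apply: I_ext => w; rewrite /F /psi [z - _](_ : _ = (- d) *: w); last first.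
    by rewrite opprD addrCA subrr addr0 scaleNr.
  rewrite euclZ sqrrN [d^-1 ^+ 2 * (_ * _)]mulrA -exprMn mulVf ?gt_eqF // expr1n mul1r [d *: w + z]addrC.
  by rewrite /rho /rho0; move: (g _) (flat _) ((I _)^-1) => p q r; ring.
rewrite I_affine // /conv -IZ //; apply: I_ext => y; rewrite /F /psi.
by rewrite !mulrA.
Qed.

Lemma smooth_A d g : 0 < d -> bbm g -> smooth (A d g).
Proof.
move=> d0 bg; rewrite A_conv //; apply: smooth_conv => //.
apply: tstZ; apply: tst_flat_eucl; by rewrite exprn_gt0 // invr_gt0.
Qed.

Lemma smooth_bbm g c : smooth g -> (forall z, `|g z| <= c) -> bbm g.
Proof. by move=> sg H; split; [exact: smooth_measurable|exists c]. Qed.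

Lemma bbm_A d g : 0 < d -> bbm g -> bbm (A d g).
Proof.
move=> d0 bg; have [_ [c H]] := bg; apply: (@smooth_bbm _ c); first exact: smooth_A.
by apply: A_bound => //; exact: ltW.
Qed.

Variable Om : set C.

Definition room r z := forall w, `|w - z| <= r -> Om w.

Lemma room_le r s z : s <= r -> room r z -> room s z.
Proof. by move=> sr H w ws; apply: H; exact: le_trans ws sr. Qed.

Lemma room_near r s z w : `|w - z| <= s -> room (r + s) z -> room r w.
Proof.
move=> ws H y yw; apply: H; rewrite -(subrK w y) -addrA; apply: le_trans (ler_normD _ _) _.
exact: lerD.
Qed.

Lemma room_center r z : 0 <= r -> room r z -> Om z.
Proof. by move=> r0; apply; rewrite subrr normr0. Qed.

(* A bounded plurisubharmonic function on [Om], arbitrarily extended. *)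
Definition subm g := [/\ bbm g,
  forall z, Om z -> forall c, g z < c -> exists2 d, 0 < d & forall w, `|w - z| <= d -> g w < c
  & forall z b, (forall p q, p ^+ 2 + q ^+ 2 <= 1 -> Om (z + cscale p q b)) -> g z <= cmean g z b].

Lemma cscaleZ p q r w : cscale p q (r *: w) = r *: cscale p q w.
Proof. by congr pair; apply/rowP => i; rewrite !mxE; ring. Qed.

Lemma room_disc d z w p q r : room d z -> 0 <= r <= d -> eucl w <= 4^-1 ->
  p ^+ 2 + q ^+ 2 <= 1 -> Om (z + cscale p q (r *: w)).
Proof.
move=> H /andP[r0 rd] ew pq; apply: H; rewrite addrC addKr cscaleZ normrZ ger0_norm //.
apply: le_trans rd; rewrite ler_piMr // (le_trans (eucl_quarter ew pq)) // invf_le1 // ?ler1n // ltr0n.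
Qed.

Lemma A_cmean d g z : bbm g -> A d g z = I (fun w => cmean g z (d *: w) * rho w) /\
  nice (fun w => cmean g z (d *: w) * rho w).
Proof. by move=> bg; have [h1 ->] := I_cmean z d bg nice_rho rho_rot; split. Qed.

(** By rotation invariance of rho the average is an average of circle means, each of which is at
    least g z. *)
Lemma le_A d g z : subm g -> 0 <= d -> room d z -> g z <= A d g z.
Proof.
move=> [bg _ sg] d0 rz; have [-> nc] := A_cmean d z bg.
rewrite -[leLHS]mulr1 -I_rho -IZ; last exact: nice_rho.
apply: le_I => //; first exact: niceZ nice_rho.
move=> w; have [->|ew] := rho_supp w; first by rewrite !mulr0.
rewrite ler_wpM2r ?rho_ge0 // sg // => p q pq.
by apply: room_disc rz _ ew pq; rewrite d0 lexx.
Qed.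

Lemma A_usc g z c : subm g -> Om z -> g z < c -> exists2 e, 0 < e & forall d, 0 <= d <= e -> A d g z <= c.
Proof.
move=> [bg ug _] Oz /(ug _ Oz)[e e0 eP]; exists e => // d /andP[d0 de].
by apply: A_near_le => // y yz; apply/ltW/eP; exact: le_trans yz de.
Qed.

Lemma A_submean d g z b : 0 < d -> subm g -> (forall p q, p ^+ 2 + q ^+ 2 <= 1 -> room d (z + cscale p q b)) ->
  A d g z <= cmean (A d g) z b.
Proof.
move=> d0 [bg _ sg] H; have [-> nc] := cmean_I z b d bg nice_rho.
apply: le_I => //; first exact: nice_A.
move=> w; have [->|ew] := rho_supp w; first by rewrite !mulr0.
rewrite ler_wpM2r ?rho_ge0 //.
have -> : cmean (fun y => g (y + d *: w)) z b = cmean g (z + d *: w) b.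
  by congr (_ * _); apply: J_ext => t; rewrite addrAC.
apply: sg => p q pq; rewrite addrAC; apply: (H p q pq).
rewrite [_ + d *: w]addrC addrK normrZ gtr0_norm // ler_piMr ?(ltW d0) //.
by apply: le_trans (norm_quarter ew) _; rewrite invf_le1 // ler1n.
Qed.

Lemma norm_cscale_le p q b : p ^+ 2 + q ^+ 2 <= 1 -> `|cscale p q b| <= `|b| + `|Jc b|.
Proof.
move=> pq; rewrite (_ : cscale p q b = p *: b + q *: Jc b); last first.
  by congr pair; apply/rowP => i; rewrite !mxE; ring.
have p1 : `|p| <= 1 by rewrite -(expr_le1 (n := 2)) // real_normK ?num_real //; apply: le_trans pq; rewrite lerDl sqr_ge0.
have q1 : `|q| <= 1 by rewrite -(expr_le1 (n := 2)) // real_normK ?num_real //; apply: le_trans pq; rewrite lerDr sqr_ge0.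
by apply: le_trans (ler_normD _ _) _; rewrite !normrZ; apply: lerD; rewrite ler_piMl.
Qed.

(** The average inherits the sub-mean inequality on discs whose points have room d; the margin d' -
    d allows all small discs around z. *)
Lemma Lap_A_ge0 d d' g z b : 0 < d < d' -> subm g -> room d' z -> 0 <= Lap b (A d g) z.
Proof.
move=> /andP[d0 dd'] sg rz; have [bg _ _] := sg.
pose k := `|b| + `|Jc b| + 1.
have k0 : 0 < k by rewrite ltr_wpDl // addr_ge0.
apply: (@submean_Lap_ge0 _ _ (A d g) z b ((d' - d) / k)); first exact: smooth_A. by rewrite divr_gt0 // subr_gt0.
move=> r /andP[r0 re]; apply: A_submean => // p q pq.
apply: (@room_near d (d' - d) z); last by rewrite addrC subrK.
rewrite addrC addKr cscaleZ normrZ gtr0_norm //.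
have rk : r * k <= d' - d by rewrite -ler_pdivlMr // ltW.
apply: le_trans rk; rewrite ler_pM2l //; apply: le_trans (norm_cscale_le b pq) _.
by rewrite lerDl.
Qed.

Lemma A_cvg g z (e : R) : 0 < e -> subm g -> room e z -> A (e / k.+2%:R) g z @[k --> \oo] --> g z.
Proof.
move=> e0 sg rz; have Oz := room_center (ltW e0) rz.
apply/cvgrPdist_le => c c0.
have gc : g z < g z + c by rewrite ltrDl.
have [d d0 dP] := A_usc sg Oz gc.
have := near_infty_natSinv_lt (PosNum (divr_gt0 d0 e0)) => /=.
apply: filterS => k; rewrite ltr_pdivlMr // mulrC => hk.
have k20 : 0 < e / k.+2%:R :> R by rewrite divr_gt0.
have kd : e / k.+2%:R <= d. apply: le_trans (ltW hk); rewrite ler_pM2l // lef_pV2 ?posrE // ler_nat.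
  exact: leqnSn.
have ke : e / k.+2%:R <= e by rewrite ler_pdivrMr // ler_peMr ?(ltW e0) // ler1n.
have h1 : A (e / k.+2%:R) g z <= g z + c by apply: dP; rewrite (ltW k20).
have h2 : g z <= A (e / k.+2%:R) g z by apply: le_A => //; [exact: ltW|exact: room_le rz].
by rewrite distrC ger0_norm ?subr_ge0 // lerBlDl.
Qed.

(** Circle means increase with the radius, which is available for smooth functions. So g is first
    averaged at the scales [ek k], which tend to 0, and the inequality passes to the limit; half of
    the margin d'' - d' is spent on these scales. *)
Lemma A_mono d d' d'' g z : 0 < d <= d' -> d' < d'' -> subm g -> room d'' z -> A d g z <= A d' g z.
Proof.
move=> /andP[d0 dd'] d'd'' sg rz; have [bg _ _] := sg; have [_ [c gc]] := bg.
have d'0 : 0 < d' by exact: lt_le_trans dd'.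
have [-> n1] := A_cmean d z bg; have [-> n2] := A_cmean d' z bg.
apply: (le_I n1 n2) => w; apply: rho_le_mul => ew.
pose e := (d'' - d') / 2.
have e0 : 0 < e by rewrite divr_gt0 // subr_gt0.
pose ek (k : nat) : R := e / k.+2%:R.
have ek0 k : 0 < ek k by rewrite divr_gt0.
have eke k : ek k < e by rewrite ltr_pdivrMr // ltr_pMr // ltr1n.
have pt r t : 0 <= r <= d' -> room e (z + rot t (r *: w)). move=> /andP[r0 rd]; apply: (@room_near e d' z).
    rewrite addrC addKr /rot cscaleZ normrZ ger0_norm //; apply: le_trans rd; rewrite ler_piMr //.
    apply: le_trans (eucl_quarter ew _) _; first by rewrite cos2sin2. by rewrite invf_le1 // ler1n.
  apply: room_le rz; rewrite /e; lra.
have cv r : 0 <= r <= d' -> cmean (A (ek k) g) z (r *: w) @[k --> \oo] --> cmean g z (r *: w).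
  move=> rd; have [|||_] := @J_cvg R (fun k t => A (ek k) g (z + rot t (r *: w)))
    (fun t => g (z + rot t (r *: w))) c.
  - by move=> k; have [] := bdm_circle z (r *: w) (bbm_A (ek0 k) bg).
  - by move=> k t; apply: A_bound => //; exact: ltW.
  - by move=> t; apply: A_cvg => //; exact: pt. by move=> H; apply: cvgMr.
have cv1 := cv d; have cv2 := cv d'.
apply: (ler_cvg_to (cv1 _) (cv2 _)); rewrite ?(ltW d0) ?(ltW d'0) ?dd' ?lexx //.
apply: nearW => k.
have dE : d *: w = (d / d') *: (d' *: w) by rewrite scalerA divfK // gt_eqF.
rewrite dE -[in leRHS](scale1r (d' *: w)); apply: smooth_cmean_mono.
- exact: smooth_A.
- by rewrite divr_ge0 ?(ltW d0) ?(ltW d'0) // ler_pdivrMr // mul1r.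
move=> s t /andP[s0 s1]; apply: (@Lap_A_ge0 _ e) => //; first by rewrite ek0 eke.
rewrite scalerA; apply: pt; rewrite mulr_ge0 ?(ltW s0) ?(ltW d'0) //=.
by rewrite ler_piMl ?(ltW s1) ?(ltW d'0).
Qed.

End convolution.

(** For n smooth functions this is, up to a constant, the density of their mixed Monge-Ampere
    measure. *)
HB.lock Definition mm {R : realType} {n : nat} (hs : seq (Cn R n -> R)) (z : Cn R n) : R :=
  cre (hmix hs finset.setT finset.setT z).

(** * Mixed Monge-Ampere densities of smooth functions *)

Section mixed_hessians.
Context {R : realType} {n : nat}.
Notation C := (Cn R n).
Implicit Types (f g h phi : C -> R) (z b : C) (hs : seq (C -> R)).

Lemma smooths_consI f hs : smooth f -> smooths hs -> smooths (f :: hs).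
Proof. by move=> sf sh [|i] /=; [exact: sf|exact: sh]. Qed.

Lemma smooths_nil : smooths ([::] : seq (C -> R)).
Proof. by move=> i; rewrite nth_nil; exact: smooth_cst. Qed.

Lemma smooths_cat hs hs' : smooths hs -> smooths hs' -> smooths (hs ++ hs').
Proof.
by elim: hs => //= h hs IH /smooths_cons[sh shs] shs'; apply: smooths_consI => //; exact: IH.
Qed.

Lemma smooths_map (T : Type) (a : T -> C -> R) s : (forall j, smooth (a j)) -> smooths (map a s).
Proof.
by move=> sa; elim: s => [|j s IH] /=; [exact: smooths_nil|exact: smooths_consI].
Qed.

Lemma smooths_nseq k f : smooth f -> smooths (nseq k f).
Proof. by move=> sf; elim: k => [|k IH] /=; [exact: smooths_nil|exact: smooths_consI]. Qed.

Definition lpsd hs z := forall i b, 0 <= Lap b (nth (fun=> 0) hs i) z.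

Lemma lpsd_cons f hs z : (forall b, 0 <= Lap b f z) -> lpsd hs z -> lpsd (f :: hs) z.
Proof. by move=> sf sh [|i] /=; [exact: sf|exact: sh]. Qed.

Lemma lpsd_nil z : lpsd [::] z.
Proof. by move=> i b; rewrite nth_nil Lap_cst. Qed.

Lemma lpsd_cat hs hs' z : lpsd hs z -> lpsd hs' z -> lpsd (hs ++ hs') z.
Proof.
elim: hs => //= h hs IH H H'; apply: lpsd_cons; first exact: (H 0%N).
by apply: IH => // i; exact: (H i.+1).
Qed.

Lemma lpsd_map (T : Type) (a : T -> C -> R) s z : (forall j b, 0 <= Lap b (a j) z) -> lpsd (map a s) z.
Proof. by move=> sa; elim: s => [|j s IH] /=; [exact: lpsd_nil|exact: lpsd_cons]. Qed.

Lemma lpsd_nseq k f z : (forall b, 0 <= Lap b f z) -> lpsd (nseq k f) z.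
Proof. by move=> sf; elim: k => [|k IH] /=; [exact: lpsd_nil|exact: lpsd_cons]. Qed.

Lemma mm_def hs z : mm hs z = cre (hmix hs finset.setT finset.setT z).
Proof. by rewrite mm.unlock. Qed.

Lemma smooth_mm hs : smooths hs -> smooth (mm hs).
Proof.
move=> sh; have [h _] := csm_hmix finset.setT finset.setT sh.
by rewrite (_ : mm hs = fun z => cre (hmix hs finset.setT finset.setT z)) //; apply/funext => z; exact: mm_def.
Qed.

Lemma mm_sym phi u hs : tst phi -> smooth u -> smooths hs ->
  I (fun z => phi z * mm (u :: hs) z) = I (fun z => u z * mm (phi :: hs) z).
Proof.
move=> tp su sh; have := congr1 cre (cI_hmix_sym finset.setT finset.setT tp su sh).
rewrite /cI /= => E; transitivity (I (fun z => cre ((phi z)%:C%C * hmix (u :: hs) finset.setT finset.setT z))).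
  by apply: I_ext => z; rewrite mm_def ReM /= mul0r subr0.
rewrite [LHS]E; apply: I_ext => z; by rewrite mm_def ReM /= mul0r subr0.
Qed.

Lemma HessD f g z : smooth f -> smooth g -> Hess (fun z => f z + g z) z = Hess f z + Hess g z.
Proof.
move=> sf sg; apply: quad_ext.
- by apply: herm_Hess; exact: smoothD.
- by move=> a b; rewrite 2!mxE rmorphD /= (herm_Hess z sf a b) (herm_Hess z sg a b).
- move=> v; have [b ->] := cvec_surj v; rewrite quad_Hess; last exact: smoothD.
  rewrite LapD // mulrDl rmorphD /= -!quad_Hess // /quad -big_split; apply: eq_bigr => a _.
  by rewrite -big_split; apply: eq_bigr => c _ /=; rewrite [X in _ = _ * X * _]mxE mulrDr mulrDl.
Qed.

Lemma HessZ (c : R) f z : smooth f -> Hess (fun z => c * f z) z = c%:C%C *: Hess f z.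
Proof.
move=> sf; apply: quad_ext.
- by apply: herm_Hess; exact: smoothZ.
- move=> a b; rewrite 2!mxE rmorphM /= (herm_Hess z sf a b); congr (_ * _). by rewrite conj_Complex oppr0.
- move=> v; have [b ->] := cvec_surj v; rewrite quad_Hess; last exact: smoothZ.
  rewrite LapZ // -mulrA rmorphM /= -quad_Hess // /quad big_distrr; apply: eq_bigr => a _ /=.
  by rewrite big_distrr; apply: eq_bigr => e _ /=; rewrite [X in _ = _ * X * _]mxE -!mulrA mulrCA.
Qed.

Lemma eq_hmix_head f g hs I J z : Hess f z = Hess g z -> hmix (f :: hs) I J z = hmix (g :: hs) I J z.
Proof. by rewrite /hmix /= => ->. Qed.

Lemma mm_addE f g h hs z : Hess h z = Hess f z + Hess g z -> mm (h :: hs) z = mm (f :: hs) z + mm (g :: hs) z.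
Proof.
move=> E; rewrite !mm_def -ReD; congr cre.
transitivity (mixed ((Hess f z + Hess g z) :: [seq Hess h z | h <- hs]) finset.setT finset.setT). by rewrite -E.
exact: mixedD.
Qed.

Lemma mmD f g hs z : smooth f -> smooth g -> mm ((fun z => f z + g z) :: hs) z = mm (f :: hs) z + mm (g :: hs) z.
Proof. by move=> sf sg; apply: mm_addE; exact: HessD. Qed.

Lemma mmZ c f hs z : smooth f -> mm ((fun z => c * f z) :: hs) z = c * mm (f :: hs) z.
Proof.
move=> sf; rewrite !mm_def.
transitivity (cre (c%:C%C * hmix (f :: hs) finset.setT finset.setT z)); last first. by rewrite ReM /= mul0r subr0.
congr cre; transitivity (mixed ((c%:C%C *: Hess f z) :: [seq Hess h z | h <- hs]) finset.setT finset.setT).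
  by rewrite -HessZ.
exact: mixedZ.
Qed.

Lemma mmB f g hs z : smooth f -> smooth g -> mm ((fun z => f z - g z) :: hs) z = mm (f :: hs) z - mm (g :: hs) z.
Proof.
move=> sf sg; rewrite -mulN1r -mmZ // -mmD //; last exact: smoothZ.
by congr (mm (_ :: hs) z); apply/funext => y; rewrite mulN1r.
Qed.

Lemma mm_move l1 f l2 z : mm (l1 ++ f :: l2) z = mm (f :: l1 ++ l2) z.
Proof. by rewrite !mm_def /hmix map_cat /= mixed_move map_cat. Qed.

Lemma Hess_psd_list hs z : smooths hs -> lpsd hs z -> forall A, A \in [seq Hess h z | h <- hs] -> psd A.
Proof.
elim: hs => [|h hs IH] // /smooths_cons[sh shs] H A; rewrite inE => /predU1P[->|].
  by apply: psd_Hess => // b; exact: (H 0%N).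
by apply: IH => // i; exact: (H i.+1).
Qed.

Lemma mm_ge0 hs z : smooths hs -> lpsd hs z -> 0 <= mm hs z.
Proof.
move=> sh H; have := mixed_psd_ge0 finset.setT (Hess_psd_list sh H).
by rewrite mm_def /hmix; case: (mixed _ _ _) => x y; rewrite lecE /= => /andP[].
Qed.

(** The density is linear in its first entry and nonnegative on positive Hessians. *)
Lemma mm_cons_le f g hs z : smooth f -> smooth g -> smooths hs -> lpsd hs z ->
  (forall b, Lap b f z <= Lap b g z) -> mm (f :: hs) z <= mm (g :: hs) z.
Proof.
move=> sf sg sh H fg; rewrite -subr_ge0 -mmB //; apply: mm_ge0. by apply: smooths_consI => //; exact: smoothB.
by apply: lpsd_cons => // b; rewrite LapB // subr_ge0.
Qed.

Lemma nice_tstM phi g : tst phi -> smooth g -> nice (fun z => phi z * g z).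
Proof. by move=> tp sg; apply: tst_nice; exact: tstM. Qed.

Lemma mm_congr hs hs' z : size hs = size hs' ->
  (forall i, Hess (nth (fun=> 0) hs i) z = Hess (nth (fun=> 0) hs' i) z) -> mm hs z = mm hs' z.
Proof.
move=> ss H; rewrite !mm_def /hmix; congr (cre (mixed _ _ _)).
elim: hs hs' ss H => [|h hs IH] [|h' hs'] //= [ss] H; rewrite (H 0%N) (IH hs') // => i.
exact: (H i.+1).
Qed.

End mixed_hessians.

(** * Convergence of mixed energies along a decreasing sequence *)

Section energy.
Context {R : realType} {n : nat}.
Notation C := (Cn R n).
Variables (h_ : nat -> C -> R) (A : R).
Hypotheses (th : forall j, tst (h_ j)) (h0 : forall j z, 0 <= h_ j z)
  (hdecr : forall i j z, (i <= j)%N -> h_ j z <= h_ i z) (A0 : 0 <= A)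
  (hA : forall j z b, 0 <= Lap b (h_ j) z + A * Lap b eucl z).

Let E : C -> R := eucl.
Let sE : smooth E. Proof. exact: smooth_eucl. Qed.

(** A function of compact support is not plurisubharmonic unless it vanishes; the support of h_j is
    kept for integration by parts, and A |z|^2 makes the sum plurisubharmonic. *)
Definition hplus j : C -> R := fun z => h_ j z + A * E z.

Let sh j : smooth (h_ j). Proof. exact: tst_smooth. Qed.

Lemma smooth_hplus j : smooth (hplus j).
Proof. by apply: smoothD => //; exact: smoothZ. Qed.

Lemma Lap_hplus_ge0 j b z : 0 <= Lap b (hplus j) z.
Proof. by rewrite /hplus LapD ?LapZ //; exact: smoothZ. Qed.
Let LapE_ge0 b z : 0 <= Lap b E z.
Proof. by rewrite Lap_eucl mulr_ge0 // eucl_ge0. Qed.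
(** Every estimate trades a factor [hplus] for a copy of |z|^2, so the two kinds of factors are
    counted separately. *)
Let rest (s : seq nat) m := map hplus s ++ nseq m E.

Let srest s m : smooths (rest s m).
Proof. by apply: smooths_cat; [apply: smooths_map; exact: smooth_hplus|exact: smooths_nseq]. Qed.
Let prest s m z : lpsd (rest s m) z.
Proof.
by apply: lpsd_cat; [apply: lpsd_map => j b; exact: Lap_hplus_ge0|apply: lpsd_nseq => b; exact: LapE_ge0].
Qed.

Definition Yint j s m := I (fun z => h_ j z * mm (rest s m) z).

Let restE s m z : mm (E :: rest s m) z = mm (rest s m.+1) z.
Proof. by rewrite /rest mm_move. Qed.

(* Replacing [h_ x] by [h_ x'] inside a mixed product costs at most the change
   of an energy with one form fewer. *)
Lemma energy_step (G : C -> R) A' x x' s m : tst G -> 0 <= A' ->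
  (forall z b, 0 <= Lap b G z + A' * Lap b E z) -> (x <= x')%N ->
  I (fun z => G z * mm (rest (x' :: s) m) z) - A' * (Yint x s m.+1 - Yint x' s m.+1) <=
  I (fun z => G z * mm (rest (x :: s) m) z).
Proof.
move=> tG A'0 GA xx'; have sG := tst_smooth tG.
have n1 y : nice (fun z => G z * mm (rest (y :: s) m) z) by apply: nice_tstM => //; exact: smooth_mm.
have n2 y : nice (fun z => h_ y z * mm (rest s m.+1) z) by apply: nice_tstM => //; exact: smooth_mm.
pose D z := h_ x z - h_ x' z.
have tD : tst D by exact: tstB.
have sD := tst_smooth tD.
have E1 : I (fun z => G z * mm (rest (x :: s) m) z) - I (fun z => G z * mm (rest (x' :: s) m) z) =
    I (fun z => D z * mm (G :: rest s m) z).
  rewrite -IB // -mm_sym //; apply: I_ext => z; rewrite -mulrBr; congr (_ * _).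
  have e1 : mm (D :: rest s m) z = mm (h_ x :: rest s m) z - mm (h_ x' :: rest s m) z by exact: mmB.
  have e2 y : mm (rest (y :: s) m) z = mm (h_ y :: rest s m) z + mm ((fun z => A * E z) :: rest s m) z.
    by apply: mmD => //; exact: smoothZ. by rewrite e1 (e2 x) (e2 x') opprD addrACA subrr addr0.
have key : - (A' * (Yint x s m.+1 - Yint x' s m.+1)) <= I (fun z => D z * mm (G :: rest s m) z).
  have sM : smooth (mm (G :: rest s m)) by apply: smooth_mm; exact: smooths_consI.
  have nB := niceB (n2 x) (n2 x'). rewrite /Yint -IB // -IZ // -mulN1r -IZ; last exact: niceZ.
  apply: le_I; [by apply: niceZ; exact: niceZ|exact: (nice_tstM tD)|].
  move=> z; rewrite (_ : -1 * _ = D z * - (A' * mm (rest s m.+1) z)); last first.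
    by rewrite /D; move: (h_ x z) (h_ x' z) (mm _ z) => p q r; ring.
  apply: ler_wpM2l; first by rewrite subr_ge0 hdecr. rewrite -restE -mmZ // -mulN1r -mmZ; last exact: smoothZ.
  apply: mm_cons_le => //; first by apply: smoothZ; exact: smoothZ.
  by move=> b; rewrite LapZ ?LapZ //; [rewrite mulN1r -subr_ge0 opprK|exact: smoothZ].
move: E1 key; set X := I _; set X' := I _; set Z := I _; set B := A' * _; lra.
Qed.

Lemma Y_ge0 j s m : 0 <= Yint j s m.
Proof. by apply: I_ge0 => z; rewrite mulr_ge0 // mm_ge0. Qed.

Definition tail_ge N (s : seq nat) := all (leq N) s.

(** The indices of s are raised to those of s' one after another, each at the cost A' eta given by
    [energy_step]; [l] collects those already raised. *)
Lemma energy_chain (G : C -> R) A' k m N eta : tst G -> 0 <= A' ->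
  (forall z b, 0 <= Lap b G z + A' * Lap b E z) ->
  (forall x x' s, size s = k -> (N <= x)%N -> (N <= x')%N -> tail_ge N s ->
     `|Yint x s m.+1 - Yint x' s m.+1| <= eta) ->
  forall l s s', (size l + size s = k.+1)%N -> tail_ge N l -> tail_ge N s -> tail_ge N s' -> all2 leq s s' ->
  I (fun z => G z * mm (rest (l ++ s') m) z) - (size s)%:R * (A' * eta) <=
  I (fun z => G z * mm (rest (l ++ s) m) z).
Proof.
move=> tG A'0 GA H l s; elim: s l => [|x s IH] l [|x' s'] //=. by move=> _ _ _ _ _; rewrite mul0r subr0.
move=> sz lN /andP[xN sN] /andP[x'N s'N] /andP[xx' ss'].
have mv y t : I (fun z => G z * mm (rest (l ++ y :: t) m) z) = I (fun z => G z * mm (rest (y :: l ++ t) m) z).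
  apply: I_ext => z; congr (_ * _); rewrite /rest !map_cat /= map_cat -!catA /=. by rewrite mm_move catA.
have szl : size (l ++ s) = k by move: sz; rewrite size_cat addnS => -[].
have := energy_step (l ++ s) m tG A'0 GA xx'; rewrite -!mv => h.
apply: le_trans h.
have szr : (size (rcons l x') + size s)%N = k.+1 by rewrite size_rcons addSnnS.
have tr : tail_ge N (rcons l x') by rewrite /tail_ge all_rcons x'N.
have := IH (rcons l x') s' szr tr sN s'N ss'; rewrite !cat_rcons.
move=> h; rewrite -natr1 mulrDl mul1r opprD addrA; apply: lerB => //.
rewrite ler_wpM2l //; apply: le_trans (ler_norm _) _; apply: H => //.
by rewrite /tail_ge all_cat; apply/andP; split.
Qed.

Lemma tail_geW N N' s : (N <= N')%N -> tail_ge N' s -> tail_ge N s.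
Proof. by move=> NN'; apply: sub_all => x /=; exact: leq_trans. Qed.

(** Raising j lowers the energy and raising the indices in s adds at most eta / 2. So beyond a point
    where the infimum is reached up to eta / 2, all energies are within eta of it. *)
Lemma energy_near_inf k m eta N0 : 0 < eta ->
  (forall j s0 s, size s0 = k -> size s = k -> tail_ge N0 s0 -> tail_ge N0 s -> all2 leq s0 s ->
    Yint j s m <= Yint j s0 m + eta / 2) -> exists N, forall j j' s s', size s = k -> size s' = k ->
  tail_ge N (j :: s) -> tail_ge N (j' :: s') -> `|Yint j s m - Yint j' s' m| <= eta.
Proof.
move=> eta0 m2; have e20 : 0 < eta / 2 by rewrite divr_gt0.
pose Sv := [set y | exists j s, [/\ size s = k, tail_ge N0 (j :: s) & y = Yint j s m]].
have hS : has_inf Sv. split; last by exists 0 => _ [j [s [_ _ ->]]]; exact: Y_ge0.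
  exists (Yint N0 (nseq k N0) m), N0, (nseq k N0); split; rewrite ?size_nseq //=.
  by rewrite !leqnn /= /tail_ge all_nseq leqnn orbT.
have [_ [j0 [s0 [ss0 ts0 ->]]] hj0] := inf_adherent e20 hS.
have le_sumn (t : seq nat) x : x \in t -> (x <= sumn t)%N.
  elim: t => [|y t IHt] //=; rewrite inE => /predU1P[->|/IHt h]; first exact: leq_addr.
  exact: leq_trans h (leq_addl _ _).
(* The sum serves as an upper bound for all the indices. *)
pose N := sumn (j0 :: s0).
have N0N : (N0 <= N)%N. have /andP[h _] := ts0; apply: leq_trans h _; by rewrite /N /= leq_addr.
have up j s : size s = k -> tail_ge N (j :: s) -> Yint j s m <= inf Sv + eta. move=> ss /andP[jN sN].
  have j0N : (j0 <= N)%N by rewrite /N /= leq_addr. have a2 : all2 leq s0 s. have : all (fun x => x <= N)%N s0.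
      by apply/allP => x xs; apply: le_sumn; rewrite inE xs orbT.
    move: ss0; rewrite -ss; elim: (s0) (s) sN => [|x t IH'] [|y t'] //= /andP[yN tN] [st] /andP[xN tN'].
    by rewrite (leq_trans xN yN) IH'. have /andP[j0N0 s0N0] := ts0. have m1 : Yint j s m <= Yint j0 s m.
    apply: le_I; [exact: (nice_tstM (th j) (smooth_mm (srest _ _)))|exact: (nice_tstM (th j0) (smooth_mm (srest _ _)))|].
    by move=> z; rewrite ler_wpM2r ?mm_ge0 // hdecr // (leq_trans j0N).
  apply: le_trans m1 _; apply: le_trans (m2 j0 s0 s ss0 ss s0N0 (tail_geW N0N sN) a2) _.
  by rewrite [eta in leRHS]splitr addrA lerD2r; exact: ltW.
have lo j s : size s = k -> tail_ge N (j :: s) -> inf Sv <= Yint j s m.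
  move=> ss jN; apply: ge_inf; first by case: hS. by exists j, s; split=> //; apply: tail_geW jN.
exists N => j j' s s' ss ss' jN j'N; rewrite ler_distl; apply/andP; split.
  rewrite lerBlDr; apply: le_trans (up j' s' ss' j'N) _; rewrite lerD2r; exact: lo.
by apply: le_trans (up j s ss jN) _; rewrite lerD2r; exact: lo.
Qed.

(** Induction on k, for all m at once: raising the k + 1 indices adds at most (k + 1) A times the
    oscillation of the energies with k indices and one more copy of |z|^2. *)
Lemma energy_cauchy k m eta : 0 < eta -> exists N, forall j j' s s', size s = k -> size s' = k ->
  tail_ge N (j :: s) -> tail_ge N (j' :: s') -> `|Yint j s m - Yint j' s' m| <= eta.
Proof.
elim: k m eta => [|k IH] m eta eta0; have e20 : 0 < eta / 2 by rewrite divr_gt0.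
  by apply: (@energy_near_inf 0 m eta 0) => // j s0 s /size0nil -> /size0nil -> _ _ _; rewrite lerDl ltW.
pose e' := eta / 2 / ((k.+1)%:R * A + 1).
have dn : 0 < (k.+1)%:R * A + 1 by rewrite ltr_wpDl // mulr_ge0.
have e'0 : 0 < e' by rewrite !divr_gt0.
have [N0 HN0] := IH m.+1 e' e'0.
apply: (@energy_near_inf k.+1 m eta N0) => // j0 s0 s ss0 ss s0N0 sN a2.
have := @energy_chain (h_ j0) A k m N0 e' (th j0) A0 (fun z b => hA j0 z b).
move=> /(_ _)/wrap[]. by move=> x x' t st xN x'N tN; apply: HN0 => //=; apply/andP; split.
move=> /(_ [::] s0 s); rewrite /= ss0 => /(_ erefl isT s0N0 sN a2).
rewrite lerBlDr => h; apply: le_trans h _; rewrite lerD2l.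
by rewrite mulrA /e' mulrA ler_pdivrMr // mulrC ler_wpM2l ?(ltW e20) // lerDl.
Qed.

(** N depends on A' and eta but not on G, because G will depend on J. Raising indices lets the
    integral grow by at most eta, so the diagonal value at J controls all later indices from
    above. *)
Lemma energy_compare k A' eta : 0 <= A' -> 0 < eta -> exists N, forall (G : C -> R) J s, tst G ->
  (forall z b, 0 <= Lap b G z + A' * Lap b E z) -> size s = k.+1 -> (N <= J)%N -> tail_ge J s ->
  I (fun z => G z * mm (map hplus s) z) - eta <= I (fun z => G z * mm (nseq k.+1 (hplus J)) z).
Proof.
move=> A'0 eta0; pose e' := eta / ((k.+1)%:R * A' + 1).
have dn : 0 < (k.+1)%:R * A' + 1 by rewrite ltr_wpDl // mulr_ge0.
have e'0 : 0 < e' by rewrite divr_gt0.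
have [N HN] := energy_cauchy k 1 e'0; exists N => G J s tG GA ss NJ tJ.
have := @energy_chain G A' k 0 J e' tG A'0 GA.
move=> /(_ _)/wrap[].
  move=> x x' t st xJ x'J tJ'; apply: HN => //=; apply/andP; split; rewrite ?(leq_trans NJ) //;
    exact: tail_geW tJ'.
have r0 l : rest l 0 = map hplus l by rewrite /rest cats0.
move=> /(_ [::] (nseq k.+1 J) s); rewrite !cat0s size_nseq !r0 map_nseq => h.
apply: le_trans (h _ _ _ _ _) => //.
- rewrite lerB // /e' mulrA mulrA ler_pdivrMr // mulrC ler_wpM2l ?(ltW eta0) //. by rewrite lerDl.
- by rewrite /tail_ge /= leqnn /= all_nseq leqnn orbT.
- move: ss tJ; rewrite -[k.+1](size_nseq k.+1 J) -/(nseq k.+1 J); move: (k.+1) => q.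
  rewrite size_nseq; elim: q s {h} => [|q IH] [|x s] //= [ss] /andP[-> tJ] /=; exact: IH.
Qed.

End energy.

(** * Bedford-Taylor powers as iterated limits of smooth mixed products *)

Section currents.
Context {R : realType} {n : nat}.
Notation C := (Cn R n).
Notation bC := (borelCn R n).
Notation K := (R[i]).
Implicit Types (f g h phi : C -> R) (psi : C -> K) (z b : C) (I J : {set 'I_n}) (x y : K).

Definition ccvg (x_ : nat -> K) x := cre (x_ j) @[j --> \oo] --> cre x /\ cim (x_ j) @[j --> \oo] --> cim x.

Lemma ccvgD (x_ y_ : nat -> K) x y : ccvg x_ x -> ccvg y_ y -> ccvg (fun j => x_ j + y_ j) (x + y).
Proof.
move=> [a1 a2] [b1 b2]; split. by under eq_fun do rewrite ReD; rewrite ReD; exact: cvgD.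
by under eq_fun do rewrite ImD; rewrite ImD; exact: cvgD.
Qed.

Lemma ccvgZ (k : K) (x_ : nat -> K) x : ccvg x_ x -> ccvg (fun j => k * x_ j) (k * x).
Proof.
move=> [a1 a2]; split. under eq_fun do rewrite ReM; rewrite ReM; apply: cvgB; exact: cvgMr.
under eq_fun do rewrite ImM; rewrite ImM; apply: cvgD; exact: cvgMr.
Qed.

Lemma ccvg0 : ccvg (fun=> 0) 0.
Proof. by split; exact: cvg_cst. Qed.

Lemma ccvg_sum (T : Type) (s : seq T) (Q : pred T) (x_ : T -> nat -> K) (x : T -> K) :
  (forall i, Q i -> ccvg (x_ i) (x i)) -> ccvg (fun j => \sum_(i <- s | Q i) x_ i j) (\sum_(i <- s | Q i) x i).
Proof.
move=> H; elim: s => [|i s IH]. by under eq_fun do rewrite big_nil; rewrite big_nil; exact: ccvg0.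
under eq_fun do rewrite big_cons; rewrite big_cons.
by case: (boolP (Q i)) => // Qi; apply: ccvgD => //; exact: H.
Qed.

(* [L] is the limit of [X [:: j1; ...; jk]] as jk, ..., j1 tend to infinity, in
   this order. *)
Fixpoint ilim k (X : seq nat -> K) (L : K) : Prop := if k is k'.+1 then
    exists2 L_ : nat -> K, forall j, ilim k' (fun s => X (j :: s)) (L_ j) & ccvg L_ L else X [::] = L.

Lemma ilim_ext k X Y L : X =1 Y -> ilim k X L -> ilim k Y L.
Proof. by move=> /funext ->. Qed.

Lemma ilimD k X Y L L' : ilim k X L -> ilim k Y L' -> ilim k (fun s => X s + Y s) (L + L').
Proof.
elim: k X Y L L' => [|k IH] X Y L L' /=; first by move=> -> ->.
move=> [L_ H1 c1] [L'_ H2 c2]; exists (fun j => L_ j + L'_ j); last exact: ccvgD.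
by move=> j; apply: IH.
Qed.

Lemma ilimZ k (a : K) X L : ilim k X L -> ilim k (fun s => a * X s) (a * L).
Proof.
elim: k X L => [|k IH] X L /=; first by move=> ->.
move=> [L_ H1 c1]; exists (fun j => a * L_ j); last exact: ccvgZ.
by move=> j; apply: IH.
Qed.

Lemma ilim0 k : ilim k (fun=> 0) 0.
Proof. by elim: k => [|k IH] //=; exists (fun=> 0) => //; exact: ccvg0. Qed.

Lemma ilim_sum k (T : Type) (s : seq T) (Q : pred T) (X : T -> seq nat -> K) (x : T -> K) :
  (forall i, Q i -> ilim k (X i) (x i)) -> ilim k (fun l => \sum_(i <- s | Q i) X i l) (\sum_(i <- s | Q i) x i).
Proof.
move=> H; elim: s => [|i s IH].
  by apply: (@ilim_ext k (fun=> 0)); [move=> l; rewrite big_nil|rewrite big_nil; exact: ilim0].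
case: (boolP (Q i)) => Qi. apply: (@ilim_ext k (fun l => X i l + \sum_(i <- s | Q i) X i l)).
    by move=> l; rewrite big_cons Qi. by rewrite big_cons Qi; apply: ilimD => //; exact: H.
apply: (@ilim_ext k (fun l => \sum_(i <- s | Q i) X i l)). by move=> l; rewrite big_cons (negbTE Qi).
by rewrite big_cons (negbTE Qi).
Qed.

Lemma ilim_le k X L (B : R) N : ilim k X L ->
  (forall s, size s = k -> all (leq N) s -> cre (X s) <= B) -> cre L <= B.
Proof.
elim: k X L => [|k IH] X L /=; first by move=> <- H; exact: H.
move=> [L_ H1 [c1 _]] H; apply: (cvgr_to_le c1); exists N => // j /= Nj.
by apply: (IH _ _ (H1 j)) => s ss sN; apply: H => /=; rewrite ?ss ?Nj.
Qed.

Variable Om : set C.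
Hypothesis oOm : open Om.

Let mOm : measurable (Om : set bC). Proof. exact: open_measurableCn. Qed.

Lemma compact_closedCn (A : set C) : compact A -> closed A.
Proof. by apply: compact_closed; exact: norm_hausdorff. Qed.

(** With A compact in Om, such a function is integrable for every Radon measure on Om. *)
Definition good (A : set C) g := [/\ mfun_on Om g, exists c : R, forall z, Om z -> `|g z| <= c
    & forall z, ~ A z -> g z = 0].

Lemma good_integrable (mu : {measure set bC -> \bar R}) (A : set C) g : radon_on Om mu ->
  compact A -> A `<=` Om -> good A g -> mu.-integrable Om (EFin \o g).
Proof.
move=> rm cA AO [mg [c gc] g0].
have mA : measurable (A : set bC) by apply: closed_measurableCn; exact: compact_closedCn.
apply/(integrable_mkcond _ mOm).
have : mu.-integrable A (EFin \o g). apply: measurable_bounded_integrable => //; first exact: rm.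
    exact: measurable_funS mg.
  by exists c; split; [exact: num_real|move=> x cx z Az; apply: le_trans (gc z (AO _ Az)) (ltW cx)].
move/(integrable_mkcond _ mA); congr (_.-integrable _ _); apply/funext => z; rewrite !patchE.
case: (boolP (z \in A)) => zA. by rewrite mem_set //; apply: AO; rewrite inE in zA.
by rewrite /= g0 ?if_same //; rewrite notin_setE in zA.
Qed.

Lemma goodD A g h : good A g -> good A h -> good A (fun z => g z + h z).
Proof.
move=> [mg [c gc] g0] [mh [d hd] h0]; split.
- exact: measurable_funD.
- by exists (c + d) => z Oz; apply: le_trans (ler_normD _ _) (lerD (gc z Oz) (hd z Oz)).
- by move=> z nA; rewrite g0 // h0 // addr0.
Qed.

Lemma goodM A g h : mfun_on Om g ->
  (exists c : R, forall z, Om z -> `|g z| <= c) -> good A h -> good A (fun z => g z * h z).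
Proof.
move=> mg [c gc] [mh [d hd] h0]; split.
- exact: measurable_funM.
- by exists (c * d) => z Oz; rewrite normrM ler_pM // ?gc ?hd.
- by move=> z nA; rewrite h0 // mulr0.
Qed.

Lemma goodN A h : good A h -> good A (fun z => - h z).
Proof.
move=> gh; rewrite (_ : (fun z => - h z) = fun z => (-1) * h z); last by apply/funext => z; rewrite mulN1r.
by apply: goodM => //; exists `|-1|.
Qed.

Lemma tst_good A phi : tst phi -> (forall z, ~ A z -> phi z = 0) -> good A phi.
Proof.
move=> tp H; have [c pc] := tst_bounded tp; split=> //; last by exists c => z _.
by apply: measurable_funTS; apply: smooth_measurable; exact: tst_smooth.
Qed.

Lemma dd_supp_closed v phi A z : closed A -> (forall z, ~ A z -> phi z = 0) -> ~ A z -> dd v phi z = 0.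
Proof.
move=> cA H nA; rewrite (@dd_near _ _ phi (fun=> 0) (~` A) v z) ?dd_cst //. by rewrite openC.
by move=> y; rewrite inE => /H.
Qed.

Lemma good0 A : good A (fun=> 0).
Proof. by split=> //; exists 0 => z _; rewrite normr0. Qed.

Lemma coef_bound S I J : current_on Om S -> (exists c : R, forall z, Om z -> `|complex.Re (coef S I J z)| <= c) /\
  (exists c : R, forall z, Om z -> `|complex.Im (coef S I J z)| <= c).
Proof.
move=> [_ _ _ /(_ I J) bd]; split; exists 1 => z /bd h; rewrite -(expr_le1 (n := 2)) // real_normK ?num_real //.
  by apply: le_trans h; rewrite lerDl sqr_ge0.
by apply: le_trans h; rewrite lerDr sqr_ge0.
Qed.

Section pairing.
Variable S : current R n.
Hypothesis cS : current_on Om S.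
Variable A : set C.
Hypotheses (cA : compact A) (AO : A `<=` Om).

Let gre I J g : good A g -> good A (fun z => complex.Re (coef S I J z) * g z).
Proof. by move=> gg; have [? ?] := coef_bound I J cS; apply: goodM => //; case: cS. Qed.
Let gim I J g : good A g -> good A (fun z => complex.Im (coef S I J z) * g z).
Proof. by move=> gg; have [? ?] := coef_bound I J cS; apply: goodM => //; case: cS. Qed.
Let int g : good A g -> (mass S).-integrable Om (EFin \o g).
Proof. by apply: good_integrable => //; case: cS. Qed.

Lemma pairing_real I J g : pairing Om S I J (fun z => (g z)%:C%C) =
  Complex (\int[mass S]_(z in Om) (complex.Re (coef S I J z) * g z))
          (\int[mass S]_(z in Om) (complex.Im (coef S I J z) * g z)).
Proof.
rewrite /pairing; congr Complex; apply: eq_Rintegral => z _.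
  by case: (coef S I J z) => a b /=; rewrite mulr0 subr0.
by case: (coef S I J z) => a b /=; rewrite mulr0 add0r.
Qed.

Lemma pairing_split I J g h : good A g -> good A h -> pairing Om S I J (fun z => Complex (g z) (h z)) =
  pairing Om S I J (fun z => (g z)%:C%C) + Complex 0 1 * pairing Om S I J (fun z => (h z)%:C%C).
Proof.
move=> gg gh; rewrite !pairing_real /pairing; apply: creim_eq.
  rewrite ReD ReM /= mul0r mul1r sub0r -RintegralB //; [|exact/int/gre|exact/int/gim].
  by apply: eq_Rintegral => z _; case: (coef S I J z) => a b.
rewrite ImD ImM /= mul0r mul1r add0r addrC -RintegralD //; [|exact/int/gre|exact/int/gim].
by apply: eq_Rintegral => z _; case: (coef S I J z) => a b.
Qed.

Lemma pairing_cvg I J (u_ : nat -> C -> R) u g h (M : R) : (forall j, mfun (u_ j)) -> mfun u ->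
  (forall j z, `|u_ j z| <= M) -> (forall z, A z -> u_ j z @[j --> \oo] --> u z) -> good A g -> good A h ->
  ccvg (fun j => pairing Om S I J (fun z => (u_ j z)%:C%C * Complex (g z) (h z)))
    (pairing Om S I J (fun z => (u z)%:C%C * Complex (g z) (h z))).
Proof.
move=> mu_ mu uM uu gg gh.
have main k : good A k ->
   (\int[mass S]_(z in Om) (u_ j z * k z)) @[j --> \oo] --> (\int[mass S]_(z in Om) (u z * k z)).
  move=> gk; have [mk [c kc] k0] := gk. have guk : (mass S).-integrable Om (fun z => (`|M| * `|k z|)%:E).
    apply: int; apply: goodM => //; first by exists `|(`|M|)|.
    split; [exact: measurableT_comp|by exists c => z /kc; rewrite normr_id|]. by move=> z /k0 ->; rewrite normr0.
  have [|||||h1 _ h2] := @dominated_convergence _ _ R (mass S) Om mOm (fun j z => (u_ j z * k z)%:E)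
    (fun z => (u z * k z)%:E) (fun z => (`|M| * `|k z|)%:E).
  - by move=> j; apply/measurable_EFinP; apply: measurable_funM => //; exact: (measurable_funTS (mu_ j)).
  - by apply/measurable_EFinP; apply: measurable_funM => //; exact: (measurable_funTS mu).
  - apply: aeW => z _; apply: cvg_EFin; first exact: nearW.
    case: (pselect (A z)) => Az; first by apply: cvgMl; exact: uu.
    rewrite k0 // mulr0; under eq_fun do rewrite mulr0; exact: cvg_cst.
  - exact: guk.
  - apply: aeW => z j _; rewrite lee_fin normrM ler_wpM2r //. exact: le_trans (uM j z) (ler_norm _).
  apply: fine_cvg; rewrite /Rintegral fineK //; exact: integrable_fin_num.
have er (w : C -> R) : cre (pairing Om S I J (fun z => (w z)%:C%C * Complex (g z) (h z))) =
    \int[mass S]_(z in Om) (w z * (complex.Re (coef S I J z) * g z + - (complex.Im (coef S I J z) * h z))).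
  by apply: eq_Rintegral => z _; case: (coef S I J z) => a b /=; ring.
have ei (w : C -> R) : cim (pairing Om S I J (fun z => (w z)%:C%C * Complex (g z) (h z))) =
    \int[mass S]_(z in Om) (w z * (complex.Im (coef S I J z) * g z + complex.Re (coef S I J z) * h z)).
  by apply: eq_Rintegral => z _; case: (coef S I J z) => a b /=; ring.
split. rewrite er; under eq_fun do rewrite er. by apply: main; exact: (goodD (gre I J gg) (goodN (gim I J gh))).
rewrite ei; under eq_fun do rewrite ei.
by apply: main; exact: (goodD (gim I J gg) (gre I J gh)).
Qed.

End pairing.

Lemma ddbar_parts (a b : 'I_n) phi z : ddbar a b phi z = Complex (cre (ddbar a b phi z)) (cim (ddbar a b phi z)).
Proof. by case: (ddbar a b phi z). Qed.

Lemma ddbar_supp (a b : 'I_n) phi A z : closed A -> (forall z, ~ A z -> phi z = 0) -> ~ A z -> ddbar a b phi z = 0.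
Proof.
move=> cA H nA; rewrite ddbar_dd.
have E u v : dd u (dd v phi) z = 0.
  by apply: (dd_supp_closed u cA) nA => y nAy; exact: (dd_supp_closed v cA H nAy).
by rewrite !E addr0 subr0 mul0r.
Qed.

Lemma test_functionP phi A : tst phi -> compact A -> A `<=` Om -> (forall z, ~ A z -> phi z = 0) ->
  test_function Om phi.
Proof. by move=> [sp _] cA AO H; split=> //; exists A. Qed.

Lemma test_function_good phi : test_function Om phi ->
  exists A, [/\ compact A, A `<=` Om, forall z, ~ A z -> phi z = 0, tst phi & good A phi].
Proof.
move=> [sp [A [cA AO pA]]]; exists A; have tp : tst phi.
  split=> //; have [r [_ rP]] := compact_bounded cA; exists (r + 1) => z hz; apply: pA => Az.
  by have := rP (r + 1) _ z Az; rewrite ltrDl => /(_ ltr01) /=; rewrite leNgt hz.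
by split=> //; exact: tst_good.
Qed.

(** In each step of the recursion u is replaced by u_j under the pairing, by dominated convergence;
    the pairing with the smooth function u_j g_(a bbar) is the induction hypothesis, applied to its
    real and imaginary parts. [cI_hmix] reassembles the sum of smooth integrals. *)
Lemma ddc_power_ilim (c : R) (u : C -> R) (u_ : nat -> C -> R) (M : R) k T :
  (forall j, smooth (u_ j)) -> mfun u -> (forall j z, `|u_ j z| <= M) -> ddc_power c Om u k T ->
  forall I J phi A, #|I| = k -> #|J| = k -> tst phi -> compact A -> A `<=` Om ->
  (forall z, ~ A z -> phi z = 0) -> (forall z, A z -> u_ j z @[j --> \oo] --> u z) ->
  ilim k (fun s => (c ^+ k)%:C%C * cI (fun z => (phi z)%:C%C * hmix (map u_ s) I J z))
    (pairing Om T I J (fun z => (phi z)%:C%C)).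
Proof.
move=> su mu uM; elim: k T => [|k IH] T [cT H] I J phi A cI_ cJ tp cA AO pA uu.
  move/eqP: cI_; rewrite cards_eq0 => /eqP ->; move/eqP: cJ; rewrite cards_eq0 => /eqP ->.
  have tf := test_functionP tp cA AO pA. rewrite /= H // expr0 mul1r; apply: creim_eq => /=.
    rewrite /I /Rintegral [in RHS]integral_mkcond; congr fine; apply: eq_integral => z _.
    rewrite patchE /= mul0r subr0 mulr1; case: (boolP (z \in Om)) => // zO.
    by rewrite pA // => /AO Oz; rewrite notin_setE in zO.
  by rewrite -[RHS](@I0 R n); apply: I_ext => z /=; rewrite mulr0 mul0r addr0.
have [S HS HT] := H.
have cS : current_on Om S by case: (k) HS => [|?] [].
have clA := compact_closedCn cA.
pose p (a b : 'I_n) z := cre (ddbar a b phi z); pose q (a b : 'I_n) z := cim (ddbar a b phi z).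
have tpq (a b : 'I_n) : tst (p a b) /\ tst (q a b) by exact: ctst_ddbar.
have p0 (a b : 'I_n) z : ~ A z -> p a b z = 0 by move=> nA; rewrite /p (ddbar_supp a b clA pA nA).
have q0 (a b : 'I_n) z : ~ A z -> q a b z = 0 by move=> nA; rewrite /q (ddbar_supp a b clA pA nA).
have gp (a b : 'I_n) : good A (p a b) by apply: tst_good => //; [case: (tpq a b)|exact: p0].
have gq (a b : 'I_n) : good A (q a b) by apply: tst_good => //; [case: (tpq a b)|exact: q0].
have dE (a b : 'I_n) z : ddbar a b phi z = Complex (p a b z) (q a b z) by exact: ddbar_parts.
have smu j : mfun (u_ j) by exact: smooth_measurable.
rewrite (HT I J cI_ cJ phi (test_functionP tp cA AO pA)).
exists (fun j => \sum_(a in I) \sum_(b in J) c%:C%C * wedge_sign R a I * wedge_sign R b J *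
  pairing Om S (I :\ a)%SET (J :\ b)%SET (fun z => (u_ j z)%:C%C * ddbar a b phi z)); last first.
  apply: ccvg_sum => a aI; apply: ccvg_sum => b bJ; apply: ccvgZ. rewrite (funext (dE a b)).
  exact: (@pairing_cvg S cS A cA AO _ _ u_ u (p a b) (q a b) M).
move=> j; have sj := su j.
apply: (@ilim_ext k (fun s => \sum_(a in I) \sum_(b in J) c%:C%C * wedge_sign R a I * wedge_sign R b J *
    ((c ^+ k)%:C%C * cI (fun z => (u_ j z)%:C%C * ddbar a b phi z * hmix (map u_ s) (I :\ a)%SET (J :\ b)%SET z)))).
  move=> s /=; have shs : smooths (map u_ s) by exact: smooths_map.
  rewrite (cI_hmix I J tp sj shs) exprS rmorphM /= -mulrA big_distrr /= big_distrr /=.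
  apply: eq_bigr => a _; rewrite !big_distrr /=; apply: eq_bigr => b _.
  rewrite -[wedge_sign R a I]/(wsgn K a I) -[wedge_sign R b J]/(wsgn K b J).
  move: (cI _) (wsgn K a I) (wsgn K b J) (c%:C%C) ((c ^+ k)%:C%C) => v1 v2 v3 v4 v5.
  by rewrite -!mulrA; congr (_ * _); rewrite [RHS]mulrCA; congr (_ * _); rewrite [RHS]mulrCA.
apply: ilim_sum => a aI; apply: ilim_sum => b bJ; apply: ilimZ.
have cIa : #|(I :\ a)%SET| = k by move: cI_; rewrite (finset.cardsD1 a I) aI => -[].
have cJb : #|(J :\ b)%SET| = k by move: cJ; rewrite (finset.cardsD1 b J) bJ => -[].
have tup : tst (fun z => u_ j z * p a b z).
  by under [X in tst X]eq_fun do rewrite mulrC; apply: tstM => //; case: (tpq a b).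
have tuq : tst (fun z => u_ j z * q a b z).
  by under [X in tst X]eq_fun do rewrite mulrC; apply: tstM => //; case: (tpq a b).
have zup z : ~ A z -> u_ j z * p a b z = 0 by move=> /p0 ->; rewrite mulr0.
have zuq z : ~ A z -> u_ j z * q a b z = 0 by move=> /q0 ->; rewrite mulr0.
have h1 := IH S HS _ _ _ A cIa cJb tup cA AO zup uu.
have h2 := IH S HS _ _ _ A cIa cJb tuq cA AO zuq uu.
have -> : (fun z => (u_ j z)%:C%C * ddbar a b phi z) = (fun z => Complex (u_ j z * p a b z) (u_ j z * q a b z)).
  by apply/funext => z; rewrite dE; apply: creim_eq; rewrite /= ?mul0r ?subr0 ?addr0.
rewrite (@pairing_split S cS A cA AO); [|exact: tst_good|exact: tst_good].
apply: ilim_ext (ilimD h1 (ilimZ (Complex 0 1) h2)) => s /=.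
have shs : smooths (map u_ s) by exact: smooths_map.
have sm := csm_hmix (I :\ a)%SET (J :\ b)%SET shs.
rewrite mulrCA -mulrDr; congr (_ * _); rewrite -cIZ; last first. by apply: ctstM => //; exact: ctst_real.
rewrite -cID; [|by apply: ctstM => //; exact: ctst_real|by apply: ctstZ; apply: ctstM => //; exact: ctst_real].
apply: cI_ext => z; rewrite mulrA -mulrDl; congr (_ * _).
by apply: creim_eq; rewrite /= ?mul0r ?mul1r ?mulr0 ?subr0 ?addr0 ?add0r.
Qed.

End currents.

(** * Bounds for the Levi form uniform in the direction; functions constant outside a ball *)

Section uniform_bounds.
Context {R : realType} {n : nat}.
Notation C := (Cn R n).
Implicit Types (f g p : C -> R) (z w b v : C).

Let re b (a c : 'I_n) : R := b.1 0 a * b.1 0 c + b.2 0 a * b.2 0 c.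
Let im b (a c : 'I_n) : R := b.1 0 a * b.2 0 c - b.2 0 a * b.1 0 c.
Let P f (a c : 'I_n) z := dd (dx R a) (dd (dx R c) f) z + dd (dy R a) (dd (dy R c) f) z.
Let Q f (a c : 'I_n) z := dd (dx R a) (dd (dy R c) f) z - dd (dy R a) (dd (dx R c) f) z.

Let coord_eucl b (a : 'I_n) : b.1 0 a ^+ 2 + b.2 0 a ^+ 2 <= eucl b.
Proof.
rewrite /eucl (bigD1 a) //= lerDl; apply: sumr_ge0 => i _.
by rewrite addr_ge0 ?sqr_ge0.
Qed.
Let sq_ineq (x1 x2 y1 y2 e : R) : x1 ^+ 2 + x2 ^+ 2 <= e -> y1 ^+ 2 + y2 ^+ 2 <= e ->
  `|x1 * y1 + x2 * y2| <= e /\ `|x1 * y2 - x2 * y1| <= e.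
Proof.
move=> h1 h2; rewrite !ler_norml; split; apply/andP; split.
- by have := sqr_ge0 (x1 + y1); have := sqr_ge0 (x2 + y2); nra.
- by have := sqr_ge0 (x1 - y1); have := sqr_ge0 (x2 - y2); nra.
- by have := sqr_ge0 (x1 + y2); have := sqr_ge0 (x2 - y1); nra.
- by have := sqr_ge0 (x1 - y2); have := sqr_ge0 (x2 + y1); nra.
Qed.
Let re_le b a c : `|re b a c| <= eucl b.
Proof. by have [] := sq_ineq (coord_eucl b a) (coord_eucl b c). Qed.
Let im_le b a c : `|im b a c| <= eucl b.
Proof. by have [] := sq_ineq (coord_eucl b a) (coord_eucl b c). Qed.
Let LapPQ b f z : smooth f -> Lap b f z = \sum_a \sum_c (re b a c * P f a c z + im b a c * Q f a c z).
Proof. exact: LapE. Qed.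
Let comb_le b (X Y : 'I_n -> 'I_n -> R) : `|\sum_a \sum_c (re b a c * X a c + im b a c * Y a c)| <=
  (\sum_a \sum_c (`|X a c| + `|Y a c|)) * eucl b.
Proof.
apply: le_trans (ler_norm_sum _ _ _) _; rewrite mulr_suml; apply: ler_sum => a _.
apply: le_trans (ler_norm_sum _ _ _) _; rewrite mulr_suml; apply: ler_sum => c _.
apply: le_trans (ler_normD _ _) _; rewrite !normrM mulrDl; apply: lerD. by rewrite mulrC ler_wpM2l // re_le.
by rewrite mulrC ler_wpM2l // im_le.
Qed.

Lemma Lap_le_eucl f z : smooth f -> exists2 k, 0 <= k & forall b, `|Lap b f z| <= k * eucl b.
Proof.
move=> sf; exists (\sum_a \sum_c (`|P f a c z| + `|Q f a c z|)). by do 2 apply: sumr_ge0 => ? _; rewrite addr_ge0.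
by move=> b; rewrite LapPQ //; exact: comb_le.
Qed.

Lemma Lap_uniform f z0 (e : R) : smooth f -> 0 < e -> exists2 d, 0 < d &
  forall z, `|z - z0| <= d -> forall b, `|Lap b f z - Lap b f z0| <= e * eucl b.
Proof.
move=> sf e0.
have cP a c : continuous (P f a c). by apply: smooth_cont; apply: smoothD; do 2 apply: smooth_dd.
have cQ a c : continuous (Q f a c). by apply: smooth_cont; apply: smoothB; do 2 apply: smooth_dd.
pose S z := \sum_a \sum_c (`|P f a c z - P f a c z0| + `|Q f a c z - Q f a c z0|).
have cS : continuous S. apply: continuous_big => [|a _]; first exact: add_continuous.
  apply: continuous_big => [|c _]; first exact: add_continuous.
  move=> z; apply: cvgD; apply: cvg_norm; apply: cvgB; [exact: cP|exact: cvg_cst|exact: cQ|exact: cvg_cst].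
have S0 : S z0 = 0 by do 2 apply: big1 => ? _; rewrite !subrr normr0 addr0.
have [d d0 dP] := continuous_ball (cS z0) e0.
have d20 : 0 < d / 2 by rewrite divr_gt0.
exists (d / 2) => // z zd b.
have -> : Lap b f z - Lap b f z0 = \sum_a \sum_c (re b a c * (P f a c z - P f a c z0) + im b a c * (Q f a c z - Q f a c z0)).
  rewrite !LapPQ // -sumrB; apply: eq_bigr => a _; rewrite -sumrB; apply: eq_bigr => c _.
  by rewrite !mulrBr opprD addrACA.
apply: le_trans (comb_le _ _ _) _; rewrite ler_wpM2r ?eucl_ge0 // -[leLHS]/(S z).
have := dP z; rewrite S0 sub0r normrN => /(_ _)/wrap[].
  rewrite -ball_normE /= distrC; apply: le_lt_trans zd _; rewrite ltr_pdivrMr //; lra.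
by move=> h; apply: le_trans (ler_norm _) (ltW h).
Qed.

Lemma tst_lipschitz phi : tst phi -> exists2 K, 0 <= K & forall z w, `|phi w - phi z| <= K * `|w - z|.
Proof.
move=> tp; have sp := tst_smooth tp.
have [K K0 KP] := tst_family_bound (fun p : bool * 'I_n => tst_dd (if p.1 then dx R p.2 else dy R p.2) tp).
exists (\sum_(a < n) 2 * K); first by apply: sumr_ge0 => ? _; rewrite mulr_ge0.
move=> z w; have [s _] := smooth_MVT z (w - z) sp (@ltr01 R).
rewrite scale1r [z + _]addrC subrK => ->; rewrite mul1r ddE dd_basis // mulr_suml.
apply: le_trans (ler_norm_sum _ _ _) _; apply: ler_sum => a _; have [v1 v2] := norm_coord (w - z).
have k1 := KP (true, a) (z + s *: (w - z)); have k2 := KP (false, a) (z + s *: (w - z)).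
apply: le_trans (ler_normD _ _) _; rewrite !normrM.
rewrite mulr_natl mulr2n mulrDl; apply: lerD; rewrite mulrC; exact: ler_pM.
Qed.

(** The functions that touch u from above. They have to dominate u on the whole space, for which
    compact support would be too restrictive; constancy outside a ball still gives boundedness and a
    Lipschitz constant. *)
Definition ctf p := exists c : R, tst (fun z => p z - c).

Lemma ctf_smooth p : ctf p -> smooth p.
Proof.
move=> [c tp]; rewrite (_ : p = fun z => (p z - c) + c); last by apply/funext => z; rewrite subrK.
by apply: smoothD; [exact: tst_smooth|exact: smooth_cst].
Qed.

Lemma ctf_bounded p : ctf p -> exists c, forall z, `|p z| <= c.
Proof.
move=> [c tp]; have [k kP] := tst_bounded tp; exists (k + `|c|) => z.
by rewrite -[p z](subrK c); apply: le_trans (ler_normD _ _) _; rewrite lerD2r.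
Qed.

Lemma ctf_bbm p : ctf p -> bbm p.
Proof. by move=> cp; have [c pc] := ctf_bounded cp; apply: smooth_bbm pc; exact: ctf_smooth. Qed.

Lemma ctf_lipschitz p : ctf p -> exists2 K, 0 <= K & forall z w, `|p w - p z| <= K * `|w - z|.
Proof.
move=> [c /tst_lipschitz[K K0 KP]]; exists K => // z w; have := KP z w.
by rewrite (_ : p w - c - (p z - c) = p w - p z) //; ring.
Qed.

End uniform_bounds.

(** * The lower bound on the Monge-Ampere measure, tested against a function *)

Section mass_bound.
Context {R : realType} {n : nat}.
Notation C := (Cn R n).
Notation bC := (borelCn R n).
Notation V := (lebesgueCn R n).
Variables (Om : set C) (oOm : open Om) (c : R) (u f : C -> R).
Hypothesis mf : mfun_on Om f.

(** On the compact set A that carries G, m0 dV <= f dV <= mu; and the integral of G against mu is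
    the pairing with T, up to 2^n. *)
Lemma monge_ampere_ge_pairing : monge_ampere_ge c Om u f ->
  exists2 T : current R n, ddc_power c Om u n T & forall G (A : set C) (m0 : R),
    tst G -> (forall z, 0 <= G z) -> compact A -> A `<=` Om -> (forall z, ~ A z -> G z = 0) ->
    0 <= m0 -> (forall z, A z -> m0 <= f z) ->
    m0 * I G <= 2 ^+ n * cre (pairing Om T finset.setT finset.setT (fun z => (G z)%:C%C)).
Proof.
move=> [mu [rmu [T HT Tmu]] muf]; exists T => // G A m0 tG G0 cA AO GA m00 fm.
have mOm : measurable (Om : set bC) by exact: open_measurableCn.
have mA : measurable (A : set bC) by apply: closed_measurableCn; exact: compact_closedCn.
have mG : measurable_fun [set: bC] (fun z : bC => (G z)%:E).
  by apply/measurable_EFinP; apply: smooth_measurable; exact: tst_smooth.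
have GE0 z : (0 <= (G z)%:E)%E by rewrite lee_fin.
have tf := test_functionP tG cA AO GA.
have -> : 2 ^+ n * cre (pairing Om T finset.setT finset.setT (fun z => (G z)%:C%C)) = \int[mu]_(z in Om) G z.
  have /(congr1 cre) := Tmu G tf; rewrite [in LHS]/cre /= => ->.
  have -> : (2 ^+ n : R[i]) = (2 ^+ n : R)%:C%C by rewrite rmorphXn rmorph_nat. by rewrite ReM /= mul0r subr0.
have supp (m : {measure set bC -> \bar R}) : (\int[m]_(z in Om) (G z)%:E = \int[m]_(z in A) (G z)%:E)%E.
  rewrite [LHS]integral_mkcond [RHS]integral_mkcond; apply: eq_integral => z _; rewrite !patchE.
  case: (boolP (z \in A)) => zA; first by rewrite mem_set //; apply: AO; rewrite inE in zA.
  by rewrite /= GA ?if_same //; rewrite notin_setE in zA.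
have IG : (m0 * I G)%:E = (\int[mscale (NngNum m00) V]_(z in A) (G z)%:E)%E.
  rewrite ge0_integral_mscale //; last exact: measurable_funTS.
  rewrite EFinM -[(NngNum m00)%:num]/m0; congr (_ * _)%E. have iG := nice_integrable (tst_nice tG).
  rewrite /I /Rintegral fineK; last exact: integrable_fin_num.
  rewrite [RHS]integral_mkcond; apply: eq_integral => z _; rewrite patchE.
  by case: (boolP (z \in A)) => // zA; rewrite GA //; rewrite notin_setE in zA.
have fin : (\int[mu]_(z in Om) (G z)%:E \is a fin_num)%E.
  apply: integrable_fin_num => //; apply: (good_integrable oOm rmu cA AO). exact: tst_good.
rewrite -lee_fin [in leRHS]/Rintegral fineK // supp IG.
rewrite (@eq_measure_integral _ bC R (A : set bC) (mrestr (mscale (NngNum m00) V) mA)); last first.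
  by move=> S mS SA; rewrite /= /mrestr setIidl.
apply: ge0_le_measure_integral => // S mS.
have mSA : measurable (S `&` A : set bC) by exact: measurableI.
apply: (@le_trans _ _ (mu (S `&` A))); last by apply: le_measure; rewrite ?inE.
apply: le_trans (muf _ mSA _); last by move=> z [_ /AO].
apply: (@le_trans _ _ (\int[V]_(z in S `&` A) m0%:E)%E). by rewrite integral_cst // /= /mrestr /= lexx.
apply: ge0_le_integral => //.
- apply/measurable_EFinP; by apply: measurable_funS mf => // z [_ /AO].
- by move=> z [_ /fm]; rewrite lee_fin.
Qed.

End mass_bound.

(** * Comparison of Monge-Ampere energies of two smooth functions *)

Section flat_derivatives.
Context {R : realType}.
Implicit Types (s t : R).

Lemma flat_poly_eq0 (q : {poly R}) t : t <= 0 -> flat_poly q t = 0.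
Proof. by rewrite /flat_poly => ->. Qed.

Lemma derive2_flat_eq0 t : t <= 0 -> derive1 (derive1 flat) t = 0.
Proof. by rewrite derive1_flatE derive1_flat_poly; exact: flat_poly_eq0. Qed.

Lemma derive3_flat_eq0 t : t <= 0 -> derive1 (derive1 (derive1 flat)) t = 0.
Proof. by rewrite derive1_flatE !derive1_flat_poly; exact: flat_poly_eq0. Qed.

Lemma smooth1_is_derive (F : R -> R) t : smooth1 F -> is_derive t (1 : R) F (derive1 F t).
Proof. by move=> sF; rewrite derive1E; apply/derivableP; exact: smooth1_derivable. Qed.

Lemma derive1_flat_mono s t : s <= t -> t <= 8^-1 -> derive1 flat s <= derive1 flat t :> R.
Proof.
move=> st t8; have sd : smooth1 (derive1 (@flat R)) by apply: smooth1_derive; exact: smooth1_flat.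
have [x /andP[_ xt] E] := MVT_le (fun x => smooth1_is_derive x sd) st.
by rewrite -subr_ge0 E mulr_ge0 ?subr_ge0 // derive2_flat_ge0 // (le_trans xt).
Qed.

Lemma derive2_flat_mono s t : s <= t -> t <= 8^-1 -> derive1 (derive1 flat) s <= derive1 (derive1 flat) t :> R.
Proof.
move=> st t8; have sd : smooth1 (derive1 (derive1 (@flat R))). by do 2 apply: smooth1_derive; exact: smooth1_flat.
have [x /andP[_ xt] E] := MVT_le (fun x => smooth1_is_derive x sd) st.
by rewrite -subr_ge0 E mulr_ge0 ?subr_ge0 // derive3_flat_ge0 // (le_trans xt).
Qed.

(** An affine minorant can be averaged: the sub-mean inequality of u then bounds averages of flat'
    (u - q + s) from below, although u itself may drop sharply near the contact point. *)
Lemma derive1_flat_ge_affine s t : 0 < s -> t <= 8^-1 -> derive1 flat (s / 2) * (t - s / 2) <= derive1 flat t.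
Proof.
move=> s0 t8; have a0 : 0 <= derive1 flat (s / 2) by exact: derive1_flat_ge0.
case: (lerP (s / 2) t) => [h|h]. apply: le_trans (derive1_flat_mono h t8); rewrite ler_piMr //; lra.
apply: (@le_trans _ _ 0); last exact: derive1_flat_ge0.
by rewrite mulr_ge0_le0 // subr_le0 ltW.
Qed.

End flat_derivatives.

Section comparison.
Context {R : realType} {n : nat}.
Notation C := (Cn R n).
Implicit Types (f g : C -> R) (z b : C).

Lemma Hess_eq_Lap f g z : smooth f -> smooth g -> (forall b, Lap b f z = Lap b g z) -> Hess f z = Hess g z.
Proof.
move=> sf sg H; apply: quad_ext; [exact: herm_Hess..|move=> v].
by have [b ->] := cvec_surj v; rewrite !quad_Hess // H.
Qed.

Lemma Lap_translate a b f z : Lap b (fun w => f (w + a)) z = Lap b f (z + a).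
Proof.
have E v g : dd v (fun w => g (w + a)) = fun w => dd v g (w + a).
  by apply/funext => w; rewrite -!ddE derive_translate.
by rewrite !Lap_def !E.
Qed.

Lemma mm_head0 f hs z : smooth f -> (forall b, Lap b f z = 0) -> mm (f :: hs) z = 0.
Proof.
move=> sf H; have s0 : smooth (fun _ : C => 0 : R) by exact: smooth_cst.
have <- : mm ((fun w => 0 * (fun _ : C => 0 : R) w) :: hs) z = 0 by rewrite mmZ // mul0r.
rewrite !mm_def; congr cre; apply: eq_hmix_head; apply: Hess_eq_Lap => //. exact: smoothZ.
by move=> b; rewrite LapZ // mul0r H.
Qed.

Variables (U q : C -> R) (s : R).
Hypotheses (sU : smooth U) (sq : smooth q).
Let k z := U z - q z + s.
Hypotheses (tP : tst (fun z => flat (k z))) (tG : tst (fun z => derive1 flat (k z))).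
Hypothesis pos : forall z, 0 < k z -> [/\ k z <= 8^-1, forall b, 0 <= Lap b U z & forall b, 0 <= Lap b q z].

Let sk : smooth k.
Proof. by apply: smoothD; [exact: smoothB|exact: smooth_cst]. Qed.
Let LapP b z : Lap b (fun z => flat (k z)) z = derive1 flat (k z) * Lap b k z +
  derive1 (derive1 flat) (k z) * (dd b k z ^+ 2 + dd (Jc b) k z ^+ 2).
Proof. by rewrite Lap_comp //; exact: smooth1_flat. Qed.
Let comparison_step i j : I (fun z => derive1 flat (k z) * mm (U :: nseq i U ++ nseq j q) z) <=
  I (fun z => derive1 flat (k z) * mm (q :: nseq i U ++ nseq j q) z).
Proof.
set l := nseq i U ++ nseq j q.
have sl : smooths l by apply: smooths_cat; exact: smooths_nseq.
have sP := tst_smooth tP.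
have [r rP] := tP.2.
have tmP : tst (mm ((fun z => flat (k z)) :: l)). split; first by apply: smooth_mm; exact: smooths_consI.
  exists r => z rz; apply: mm_head0 => // b.
  rewrite (@Lap_near _ _ _ (fun=> 0) [set w | r < `|w|]) ?Lap_cst //; first exact: open_normgt.
  by move=> w; rewrite inE => /rP.
(* By symmetry this is the integral of flat (k) against a mixed density containing the Hessian of
   the constant 1. *)
have IP0 : I (mm ((fun z => flat (k z)) :: l)) = 0. have s1 : smooth (fun _ : C => 1 : R) by exact: smooth_cst.
  have := mm_sym tP s1 sl. rewrite (@I_ext _ _ _ (fun=> 0)) ?I0; last first.
    by move=> z; rewrite mm_head0 ?mulr0 // => b; rewrite Lap_cst. by move=> ->; apply: I_ext => z; rewrite mul1r.
rewrite -subr_le0 -IB; [|exact: (nice_tstM tG (smooth_mm (smooths_consI sU sl)))|exact: (nice_tstM tG (smooth_mm (smooths_consI sq sl)))].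
rewrite -IP0; apply: le_I.
- by apply: niceB; [exact: (nice_tstM tG (smooth_mm (smooths_consI sU sl)))|exact: (nice_tstM tG (smooth_mm (smooths_consI sq sl)))].
- exact: tst_nice.
move=> z; rewrite -mulrBr -mmB //.
case: (lerP (k z) 0) => k0. rewrite derive1_flat_eq0 // mul0r mm_head0 // => b.
  by rewrite LapP derive1_flat_eq0 // derive2_flat_eq0 // !mul0r addr0.
have [k8 LU Lq] := pos k0; have sUq : smooth (fun w => U w - q w) by exact: smoothB.
rewrite -mmZ //; apply: mm_cons_le => //; first exact: smoothZ. by apply: lpsd_cat; exact: lpsd_nseq.
move=> b; rewrite LapZ // LapP.
have -> : Lap b k z = Lap b (fun w => U w - q w) z. by rewrite /k LapD ?Lap_cst ?addr0 //; exact: smooth_cst.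
by rewrite lerDl mulr_ge0 ?addr_ge0 ?sqr_ge0 // derive2_flat_ge0.
Qed.

(* Replaces [U] by [q] one slot at a time: the integral of [mm (flat (k) :: l)]
   vanishes, and flat being convex near 0 its Hessian dominates [flat' (k)] times that of [k]. *)
Lemma comparison m : I (fun z => derive1 flat (k z) * mm (nseq m U) z) <=
  I (fun z => derive1 flat (k z) * mm (nseq m q) z).
Proof.
suff H i j : I (fun z => derive1 flat (k z) * mm (nseq i U ++ nseq j q) z) <=
    I (fun z => derive1 flat (k z) * mm (nseq (i + j) q) z).
  by have := H m 0%N; rewrite addn0; under [in X in X -> _]I_ext do rewrite cats0.
elim: i j => [|i IH] j //; rewrite addSnnS; apply: le_trans (IH j.+1).
apply: le_trans (comparison_step i j) _; rewrite (@I_ext _ _ _ (fun z => derive1 flat (k z) * mm (nseq i U ++ nseq j.+1 q) z)) //.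
by move=> z /=; rewrite mm_move.
Qed.

End comparison.

Lemma mul_sub_ge0 {R : realFieldType} (x y l m k : R) :
  0 <= x -> x <= y -> l <= m -> 0 <= m -> 0 <= k -> 0 <= x * (k - l) + y * m.
Proof.
move=> x0 xy lm m0 k0; have h : x * l <= y * m.
  by apply: (@le_trans _ _ (x * m)); [exact: ler_wpM2l|exact: ler_wpM2r].
by have : 0 <= x * k := mulr_ge0 x0 k0; rewrite mulrBr; move: h; lra.
Qed.

Section average_bound.
Context {R : realType} {n : nat}.

(** The kernel rho is bounded, and w -> z + d w has Jacobian d^(2n). It turns a lower bound on an
    average into one on the integral. *)
Lemma A_le_I : exists2 k, 0 <= k & forall (d : R) (g : Cn R n -> R) z, 0 < d -> nice g ->
  (forall z, 0 <= g z) -> A d g z <= (k + 1) * d^-1 ^+ (n + n) * I g.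
Proof.
have [k k0 kP] := tst_sup_bound (@tst_rho R n); exists k => // d g z d0 ng g0.
have bg := nice_bbm ng.
have E : (fun w => g (d *: w + z)) = (fun w => g (z + d *: w)) by apply/funext => w; rewrite addrC.
have nga : nice (fun w => g (z + d *: w)). have [mg [m [r gk]]] := ng; split; first by case: (bbm_affine d z bg).
  exists m, ((`|r| + `|z|) / d) => w; have [gk1 gk2] := gk (z + d *: w); split=> // hw; apply: gk2.
  rewrite ltr_pdivrMr // in hw. have : `|d *: w| <= `|z + d *: w| + `|z|.
    by rewrite -{1}(addKr z (d *: w)) addrC; apply: le_trans (ler_normD _ _) _; rewrite normrN addrC.
  by rewrite normrZ gtr0_norm // => h; have := ler_norm r; move: hw h; lra.
rewrite -mulrA -(I_affine z d0 ng) E -IZ //.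
apply: le_I; [exact: nice_A|exact: niceZ|move=> w].
rewrite mulrC ler_wpM2r //; have := kP w; rewrite ler_norml => /andP[_ h]; move: h; lra.
Qed.

End average_bound.

(** * Smooth functions touching u from above *)

Section touching.
Context {R : realType} {n' : nat}.
Notation n := n'.+1.
Notation C := (Cn R n).
Implicit Types (g h : C -> R) (z b w y : C) (s t : R) (i j J : nat).
Variables (Om : set C) (c : R) (u f p : C -> R) (x0 : C) (m0 r0 kap : R).
Hypotheses (oOm : open Om) (c0 : 0 < c) (mf : mfun_on Om f) (su : subm Om u) (MA : monge_ampere_ge c Om u f).
Hypotheses (cp : ctf p) (up : forall z, u z <= p z) (ux : u x0 = p x0).
Hypotheses (m00 : 0 <= m0) (r00 : 0 < r0) (fm : forall z, `|z - x0| <= r0 -> Om z /\ m0 <= f z).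
Hypothesis kap0 : 0 < kap.

Let E0 z := eucl (z - x0).
(** The quadratic term makes the contact strict, so that u - q + s is positive only near x0 for
    small s, and makes q plurisubharmonic in a neighbourhood of x0. *)
Let q z := p z + kap * E0 z.
Let e := r0 / 2.
Let uj j := A (e / j.+2%:R) u.

Let e0 : 0 < e. Proof. by rewrite divr_gt0. Qed.
Let sp : smooth p. Proof. exact: ctf_smooth. Qed.
Let bu : bbm u. Proof. by case: su. Qed.

Lemma touch_smooth_E0 : smooth E0.
Proof. by apply: smooth_translate; exact: smooth_eucl. Qed.
Let sE0 := touch_smooth_E0.

Let LapE0 b z : Lap b E0 z = 4 * eucl b.
Proof. by rewrite /E0 Lap_translate Lap_eucl. Qed.
Let sq : smooth q.
Proof. by apply: smoothD => //; exact: smoothZ. Qed.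
Let Lapq b z : Lap b q z = Lap b p z + 4 * kap * eucl b.
Proof. by rewrite LapD //; [rewrite LapZ // LapE0; ring|exact: smoothZ]. Qed.

(** At x0 the function p inherits the sub-mean inequality of u, which it dominates and equals
    there. *)
Lemma touch_Lap_ge0 b : 0 <= Lap b p x0.
Proof.
pose k := `|b| + `|Jc b| + 1.
have k0 : 0 < k by rewrite ltr_wpDl // addr_ge0.
apply: (@submean_Lap_ge0 _ _ p x0 b (r0 / k)) => //; first exact: divr_gt0.
move=> r /andP[r1 r2]; rewrite -ux.
have [_ _ /(_ x0 (r *: b))/(_ _)/wrap[]] := su. move=> p' q' pq; have [] // := @fm (x0 + cscale p' q' (r *: b)) _.
  rewrite addrAC subrr add0r cscaleZ normrZ gtr0_norm //.
  apply: (@le_trans _ _ (r * k)); last by rewrite -ler_pdivlMr // ltW.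
  rewrite ler_wpM2l ?(ltW r1) //; apply: le_trans (norm_cscale_le b pq) _. by rewrite lerDl.
move=> h; apply: le_trans h _; apply: le_cmean => //; exact: ctf_bbm.
Qed.
Let near z := `|z - x0| <= e.

Let near_room z : near z -> room Om e z.
Proof.
move=> nz w we; have [] // := @fm w _; rewrite -(subrK z w) -addrA.
by apply: le_trans (ler_normD _ _) _; rewrite [r0]splitr; apply: lerD.
Qed.
Let dj j : 0 < e / j.+2%:R. Proof. by rewrite divr_gt0. Qed.
Let dje j : e / j.+2%:R < e.
Proof. by rewrite ltr_pdivrMr // ltr_pMr // ltr1n. Qed.
Let sU j : smooth (uj j). Proof. exact: smooth_A. Qed.
Let LapU j z b : near z -> 0 <= Lap b (uj j) z.
Proof. by move=> /near_room; apply: (@Lap_A_ge0 _ _ _ (e / j.+2%:R) e) => //; rewrite dj dje. Qed.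
Let Udec i j z : near z -> (i <= j)%N -> uj j z <= uj i z.
Proof.
move=> /near_room rz ij; apply: (@A_mono _ _ Om _ _ e) => //; rewrite dj /=.
by rewrite ler_wpM2l ?(ltW e0) // lef_pV2 ?posrE // ler_nat.
Qed.
Let Uge j z : near z -> u z <= uj j z.
Proof.
move=> /near_room rz; apply: (@le_A _ _ Om) => //; first exact: ltW.
by apply: room_le rz; exact: ltW.
Qed.
(** The average of u is at most a value of p within distance e / (j + 2), and p is Lipschitz; hence
    uniformity in z. *)
Let Uq s : 0 < s -> exists N, forall j z, (N <= j)%N -> uj j z <= p z + s.
Proof.
move=> s0; have [K K0 KP] := ctf_lipschitz cp.
have [N _ HN] := near_infty_natSinv_lt (PosNum (divr_gt0 s0 (ltr_wpDl (mulr_ge0 K0 (ltW e0)) (@ltr01 R)))).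
exists N => j z Nj; apply: A_near_le => //; first exact: ltW.
move=> y yz; apply: le_trans (up y) _; rewrite -lerBlDl; apply: le_trans (ler_norm _) _.
apply: le_trans (KP z y) _.
have := HN j Nj => /=; rewrite ltr_pdivlMr; last by rewrite ltr_wpDl // mulr_ge0 // ltW.
move=> h; apply: le_trans (ltW h); apply: le_trans (ler_wpM2l K0 yz) _.
have h2 : (j.+2%:R : R)^-1 <= j.+1%:R^-1 by rewrite lef_pV2 ?posrE // ler_nat.
rewrite mulrA; apply: (@le_trans _ _ (K * e * j.+1%:R^-1)). by rewrite ler_wpM2l // mulr_ge0 // ltW.
by rewrite mulrC ler_wpM2l // lerDl.
Qed.
Let M := Num.max 0 (projT1 (cid bu.2)).
Let M0 : 0 <= M. Proof. by rewrite le_max lexx. Qed.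
Let uM z : `|u z| <= M.
Proof. by apply: le_trans (projT2 (cid bu.2) z) _; rewrite le_max lexx orbT. Qed.
Let ujM j z : `|uj j z| <= M.
Proof. by apply: A_bound => //; exact: ltW. Qed.
(** Since Ap rh = M + 1, [w_] is at most -1 for E0 >= 3 rh = e^2 and at least 1 for E0 <= rh. Hence
    [h_] has compact support and equals [w_] near x0, where its Hessian is that of [uj] minus that
    of Ap |z|^2; [hplus] with the constant Ap restores the Hessian of [uj]. *)
Let rh := e ^+ 2 / 3.
Let rh0 : 0 < rh. Proof. by rewrite divr_gt0 // exprn_gt0. Qed.
Let Ap := (M + 1) / rh.
Let Ap0 : 0 <= Ap. Proof. by rewrite divr_ge0 ?(ltW rh0) // addr_ge0. Qed.
Let Aprh : Ap * rh = M + 1. Proof. by rewrite /Ap divfK // gt_eqF. Qed.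
Let E0_near z : E0 z <= 3 * rh -> near z.
Proof.
move=> h; rewrite /near -(ler_pXn2r (ltn0Sn 1)) ?nnegrE ?(ltW e0) //.
by apply: le_trans (eucl_norm _) _; apply: le_trans h _; rewrite /rh; lra.
Qed.
Let w_ j z := uj j z - Ap * (E0 z - 2 * rh).
Let h_ j z := smax (w_ j z).

Let sw j : smooth (w_ j).
Proof.
apply: smoothB => //; apply: smoothZ; apply: smoothB => //; exact: smooth_cst.
Qed.
Let LapAE b z : Lap b (fun z => Ap * (E0 z - 2 * rh)) z = Ap * (4 * eucl b).
Proof.
have s2 : smooth (fun _ : C => 2 * rh) by exact: smooth_cst.
by rewrite LapZ; [rewrite LapB // Lap_cst subr0 LapE0|exact: smoothB].
Qed.
Let sAE : smooth (fun z => Ap * (E0 z - 2 * rh)).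
Proof. by apply: smoothZ; apply: smoothB => //; exact: smooth_cst. Qed.
Let w_far j z : 3 * rh <= E0 z -> w_ j z <= -1.
Proof.
move=> h; have := ujM j z; rewrite ler_norml => /andP[_ h2].
have h3 : Ap * rh <= Ap * (E0 z - 2 * rh) by rewrite ler_wpM2l //; lra.
by rewrite /w_; move: h3; rewrite Aprh; lra.
Qed.
Let w_close j z : E0 z <= rh -> 1 <= w_ j z.
Proof.
move=> h; have := ujM j z; rewrite ler_norml => /andP[h2 _].
have h3 : Ap * (E0 z - 2 * rh) <= Ap * (- rh) by rewrite ler_wpM2l //; lra.
by rewrite /w_; move: h3; rewrite mulrN Aprh; lra.
Qed.
Let th j : tst (h_ j).
Proof.
have [s1 [z1 _ _ _] _ _] := @smaxP R; split; first exact: smooth_comp.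
exists (`|x0| + e) => z hz; apply: z1; apply: w_far.
have h1 : e <= `|z - x0|. rewrite -(lerD2l `|x0|); apply: le_trans (ltW hz) _.
  by rewrite -{1}(subrK x0 z) addrC; exact: ler_normD.
apply: le_trans (eucl_norm _); apply: (@le_trans _ _ (e ^+ 2)); first by rewrite /rh; lra.
by rewrite ler_pXn2r ?nnegrE ?(ltW e0).
Qed.
Let h0 j z : 0 <= h_ j z.
Proof.
have [_ [_ _ h _] _ _] := @smaxP R.
by apply: le_trans (h (w_ j z)); rewrite le_max lexx orbT.
Qed.
Let smax_mono s t : s <= t -> smax s <= smax t.
Proof.
move=> st; have [s1 _ [d0 _ _ _] _] := @smaxP R.
have [x _ E] := MVT_le (fun x => smooth1_is_derive x s1) st.
by rewrite -subr_ge0 E mulr_ge0 // subr_ge0.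
Qed.
Let hdecr i j z : (i <= j)%N -> h_ j z <= h_ i z.
Proof.
move=> ij; case: (lerP (3 * rh) (E0 z)) => hz. have [_ [z1 _ _ _] _ _] := @smaxP R.
  by rewrite /h_ (z1 (w_ j z)) ?(z1 (w_ i z)) ?w_far.
apply: smax_mono; rewrite /w_ lerD2r; apply: Udec => //; apply: E0_near; exact: ltW.
Qed.
Let hA j z b : 0 <= Lap b (h_ j) z + Ap * Lap b eucl z.
Proof.
have [s1 _ [d0 d1 d2 _] dd0] := @smaxP R.
have e4 : 0 <= Ap * (4 * eucl b) by rewrite mulr_ge0 // mulr_ge0 // eucl_ge0.
rewrite Lap_comp // Lap_eucl addrAC addr_ge0 //; last by rewrite mulr_ge0 ?dd0 // addr_ge0 ?sqr_ge0.
case: (lerP (3 * rh) (E0 z)) => hz; first by rewrite (d2 (w_ j z)) ?w_far // mul0r add0r.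
have -> : Lap b (w_ j) z = Lap b (uj j) z - Ap * (4 * eucl b). by rewrite /w_ LapB // LapAE.
have hU : 0 <= Lap b (uj j) z by apply: LapU; apply: E0_near; exact: ltW.
rewrite mulrBr -addrA addr_ge0 ?mulr_ge0 ?d0 //.
by rewrite addrC subr_ge0 ler_piMl // d1.
Qed.
Let Hess_hplus j z : E0 z < rh -> Hess (hplus h_ Ap j) z = Hess (uj j) z.
Proof.
move=> hz; have se := @smooth_eucl R n.
have [_ [_ z2 _ _] _ _] := @smaxP R.
apply: Hess_eq_Lap => //; first exact: (smooth_hplus Ap th j).
move=> b; rewrite /hplus LapD //; last exact: smoothZ. have oW : open [set y | E0 y < rh].
    have : continuous E0 by exact: smooth_cont. by move/continuousP/(_ _ (@open_lt R rh)).
  rewrite (@Lap_near _ _ (h_ j) (w_ j) [set y | E0 y < rh]) //; last first.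
    by move=> y; rewrite inE /= => hy; rewrite /h_ z2 //; apply: w_close; exact: ltW.
  by rewrite /w_ LapB // LapAE (LapZ b Ap z se) Lap_eucl subrK.
exact: tst_smooth.
Qed.
Let G s J z := derive1 flat (uj J z - q z + s).

Let sG s J : smooth (fun z => uj J z - q z + s).
Proof. by apply: smoothD; [exact: smoothB|exact: smooth_cst]. Qed.
Let G_supp s J z : (forall y, uj J y <= p y + s) -> 2 * s < kap * E0 z -> uj J z - q z + s <= 0.
Proof. by move=> /(_ z) h1 h2; rewrite /q; lra. Qed.
Let tst_far (F : R -> R) s J : smooth1 F -> (forall t, t <= 0 -> F t = 0) -> 0 <= s ->
  (forall y, uj J y <= p y + s) -> tst (fun z => F (uj J z - q z + s)).
Proof.
move=> sF F0 s0 H; split; first exact: smooth_comp.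
exists (`|x0| + (2 * s / kap + 1)) => z hz; apply: F0; apply: G_supp => //.
have h1 : 2 * s / kap + 1 <= `|z - x0|. rewrite -(lerD2l `|x0|); apply: le_trans (ltW hz) _.
  by rewrite -{1}(subrK x0 z) addrC; exact: ler_normD.
have h2 : 0 <= 2 * s / kap by rewrite divr_ge0 ?mulr_ge0 // ltW.
rewrite [kap * _]mulrC -ltr_pdivrMr //; apply: lt_le_trans (eucl_norm _).
set a := 2 * s / kap in h1 h2 *; set b := `|z - x0| in h1 *; nra.
Qed.
(** The bound must not depend on J. The average of G around x0 at a small scale d is at least that
    of a (u - u x0 + s / 4), by the affine minorant of flat', and the sub-mean inequality bounds the
    latter by a s / 4. *)
Let I_G_lower s : 0 < s -> 2 * s <= 8^-1 -> exists2 sg, 0 < sg & forall J,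
  (forall y, uj J y <= p y + s) -> sg <= I (G s J).
Proof.
move=> s0 s8; pose a := derive1 (@flat R) (s / 2).
have a0 : 0 < a by apply: derive1_flat_gt0; rewrite divr_gt0.
have [d [d0 de dq]] : exists d, [/\ 0 < d, d <= e & forall y, `|y - x0| <= d -> q y <= q x0 + s / 4].
  have s40 : 0 < s / 4 by rewrite divr_gt0. have [d d0 dP] := continuous_ball (smooth_cont sq (x := x0)) s40.
  exists (Num.min (d / 2) e); split; rewrite ?lt_min ?e0 ?divr_gt0 //; first by rewrite ge_min lexx orbT.
  move=> y; rewrite le_min => /andP[yd _]; have := dP y => /(_ _)/wrap[].
    rewrite -ball_normE /= distrC; apply: le_lt_trans yd _; rewrite ltr_pdivrMr //; lra.
  rewrite ltr_norml => /andP[h _]; move: h; lra.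
have [Kr Kr0 KrP] := @A_le_I R n.
pose D := d^-1 ^+ (n + n).
have D0 : 0 < D by rewrite exprn_gt0 // invr_gt0.
have KD0 : 0 < (Kr + 1) * D by rewrite mulr_gt0 // ltr_wpDl.
exists (a * (s / 4) / ((Kr + 1) * D)); first by rewrite divr_gt0 // mulr_gt0 // divr_gt0.
move=> J H; have tG : tst (G s J).
  by apply: tst_far => //; [apply: smooth1_derive; exact: smooth1_flat|exact: derive1_flat_eq0|exact: ltW].
have nG := tst_nice tG.
have bG := nice_bbm nG.
have k8 z : uj J z - q z + s <= 8^-1.
  have := H z; rewrite /q; have : 0 <= kap * E0 z by rewrite mulr_ge0 ?eucl_ge0 // ltW. by move: s8; lra.
have G0 z : 0 <= G s J z by exact: derive1_flat_ge0.
rewrite ler_pdivrMr // [leRHS]mulrC.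
apply: (@le_trans _ _ (A d (G s J) x0)). have nr := @nice_rho R n.
  have nu : nice (fun w => u (x0 + d *: w) * rho w) by exact: nice_A.
  apply: (@le_trans _ _ (I (fun w => a * (u (x0 + d *: w) * rho w) + a * (s / 4 - u x0) * rho w))).
    rewrite ID ?IZ ?I_rho ?mulr1; [|exact: nr|exact: nu|exact: niceZ|exact: niceZ].
    have h : u x0 <= I (fun w => u (x0 + d *: w) * rho w).
      by apply: (le_A (Om := Om)) => //; [exact: ltW|apply: (@room_le _ _ Om e) => //; apply: near_room; rewrite /near subrr normr0 ltW].
    rewrite -mulrDr ler_wpM2l ?(ltW a0) //; move: h; lra.
  apply: le_I; [by apply: niceD; exact: niceZ|exact: nice_A|move=> w].
  rewrite (_ : _ + _ = a * (u (x0 + d *: w) + s / 4 - u x0) * rho w); last by ring.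
  apply: rho_le_mul => hw; set y := x0 + d *: w. have yd : `|y - x0| <= d.
    rewrite /y addrAC subrr add0r normrZ gtr0_norm // ler_piMr ?(ltW d0) //.
    by apply: le_trans (norm_quarter hw) _; rewrite invf_le1 // ler1n.
  apply: le_trans (derive1_flat_ge_affine s0 (k8 y)); rewrite ler_wpM2l ?(ltW a0) //.
  have h1 := dq y yd; have h2 : u y <= uj J y by apply: Uge; exact: le_trans yd de.
  move: h1; have -> : q x0 = u x0 by rewrite /q /E0 subrr eucl0 mulr0 addr0. by move: h2; lra.
exact: KrP.
Qed.
Let cdd2 : continuous (mm (nseq n q)).
Proof. by apply: smooth_cont; apply: smooth_mm; exact: smooths_nseq. Qed.
Let compact_E0 (k : R) : 0 <= k -> compact [set z | E0 z <= k].
Proof.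
move=> k0; apply: (@subclosed_compact _ _ [set z : C | `|z| <= `|x0| + (k + 1)]).
- have cE : continuous E0 by exact: smooth_cont. rewrite (_ : [set z | E0 z <= k] = E0 @^-1` [set t | t <= k]) //.
  by apply: closed_comp => [z _|]; [exact: cE|exact: closed_le].
- exact: normle_compact.
move=> z /= hz.
have h1 : `|z - x0| <= k + 1. have : `|z - x0| ^+ 2 <= k by exact: le_trans (eucl_norm _) hz.
  rewrite expr2; set t := `|z - x0| => ht; have : 0 <= t by exact: normr_ge0. by nra.
by rewrite -(subrK x0 z) addrC; apply: le_trans (ler_normD _ _) _; rewrite lerD2l.
Qed.
Let nth_map_default (F : nat -> C -> R) (F' : nat -> C -> R) (l : seq nat) z :
  (forall j, Hess (F j) z = Hess (F' j) z) -> mm (map F l) z = mm (map F' l) z.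
Proof.
move=> H; apply: mm_congr => [|k]; first by rewrite !size_map.
case: (ltnP k (size l)) => kl; first by rewrite !(nth_map 0%N).
by rewrite !nth_default ?size_map.
Qed.

(** Suppose the inequality fails by 2 th0. Testing the hypothesis on u with G = flat' (uj J - q + s)
    gives m0 I G <= cn (Iq + eta): the iterated limit is bounded by the diagonal value at J
    ([energy_compare]), where [comparison] replaces uj J by q. But cn mm q^n <= m0 - th0 on the set
    B carrying G, so th0 sg <= cn eta = th0 sg / 2. *)
Lemma touch_mm : m0 <= (2 * c) ^+ n * mm (nseq n q) x0.
Proof.
rewrite leNgt; apply/negP => lt0.
set cn := (2 * c) ^+ n in lt0; have cn0 : 0 < cn by rewrite exprn_gt0 // mulr_gt0.
pose th0 := (m0 - cn * mm (nseq n q) x0) / 2.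
have th00 : 0 < th0 by rewrite divr_gt0 // subr_gt0.
have [d1 d10 d1P] : exists2 d, 0 < d & forall z, `|z - x0| <= d -> cn * mm (nseq n q) z <= m0 - th0.
  have e1 : 0 < th0 / cn by rewrite divr_gt0. have [d d0 dP] := continuous_ball (@cdd2 x0) e1.
  exists (d / 2); first by rewrite divr_gt0. move=> z zd; have := dP z => /(_ _)/wrap[].
    rewrite -ball_normE /= distrC; apply: le_lt_trans zd _; rewrite ltr_pdivrMr //; lra.
  rewrite ltr_norml => /andP[h _]; move: h; rewrite ltrBrDl ltrBlDl => h.
  have : cn * mm (nseq n q) z < cn * (th0 / cn + mm (nseq n q) x0) by rewrite ltr_pM2l // addrC -ltrBlDl.
  rewrite mulrDr [cn * (_ / _)]mulrC divfK ?gt_eqF //.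
  rewrite (_ : m0 - th0 = th0 + cn * mm (nseq n q) x0); last by rewrite /th0; field. exact: ltW.
have k40 : 0 < 4 * kap by rewrite mulr_gt0.
have [d2 d20 d2P] := Lap_uniform x0 sq k40.
have [Kq Kq0 KqP] := Lap_le_eucl x0 sq.
pose d := Num.min (Num.min d1 d2) e.
have d0 : 0 < d by rewrite !lt_min d10 d20 e0.
pose bet := Num.min (d ^+ 2) (rh / 2).
have bet0 : 0 < bet by rewrite lt_min exprn_gt0 // divr_gt0.
have betP z : E0 z <= bet -> [/\ `|z - x0| <= d1, `|z - x0| <= d2, near z & E0 z < rh].
  rewrite le_min => /andP[h1 h2]. have : `|z - x0| <= d.
    rewrite -(ler_pXn2r (ltn0Sn 1)) ?nnegrE ?(ltW d0) //; exact: le_trans (eucl_norm _) h1.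
  rewrite !le_min => /andP[/andP[h3 h4] h5]; split=> //.
  by apply: le_lt_trans h2 _; rewrite ltr_pdivrMr // ltr_pMr // ltr1n.
(* As uj J <= p + s, the argument uj J - q + s is at most 2 s - kap E0. The first bound on s keeps
   it below 1/8, the second makes it nonpositive outside B. *)
pose s := Num.min 16^-1 (kap * bet / 2).
have s0 : 0 < s by rewrite lt_min invr_gt0 ltr0n /= divr_gt0 // mulr_gt0.
have s8 : 2 * s <= 8^-1. have : s <= 16^-1 by rewrite ge_min lexx. lra.
have sb : 2 * s <= kap * bet. have : s <= kap * bet / 2 by rewrite ge_min lexx orbT. lra.
pose B := [set z | E0 z <= bet].
have cB : compact B by apply: compact_E0; exact: ltW.
have BO : B `<=` Om. move=> z /betP[_ _ /near_room rz _]; apply: rz; by rewrite subrr normr0 ltW.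
have Bf z : B z -> m0 <= f z.
  move=> /betP[_ _ nz _]; have [] // := @fm z _; apply: le_trans nz _; have := r00; rewrite /e; lra.
have [sg sg0 sgP] := I_G_lower s0 s8.
have [N1 N1P] := Uq s0.
pose D2 := derive1 (derive1 (@flat R)) 8^-1.
have D20 : 0 <= D2 by exact: derive2_flat_ge0.
(* The only negative part of the Laplacian of G is - flat'' Lap q >= - D2 (Kq + 4 kap) |b|^2, while
   |z|^2 has Laplacian 4 |b|^2. The constant is free of J, so N can be chosen first. *)
pose A' := D2 * (Kq + 4 * kap) / 4.
have A'0 : 0 <= A' by rewrite !mulr_ge0 // ltW // ltr_wpDl.
pose eta := th0 * sg / (2 * cn).
have eta0 : 0 < eta by apply: divr_gt0; apply: mulr_gt0.
have [N NP] := energy_compare th h0 hdecr Ap0 hA n' A'0 eta0.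
pose J := maxn N N1.
have JP y : uj J y <= p y + s by apply: N1P; exact: leq_maxr.
have tG : tst (G s J).
  by apply: tst_far => //; [apply: smooth1_derive; exact: smooth1_flat|exact: derive1_flat_eq0|exact: ltW].
have G0 z : 0 <= G s J z by exact: derive1_flat_ge0.
have kB z : 0 < uj J z - q z + s -> B z. move=> hz; rewrite /B /= leNgt; apply/negP => hB.
  suff : uj J z - q z + s <= 0 by rewrite leNgt hz.
  by apply: G_supp => //; apply: le_lt_trans sb _; rewrite ltr_pM2l.
have GB z : ~ B z -> G s J z = 0. move=> nB; apply: derive1_flat_eq0; rewrite leNgt; apply/negP => /kB; exact: nB.
have k8 z : uj J z - q z + s <= 8^-1.
  have := JP z; rewrite /q; have : 0 <= kap * E0 z by rewrite mulr_ge0 ?eucl_ge0 // ltW. by move: s8; lra.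
have Lq z b : B z -> 0 <= Lap b q z <= (Kq + 4 * kap) * eucl b.
  move=> /betP[_ /d2P/(_ b) + _ _]; rewrite ler_norml => /andP[h1 h2].
  have := KqP b; rewrite ler_norml => /andP[_ h3].
  have h4 := touch_Lap_ge0 b; move: h1 h2 h3; rewrite [Lap b q x0]Lapq => h1 h2 h3.
  by apply/andP; split; move: h1 h2 h3 h4; lra.
have GA' z b : 0 <= Lap b (G s J) z + A' * Lap b eucl z.
  have e4 : 0 <= A' * (4 * eucl b) by rewrite mulr_ge0 // mulr_ge0 // eucl_ge0.
  rewrite Lap_eucl /G (Lap_comp b (F := derive1 flat)); [|by apply: smooth1_derive; exact: smooth1_flat|exact: sG].
  case: (lerP (uj J z - q z + s) 0) => hk. by rewrite derive2_flat_eq0 // derive3_flat_eq0 // !mul0r !add0r.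
  have zB := kB _ hk; have /andP[_ L2] := Lq z b zB. have [_ _ nz _] := betP z zB.
  rewrite addrAC addr_ge0 //; last by rewrite mulr_ge0 ?derive3_flat_ge0 // addr_ge0 ?sqr_ge0.
  have -> : Lap b (fun z => uj J z - q z + s) z = Lap b (uj J) z - Lap b q z.
    have ss : smooth (fun _ : C => s) by exact: smooth_cst.
    by rewrite (LapD _ _ (smoothB (sU J) sq) ss) Lap_cst addr0 LapB.
  have dd1 : 0 <= derive1 (derive1 flat) (uj J z - q z + s) by exact: derive2_flat_ge0.
  have dd2 : derive1 (derive1 flat) (uj J z - q z + s) <= D2 by apply: derive2_flat_mono. have LU := LapU J b nz.
  have -> : A' * (4 * eucl b) = D2 * ((Kq + 4 * kap) * eucl b) by rewrite /A'; field.
  apply: mul_sub_ge0 dd1 dd2 L2 _ LU. by rewrite mulr_ge0 ?eucl_ge0 // ltW // ltr_wpDl.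
have [T HT TP] := monge_ampere_ge_pairing oOm mf MA.
have F0 := TP (G s J) B m0 tG G0 cB BO GB m00 Bf.
pose Iq := I (fun z => G s J z * mm (nseq n q) z).
have IU : I (fun z => G s J z * mm (nseq n (uj J)) z) <= Iq. apply: (comparison (sU J) sq) => //.
    by apply: tst_far => //; [exact: smooth1_flat|exact: flat0|exact: ltW].
  move=> z hz; have zB := kB _ hz; have [_ _ nz _] := betP z zB.
  by split=> // b; [exact: LapU|case/andP: (Lq z b zB)].
have Hj z j : B z -> Hess (hplus h_ Ap j) z = Hess (uj j) z. by move=> /betP[_ _ _ hz]; exact: Hess_hplus.
have F2 l : size l = n -> all (leq J) l -> I (fun z => G s J z * mm (map uj l) z) <= Iq + eta.
  move=> sl lJ; rewrite -lerBlDr; apply: le_trans IU.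
  rewrite (@I_ext _ _ _ (fun z => G s J z * mm (map (hplus h_ Ap) l) z)); last first.
    move=> z; case: (pselect (B z)) => zB; last by rewrite GB // !mul0r.
    by congr (_ * _); apply: nth_map_default => j; rewrite Hj.
  apply: le_trans (NP (G s J) J l tG GA' sl (leq_maxl _ _) lJ) _.
  rewrite le_eqVlt; apply/orP; left; apply/eqP; apply: I_ext => z.
  case: (pselect (B z)) => zB; last by rewrite GB // !mul0r.
  by congr (_ * _); rewrite -!map_nseq; apply: nth_map_default => j; rewrite Hj.
have F3 : cre (pairing Om T finset.setT finset.setT (fun z => (G s J z)%:C%C)) <= c ^+ n * (Iq + eta).
  have cT : #|[set: 'I_n]%SET| = n by rewrite cardsT card_ord.
  have := @ddc_power_ilim _ _ Om oOm c u uj M n T sU bu.1 ujM HT _ _ (G s J) B cT cT tG cB BO GB.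
  move=> /(_ _)/wrap[]. by move=> z /betP[_ _ /near_room rz _]; exact: (A_cvg e0 su rz).
  move=> h; apply: (ilim_le (N := J) h) => l sl lJ. have cn00 : 0 <= c ^+ n by rewrite exprn_ge0 // ltW.
  rewrite ReM /= mul0r subr0 ler_wpM2l //; apply: le_trans (F2 l sl lJ).
  rewrite le_eqVlt; apply/orP; left; apply/eqP; apply: I_ext => z. by rewrite ReM /= mul0r subr0 mm_def.
have F4 : m0 * I (G s J) <= cn * (Iq + eta). by apply: le_trans F0 _; rewrite /cn exprMn -mulrA ler_wpM2l //.
have F5 : cn * Iq <= (m0 - th0) * I (G s J). have nG := nice_tstM tG (smooth_mm (smooths_nseq n sq)).
  rewrite /Iq -!IZ //; last exact: tst_nice.
  apply: le_I; [exact: niceZ|by apply: niceZ; exact: tst_nice|move=> z].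
  case: (pselect (B z)) => zB; last by rewrite GB // !(mul0r, mulr0).
  rewrite mulrCA mulrC ler_wpM2r //; apply: d1P; by case/betP: zB.
have F6 := sgP J JP.
have : th0 * sg <= cn * eta. apply: (@le_trans _ _ (th0 * I (G s J))); first by rewrite ler_wpM2l // ltW.
  by move: F4 F5; rewrite mulrDr mulrBl; lra.
rewrite /eta (_ : cn * (th0 * sg / (2 * cn)) = th0 * sg / 2); last by field; rewrite gt_eqF.
have : 0 < th0 * sg by rewrite mulr_gt0.
lra.
Qed.

(** The arithmetic-geometric inequality for the positive matrix Hess q x0, whose determinant
    [touch_mm] bounds from below. *)
Lemma touch_sum (lam : R) (Bm : 'M[R[i]]_n) (bs : 'I_n -> C) : 0 <= lam ->
  n`!%:R * (2 * c) ^+ n * lam ^+ n <= m0 -> `|\det Bm| = 1 -> (forall j : 'I_n, cvec (bs j) = row j Bm) ->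
  4 * n%:R * lam <= \sum_(j < n) Lap (bs j) p x0 + 4 * kap * \sum_(j < n) eucl (bs j).
Proof.
move=> l0 lm dB bsE.
have pq : psd (Hess q x0). apply: psd_Hess => // b; rewrite Lapq addr_ge0 ?touch_Lap_ge0 //.
  by rewrite mulr_ge0 ?eucl_ge0 // mulr_ge0 // ltW.
have mE : mixed (nseq n (Hess q x0)) finset.setT finset.setT = n`!%:R * \det (Hess q x0) by exact: mixed_det.
have m_ge : 0 <= mixed (nseq n (Hess q x0)) finset.setT finset.setT.
  by apply: mixed_psd_ge0 => X; rewrite mem_nseq => /andP[_ /eqP ->].
have n0 : 0 < n`!%:R :> R by rewrite ltr0n fact_gt0.
have detge : 0 <= \det (Hess q x0). by move: m_ge; rewrite mE pmulr_rge0 // ltr0n fact_gt0.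
pose D := cre (\det (Hess q x0)).
have DE : \det (Hess q x0) = D%:C%C.
  by rewrite /D; move: detge; case: (\det _) => x y /=; rewrite lecE /= => /andP[/eqP -> _].
have lD : lam ^+ n <= D. have cn0 : 0 < (2 * c) ^+ n by rewrite exprn_gt0 // mulr_gt0.
  have k0 : 0 < n`!%:R * (2 * c) ^+ n by rewrite mulr_gt0.
  rewrite -(ler_pM2l k0); apply: le_trans lm _; apply: le_trans touch_mm _.
  rewrite mm_def /hmix map_nseq mE DE -[(n`!%:R : R[i])](rmorph_nat (real_complex R)) ReM /= mul0r subr0.
  by rewrite mulrA [(2 * c) ^+ n * _]mulrC.
have := @psd_AGM _ n (Hess q x0) Bm (lam%:C%C) pq.
rewrite real_ge0 DE -rmorphXn lecR => /(_ l0 lD dB).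
under eq_bigr do rewrite -bsE quad_Hess //.
rewrite -[(n%:R : R[i])](rmorph_nat (real_complex R)) -rmorphM -rmorph_sum lecR => h.
have E : \sum_j (Lap (bs j) q x0 / 4) = 4^-1 * (\sum_j Lap (bs j) p x0 + 4 * kap * \sum_j eucl (bs j)).
  rewrite mulr_sumr -big_split mulr_sumr; apply: eq_bigr => j _ /=; by rewrite Lapq mulrC.
by move: h; rewrite E -mulrA; lra.
Qed.

End touching.

(** The quadratic perturbation is removed by letting kap tend to 0. *)
Lemma touching {R : realType} {n : nat} (Om : set (Cn R n)) (c : R) (u f p : Cn R n -> R) (x0 : Cn R n)
    (m0 r0 lam : R) (Bm : 'M[R[i]]_n) (bs : 'I_n -> Cn R n) :
  open Om -> 0 < c -> measurable_fun (Om : set (borelCn R n)) (f : borelCn R n -> measurableTypeR R) ->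
  subm Om u -> monge_ampere_ge c Om u f -> ctf p -> (forall z, u z <= p z) -> u x0 = p x0 ->
  0 < r0 -> (forall z, `|z - x0| <= r0 -> Om z /\ m0 <= f z) ->
  0 <= lam -> n`!%:R * (2 * c) ^+ n * lam ^+ n <= m0 -> `|\det Bm| = 1 ->
  (forall j, cvec (bs j) = row j Bm) -> 4 * n%:R * lam <= \sum_j Lap (bs j) p x0.
Proof.
case: n Om u f p x0 Bm bs => [|n'] Om u f p x0 Bm bs. by move=> *; rewrite big_ord0 mulr0 mul0r.
move=> oOm c0 mf su MA cp up ux r00 fm l0 lm dB bsE.
have m00 : 0 <= m0 by apply: le_trans lm; rewrite !mulr_ge0 // exprn_ge0 // mulr_ge0 // ltW.
have H kap : 0 < kap -> 4 * n'.+1%:R * lam <= \sum_j Lap (bs j) p x0 + 4 * kap * \sum_j eucl (bs j).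
  by move=> k0; exact: (touch_sum oOm c0 mf su MA cp up ux m00 r00 fm k0 l0 lm dB bsE).
apply/ler_addgt0Pr => e e0; pose S := \sum_j eucl (bs j).
have S0 : 0 <= S by apply: sumr_ge0 => j _; exact: eucl_ge0.
have k0 : 0 < e / (4 * (S + 1)) by rewrite divr_gt0 // mulr_gt0 // ltr_wpDl.
apply: le_trans (H _ k0) _; rewrite lerD2l.
rewrite (_ : 4 * (e / (4 * (S + 1))) * _ = e * (S / (S + 1))); last first.
  by rewrite /S; field; rewrite gt_eqF // ltr_wpDl.
rewrite ler_piMr ?(ltW e0) // ler_pdivrMr ?mul1r ?lerDl // ltr_wpDl //.
Qed.

(** * Cluster points of sequences; maxima of upper semicontinuous functions *)

Section compact_sequences.
Context {R : realType} {n : nat}.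
Notation C := (Cn R n).
Implicit Types (A : set C) (g : C -> R) (z y x : C) (k N : nat).

Lemma compact_seq A (z_ : nat -> C) : compact A -> (forall k, A (z_ k)) ->
  exists2 x, A x & forall e : R, 0 < e -> forall N, exists2 k, (N <= k)%N & `|z_ k - x| <= e.
Proof.
move=> cA Az; have [|x [Ax clx]] := cA (z_ @ \oo); first by exists 0%N => // k _; exact: Az.
exists x => // e e0 N.
have /clx : (z_ @ \oo) [set z_ k | k in [set k | (N <= k)%N]] by exists N => // k /= Nk; exists k.
have nx : nbhs x [set y | `|y - x| <= e].
  by apply/nbhs_ballP; exists e => //= y; rewrite -ball_normE /= distrC => /ltW.
by move=> /(_ _ nx)[_ [[k /= Nk <-] h]]; exists k.
Qed.

Lemma nbhs_norm_le A z : nbhs z A -> exists2 d : R, 0 < d & forall y, `|y - z| <= d -> A y.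
Proof.
move=> /nbhs_ballP[d /= d0 dP]; exists (d / 2); first by rewrite divr_gt0.
move=> y yz; apply: dP; rewrite -ball_normE /= distrC.
by apply: le_lt_trans yz _; rewrite ltr_pdivrMr // ltr_pMr // ltr1n.
Qed.

Lemma inv_lt (e : R) : 0 < e -> exists N, forall k, (N <= k)%N -> k.+1%:R^-1 < e.
Proof.
move=> e0; have [N _ HN] := near_infty_natSinv_lt (PosNum e0); exists N => k Nk; exact: HN.
Qed.

Lemma usc_max A g (M : R) : compact A -> A !=set0 -> (forall z, A z -> g z <= M) ->
  (forall z, A z -> forall c, g z < c -> \forall w \near z, g w < c) ->
  exists2 x, A x & forall z, A z -> g z <= g x.
Proof.
move=> cA [a Aa] gM usc; pose S := [set g z | z in A].
have hS : has_sup S by split; [exists (g a), a|exists M => _ [z Az <-]; exact: gM].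
have H k : exists z, A z /\ sup S - k.+1%:R^-1 < g z. have k0 : 0 < k.+1%:R^-1 :> R by rewrite invr_gt0.
  by have [_ [z Az <-] h] := sup_adherent k0 hS; exists z.
have [z_ zP] := choice H.
have [|x Ax xP] := compact_seq (z_ := z_) cA; first by move=> k; case: (zP k).
exists x => // z Az; rewrite leNgt; apply/negP => xz.
have zS : g z <= sup S by apply: ub_le_sup; [case: hS|exists z].
have r1 : g x < (g x + g z) / 2 by lra.
have r2 : 0 < sup S - (g x + g z) / 2 by lra.
have /nbhs_norm_le[d d0 dP] := usc x Ax _ r1.
have [N NP] := inv_lt r2; have [k Nk /dP h] := xP d d0 N.
by have [_ h3] := zP k; have := NP k Nk; move: h h3; move: (k.+1%:R^-1) => q; lra.
Qed.

End compact_sequences.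

(** * Random walks along finitely many directions *)

Section walk.
Context {R : realType} {n N' : nat}.
Notation N := N'.+1.
Notation C := (Cn R n).
Variable v : 'I_N -> C.
Implicit Types (F G f g phi p : C -> R) (z w : C) (h t K : R) (k m : nat).

Lemma dd_translate (a b : C) f : dd b (fun w => f (w + a)) = fun w => dd b f (w + a).
Proof. by apply/funext => w; rewrite -!ddE derive_translate. Qed.

Lemma line_lipschitz f (b : C) K : smooth f -> (forall z, `|dd b f z| <= K) ->
  forall z (s : R), `|f (z + s *: b) - f z| <= `|s| * K.
Proof.
move=> sf fK z s; have H t : is_derive t (1 : R) (fun s => f (z + s *: b)) (dd b f (z + t *: b)).
  by rewrite -ddE; exact: smooth_line.
have E0 : f z = f (z + 0 *: b) by rewrite scale0r addr0.
case: (lerP 0 s) => s0.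
  have [x _ E] := MVT_le H s0; rewrite [in X in _ - X]E0 E subr0 normrM mulrC ler_wpM2l //; exact: fK.
have [x _ E] := MVT_le H (ltW s0); rewrite distrC [in X in X - _]E0 E sub0r normrM normrN mulrC ler_wpM2l //.
Qed.

Lemma second_difference F (b : C) K z h : smooth F -> 0 <= h -> (forall z, `|dd b (dd b (dd b F)) z| <= K) ->
  `|F (z + h *: b) + F (z + (- h) *: b) - 2 * F z - h ^+ 2 * dd b (dd b F) z| <= 2 * h ^+ 3 * K.
Proof.
move=> sF h0 FK; set D2 := dd b (dd b F) z.
have K0 : 0 <= K by apply: le_trans (FK 0).
have H f t : smooth f -> is_derive t (1 : R) (fun s => f (z + s *: b)) (dd b f (z + t *: b)).
  by move=> sf; rewrite -ddE; exact: smooth_line.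
have Hm t : is_derive t (1 : R) (fun s => F (z + (- s) *: b)) (- dd b F (z + (- t) *: b)).
  have := smooth_line z (- b) sF t; rewrite ddE -scaleN1r ddZv // mulN1r.
  rewrite scalerA mulrN1; congr (is_derive _ _ _ _); apply/funext => s; by rewrite scalerA mulrN1.
pose k t := F (z + t *: b) + F (z + (- t) *: b) - 2 * F z - t ^+ 2 * D2.
have dk t : is_derive t (1 : R) k (dd b F (z + t *: b) - dd b F (z + (- t) *: b) - 2 * t * D2).
  have h1 := H F t sF; have h2 := Hm t.
  rewrite (_ : k = (fun s => F (z + s *: b)) \+ (fun s => F (z + (- s) *: b)) \+ (fun s => - 2 * F z + (- D2) * (s * s))); last first.
    by apply/funext => s; rewrite /k /=; ring. apply: is_derive_eq; rewrite /GRing.scale /=; ring.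
have [c /andP[c0 ch] E] := MVT_le dk h0.
have k0 : k 0 = 0 by rewrite /k oppr0 scale0r addr0; ring.
rewrite -/(k h) -[k h]subr0 -[in X in _ - X]k0 E.
have cc : - c <= c by lra.
have [s /andP[s1 s2] E2] := MVT_le (fun t => H (dd b F) t (smooth_dd b sF)) cc.
have -> : dd b F (z + c *: b) - dd b F (z + - c *: b) - 2 * c * D2 =
    (dd b (dd b F) (z + s *: b) - D2) * (2 * c) by rewrite E2; ring.
rewrite normrM [`|_ * (2 * c)|]normrM subr0 (ger0_norm h0) (ger0_norm (x := 2 * c)); last by rewrite mulr_ge0.
have l1 : `|dd b (dd b F) (z + s *: b) - D2| <= h * K.
  apply: le_trans (line_lipschitz _ FK z s) _; first by do 2 apply: smooth_dd.
  by rewrite ler_wpM2r // ler_norml; apply/andP; split; lra.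
rewrite (_ : 2 * h ^+ 3 * K = h * K * (2 * h) * h); last by ring.
by rewrite ler_wpM2r // ler_pM ?mulr_ge0 // ler_pM2l.
Qed.

Variable h : R.
Hypotheses (h0 : 0 < h) (h1 : h <= 1).

Definition walk F z := (2 * N%:R)^-1 * \sum_(i < N) (F (z + h *: v i) + F (z + (- h) *: v i)).
Definition lap F z := \sum_(i < N) dd (v i) (dd (v i) F) z.
(** The case i = j controls the Taylor remainder of one step, the other cases control the variation
    of [lap F] along the walk; the bound is preserved by the walk. *)
Definition third K F := forall i j z, `|dd (v j) (dd (v i) (dd (v i) F)) z| <= K.
(** The time step: one step of the walk is F + tau lap F up to O(h^3). *)
Let tau := h ^+ 2 / (2 * N%:R).

Let N0 : 0 < 2 * N%:R :> R. Proof. by rewrite mulr_gt0. Qed.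
Let tau0 : 0 <= tau. Proof. by rewrite divr_ge0 ?exprn_ge0 ?ltW. Qed.
Let avg_cst (a : R) : (2 * N%:R)^-1 * \sum_(i < N) 2 * a = a.
Proof.
have Nn0 : N%:R != 0 :> R by rewrite pnatr_eq0.
by rewrite sumr_const card_ord -mulr_natl; field.
Qed.

Lemma walk_le F G : (forall z, F z <= G z) -> forall z, walk F z <= walk G z.
Proof.
move=> FG z; rewrite ler_wpM2l ?invr_ge0 ?(ltW N0) //.
by apply: ler_sum => i _; apply: lerD.
Qed.

Lemma walk_cst (a : R) z : walk (fun=> a) z = a.
Proof.
rewrite -[RHS](avg_cst a) /walk; congr (_ * _); apply: eq_bigr => i _; by rewrite mulr_natl.
Qed.

Lemma walkD F G z : walk (fun z => F z + G z) z = walk F z + walk G z.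
Proof.
rewrite /walk -mulrDr -big_split; congr (_ * _); apply: eq_bigr => i _ /=; by rewrite addrACA.
Qed.

Lemma walkZ (a : R) F z : walk (fun z => a * F z) z = a * walk F z.
Proof.
rewrite /walk mulrCA; congr (_ * _); rewrite mulr_sumr; apply: eq_bigr => i _; by rewrite mulrDr.
Qed.

Lemma walk_bound F K : (forall z, `|F z| <= K) -> forall z, `|walk F z| <= K.
Proof.
move=> FK z; rewrite ler_norml -{1}(walk_cst (- K) z) -{2}(walk_cst K z).
by apply/andP; split; apply: walk_le => w; have := FK w; rewrite ler_norml => /andP[].
Qed.

Lemma smooth_walk F : smooth F -> smooth (walk F).
Proof.
move=> sF; apply: smoothZ; apply: smooth_sum => i _.
by apply: smoothD; exact: smooth_translate.
Qed.

Lemma dd_walk (b : C) F : smooth F -> dd b (walk F) = walk (dd b F).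
Proof.
move=> sF; apply/funext => z; have st (a : C) : smooth (fun z => F (z + a)) by exact: smooth_translate.
rewrite /walk ddZ; last by apply: smooth_sum => i _; apply: smoothD.
rewrite dd_sum; last by move=> i; exact: smoothD.
by congr (_ * _); apply: eq_bigr => i _; rewrite ddD // !dd_translate.
Qed.

Lemma lap_walk F z : smooth F -> lap (walk F) z = walk (lap F) z.
Proof.
move=> sF; rewrite /lap; under eq_bigr => i _ do rewrite (dd_walk _ sF) (dd_walk _ (smooth_dd (v i) sF)).
by rewrite /walk -mulr_sumr exchange_big; congr (_ * _); apply: eq_bigr => i _; rewrite big_split.
Qed.

Lemma third_walk K F : smooth F -> third K F -> third K (walk F).
Proof.
move=> sF FK i j z; have [s1 s2] := (smooth_dd (v i) sF, smooth_dd (v i) (smooth_dd (v i) sF)).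
by rewrite !dd_walk //; apply: walk_bound => w; exact: FK.
Qed.

Lemma smooth_lap F : smooth F -> smooth (lap F).
Proof. by move=> sF; apply: smooth_sum => i _; do 2 apply: smooth_dd. Qed.

Lemma lapD F G z : smooth F -> smooth G -> lap (fun z => F z + G z) z = lap F z + lap G z.
Proof.
move=> sF sG; rewrite /lap -big_split; apply: eq_bigr => i _ /=.
by rewrite ddDf // ddD //; exact: smooth_dd.
Qed.

Lemma lapZ (a : R) F z : smooth F -> lap (fun z => a * F z) z = a * lap F z.
Proof.
by move=> sF; rewrite /lap mulr_sumr; apply: eq_bigr => i _ /=; rewrite ddZf // ddZ //; exact: smooth_dd.
Qed.
Let dd_cstf (b : C) (a : R) : dd b (fun=> a) = fun=> 0.
Proof. by apply/funext => z; exact: dd_cst. Qed.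

Lemma lap_cst (a : R) z : lap (fun=> a) z = 0.
Proof. by apply: big1 => i _; rewrite !dd_cstf. Qed.

Lemma thirdD K K' F G : smooth F -> smooth G -> third K F -> third K' G -> third (K + K') (fun z => F z + G z).
Proof.
move=> sF sG FK GK i j z; rewrite ddDf // ddDf; [|exact: smooth_dd..].
rewrite ddD; [|by do 2 apply: smooth_dd..].
by apply: le_trans (ler_normD _ _) _; apply: lerD.
Qed.

Lemma thirdZ K (a : R) F : 0 <= a -> smooth F -> third K F -> third (a * K) (fun z => a * F z).
Proof.
move=> a0 sF FK i j z; rewrite ddZf // ddZf; last exact: smooth_dd.
rewrite ddZ; last by do 2 apply: smooth_dd.
by rewrite normrM (ger0_norm a0) ler_wpM2l.
Qed.

Lemma third_cst K (a : R) : 0 <= K -> third K (fun=> a).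
Proof. by move=> K0 i j z; rewrite !dd_cstf normr0. Qed.

Lemma walk_taylor K F z : smooth F -> third K F -> `|walk F z - F z - tau * lap F z| <= h ^+ 3 * K.
Proof.
move=> sF FK.
have -> : walk F z - F z - tau * lap F z = (2 * N%:R)^-1 * \sum_(i < N)
    (F (z + h *: v i) + F (z + (- h) *: v i) - 2 * F z - h ^+ 2 * dd (v i) (dd (v i) F) z).
  rewrite sumrB sumrB mulrBr mulrBr -/(walk F z); congr (_ - _ - _). by rewrite avg_cst.
  by rewrite /tau /lap -mulr_sumr mulrA [_^-1 * _]mulrC.
rewrite normrM gtr0_norm ?invr_gt0 // mulrC ler_pdivrMr //.
apply: le_trans (ler_norm_sum _ _ _) _.
apply: (@le_trans _ _ (\sum_(i < N) 2 * h ^+ 3 * K)).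
  apply: ler_sum => i _; exact: (second_difference z sF (ltW h0) (fun w => FK i i w)).
by rewrite sumr_const card_ord -mulr_natr; lra.
Qed.

Lemma walk_lap_near K F z : smooth F -> third K F -> `|walk (lap F) z - lap F z| <= h * N%:R * K.
Proof.
move=> sF FK.
have L i (s : R) : `|lap F (z + s *: v i) - lap F z| <= `|s| * (N%:R * K).
  apply: line_lipschitz; first exact: smooth_lap.
  move=> w; rewrite /lap dd_sum; last by move=> j; do 2 apply: smooth_dd.
  apply: le_trans (ler_norm_sum _ _ _) _; rewrite mulr_natl -[in leRHS](card_ord N) -sumr_const.
  by apply: ler_sum => j _; exact: FK.
have -> : walk (lap F) z - lap F z = (2 * N%:R)^-1 * \sum_(i < N)
    ((lap F (z + h *: v i) - lap F z) + (lap F (z + (- h) *: v i) - lap F z)).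
  rewrite -[in X in _ - X](walk_cst (lap F z) z) /walk -mulrBr -sumrB; congr (_ * _).
  by apply: eq_bigr => i _; rewrite opprD addrACA.
rewrite normrM gtr0_norm ?invr_gt0 // mulrC ler_pdivrMr //.
apply: le_trans (ler_norm_sum _ _ _) _.
apply: (@le_trans _ _ (\sum_(i < N) 2 * (h * (N%:R * K)))).
  apply: ler_sum => i _; apply: le_trans (ler_normD _ _) _.
  have := L i h; have := L i (- h); rewrite normrN (gtr0_norm h0) => l1 l2.
  by apply: le_trans (lerD l2 l1) _; lra.
by rewrite sumr_const card_ord -mulr_natr; lra.
Qed.

Lemma walk_near K K2 F z : smooth F -> third K F -> (forall z, `|lap F z| <= K2) ->
  `|walk F z - F z| <= tau * K2 + h ^+ 3 * K.
Proof.
move=> sF FK F2; have h2 := walk_taylor z sF FK.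
rewrite -(subrK (tau * lap F z) (walk F z - F z)); apply: le_trans (ler_normD _ _) _.
by rewrite addrC; apply: lerD => //; rewrite normrM (ger0_norm tau0) ler_wpM2l.
Qed.

Lemma I_walk F phi : nice F -> nice phi ->
  nice (walk F) /\ I (fun z => walk F z * phi z) = I (fun z => F z * walk phi z).
Proof.
move=> nF np.
have nt f (a : C) : nice f -> nice (fun z => f (z + a)).
  move=> nf; have [_ [k [r fr]]] := nf; have bf := nice_bbm nf; split.
    have [m _] := bbm_affine 1 a bf; rewrite (_ : (fun z => f (z + a)) = fun z => f (a + 1 *: z)) //.
    by apply/funext => w; rewrite scale1r addrC.
  exists k, (r + `|a|) => w; have [f1 f2] := fr (w + a); split=> // hw; apply: f2.
  rewrite -(ltrD2r `|a|); apply: lt_le_trans hw _.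
  by rewrite -{1}(addrK a w); apply: le_trans (ler_normD _ _) _; rewrite normrN.
have nm f g : nice f -> nice g -> nice (fun z => f z * g z).
  by move=> nf [mg [k [r gr]]]; apply: niceM => //; exists k => z; case: (gr z).
have sh (a : C) : I (fun z => F (z + a) * phi z) = I (fun z => F z * phi (z + - a)).
  rewrite -(I_translate a (nm _ _ nF (nt _ (- a) np))); apply: I_ext => z; by rewrite addrK.
have nwF : nice (walk F). by apply: niceZ; apply: nice_sum => i _; apply: niceD; exact: nt.
split=> //.
have E f g : (fun z => walk f z * g z) = (fun z => (2 * N%:R)^-1 * \sum_(i < N)
    (f (z + h *: v i) * g z + f (z + (- h) *: v i) * g z)).
  by apply/funext => z; rewrite /walk -mulrA mulr_suml; congr (_ * _); apply: eq_bigr => i _; rewrite mulrDl.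
have EI f g : nice f -> nice g -> I (fun z => walk f z * g z) = (2 * N%:R)^-1 * \sum_(i < N)
    (I (fun z => f (z + h *: v i) * g z) + I (fun z => f (z + (- h) *: v i) * g z)).
  move=> nf ng; have n1 a : nice (fun z => f (z + a) * g z) by apply: nm => //; exact: nt.
  rewrite E IZ; last by apply: nice_sum => i _; exact: niceD. rewrite I_sum; last by move=> i _; exact: niceD.
  by congr (_ * _); apply: eq_bigr => i _; rewrite ID.
rewrite EI //; under [RHS]I_ext do rewrite mulrC; rewrite EI //; congr (_ * _).
apply: eq_bigr => i _; rewrite !sh addrC; congr (_ + _); apply: I_ext => z; rewrite mulrC.
  by rewrite scaleNr opprK.
by rewrite scaleNr.
Qed.

Fixpoint walks k F := if k is k'.+1 then walk (walks k' F) else F.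

Lemma smooth_walks k F : smooth F -> smooth (walks k F).
Proof. by move=> sF; elim: k => //= k IH; exact: smooth_walk. Qed.

Lemma nice_walks k F : nice F -> nice (walks k F).
Proof. by move=> nF; elim: k => //= k IH; have [] := I_walk IH IH. Qed.

Lemma I_walks k F phi : nice F -> nice phi -> I (fun z => walks k F z * phi z) = I (fun z => F z * walks k phi z).
Proof.
move=> nF; elim: k phi => //= k IH phi np.
have [_ ->] := I_walk (nice_walks k nF) np.
rewrite IH; last by have [] := I_walk np np.
have -> : walks k (walk phi) = walk (walks k phi) by elim: k {IH} => //= k ->.
by [].
Qed.

Lemma third_walks K k F : smooth F -> third K F -> third K (walks k F).
Proof. by move=> sF FK; elim: k => //= k IH; apply: third_walk => //; exact: smooth_walks. Qed.

Lemma walks_bound k K F : (forall z, `|F z| <= K) -> forall z, `|walks k F z| <= K.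
Proof. by move=> FK; elim: k => //= k; exact: walk_bound. Qed.

Lemma lap_walks k F z : smooth F -> lap (walks k F) z = walks k (lap F) z.
Proof.
move=> sF; elim: k z => //= k IH z; rewrite lap_walk; last exact: smooth_walks.
by congr (walk _ z); apply/funext => w; exact: IH.
Qed.

Lemma walkB F G z : walk (fun z => F z - G z) z = walk F z - walk G z.
Proof.
rewrite walkD; congr (_ + _); rewrite (_ : (fun z => - G z) = fun z => (-1) * G z). by rewrite walkZ mulN1r.
by apply/funext => w; rewrite mulN1r.
Qed.

Lemma walks_near K K2 k F z : smooth F -> third K F -> (forall z, `|lap F z| <= K2) ->
  `|walks k F z - F z| <= k%:R * (tau * K2 + h ^+ 3 * K).
Proof.
move=> sF FK F2; elim: k => [|k IH]; first by rewrite /= subrr normr0 mul0r.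
have -> : walks k.+1 F z - F z = (walks k F z - F z) + (walk (walks k F) z - walks k F z) by rewrite /=; ring.
apply: le_trans (ler_normD _ _) _; rewrite -natr1 mulrDl mul1r; apply: lerD => //.
apply: walk_near; [exact: smooth_walks|exact: third_walks|move=> w].
by rewrite lap_walks //; exact: walks_bound.
Qed.

(** The walk commutes with [lap], so step m adds tau times [walks m (lap F)], which stays close to
    lap F by [walks_near]; the errors are summed. *)
Lemma walks_taylor K K' K2 k F z : smooth F -> third K F -> third K' (lap F) ->
  (forall z, `|lap (lap F) z| <= K2) -> `|walks k F z - F z - k%:R * tau * lap F z| <=
  k%:R * (h ^+ 3 * K + tau * (k%:R * (tau * K2 + h ^+ 3 * K'))).
Proof.
move=> sF FK FK' F2; have e0 : 0 <= tau * K2 + h ^+ 3 * K'. have K20 : 0 <= K2 by apply: le_trans (F2 0).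
  have K'0 : 0 <= K' by apply: le_trans (FK' ord0 ord0 0).
  by apply: addr_ge0; apply: mulr_ge0 => //; rewrite exprn_ge0 // ltW.
set e := tau * K2 + h ^+ 3 * K' in e0 *.
suff H m : (m <= k)%N -> `|walks m F z - F z - m%:R * tau * lap F z| <= m%:R * (h ^+ 3 * K + tau * (k%:R * e)).
  exact: H.
elim: m => [|m IH] mk; first by rewrite /= subrr !mul0r subrr normr0.
have h2 := walk_taylor z (smooth_walks m sF) (third_walks m sF FK).
have h3 := walks_near m z (smooth_lap sF) FK' F2.
have h4 := IH (ltnW mk).
rewrite lap_walks // in h2.
rewrite /= (_ : _ - _ = (walk (walks m F) z - walks m F z - tau * walks m (lap F) z) +
   (tau * (walks m (lap F) z - lap F z) + (walks m F z - F z - m%:R * tau * lap F z))); last first.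
  by rewrite -natr1; ring.
apply: le_trans (ler_normD _ _) _; rewrite -natr1 mulrDl mul1r.
rewrite [leRHS]addrC -[leRHS]addrA; apply: lerD => //.
apply: le_trans (ler_normD _ _) _; apply: lerD => //.
rewrite normrM ger0_norm // ler_wpM2l //; apply: le_trans h3 _.
by rewrite ler_wpM2r // ler_nat ltnW.
Qed.

End walk.

(** * From the touching inequality to an inequality in the sense of distributions *)

Section walk_limit.
Context {R : realType} {n N' : nat}.
Notation N := N'.+1.
Notation C := (Cn R n).
Variable v : 'I_N -> C.
Implicit Types (F G f phi p : C -> R) (z w : C) (t K : R) (k m q : nat).

Lemma tst_third phi : tst phi -> exists2 K, 0 <= K & third v K phi.
Proof.
move=> tp; have [K K0 KP] := tst_family_bound (fun p : 'I_N * 'I_N => tst_dd (v p.2) (tst_dd (v p.1) (tst_dd (v p.1) tp))).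
by exists K => // i j z; exact: KP (i, j) z.
Qed.

Lemma tst_lap phi : tst phi -> tst (lap v phi).
Proof.
move=> tp; split; first by apply: smooth_lap; exact: tst_smooth.
have [r rP] := tp.2; exists r => z rz; apply: big1 => i _.
exact: (dd_supp (v i) (fun w rw => dd_supp (v i) rP rw) rz).
Qed.

Lemma ctf_dd g : ctf g -> exists2 phi, tst phi & forall z, g z = phi z + (g 0 - phi 0).
Proof.
move=> [a tp]; exists (fun z => g z - a) => // z; ring.
Qed.

Lemma ctf_bounds g : ctf g -> exists K, [/\ 0 <= K, third v K g & forall z, `|lap v g z| <= K].
Proof.
move=> cg; have [phi tp gE] := ctf_dd cg; have sp := tst_smooth tp.
have [K K0 KP] := tst_third tp; have [K2 K20 K2P] := tst_sup_bound (tst_lap tp).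
have sc : smooth (fun _ : C => g 0 - phi 0) by exact: smooth_cst.
have -> : g = fun z => phi z + (g 0 - phi 0) by apply/funext.
exists (K + K2); split; first exact: addr_ge0.
  move=> i j z; have := thirdD sp sc KP (third_cst v (g 0 - phi 0) (lexx 0)) i j z.
  by rewrite addr0 => h; apply: le_trans h _; rewrite lerDl.
by move=> z; rewrite lapD // lap_cst addr0; apply: le_trans (K2P z) _; rewrite lerDr.
Qed.

Variables (U g : C -> R) (r M : R).
Hypotheses (nU : nice U) (U0 : forall z, 0 <= U z) (Usupp : forall z, r < `|z| -> U z = 0)
  (usc : forall z c, U z < c -> \forall w \near z, U w < c) (cg : ctf g) (g0 : forall z, r < `|z| -> 0 <= g z)
  (visc : forall p x0, ctf p -> (forall z, U z <= p z) -> U x0 = p x0 -> - g x0 <= lap v p x0).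

Let sg : smooth g.
Proof. exact: ctf_smooth. Qed.

Section step.
Variable h : R.
Hypotheses (h0 : 0 < h) (h1 : h <= 1).
Let tau := h ^+ 2 / (2 * N%:R).
Notation T := (walk v h).

Let tau0 : 0 <= tau. Proof. by rewrite divr_ge0 ?exprn_ge0 ?mulr_ge0 // ltW. Qed.
Let ctf_walk F : ctf F -> ctf (T F).
Proof.
move=> [a tF]; exists a.
have -> : (fun z => T F z - a) = T (fun z => F z - a).
  by apply/funext => z; rewrite -[in LHS](walk_cst v h a z) -walkB.
have [_ [r' F0]] := tF; split; first by apply: smooth_walk; exact: tst_smooth.
pose s := \sum_(i < N) `|v i|; exists (r' + s) => z hz; apply/eqP.
rewrite mulf_eq0; apply/orP; right; apply/eqP; apply: big1 => i _.
have vs : `|v i| <= s by rewrite /s (bigD1 i) //= lerDl sumr_ge0.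
have far (k : R) : `|k| <= 1 -> F (z + k *: v i) - a = 0.
  move=> k1; apply: F0; rewrite -(ltrD2r s); apply: lt_le_trans hz _.
  rewrite -{1}(addrK (k *: v i) z); apply: le_trans (ler_normB _ _) _; rewrite lerD2l.
  by apply: le_trans vs; rewrite normrZ ler_piMl.
by rewrite !far ?addr0 // ?normrN gtr0_norm.
Qed.
(** Up to O(h^3), F is T F - tau lap F, and tau lap F is tau T (lap F) = tau lap (T F). The
    hypothesis at z bounds the last term from below by - tau g z, up to tau^2 lap g. *)
Let step_error K K2 z F : smooth F -> third v K F -> (forall z, `|lap v g z| <= K2) ->
  - g z <= lap v (fun w => T F w + tau * g w) z -> F z <= T F z + tau * g z + h ^+ 3 * (2 * K + K2).
Proof.
move=> sF FK g2 hz.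
have K0 : 0 <= K by apply: le_trans (FK ord0 ord0 0).
have K20 : 0 <= K2 by apply: le_trans (g2 0).
move: hz; rewrite lapD; [|exact: smooth_walk|exact: smoothZ].
rewrite lapZ // lap_walk // => hz.
have t1 := walk_taylor h0 z sF FK; have t2 := walk_lap_near h0 z sF FK.
move: t1 t2 (g2 z); rewrite -/tau !ler_norml => /andP[t1 _] /andP[_ t2] /andP[_ t3].
have NR : tau * (h * N%:R * K) = h ^+ 3 * K / 2. have Nn0 : N%:R != 0 :> R by rewrite pnatr_eq0.
  by rewrite /tau; field.
have tt : tau * (tau * lap v g z) <= h ^+ 3 * K2. have th : tau <= h ^+ 2.
    rewrite ler_pdivrMr ?mulr_gt0 // ler_peMr ?exprn_ge0 ?(ltW h0) //. by rewrite -natrM ler1n.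
  have th1 : tau <= h by apply: le_trans th _; rewrite expr2 ler_piMr // ltW.
  rewrite mulrA; apply: (@le_trans _ _ (tau * tau * K2)); first by rewrite ler_wpM2l // mulr_ge0.
  rewrite ler_wpM2r // (_ : h ^+ 3 = h ^+ 2 * h); last by rewrite exprSr. by apply: ler_pM.
have h3K : 0 <= h ^+ 3 * K by rewrite mulr_ge0 // exprn_ge0 // ltW.
move: (T F z) (T (lap v F) z) hz t1 t2 => Y X hz t1 t2.
have := ler_wpM2l tau0 hz; have := ler_wpM2l tau0 t2; rewrite NR.
rewrite mulrBr mulrN [tau * (X + _)]mulrDr => a1 a2.
by rewrite mulrDr mulrCA; move: a1 a2 t1 tt h3K; lra.
Qed.

(** Let H = T F + tau g. At a maximum point x0 of U - H, if the maximum m is positive, H + m touches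
    U from above; [visc] then supplies the hypothesis of [step_error], and U x0 <= F x0 <= H x0 + e
    shows m <= e. *)
Lemma walk_step K K2 F : ctf F -> (forall z, U z <= F z) -> third v K F -> (forall z, `|lap v g z| <= K2) ->
  forall z, U z <= T F z + tau * g z + h ^+ 3 * (2 * K + K2).
Proof.
move=> cF UF FK g2; set e := h ^+ 3 * (2 * K + K2); pose H z := T F z + tau * g z.
have K0 : 0 <= K by apply: le_trans (FK ord0 ord0 0).
have K20 : 0 <= K2 by apply: le_trans (g2 0).
have e0 : 0 <= e by rewrite mulr_ge0 ?exprn_ge0 ?(ltW h0) // addr_ge0 // mulr_ge0.
have sF := ctf_smooth cF.
have cH : ctf H. have [a ta] := ctf_walk cF; have [a' ta'] := cg; exists (a + tau * a').
  have -> : (fun z => H z - (a + tau * a')) = (fun z => (T F z - a) + tau * (g z - a')).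
    by apply/funext => z; rewrite /H; ring. by apply: tstD => //; exact: tstZ.
have Hout z : r < `|z| -> 0 <= H z. move=> rz; apply: addr_ge0; last by apply: mulr_ge0 => //; exact: g0.
  have F0 w : (fun _ : C => 0 : R) w <= F w by exact: le_trans (U0 w) (UF w).
  by have := walk_le v h F0 z; rewrite walk_cst.
have cc : continuous H by apply: smooth_cont; exact: ctf_smooth.
move=> z; rewrite leNgt; apply/negP => zbad.
have zin : `|z| <= r.
  by rewrite leNgt; apply/negP => rz; have := Hout z rz; move: zbad; rewrite Usupp // -/(H z); lra.
have [M' M'P] := nU.2.
have [k' kP] := ctf_bounded cH.
have [r'' M'P2] := M'P.
have ubd (w : C) : [set w : C | `|w| <= r] w -> U w - H w <= M' + k'.
  move=> _; have [+ _] := M'P2 w; have := kP w; rewrite !ler_norml => /andP[? ?] /andP[? ?]; lra.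
have uscd (w : C) : [set w : C | `|w| <= r] w -> forall c, U w - H w < c -> \forall y \near w, U y - H y < c.
  move=> _ c wc. have d0 : 0 < (c - (U w - H w)) / 2 by rewrite divr_gt0 // subr_gt0.
  have := usc (z := w) (c := U w + (c - (U w - H w)) / 2); rewrite ltrDl => /(_ d0) n1.
  have n2 : \forall y \near w, H w - (c - (U w - H w)) / 2 < H y.
    by apply: (cvgr_gt (H w) (cc w)); rewrite ltrBlDr ltrDl.
  near=> y; have y1 : U y < U w + (c - (U w - H w)) / 2 by near: y.
  have y2 : H w - (c - (U w - H w)) / 2 < H y by near: y. by move: y1 y2; lra.
have [x0 _ x0P] := usc_max (@normle_compact R n r) (ex_intro _ z zin) ubd uscd.
pose m := U x0 - H x0.
have zm : U z - H z <= m by exact: x0P.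
have m0 : 0 < m by move: zbad; rewrite -/(H z); lra.
have tch : - g x0 <= lap v (fun w => H w + m) x0. apply: visc.
  - have [a ta] := cH; exists (a + m); rewrite (_ : (fun z => H z + m - (a + m)) = fun z => H z - a) //.
    by apply/funext => w; ring.
  - move=> w; case: (lerP `|w| r) => hw; first by have := x0P w hw; rewrite -/m; lra.
    by rewrite Usupp // addr_ge0 ?Hout // ltW.
  - by rewrite /m; ring.
rewrite lapD ?lap_cst ?addr0 in tch; [|exact: ctf_smooth|exact: smooth_cst].
have := step_error sF FK g2 tch; have := UF x0; rewrite -/(H x0) -/e => u1 u2.
by move: zbad; rewrite -/(H z); have := zm; rewrite /m; lra.
Unshelve. all: end_near.
Qed.

Lemma third_le K K' F : K <= K' -> third v K F -> third v K' F.
Proof. by move=> KK' FK i j z; exact: le_trans (FK i j z) KK'. Qed.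

(** Adding the error h^3 B after each step restores a majorant of U, so the step can be repeated.
    Third derivatives grow by tau Kg per step and stay below K + T1 Kg up to time T1. *)
Lemma walk_iter K Kg T1 m F : ctf F -> (forall z, U z <= F z) -> third v K F -> third v Kg g ->
  (forall z, `|lap v g z| <= Kg) -> m%:R * tau <= T1 -> forall z, U z <= walks v h m F z + m%:R * tau * g z +
    m%:R * (m%:R * tau * (tau * Kg + h ^+ 3 * Kg) + h ^+ 3 * (2 * (K + T1 * Kg) + Kg)).
Proof.
move=> cF UF FK g3 g2 mT; set B := 2 * (K + T1 * Kg) + Kg; set eta := tau * Kg + h ^+ 3 * Kg.
have Kg0 : 0 <= Kg by apply: le_trans (g2 0).
have eta0 : 0 <= eta by rewrite addr_ge0 // mulr_ge0 // exprn_ge0 // ltW.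
suff H k : (k <= m)%N -> exists W, [/\ ctf W, forall z, U z <= W z, third v (K + k%:R * tau * Kg) W &
    forall z, W z <= walks v h k F z + k%:R * tau * g z + k%:R * (m%:R * tau * eta + h ^+ 3 * B)].
  by have [W [_ UW _ WF] z] := H m (leqnn m); exact: le_trans (UW z) (WF z).
elim: k => [|k IH] km. exists F; split=> //; first by rewrite !mul0r addr0. by move=> z; rewrite /= !mul0r !addr0.
have [W [cW UW W3 WF]] := IH (ltnW km); have sW := ctf_smooth cW.
have kmR : k%:R * tau <= m%:R * tau by rewrite ler_wpM2r // ler_nat ltnW.
have W3' : third v (K + T1 * Kg) W. by apply: third_le W3; rewrite lerD2l ler_wpM2r // (le_trans kmR).
exists (fun z => walk v h W z + tau * g z + h ^+ 3 * B); split.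
- have [a ta] := ctf_walk cW; have [a' ta'] := cg; exists (a + tau * a' + h ^+ 3 * B).
  have -> : (fun z => walk v h W z + tau * g z + h ^+ 3 * B - (a + tau * a' + h ^+ 3 * B)) =
     (fun z => (walk v h W z - a) + tau * (g z - a')) by apply/funext => z; ring.
  by apply: tstD => //; exact: tstZ.
- exact: walk_step.
- rewrite -natr1 mulrDl mul1r mulrDl addrA -[X in third _ X _]addr0.
  have st : smooth (fun z => tau * g z) by exact: smoothZ.
  apply: thirdD; [by apply: smoothD => //; exact: smooth_walk|exact: smooth_cst| |exact: third_cst].
  apply: thirdD => //; [exact: smooth_walk|exact: third_walk|exact: thirdZ].
move=> z; have := walk_le v h WF z.
rewrite !walkD walkZ walk_cst -/(walks v h k.+1 F z) => h2.
have tg : walk v h g z <= g z + eta.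
  have := walk_near h0 z sg g3 g2; rewrite ler_norml => /andP[_]; rewrite lerBlDr addrC; exact.
have h3 : k%:R * tau * walk v h g z <= k%:R * tau * g z + m%:R * tau * eta.
  apply: (@le_trans _ _ (k%:R * tau * (g z + eta))); first by rewrite ler_wpM2l // mulr_ge0.
  by rewrite mulrDr lerD2l ler_wpM2r.
rewrite -natr1; move: h2 h3; rewrite !mulrDl !mul1r; lra.
Qed.

End step.

Lemma le_of_inv (x y z : R) : (forall q, x <= y + z / q.+1%:R) -> x <= y.
Proof.
move=> H; apply/ler_addgt0Pr => e e0.
have [K _ KP] := near_infty_natSinv_lt (PosNum (divr_gt0 e0 (ltr_wpDl (normr_ge0 z) (@ltr01 R)))).
apply: le_trans (H K) _; rewrite lerD2l; have := KP K (leqnn K); rewrite /= ltr_pdivlMr; last exact: ltr_wpDl.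
move=> hh; apply: le_trans (ltW hh); rewrite mulrC ler_wpM2l //.
by apply: le_trans (ler_norm z) _; rewrite lerDl.
Qed.

Lemma nice_mul_tst F phi : nice F -> tst phi -> nice (fun z => F z * phi z).
Proof. by move=> nF tp; apply: niceM => //; [exact: (tst_nice tp).1|exact: tst_bounded]. Qed.

Lemma nice_ctf_tst F phi : ctf F -> tst phi -> nice (fun z => F z * phi z).
Proof.
move=> cF tp; rewrite (_ : (fun z => F z * phi z) = (fun z => phi z * F z)); last by apply/funext => z; rewrite mulrC.
by apply: nice_tstM => //; exact: ctf_smooth.
Qed.

(** With h = t / Q and m = Q^2 steps the total time m tau = s is fixed, while m h^3 = t^3 / Q tends
    to 0: all errors involving third derivatives of F vanish as Q grows. The walk is transferred to
    phi by symmetry, so the remaining error is of order s^2 with a constant free of F. *)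
Lemma walk_pairing phi : tst phi -> (forall z, 0 <= phi z) -> exists K, forall t F s, 0 < t -> t <= 1 ->
  tst F -> (forall z, U z <= F z) -> s = t ^+ 2 / (2 * N%:R) ->
  I (fun z => U z * phi z) <= I (fun z => F z * phi z) + s * I (fun z => F z * lap v phi z) +
    s * I (fun z => g z * phi z) + s ^+ 2 * (K * (I F + I phi)).
Proof.
move=> tp p0; have sp := tst_smooth tp; have tlp := tst_lap tp.
have [K1 K10 K1P] := tst_third tp; have [K' K'0 K'P] := tst_third tlp.
have [K2 K20 K2P] := tst_sup_bound (tst_lap tlp).
have [Kg [Kg0 Kg3 Kg2]] := ctf_bounds cg.
exists (K2 + Kg) => t F s t0 t1 tF UF sE.
have F0 z : 0 <= F z by exact: le_trans (U0 z) (UF z).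
have Nn0 : N%:R != 0 :> R by rewrite pnatr_eq0.
have s0 : 0 <= s by rewrite sE divr_ge0 ?exprn_ge0 ?mulr_ge0 // ltW.
have [K K0 KP] := tst_third tF.
have cF : ctf F by exists 0; under eq_fun do rewrite subr0.
have IF0 : 0 <= I F by exact: I_ge0.
have Ip0 : 0 <= I phi by exact: I_ge0.
pose B := 2 * (K + s * Kg) + Kg.
pose Z := (s * t ^+ 3 * Kg + t ^+ 3 * B) * I phi + (t ^+ 3 * K1 + s * (t ^+ 3 * K')) * I F.
apply: (@le_of_inv _ _ Z) => q; have [Q QE] : exists Q : R, Q = q.+1%:R by eexists.
rewrite -QE; have Q0 : 0 < Q by rewrite QE ltr0n.
have Qn : Q != 0 by rewrite gt_eqF.
pose h := t / Q; have h0 : 0 < h by rewrite divr_gt0.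
have h1 : h <= 1 by rewrite ler_pdivrMr // mul1r (le_trans t1) // QE ler1n.
pose m := (q.+1 ^ 2)%N; pose tau := h ^+ 2 / (2 * N%:R).
have mQ : m%:R = Q ^+ 2 :> R by rewrite /m natrX QE.
have mtau : m%:R * tau = s by rewrite mQ sE /tau /h; move: (N%:R : R) Nn0 => x x0; field; rewrite ?x0 ?Qn.
have mh3 : m%:R * h ^+ 3 = t ^+ 3 / Q by rewrite mQ /h; field; rewrite Qn.
have W := walk_iter h0 h1 cF UF KP Kg3 Kg2 (T1 := s) (m := m).
rewrite -/tau mtau in W; have {}W := W (lexx s).
set e := m%:R * _ in W.
have eE : e = s ^+ 2 * Kg + (s * t ^+ 3 * Kg + t ^+ 3 * B) / Q.
  rewrite /e -/B (_ : _ * (_ + _) = s * ((m%:R * tau) * Kg + (m%:R * h ^+ 3) * Kg) + (m%:R * h ^+ 3) * B); last by ring.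
  by rewrite mtau mh3; field; rewrite Qn.
have nF := tst_nice tF; have np := tst_nice tp.
have nwp : nice (fun z => walks v h m F z * phi z) by apply: nice_mul_tst => //; exact: nice_walks.
have ngp : nice (fun z => g z * phi z) by exact: nice_ctf_tst.
have step1 : I (fun z => U z * phi z) <= I (fun z => walks v h m F z * phi z) + s * I (fun z => g z * phi z) + e * I phi.
  have n3 : nice (fun z => s * (g z * phi z)) by exact: niceZ.
  have n4 : nice (fun z => e * phi z) by exact: niceZ. rewrite -!IZ // -ID // -ID //; last exact: niceD.
  apply: le_I; [exact: nice_mul_tst|by apply: niceD => //; exact: niceD|move=> z].
  by have := ler_wpM2r (p0 z) (W z); rewrite !mulrDl mulrA.
pose e2 := m%:R * (h ^+ 3 * K1 + tau * (m%:R * (tau * K2 + h ^+ 3 * K'))).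
have e2E : e2 = s ^+ 2 * K2 + (t ^+ 3 * K1 + s * (t ^+ 3 * K')) / Q.
  rewrite /e2 (_ : _ * (_ + _) = (m%:R * h ^+ 3) * K1 + (m%:R * tau) * ((m%:R * tau) * K2 + (m%:R * h ^+ 3) * K')); last by ring.
  by rewrite mtau mh3; field; rewrite Qn.
have step2 : I (fun z => walks v h m F z * phi z) <=
    I (fun z => F z * phi z) + s * I (fun z => F z * lap v phi z) + e2 * I F. rewrite I_walks //.
  have n1 : nice (fun z => F z * phi z) by exact: nice_mul_tst.
  have n2 : nice (fun z => F z * lap v phi z) by exact: nice_mul_tst.
  have n3 : nice (fun z => s * (F z * lap v phi z)) by exact: niceZ.
  have n4 : nice (fun z => e2 * F z) by exact: niceZ. rewrite -!IZ // -ID // -ID //; last exact: niceD.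
  apply: le_I; [|by apply: niceD => //; exact: niceD|move=> z]. have [mw [k [r' wr]]] := nice_walks v h m np.
    by apply: niceM => //; exists k => z; case: (wr z).
  have := walks_taylor h0 m z sp K1P K'P K2P; rewrite -/tau mtau -/e2 ler_norml => /andP[_ h2].
  have := ler_wpM2l (F0 z) h2; rewrite !mulrBr [s * (_ * _)]mulrCA [e2 * _]mulrC; lra.
move: step1 step2; rewrite eE e2E /Z.
have x1 : 0 <= s ^+ 2 * Kg * I F by rewrite mulr_ge0 // mulr_ge0 // exprn_ge0.
have x2 : 0 <= s ^+ 2 * K2 * I phi by rewrite mulr_ge0 // mulr_ge0 // exprn_ge0.
rewrite !mulrDl !mulrDr; move: x1 x2; lra.
Qed.

(** For F running through the approximants of U, the integrals of U phi on both sides cancel in the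
    limit; dividing by s and letting t tend to 0 removes the last error. This is lap U >= - g in the
    sense of distributions, where [visc] was the same in the viscosity sense. *)
Lemma walk_main (G_ : nat -> C -> R) M' phi : (forall k, tst (G_ k)) -> (forall k z, U z <= G_ k z) ->
  (forall k z, `|G_ k z| <= M') -> (forall k z, r < `|z| -> G_ k z = 0) ->
  (forall z, G_ k z @[k --> \oo] --> U z) -> tst phi -> (forall z, 0 <= phi z) ->
  0 <= I (fun z => U z * lap v phi z) + I (fun z => g z * phi z).
Proof.
move=> tG UG GM Gr GU tp p0; have [K KP] := walk_pairing tp p0; have tlp := tst_lap tp.
have mG k : mfun (G_ k) by case: (tst_nice (tG k)).
have cv f : mfun f -> (exists c, forall z, `|f z| <= c) ->
    I (fun z => G_ k z * f z) @[k --> \oo] --> I (fun z => U z * f z).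
  move=> mf [c fc]; apply: (@I_cvg _ _ _ _ (M' * c) r _ _ _ _).2.
  - by move=> k; exact: (measurable_funM (mG k) mf).
  - by move=> k z; rewrite normrM ler_pM.
  - by move=> k z rz; rewrite Gr // mul0r.
  - by move=> z; apply: cvgMl; exact: GU.
have c1 := cv phi (tst_nice tp).1 (tst_bounded tp).
have c2 := cv _ (tst_nice tlp).1 (tst_bounded tlp).
have c3 : I (G_ k) @[k --> \oo] --> I U. exact: (I_cvg mG GM Gr GU).2.
set X := I (fun z => U z * lap v phi z); set Y := I (fun z => g z * phi z).
have H t s : 0 < t -> t <= 1 -> s = t ^+ 2 / (2 * N%:R) -> 0 <= X + Y + s * (K * (I U + I phi)).
  move=> t0 t1 sE; have s0 : 0 < s by rewrite sE divr_gt0 ?exprn_gt0 ?mulr_gt0.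
  rewrite -(pmulr_rge0 _ s0) -(lerD2l (I (fun z => U z * phi z))) addr0.
  have cvv : (I (fun z => G_ k z * phi z) + s * I (fun z => G_ k z * lap v phi z) +
    s * Y + s ^+ 2 * (K * (I (G_ k) + I phi))) @[k --> \oo] -->
    (I (fun z => U z * phi z) + s * X + s * Y + s ^+ 2 * (K * (I U + I phi))).
    apply: cvgD; [apply: cvgD; [apply: cvgD => //; exact: cvgMr|exact: cvg_cst]|].
    by apply: cvgMr; apply: cvgMr; apply: cvgD => //; exact: cvg_cst.
  have -> : I (fun z => U z * phi z) + s * (X + Y + s * (K * (I U + I phi))) =
     I (fun z => U z * phi z) + s * X + s * Y + s ^+ 2 * (K * (I U + I phi)) by ring.
  apply: (cvgr_to_ge cvv); apply: nearW => k; exact: (KP t (G_ k) s t0 t1 (tG k) (UG k) sE).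
set S := K * (I U + I phi) in H *.
apply: (@le_of_inv _ _ `|S|) => q.
have Q0 : 0 < q.+1%:R :> R by rewrite ltr0n.
have t0 : 0 < q.+1%:R^-1 :> R by rewrite invr_gt0.
have t1 : q.+1%:R^-1 <= 1 :> R by rewrite invf_le1 // ler1n.
apply: le_trans (H _ _ t0 t1 erefl) _; rewrite lerD2l.
apply: (@le_trans _ _ (q.+1%:R^-1 ^+ 2 / (2 * N%:R) * `|S|)).
  by rewrite ler_wpM2l ?ler_norm // divr_ge0 ?exprn_ge0 ?mulr_ge0 // ltW.
rewrite mulrC ler_wpM2l // ler_pdivrMr ?mulr_gt0 // expr2 ler_pM ?invr_ge0 //.
by apply: le_trans t1 _; rewrite -natrM ler1n.
Qed.

End walk_limit.

Lemma cvg_max0 {R : realType} (x_ : nat -> R) (x : R) :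
  x_ k @[k --> \oo] --> x -> Num.max 0 (x_ k) @[k --> \oo] --> Num.max 0 x.
Proof.
move=> h; rewrite maxr_absE; under eq_fun do rewrite maxr_absE.
apply: cvgMl; apply: cvgD; first by apply: cvgD => //; exact: cvg_cst.
by apply: cvg_norm; apply: cvgB => //; exact: cvg_cst.
Qed.

(** * Even functions and radial cut-offs *)

Section parity.
Context {R : realType} {n : nat}.
Notation C := (Cn R n).
Implicit Types (f g : C -> R) (z b v : C).

Lemma dd_parity f v (sg : R) : smooth f -> (forall z, f (- z) = sg * f z) ->
  forall z, dd v f (- z) = - sg * dd v f z.
Proof.
move=> sf fE z; have h1 := smooth_line z v sf 0; have h2 := smooth_line (- z) (- v) sf 0.
have E : (fun s : R => f (- z + s *: - v)) = (fun s => sg * f (z + s *: v)).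
  by apply/funext => s; rewrite scalerN -opprD fE.
rewrite !scale0r !addr0 in h1 h2; rewrite E in h2.
have h3 : is_derive (0 : R) (1 : R) (fun s => sg * f (z + s *: v)) (sg * 'D_v f z). exact: (is_deriveZ sg h1).
have := @derive_val _ _ _ _ _ _ _ h2; rewrite (@derive_val _ _ _ _ _ _ _ h3) => E2.
have -> : dd v f (- z) = - dd (- v) f (- z) by rewrite -[- v]scaleN1r ddZv // mulN1r opprK.
by rewrite -!ddE -E2 mulNr.
Qed.

Lemma dd2_even f v : smooth f -> (forall z, f (- z) = f z) -> forall z, dd v (dd v f) (- z) = dd v (dd v f) z.
Proof.
move=> sf fE z; rewrite (@dd_parity (dd v f) v (-1)) ?opprK ?mul1r //; first exact: smooth_dd.
by move=> w; apply: dd_parity => // y; rewrite mul1r.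
Qed.

Lemma euclN z : eucl (- z) = eucl z.
Proof. by rewrite -scaleN1r euclZ sqrrN expr1n mul1r. Qed.

Lemma smooth_eucl_at (x0 : C) : smooth (fun z => eucl (z - x0)).
Proof. by apply: smooth_translate; exact: smooth_eucl. Qed.

Lemma eucl_far (x0 z : C) (k : R) : 0 <= k -> `|x0| + k < `|z| -> k ^+ 2 < eucl (z - x0).
Proof.
move=> k0 kz; apply: lt_le_trans (eucl_norm _); rewrite ltr_pXn2r ?nnegrE //.
rewrite -(ltrD2l `|x0|); apply: lt_le_trans kz _.
by rewrite -{1}(subrK x0 z) addrC; exact: ler_normD.
Qed.

Lemma eucl_close (x0 z : C) (k : R) : 0 <= k -> eucl (z - x0) <= k ^+ 2 -> `|z - x0| <= k.
Proof.
move=> k0 h; rewrite -(ler_pXn2r (ltn0Sn 1)) ?nnegrE //; exact: le_trans (eucl_norm _) h.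
Qed.

Lemma smooth1_sstep_affine (k0 k1 : R) : smooth1 (fun t : R => sstep ((t - k0) / k1)).
Proof.
apply: (smooth1_comp smooth1_sstep).
rewrite (_ : (fun t => (t - k0) / k1) = fun t => k1^-1 * t + - (k0 / k1)); last first. by apply/funext => t; ring.
exact: smooth1_affine.
Qed.

Lemma ctf_cut (x0 : C) (k0 k1 : R) : 0 < k1 -> ctf (fun z => sstep ((eucl (z - x0) - k0) / k1)).
Proof.
move=> k10; exists 1; split. apply: smoothB; last exact: smooth_cst.
  exact: (smooth_comp (@smooth1_sstep_affine k0 k1) (smooth_eucl_at x0)).
pose r := Num.max 0 (k0 + k1) + 1; exists (`|x0| + r) => z hz.
have r0 : 1 <= r by rewrite /r lerDr le_max lexx.
have r1 : k0 + k1 <= r by apply: ler_wpDr => //; rewrite le_max lexx orbT.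
have h := eucl_far (le_trans ler01 r0) hz.
rewrite sstep1 ?subrr // ler_pdivlMr // mul1r lerBrDl; apply: le_trans r1 _.
by apply: ltW; apply: le_lt_trans h; rewrite expr2 ler_peMl // (le_trans ler01).
Qed.

Lemma ctfD f g : ctf f -> ctf g -> ctf (fun z => f z + g z).
Proof.
move=> [a tf] [b tg]; exists (a + b); rewrite (_ : (fun z => _) = fun z => (f z - a) + (g z - b)). exact: tstD.
by apply/funext => z; ring.
Qed.

Lemma ctfZ (k : R) f : ctf f -> ctf (fun z => k * f z).
Proof.
move=> [a tf]; exists (k * a); rewrite (_ : (fun z => _) = fun z => k * (f z - a)); first exact: tstZ.
by apply/funext => z; ring.
Qed.

Lemma ctf_cst (k : R) : ctf (fun _ : C => k).
Proof. by exists k; under eq_fun do rewrite subrr; exact: tst0. Qed.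

Lemma Lap_ge0_min f z b : smooth f -> (forall w, f z <= f w) -> bbm f -> 0 <= Lap b f z.
Proof.
move=> sf fz bf; apply: (@submean_Lap_ge0 _ _ f z b 1) => // r _.
rewrite -{1}(cmean_cst (f z) z (r *: b)); apply: le_cmean => //.
by split; [exact: measurable_cst|exists `|f z|].
Qed.

End parity.

(** * The linear inequality for the averages of u *)

Section linear_bound.
Context {R : realType} {n' : nat}.
Notation n := n'.+1.
Notation C := (Cn R n).
Notation bC := (borelCn R n).
Implicit Types (g h : C -> R) (z b w y : C) (s t : R) (k : nat).
Variables (Om : set C) (c : R) (u f : C -> R) (xs : C) (m0 eps lam : R) (Bm : 'M[R[i]]_n) (bs : 'I_n -> C).
Hypotheses (oOm : open Om) (c0 : 0 < c) (mf : mfun_on Om f) (su : subm Om u) (MA : monge_ampere_ge c Om u f).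
Hypotheses (eps0 : 0 < eps) (fm : forall z, `|z - xs| <= 2 * eps -> Om z /\ m0 <= f z)
  (lam0 : 0 <= lam) (lamm : n`!%:R * (2 * c) ^+ n * lam ^+ n <= m0) (dB : `|\det Bm| = 1)
  (bsE : forall j : 'I_n, cvec (bs j) = row j Bm).

(** The directions b_j and i b_j together, so that the sum of second derivatives is the sum of the
    directional Laplacians. The index type is 'I_(n + n), written as a successor. *)
Let dirs (i : 'I_(n' + n).+1) : C := match fintype.split (i : 'I_(n + n)) with inl j => bs j | inr j => Jc (bs j) end.

Let lap_dirs g z : lap dirs g z = \sum_(j < n) Lap (bs j) g z.
Proof.
under [RHS]eq_bigr do rewrite Lap_def.
rewrite /lap (@big_split_ord _ _ _ n n) big_split /=; congr (_ + _); apply: eq_bigr => j _; rewrite /dirs.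
  by rewrite (unsplitK (inl _ j : 'I_n + 'I_n)).
by rewrite (unsplitK (inr _ j : 'I_n + 'I_n)).
Qed.
Let bu : bbm u.
Proof. by case: su. Qed.
Let M := Num.max 1 (projT1 (cid bu.2)).

Let M1 : 1 <= M.
Proof. by rewrite le_max lexx. Qed.
Let uM z : - M <= u z <= M.
Proof.
by rewrite -ler_norml; apply: le_trans (projT2 (cid bu.2) z) _; rewrite le_max lexx orbT.
Qed.
Let E0 z := eucl (z - xs).
Let a := eps ^+ 2.

Let a0 : 0 < a.
Proof. exact: exprn_gt0. Qed.
Let chi z := sstep ((E0 z - a / 4) / (a / 4)).
(** The inequality for u is known near xs only. Subtracting psi and truncating at 0 gives a global U
    of compact support: for E0 <= a / 2 it is u + 3 M > 0, and for E0 >= a it is 0 because u + 3 M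
    <= 4 M. *)
Let psi z := (4 * M + 1) * sstep ((E0 z - a / 2) / (a / 2)).

Let cchi : ctf chi.
Proof. by apply: ctf_cut; rewrite divr_gt0. Qed.
Let cpsi : ctf psi.
Proof. by apply: ctfZ; apply: ctf_cut; rewrite divr_gt0. Qed.
Let chi_in z : E0 z <= a / 4 -> chi z = 0.
Proof. by move=> h; apply: sstep0; rewrite pmulr_lle0 ?invr_gt0 ?divr_gt0 // subr_le0. Qed.
Let chi_out z : a / 2 <= E0 z -> chi z = 1.
Proof. by move=> h; apply: sstep1; rewrite ler_pdivlMr ?divr_gt0 //; lra. Qed.
Let psi_in z : E0 z <= a / 2 -> psi z = 0.
Proof. by move=> h; rewrite /psi sstep0 ?mulr0 // pmulr_lle0 ?invr_gt0 ?divr_gt0 // subr_le0. Qed.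
Let psi_out z : a <= E0 z -> psi z = 4 * M + 1.
Proof. by move=> h; rewrite /psi sstep1 ?mulr1 // ler_pdivlMr ?divr_gt0 //; lra. Qed.
Let psi_ge0 z : 0 <= psi z.
Proof. by rewrite mulr_ge0 ?sstep_ge0 //; move: M1; lra. Qed.
Let Lam := 4 * n%:R * lam.

Let Lam0 : 0 <= Lam.
Proof. by rewrite !mulr_ge0. Qed.
Let Kp := projT1 (cid (ctf_bounds dirs cpsi)).

Let KpP z : 0 <= Kp /\ `|lap dirs psi z| <= Kp.
Proof. by have [h1 _ h2] := projT2 (cid (ctf_bounds dirs cpsi)). Qed.
(** Equal to - Lam for E0 <= a / 4, where the averaging kernel lives, and to Kp for E0 >= a / 2,
    where it absorbs the Laplacian of psi. *)
Let g z := (Kp + Lam) * chi z - Lam.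

Let cg : ctf g.
Proof. by apply: ctfD; [exact: ctfZ|exact: ctf_cst]. Qed.
Let g_ge z : - Lam <= g z.
Proof. by rewrite lerDr mulr_ge0 ?sstep_ge0 // addr_ge0 //; case: (KpP 0). Qed.
Let g_out z : a / 2 <= E0 z -> g z = Kp.
Proof. by move=> h; rewrite /g chi_out // mulr1 addrK. Qed.
Let U z := Num.max 0 (u z - psi z + 3 * M).

Let U_out z : a <= E0 z -> U z = 0.
Proof.
move=> h; apply: max_idPl; rewrite psi_out //; have /andP[_] := uM z; have := M1; lra.
Qed.
Let near z : E0 z <= a -> `|z - xs| <= eps.
Proof. by apply: eucl_close; exact: ltW. Qed.
Let room_near z : `|z - xs| <= eps -> room Om eps z.
Proof.
move=> nz w we; have [] // := @fm w _; rewrite -(subrK z w) -addrA.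
by apply: le_trans (ler_normD _ _) _; rewrite mulr2n mulrDl mul1r; apply: lerD.
Qed.
Let rr := `|xs| + eps.

Let far z : rr < `|z| -> a < E0 z.
Proof. by apply: eucl_far; exact: ltW. Qed.
Let U0 z : 0 <= U z.
Proof. by rewrite le_max lexx. Qed.
Let U_le z : U z <= 4 * M.
Proof.
rewrite ge_max; apply/andP; split; first by have := M1; lra.
by have /andP[_] := uM z; have := psi_ge0 z; lra.
Qed.
Let nU : nice U.
Proof.
split; last first. exists (4 * M), rr => z; split; first by rewrite ger0_norm.
  by move=> /far h; apply: U_out; exact: ltW.
have mp : mfun psi. by apply: smooth_measurable; exact: ctf_smooth.
apply: (@measurable_maxr _ bC R setT (fun=> 0)) => //.
apply: measurable_funD; last exact: measurable_cst.
by apply: measurable_funB => //; case: bu.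
Qed.
Let usc z (k : R) : U z < k -> \forall w \near z, U w < k.
Proof.
have cE : continuous E0 by apply: smooth_cont; exact: smooth_eucl_at.
have cp : continuous psi by apply: smooth_cont; exact: ctf_smooth.
case: (ltP a (E0 z)) => hz Uk. have : \forall w \near z, a < E0 w by apply: (cvgr_gt (E0 z) (cE z)).
  by apply: filterS => w hw; rewrite U_out ?ltW //; apply: le_lt_trans Uk.
have Oz : Om z by have [] // := @fm z _; apply: le_trans (near hz) _; move: eps0; lra.
move: Uk; rewrite /U gt_max => /andP[k0 k1].
pose d := (k - (u z - psi z + 3 * M)) / 2.
have d0 : 0 < d by rewrite divr_gt0 // subr_gt0.
have [_ /(_ z Oz (u z + d))/(_ _)/wrap[]] := su; first by rewrite ltrDl.
move=> [d1 d10 d1P] _.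
have n1 : \forall w \near z, u w < u z + d.
  apply/nbhs_ballP; exists d1 => //= w; rewrite -ball_normE /= distrC => hw; apply: d1P; exact: ltW.
have n2 : \forall w \near z, psi z - d < psi w. by apply: (cvgr_gt (psi z) (cp z)); rewrite ltrBlDr ltrDl.
near=> w; rewrite gt_max k0 /=.
have w1 : u w < u z + d by near: w.
have w2 : psi z - d < psi w by near: w.
by move: w1 w2; rewrite /d; lra.
Unshelve. all: end_near.
Qed.
(** Either u - psi + 3 M <= 0 at x0: then U x0 = 0, p has a minimum there and g = Kp >= 0. Or p +
    psi - 3 M touches u, and [touching] applies, the Laplacian of psi being 0 for E0 < a / 2 and at
    most Kp elsewhere. *)
Let visc p x0 : ctf p -> (forall z, U z <= p z) -> U x0 = p x0 -> - g x0 <= lap dirs p x0.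
Proof.
move=> cp Up Ux; have sp := ctf_smooth cp; have sps := ctf_smooth cpsi.
case: (ltP 0 (u x0 - psi x0 + 3 * M)) => hu; last first. have U00 : U x0 = 0 by apply: max_idPl.
  have hE : a / 2 <= E0 x0. rewrite leNgt; apply/negP => hE; move: hu; rewrite (psi_in (ltW hE)).
    by have /andP[+ _] := uM x0; have := M1; lra. have [Kp0 _] := KpP 0.
  apply: (@le_trans _ _ 0); first by rewrite g_out // oppr_le0.
  rewrite lap_dirs; apply: sumr_ge0 => j _; apply: Lap_ge0_min => //; last exact: ctf_bbm.
  by move=> w; rewrite -Ux U00; exact: le_trans (U0 w) (Up w).
have UE : U x0 = u x0 - psi x0 + 3 * M by apply: max_idPr; exact: ltW.
have hE : E0 x0 <= a.
  rewrite leNgt; apply/negP => hE; have := U_out (ltW hE); rewrite UE => h; move: hu; rewrite h ltxx //.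
pose p2 z := p z + (psi z + - (3 * M)).
have cp2 : ctf p2 by apply: ctfD => //; apply: ctfD => //; exact: ctf_cst.
have up2 z : u z <= p2 z. have := Up z; rewrite /U ge_max => /andP[_]; rewrite /p2; lra.
have ux2 : u x0 = p2 x0 by rewrite /p2 -Ux UE; ring.
have fm' z : `|z - x0| <= eps -> Om z /\ m0 <= f z.
  move=> h; apply: fm; rewrite -(subrK x0 z) -addrA; apply: le_trans (ler_normD _ _) _.
  by rewrite mulr2n mulrDl mul1r; apply: lerD => //; exact: near.
have := touching oOm c0 mf su MA cp2 up2 ux2 eps0 fm' lam0 lamm dB bsE.
rewrite -lap_dirs lapD //; last by apply: smoothD => //; exact: smooth_cst.
rewrite lapD //; last exact: smooth_cst.
rewrite lap_cst addr0 -/Lam => h.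
case: (ltP (E0 x0) (a / 2)) => hE2. have l0 : lap dirs psi x0 = 0.
    rewrite lap_dirs; apply: big1 => j _; rewrite (@Lap_near _ _ _ (fun=> 0) [set z | E0 z < a / 2]) ?Lap_cst //.
      have cE : continuous E0 by apply: smooth_cont; exact: smooth_eucl_at.
      by move/continuousP: cE => /(_ _ (@open_lt R (a / 2))). by move=> y; rewrite inE /= => /ltW; exact: psi_in.
  by have := g_ge x0; move: h; rewrite l0; lra.
rewrite g_out //; have [_] := KpP x0; rewrite ler_norml => /andP[_]; move: h Lam0; lra.
Qed.
(** Smooth majorants of U: the rescaling by k + 1 reduces the error of [smax] to 1 / (k + 1). *)
Let G k z := k.+1%:R^-1 * smax (k.+1%:R * (A (eps / k.+2%:R) u z - psi z + 3 * M)).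

Let dj k : 0 < eps / k.+2%:R.
Proof. by rewrite divr_gt0. Qed.
Let G_ge k z : Num.max 0 (A (eps / k.+2%:R) u z - psi z + 3 * M) <= G k z.
Proof.
have [_ [_ _ h _] _ _] := @smaxP R; set t := _ + 3 * M.
apply: (@le_trans _ _ (k.+1%:R^-1 * Num.max (k.+1%:R * t) 0)); last by rewrite ler_wpM2l ?invr_ge0.
by rewrite maxr_pMr ?invr_ge0 // mulr0 mulKf ?pnatr_eq0 // maxC.
Qed.
Let G_le k z : G k z <= Num.max 0 (A (eps / k.+2%:R) u z - psi z + 3 * M) + k.+1%:R^-1.
Proof.
have [_ [_ _ _ h] _ _] := @smaxP R; set t := _ + 3 * M.
apply: (@le_trans _ _ (k.+1%:R^-1 * (Num.max (k.+1%:R * t) 0 + 1))); first by rewrite ler_wpM2l ?invr_ge0.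
by rewrite mulrDr mulr1 maxr_pMr ?invr_ge0 // mulr0 mulKf ?pnatr_eq0 // maxC.
Qed.
Let AM k z : - M <= A (eps / k.+2%:R) u z <= M.
Proof.
rewrite -ler_norml; apply: A_bound => //; first exact: ltW.
by move=> w; rewrite ler_norml; exact: uM.
Qed.
Let G_out k z : a <= E0 z -> G k z = 0.
Proof.
move=> h; have [_ [s0 _ _ _] _ _] := @smaxP R.
rewrite /G psi_out // s0 ?mulr0 //; have /andP[_ h2] := AM k z.
have k1 : 1 <= k.+1%:R :> R by rewrite ler1n.
have t1 : A (eps / k.+2%:R) u z - (4 * M + 1) + 3 * M <= -1 by move: h2; lra.
apply: (@le_trans _ _ (k.+1%:R * (-1))); first by rewrite ler_wpM2l.
by rewrite mulrN1 lerN2.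
Qed.
Let G_sm k : smooth (G k).
Proof.
have [s1 _ _ _] := @smaxP R.
apply: smoothZ; apply: (smooth_comp s1); apply: smoothZ; apply: smoothD; last exact: smooth_cst.
by apply: smoothB; [exact: smooth_A|exact: ctf_smooth].
Qed.
Let G_U k z : U z <= G k z.
Proof.
case: (lerP a (E0 z)) => hz; first by rewrite U_out // G_out.
apply: le_trans (G_ge k z); have rz := room_near (near (ltW hz)).
have h : u z <= A (eps / k.+2%:R) u z. apply: (@le_A _ _ Om) => //; first exact: ltW.
  by apply: room_le rz; rewrite ler_pdivrMr // ler_peMr ?(ltW eps0) // ler1n.
rewrite /U ge_max le_max lexx /= le_max; apply/orP; right; move: h; lra.
Qed.
Let G_cvg z : G k z @[k --> \oo] --> U z.
Proof.
case: (lerP a (E0 z)) => hz. by rewrite U_out //; under eq_fun do rewrite G_out //; exact: cvg_cst.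
have rz := room_near (near (ltW hz)).
have h1 : A (eps / k.+2%:R) u z - psi z + 3 * M @[k --> \oo] --> u z - psi z + 3 * M.
  apply: cvgD; last exact: cvg_cst. by apply: cvgB; [exact: (A_cvg eps0 su rz)|exact: cvg_cst].
have h2 : Num.max 0 (A (eps / k.+2%:R) u z - psi z + 3 * M) @[k --> \oo] --> U z. exact: cvg_max0.
have h3 : Num.max 0 (A (eps / k.+2%:R) u z - psi z + 3 * M) + k.+1%:R^-1 @[k --> \oo] --> U z.
  rewrite -[U z]addr0; apply: cvgD => //; exact: cvg_harmonic.
apply: squeeze_cvgr h2 h3; apply: nearW => k; by rewrite G_ge G_le.
Qed.
(** The kernel of [A eps] as found in [A_conv]. It is even, so its translate phi computes
    derivatives of A eps u at xs. *)
Let kk z := eps^-1 ^+ (n + n) * (I (@rho0 R n))^-1 * flat (4^-1 - eps^-1 ^+ 2 * eucl z).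

Let tkk : tst kk.
Proof. by apply: tstZ; apply: tst_flat_eucl; rewrite exprn_gt0 // invr_gt0. Qed.
Let kk_even z : kk (- z) = kk z.
Proof. by rewrite /kk euclN. Qed.
Let phi z := kk (z - xs).

Let tphi : tst phi.
Proof. exact: tst_translate. Qed.
Let phi0 z : 0 <= phi z.
Proof.
apply: mulr_ge0; last exact: flat_ge0.
by rewrite mulr_ge0 ?exprn_ge0 ?invr_ge0 ?(ltW eps0) // ltW // I_rho0_gt0.
Qed.
Let phi_out z : a / 4 <= E0 z -> phi z = 0.
Proof.
move=> h; rewrite /phi /kk flat0 ?mulr0 // subr_le0 exprVn mulrC ler_pdivlMr ?exprn_gt0 //.
by move: h; rewrite /a /E0; lra.
Qed.
Let phi_kk y : kk (xs - y) = phi y.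
Proof. by rewrite /phi -kk_even opprB. Qed.
Let I_phi : I phi = 1.
Proof.
have b1 : bbm (fun _ : C => 1 : R) by split; [exact: measurable_cst|exists `|1|].
have := congr1 (fun F => F xs) (A_conv eps0 b1); rewrite /A.
rewrite (@I_ext _ _ _ (@rho R n)); last by move=> w; rewrite mul1r.
rewrite I_rho => ->; apply: I_ext => y; by rewrite mulr1 -phi_kk.
Qed.
Let lap_phi_A : lap dirs (A eps u) xs = I (fun y => u y * lap dirs phi y).
Proof.
have sk := tst_smooth tkk.
have E v z : dd v (dd v (A eps u)) z = I (fun y => dd v (dd v kk) (z - y) * u y). rewrite A_conv // -/kk.
  have -> : dd v (conv kk u) = conv (dd v kk) u by rewrite -ddEf (conv_smooth_step tkk bu).2.
  have -> // : dd v (conv (dd v kk) u) = conv (dd v (dd v kk)) u.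
  by rewrite -ddEf (conv_smooth_step (tst_dd v tkk) bu).2.
rewrite /lap; under eq_bigr do rewrite E.
rewrite -I_sum; last first. by move=> i _; apply: nice_conv => //; apply: tst_nice; do 2 apply: tst_dd.
apply: I_ext => y; rewrite mulr_sumr; apply: eq_bigr => i _.
rewrite mulrC; congr (_ * _); rewrite -(dd2_even _ sk kk_even) opprB.
by rewrite /phi !dd_translate.
Qed.
Let I_lap_phi : I (lap dirs phi) = 0.
Proof.
rewrite /lap I_sum; last by move=> i _; apply: tst_nice; do 2 apply: tst_dd.
by apply: big1 => i _; rewrite -ddEf I_derive //; exact: tst_dd.
Qed.
Let lap_phi_out z : a / 4 < E0 z -> lap dirs phi z = 0.
Proof.
move=> hz; rewrite lap_dirs; apply: big1 => j _.
rewrite (@Lap_near _ _ _ (fun=> 0) [set y | a / 4 < E0 y]) ?Lap_cst //.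
  have cE : continuous E0 by apply: smooth_cont; exact: smooth_eucl_at.
  by move/continuousP: cE => /(_ _ (@open_gt R (a / 4))).
by move=> y; rewrite inE /= => /ltW; exact: phi_out.
Qed.

(** On the support of phi, U = u + 3 M and g = - Lam. The constant 3 M pairs to 0 with lap phi and
    phi has integral 1, so [walk_main] reads Lam <= lap (A eps u) xs. *)
Lemma linear_bound : 4 * n%:R * lam <= \sum_(j < n) Lap (bs j) (A eps u) xs.
Proof.
have GM k z : `|G k z| <= 4 * M + 1. have k1 : k.+1%:R^-1 <= 1 :> R by rewrite invf_le1 // ler1n.
  rewrite ger0_norm; last exact: le_trans (U0 z) (G_U k z). apply: le_trans (G_le k z) _; apply: lerD => //.
  by rewrite ge_max; have /andP[_ h] := AM k z; have := psi_ge0 z; have := M1; move: h => *; apply/andP; split; lra.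
have Gsupp k z : rr < `|z| -> G k z = 0 by move=> /far h; apply: G_out; exact: ltW.
have tG k : tst (G k) by split=> //; exists rr => z; exact: Gsupp.
have Usupp z : rr < `|z| -> U z = 0 by move=> /far h; apply: U_out; exact: ltW.
have gsupp z : rr < `|z| -> 0 <= g z. move=> /far h; rewrite g_out; first by case: (KpP 0).
  by apply: le_trans (ltW h); rewrite ler_pdivrMr // ler_pMr // ler1n.
have := walk_main nU U0 Usupp usc cg gsupp visc tG G_U GM Gsupp G_cvg tphi phi0.
have np := tst_nice tphi; have nlp := tst_nice (tst_lap dirs tphi).
have nul : nice (fun z => u z * lap dirs phi z).
  by rewrite (_ : (fun z => _) = fun z => lap dirs phi z * u z); [apply: niceM => //; case: bu|apply/funext => z; rewrite mulrC].
rewrite (@I_ext _ _ _ (fun z => u z * lap dirs phi z + (3 * M) * lap dirs phi z)); last first.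
  move=> z; rewrite -mulrDl; case: (ltP (a / 4) (E0 z)) => hz; first by rewrite lap_phi_out // !mulr0.
  have h2 : E0 z <= a / 2 by apply: le_trans hz _; move: a0; lra.
  congr (_ * _); rewrite /U psi_in // subr0; apply: max_idPr. by have /andP[+ _] := uM z; have := M1; lra.
rewrite ID //; last exact: niceZ.
rewrite IZ // I_lap_phi mulr0 addr0 -lap_phi_A.
rewrite (@I_ext _ _ (fun z => g z * phi z) (fun z => - Lam * phi z)); last first.
  move=> z; case: (lerP (a / 4) (E0 z)) => hz; first by rewrite phi_out // !mulr0.
  by rewrite /g chi_in ?ltW // mulr0 add0r.
by rewrite IZ // I_phi mulr1 lap_dirs subr_ge0.
Qed.

End linear_bound.

(** * Strict positivity and its stability under smooth maxima *)

Section strict_positivity.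
Context {R : realType} {n : nat}.
Notation C := (Cn R n).
Notation K := (R[i]).
Implicit Types (f g h k : C -> R) (z b : C) (l s : R).

(* [g] is strictly plurisubharmonic at [z] and, by the arithmetic-geometric
   inequality, the second condition is [(l / 4 n) ^ n <= \det (Hess g z)]; unlike
   the determinant, it is linear in [g]. *)
Definition spos l g z := (forall b, b != 0 -> 0 < Lap b g z) /\
  forall (Bm : 'M[K]_n) (bs : 'I_n -> C), `|\det Bm| = 1 -> (forall j, cvec (bs j) = row j Bm) ->
    l <= \sum_j Lap (bs j) g z.

Lemma spos_le l l' g z : l' <= l -> spos l g z -> spos l' g z.
Proof. by move=> ll [h1 h2]; split=> // Bm bs dB bE; exact: le_trans ll (h2 Bm bs dB bE). Qed.

Lemma spos_Lap_ge0 l g z b : smooth g -> spos l g z -> 0 <= Lap b g z.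
Proof.
move=> sg [h _]; case: (eqVneq b 0) => [->|/h/ltW //].
by have := LapZdir 0 0 z sg; rewrite scale0r expr0n mul0r => ->.
Qed.

Lemma eucl_cvec b : quad (1%:M : 'M[K]_n) (cvec b) = (eucl b)%:C%C.
Proof.
rewrite /quad /eucl rmorph_sum; apply: eq_bigr => a _.
rewrite (bigD1 a) //= big1 ?addr0 => [|c ca]; last first. by rewrite [1%:M _ _]mxE eq_sym (negbTE ca) mulr0 mul0r.
rewrite !mxE eqxx mulr1 conj_Complex /coordx /coordy; apply: creim_eq => /=; ring.
Qed.

(** The arithmetic-geometric inequality for the identity matrix. *)
Lemma sum_eucl_ge (Bm : 'M[K]_n) (bs : 'I_n -> C) : `|\det Bm| = 1 ->
  (forall j, cvec (bs j) = row j Bm) -> n%:R <= \sum_j eucl (bs j).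
Proof.
move=> dB bE; have p1 : psd (1%:M : 'M[K]_n).
  split=> [a c|v]; first by rewrite !mxE eq_sym; case: eqP => _; rewrite ?rmorph1 ?rmorph0.
  by have [b ->] := cvec_surj v; rewrite eucl_cvec real_ge0 eucl_ge0.
have := psd_AGM p1 (@ler01 K); rewrite det1 expr1n lexx => /(_ Bm isT dB).
under eq_bigr do rewrite -bE eucl_cvec.
by rewrite mulr1 -rmorph_sum -[(n%:R : K)](rmorph_nat (real_complex R)) lecR.
Qed.

Lemma spos_of_Lap g z (a : R) : 0 < a -> (forall b, 4 * a * eucl b <= Lap b g z) -> spos (4 * n%:R * a) g z.
Proof.
move=> a0 H; split=> [b b0|Bm bs dB bE]. by apply: lt_le_trans (H b); rewrite mulr_gt0 ?eucl_gt0 // mulr_gt0.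
apply: (@le_trans _ _ (\sum_j 4 * a * eucl (bs j))); last by apply: ler_sum => j _; exact: H.
rewrite -mulr_sumr -mulrA [n%:R * a]mulrC mulrA ler_wpM2l ?mulr_ge0 ?(ltW a0) //.
exact: sum_eucl_ge dB bE.
Qed.

Lemma sposD_eucl l g z (a r : R) : smooth g -> 0 < a -> (forall b, 0 <= Lap b g z) ->
  (forall (Bm : 'M[K]_n) (bs : 'I_n -> C), `|\det Bm| = 1 -> (forall j, cvec (bs j) = row j Bm) ->
    l <= \sum_j Lap (bs j) g z) -> spos (l + 4 * n%:R * a) (fun z => g z + a * eucl z + r) z.
Proof.
move=> sg a0 g0 gl.
have se : smooth (fun z : C => a * eucl z) by apply: smoothZ; exact: smooth_eucl.
have E b : Lap b (fun z => g z + a * eucl z + r) z = Lap b g z + a * (4 * eucl b).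
  rewrite LapD; [|exact: smoothD|exact: smooth_cst].
  by rewrite Lap_cst addr0 LapD // LapZ ?Lap_eucl //; exact: smooth_eucl.
split=> [b b0|Bm bs dB bE]. by rewrite E ltr_wpDl // mulr_gt0 // mulr_gt0 // eucl_gt0.
under eq_bigr do rewrite E; rewrite big_split lerD //=; first exact: gl bE.
rewrite -mulr_sumr -mulr_sumr; have := ler_wpM2l (ltW a0) (sum_eucl_ge dB bE).
by move: (\sum_j _) => S; lra.
Qed.

(** Here the determinant is recovered from the linear bounds, through the unimodular basis that
    gives equality in the arithmetic-geometric inequality. *)
Lemma spos_det g z (lam : R) : (0 < n)%N -> smooth g -> 0 <= lam -> spos (4 * n%:R * lam) g z ->
  n`!%:R * lam ^+ n <= mm (nseq n g) z.
Proof.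
move=> n0 sg l0 [gp gl]; set H := Hess g z.
have hH : herm H by exact: herm_Hess.
have qH (v : 'rV[K]_n) : v != 0 -> 0 < quad H v.
  have [b ->] := cvec_surj v; rewrite cvec_eq0 => /gp h; rewrite quad_Hess //.
  by rewrite lt0r real_ge0 ltW ?divr_gt0 // andbT -[X in _ != X](rmorph0 (real_complex R)) (inj_eq (@complexI R)) gt_eqF ?divr_gt0.
have lK : 0 <= (lam%:C%C : K) by rewrite real_ge0.
have det_ge : (lam%:C%C : K) ^+ n <= \det H. apply: psd_AGM_conv => // B dB.
  pose bs j := projT1 (cid (cvec_surj (row j B))). have bE j : cvec (bs j) = row j B by rewrite /bs; case: cid.
  under eq_bigr do rewrite -bE quad_Hess //.
  rewrite -[(n%:R : K)](rmorph_nat (real_complex R)) -rmorphM -rmorph_sum lecR -mulr_suml ler_pdivlMr //.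
  by have := gl B bs dB bE; lra.
rewrite mm_def /hmix map_nseq (mixed_det H).
have : cre ((lam%:C%C : K) ^+ n) <= cre (\det H). by move: det_ge; rewrite lecE => /andP[_].
rewrite -rmorphXn -[(n`!%:R : K)](rmorph_nat (real_complex R)) ReM /= mul0r subr0 => h.
by rewrite ler_wpM2l.
Qed.

(** A smooth maximum of f and g, equal to the larger function wherever they differ by at least s. *)
Definition glue s f g z := f z + s * smax (s^-1 * (g z - f z)).

Section glue.
Variables (s : R) (f g : C -> R).
Hypotheses (s0 : 0 < s) (sf : smooth f) (sg : smooth g).

Lemma smooth_glue : smooth (glue s f g).
Proof.
have [s1 _ _ _] := @smaxP R.
apply: smoothD => //; apply: smoothZ; apply: (smooth_comp s1); apply: smoothZ; exact: smoothB.
Qed.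

Lemma glue_eql z : g z <= f z - s -> glue s f g z = f z.
Proof.
move=> h; have [_ [z1 _ _ _] _ _] := @smaxP R.
by rewrite /glue z1 ?mulr0 ?addr0 // mulrC ler_pdivrMr //; lra.
Qed.

Lemma glue_gel z : f z <= glue s f g z.
Proof.
have [_ [_ _ h _] _ _] := @smaxP R; rewrite /glue lerDl mulr_ge0 ?(ltW s0) //.
by apply: le_trans (h _); rewrite le_max lexx orbT.
Qed.

Lemma glue_ger z : g z <= glue s f g z.
Proof.
have [_ [_ _ h _] _ _] := @smaxP R; rewrite /glue -lerBlDl.
apply: (@le_trans _ _ (s * (s^-1 * (g z - f z)))); first by rewrite mulrA divff ?mul1r // gt_eqF.
by rewrite ler_wpM2l ?(ltW s0) //; apply: le_trans (h _); rewrite le_max lexx.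
Qed.

Lemma glue_le z : glue s f g z <= Num.max (f z) (g z + 2 * s).
Proof.
case: (lerP (g z) (f z - s)) => h; first by rewrite glue_eql // le_max lexx.
have [_ [_ _ _ h2] _ _] := @smaxP R; rewrite le_max; apply/orP; right.
rewrite /glue; have E : s * (s^-1 * (g z - f z)) = g z - f z by rewrite mulrA divff ?mul1r // gt_eqF.
move: (s^-1 * (g z - f z)) E => t E; have := ler_wpM2l (ltW s0) (h2 t).
rewrite mulrDr mulr1 maxr_pMr ?(ltW s0) // mulr0 E => h3.
rewrite -lerBrDl; apply: le_trans h3 _; rewrite -lerBrDr ge_max; apply/andP; split; move: h s0; lra.
Qed.

(** The chain rule gives a convex combination with th = smax', plus a term with factor smax'' >=
    0. *)
Lemma Lap_glue z : exists th, [/\ 0 <= th, th <= 1, g z <= f z - s -> th = 0, f z <= g z - s -> th = 1 &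
  forall b, (1 - th) * Lap b f z + th * Lap b g z <= Lap b (glue s f g) z].
Proof.
have [s1 _ [d0 d1 d2 d3] ddp] := @smaxP R; set t := s^-1 * (g z - f z).
exists (derive1 smax t); split=> //.
- by move=> h; apply: d2; rewrite /t mulrC ler_pdivrMr //; lra.
- by move=> h; apply: d3; rewrite /t mulrC ler_pdivlMr //; lra.
move=> b; have sgf : smooth (fun z => g z - f z) by exact: smoothB.
have sk : smooth (fun z => s^-1 * (g z - f z)) by exact: smoothZ.
have sm : smooth (fun z => smax (s^-1 * (g z - f z))) by exact: (smooth_comp s1).
rewrite /glue LapD //; last exact: smoothZ.
rewrite LapZ // (Lap_comp b z s1 sk) LapZ // LapB // -/t.
have : 0 <= s * (derive1 (derive1 smax) t * (dd b (fun z => s^-1 * (g z - f z)) z ^+ 2 + dd (Jc b) (fun z => s^-1 * (g z - f z)) z ^+ 2)).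
  by rewrite mulr_ge0 ?(ltW s0) // mulr_ge0 ?ddp // addr_ge0 ?sqr_ge0.
move: (derive1 (derive1 smax) t * _) => y hy.
rewrite mulrDr mulrCA [s * (s^-1 * _)]mulrA divff ?gt_eqF // mul1r.
by rewrite mulrBr mulrBl mul1r; lra.
Qed.

Lemma spos_glue l z : spos l f z -> spos l g z -> spos l (glue s f g) z.
Proof.
move=> [f1 f2] [g1 g2]; have [th [t0 t1 _ _ H]] := Lap_glue z; split=> [b b0|Bm bs dB bE].
  apply: lt_le_trans (H b); have h1 := f1 b b0; have h2 := g1 b b0.
  case: (ltrgt0P th) t0 => // ht _; last by rewrite ht subr0 mul1r mul0r addr0.
  by rewrite ltr_wpDl ?mulr_gt0 // mulr_ge0 ?subr_ge0 // ltW.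
apply: (@le_trans _ _ (\sum_j ((1 - th) * Lap (bs j) f z + th * Lap (bs j) g z))); last first.
  by apply: ler_sum => j _; exact: H.
rewrite big_split -!mulr_sumr /=; have h1 := f2 Bm bs dB bE; have h2 := g2 Bm bs dB bE.
have : (1 - th) * l <= (1 - th) * \sum_j Lap (bs j) f z by rewrite ler_wpM2l // subr_ge0.
have : th * l <= th * \sum_j Lap (bs j) g z by rewrite ler_wpM2l.
by rewrite mulrBl mul1r; lra.
Qed.

Lemma spos_gluel l z : spos l f z -> g z <= f z - s -> spos l (glue s f g) z.
Proof.
move=> [f1 f2] h; have [th [_ _ /(_ h) -> _ H]] := Lap_glue z.
have {}H b : Lap b f z <= Lap b (glue s f g) z by have := H b; rewrite subr0 mul1r mul0r addr0.
split=> [b b0|Bm bs dB bE]; first exact: lt_le_trans (f1 b b0) (H b).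
by apply: le_trans (f2 Bm bs dB bE) _; apply: ler_sum => j _.
Qed.

Lemma spos_gluer l z : spos l g z -> f z <= g z - s -> spos l (glue s f g) z.
Proof.
move=> [f1 f2] h; have [th [_ _ _ /(_ h) -> H]] := Lap_glue z.
have {}H b : Lap b g z <= Lap b (glue s f g) z by have := H b; rewrite subrr mul1r mul0r add0r.
split=> [b b0|Bm bs dB bE]; first exact: lt_le_trans (f1 b b0) (H b).
by apply: le_trans (f2 Bm bs dB bE) _; apply: ler_sum => j _.
Qed.

End glue.

(** * An infinite chain of smooth maxima, locally stationary *)

Section chain.
Variables (Om : set C) (v : C -> R) (R0 : C -> R) (b_ : nat -> C -> R) (t_ : nat -> R) (l : C -> R)
  (D : nat -> set C).
Hypotheses (sR0 : smooth R0) (sb : forall j, smooth (b_ j)) (t0 : forall j, 0 < t_ j)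
  (tS : forall j, t_ j.+1 <= t_ j / 16).
Hypotheses (b_le : forall j z, Om z -> b_ j z <= v z + 9 / 8 * t_ j)
  (b_D : forall j z, D j z -> v z + 7 / 8 * t_ j <= b_ j z)
  (b_dich : forall j z, Om z -> (spos (l z) (b_ j) z /\ v z - 9 / 8 * t_ j <= b_ j z) \/
     b_ j z <= v z - 7 / 8 * t_ j) (R0_dich : forall z, Om z -> spos (l z) R0 z \/ R0 z <= v z - 4 * t_ 0%N)
  (DO : forall j z, D j z -> Om z).

(** The gluing width t_j / 16 is small against the heights 7/8 t_j and 9/8 t_j of the level b_ j
    relative to v. *)
Fixpoint chain j : C -> R := if j is j'.+1 then glue (t_ j' / 16) (chain j') (b_ j') else R0.

Let s0 j : 0 < t_ j / 16.
Proof. by rewrite divr_gt0. Qed.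

Lemma smooth_chain j : smooth (chain j).
Proof. by elim: j => //= j IH; exact: smooth_glue. Qed.

Lemma chain_S j z : chain j z <= chain j.+1 z.
Proof. exact: (glue_gel (chain j) (b_ j) (s0 j) z). Qed.

Lemma chain_mono i j z : (i <= j)%N -> chain i z <= chain j z.
Proof.
move=> ij; rewrite -(subnK ij); elim: (j - i)%N => // k IH; rewrite addSn; exact: le_trans IH (chain_S _ _).
Qed.

Lemma chain_tau i j : (i <= j)%N -> t_ j <= t_ i.
Proof.
move=> ij; rewrite -(subnK ij); elim: (j - i)%N => // k IH; rewrite addSn; apply: le_trans IH.
by apply: le_trans (tS _) _; have := t0 (k + i); lra.
Qed.

(** On D i the chain has reached v + 7/8 t_i, while each later level is at most v + 9/8 t_i / 16:
    the later gluings change nothing there. *)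
Lemma chain_D i j z : D i z -> (i < j)%N -> chain j z = chain i.+1 z.
Proof.
move=> Dz ij; rewrite -(subnK ij); elim: (j - i.+1)%N => // k IH.
rewrite addSn -[RHS]IH /=; apply: (glue_eql (s0 _)); rewrite IH.
have h1 : v z + 7 / 8 * t_ i <= chain i.+1 z by apply: le_trans (b_D Dz) _; exact: (glue_ger (chain i) (b_ i) (s0 i) z).
have h2 := b_le (k + i.+1) (DO Dz).
have h3 : t_ (k + i.+1) <= t_ i / 16. by apply: le_trans (tS i); apply: chain_tau; exact: leq_addl.
by have := t0 i; have := t0 (k + i.+1); move: h1 h2 h3; lra.
Qed.

Lemma chain_dich j z : Om z -> spos (l z) (chain j) z \/ chain j z <= v z - 4 * t_ j.
Proof.
move=> Oz; elim: j => [|j IH]; first exact: R0_dich.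
have sc := smooth_chain j; have tj := t0 j; have tj1 := tS j.
case: (b_dich j Oz) => [[gb bl]|bl]. left; case: IH => [gc|cl]; first exact: (spos_glue (s0 j) sc (sb j) gc gb).
  by apply: (spos_gluer (s0 j) sc (sb j) gb); move: bl cl tj; lra.
case: IH => [gc|cl]; last first.
  right; apply: le_trans (glue_le (chain j) (b_ j) (s0 j) z) _; rewrite ge_max; apply/andP; split; move: bl cl tj tj1; lra.
case: (lerP (b_ j z) (chain j z - t_ j / 16)) => h; first by left; exact: (spos_gluel (s0 j) sc (sb j) gc h).
right; apply: le_trans (glue_le (chain j) (b_ j) (s0 j) z) _; rewrite ge_max; apply/andP; split; move: h bl tj tj1; lra.
Qed.

Lemma chain_spos i z : D i z -> spos (l z) (chain i.+1) z.
Proof.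
move=> Dz; case: (chain_dich i.+1 (DO Dz)) => // h.
have h1 : v z + 7 / 8 * t_ i <= chain i.+1 z by apply: le_trans (b_D Dz) _; exact: (glue_ger (chain i) (b_ i) (s0 i) z).
by have := t0 i; have := t0 i.+1; move: h h1; lra.
Qed.

Lemma chain_le j z : Om z -> chain j z <= Num.max (R0 z) (v z + 2 * t_ 0%N).
Proof.
move=> Oz; elim: j => [|j IH]; first by rewrite le_max lexx.
apply: le_trans (glue_le (chain j) (b_ j) (s0 j) z) _; rewrite ge_max IH /= le_max; apply/orP; right.
by have := b_le j Oz; have := chain_tau (leq0n j); have := t0 j; lra.
Qed.

(** Near the boundary the first i levels are low, so that only levels of height at most 9/8 t_i
    contribute. *)
Lemma chain_far i j z : Om z -> R0 z <= v z -> (forall k : nat, (k < i)%N -> b_ k z <= v z - 7 / 8 * t_ k) ->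
  chain j z <= v z + 2 * t_ i.
Proof.
move=> Oz R0v bk; have ti := t0 i; elim: j => [|j IH]; first by apply: le_trans R0v _; rewrite lerDl mulr_ge0 // ltW.
apply: le_trans (glue_le (chain j) (b_ j) (s0 j) z) _; rewrite ge_max IH /=; have tj := t0 j.
case: (ltnP j i) => ji; first by have := bk j ji; move: ti tj; lra.
by have := b_le j Oz; have := chain_tau ji; move: tj; lra.
Qed.

End chain.
End strict_positivity.

Import HBNNSimple.

(** * Measures given by a density *)

Section density.
Context {d : measure_display} {T : measurableType d} {R : realType}.
Variables (mu : {measure set T -> \bar R}) (m : T -> R).
Implicit Types (A E : set T).
Local Open Scope ereal_scope.

Definition density of measurable_fun setT m & (forall x, 0 <= m x)%R := fun A => \int[mu]_(x in A) (m x)%:E.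

Variables (m_meas : measurable_fun setT m) (m0 : (forall x, 0 <= m x)%R).
Local Notation nu := (density m_meas m0).

Let nu0 : nu set0 = 0.
Proof. exact: integral_set0. Qed.
Let nu_ge0 A : 0 <= nu A.
Proof. by apply: integral_ge0 => x _; rewrite lee_fin. Qed.
Let nu_sigma : semi_sigma_additive nu.
Proof.
move=> F mF tF mU; rewrite /density ge0_integral_bigcup //.
- by apply: is_cvg_nneseries => k _ _; exact: nu_ge0.
- by apply/measurable_EFinP; apply: measurable_funTS.
- by move=> x _; rewrite lee_fin.
Qed.

HB.instance Definition _ := isMeasure.Build _ _ _ nu nu0 nu_ge0 nu_sigma.

Lemma integral_density_indic A E : measurable A -> measurable E ->
  \int[nu]_(x in E) (\1_A x)%:E = \int[mu]_(x in E) ((\1_A x)%:E * (m x)%:E).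
Proof.
move=> mA mE; rewrite integral_indic // /nu /= /density setIC integral_mkcondr.
by apply: eq_integral => x _; rewrite restrict_EFin /= patchE indicE; case: ifP => _; rewrite ?mul1e ?mul0e.
Qed.

(** Indicators first, then simple functions, then monotone limits. *)
Lemma ge0_integral_density (f : T -> R) E : measurable E -> measurable_fun E f ->
  (forall x, 0 <= f x)%R -> \int[nu]_(x in E) (f x)%:E = \int[mu]_(x in E) (f x * m x)%:E.
Proof.
move=> mE mf f0.
have mfE : measurable_fun E (EFin \o f) by exact/measurable_EFinP.
pose h := nnsfun_approx mE mfE.
have hcv x : E x -> (h n x)%:E @[n --> \oo] --> (f x)%:E. by apply: cvg_nnsfun_approx => y _; rewrite lee_fin.
have hnd x i j : (i <= j)%N -> (h i x <= h j x)%R. by move=> ij; exact/lefP/nd_nnsfun_approx.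
have mm' : measurable_fun E (fun x => (m x)%:E) by apply/measurable_EFinP; exact: measurable_funTS.
have mh i : measurable_fun E (fun x => (h i x)%:E) by apply/measurable_EFinP; exact: measurable_funTS.
have -> : \int[nu]_(x in E) (f x)%:E = limn (fun i => \int[nu]_(x in E) (h i x)%:E).
  rewrite -monotone_convergence //; last by move=> x _ i j ij; rewrite lee_fin hnd.
    by apply: eq_integral => x; rewrite inE => Ex; apply/esym/cvg_lim => //; exact: hcv.
  by move=> i x _; rewrite lee_fin.
have -> : \int[mu]_(x in E) (f x * m x)%:E = limn (fun i => \int[mu]_(x in E) ((h i x)%:E * (m x)%:E)).
  rewrite -monotone_convergence //; first last.
  - by move=> x _ i j ij; rewrite -!EFinM lee_fin ler_wpM2r // hnd.
  - by move=> i x _; rewrite -EFinM lee_fin mulr_ge0.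
  - by move=> i; exact: emeasurable_funM. apply: eq_integral => x; rewrite inE => Ex; apply/esym/cvg_lim => //.
  by rewrite EFinM; apply: cvgeZr => //; exact: hcv.
congr (limn _); apply/funext => i; set g := h i.
have gE x : (g x)%:E = \sum_(y \in range g) (y%:E * (\1_(g @^-1` [set y]) x)%:E).
  by rewrite fimfunE -fsumEFin //; apply: eq_fsbigr => y _; rewrite EFinM.
have ind_ge0 y x : 0 <= y%:E * (\1_(g @^-1` [set y]) x)%:E by rewrite -EFinM; exact: nnfun_muleindic_ge0.
have mind y : measurable_fun E (fun x => y%:E * (\1_(g @^-1` [set y]) x)%:E).
  by under eq_fun do rewrite -EFinM; apply/measurable_EFinP; apply: measurable_funTS; exact: measurable_funM.
under [LHS]eq_integral do rewrite gE.
under [RHS]eq_integral do rewrite gE ge0_mule_fsuml //.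
rewrite ge0_integral_fsum // ge0_integral_fsum //; last 2 first.
- by move=> y; exact: emeasurable_funM.
- by move=> y x _; rewrite mule_ge0 // lee_fin.
apply: eq_fsbigr => y; rewrite inE => -[x _ <-].
have gx0 : (0 <= g x)%R by [].
have mg1 : measurable (g @^-1` [set g x]) by [].
have mi : measurable_fun E (fun z => (\1_(g @^-1` [set g x]) z : R)%:E).
  by apply/measurable_EFinP; exact: measurable_funTS.
have i0 z : E z -> 0 <= (\1_(g @^-1` [set g x]) z : R)%:E by rewrite lee_fin.
rewrite (ge0_integralZl_EFin _ mE i0 mi gx0) integral_density_indic //.
under [RHS]eq_integral do rewrite -muleA.
have im0 z : E z -> 0 <= (\1_(g @^-1` [set g x]) z : R)%:E * (m z)%:E by rewrite mule_ge0 // lee_fin.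
by rewrite (ge0_integralZl_EFin _ mE im0 _ gx0) //; exact: emeasurable_funM.
Qed.

End density.

(** * Monge-Ampere measure and plurisubharmonicity of a locally smooth function *)

Section locally_smooth.
Context {R : realType} {n : nat}.
Notation C := (Cn R n).
Notation bC := (borelCn R n).
Notation K := (R[i]).
Notation V := (lebesgueCn R n).
Implicit Types (g h phi : C -> R) (z b : C) (I J : {set 'I_n}) (k i : nat).
Variables (Om : set C) (w : C -> R) (D : nat -> set C) (W : nat -> C -> R) (c : R).
Hypotheses (oOm : open Om) (c0 : 0 < c) (oD : forall i, open (D i)) (DO : forall i, D i `<=` Om)
  (DK : forall A : set C, compact A -> A `<=` Om -> exists i, A `<=` D i)
  (sW : forall i, smooth (W i)) (wW : forall i z, D i z -> w z = W i z).

Let mOm : measurable (Om : set bC).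
Proof. exact: open_measurableCn. Qed.
Let in_D z : Om z -> exists i, D i z.
Proof.
move=> Oz; have [|i H] := DK (@compact_set1 _ z); first by move=> _ ->.
by exists i; exact: H.
Qed.

Lemma locally_cont_measurable g :
  (forall z, Om z -> exists A h, [/\ open A, A z, continuous h & {in A, g =1 h}]) -> mfun_on Om g.
Proof.
move=> H; apply: usc_measurable => // r; exists [set z | Om z /\ g z < r]; last first.
  by apply/seteqP; split => [z [h1 h2]|z [h1 [h2 h3]]].
rewrite openE => z [Oz gz]; have [A [h [oA Az ch Ah]]] := H z Oz.
have n1 : \forall y \near z, h y < r by apply: (cvgr_lt (h z) (ch z)); rewrite -Ah // mem_set.
have n2 : nbhs z A by exact: open_nbhs_nbhs.
have n3 : nbhs z Om by exact: open_nbhs_nbhs.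
rewrite /interior; near=> y; split; first by near: y.
rewrite Ah; first by near: y.
by rewrite inE; near: y.
Unshelve. all: end_near.
Qed.
Let dens k I J z : K := (c ^+ k)%:C%C * hmix (nseq k w) I J z.
Let densW i k I J z : K := (c ^+ k)%:C%C * hmix (nseq k (W i)) I J z.

Let densE i k I J z : D i z -> dens k I J z = densW i k I J z.
Proof.
move=> Dz; congr (_ * _); rewrite /hmix !map_nseq; congr (mixed (nseq _ _) _ _).
apply: (@Hess_near _ _ _ _ (D i)) => // y; rewrite inE; exact: wW.
Qed.
Let csm_densW i k I J : csm (densW i k I J).
Proof. by apply: csmZ; apply: csm_hmix; exact: smooths_nseq. Qed.
(** Coefficients of a [current] must have modulus at most 1, so the mass receives a density
    dominating all of them; the summand 1 allows division by it. *)
Let size1 (d : {set 'I_n} -> {set 'I_n} -> C -> K) z : R :=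
  1 + \sum_I \sum_J (`|cre (d I J z)| + `|cim (d I J z)|).

Let size1_ge d z I J : `|cre (d I J z)| + `|cim (d I J z)| <= size1 d z.
Proof.
rewrite /size1 (bigD1 I) //= (bigD1 J) //= ler_wpDl // -addrA lerDl addr_ge0 //.
  by apply: sumr_ge0 => ? _; rewrite addr_ge0.
by do 2 apply: sumr_ge0 => ? _; rewrite addr_ge0.
Qed.
Let size1_gt0 d z : 0 < size1 d z.
Proof. by rewrite ltr_pwDl //; do 2 apply: sumr_ge0 => ? _; rewrite addr_ge0. Qed.
Let size1_cont i k : continuous (size1 (densW i k)).
Proof.
have cS : continuous (fun z => \sum_I \sum_J (`|cre (densW i k I J z)| + `|cim (densW i k I J z)|)).
  apply: continuous_big => [|I _]; first exact: add_continuous.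
  apply: continuous_big => [|J _]; first exact: add_continuous. have [s1 s2] := csm_densW i k I J.
  by move=> y; apply: cvgD; apply: cvg_norm; [exact: (smooth_cont s1)|exact: (smooth_cont s2)].
by move=> z; apply: cvgD; [exact: cvg_cst|exact: cS].
Qed.
Let mk k z : R := if z \in Om then size1 (dens k) z else 0.

Let mk_D i k z : D i z -> mk k z = size1 (densW i k) z.
Proof.
move=> Dz; rewrite /mk mem_set; last exact: DO Dz.
by congr (1 + _); apply: eq_bigr => I _; apply: eq_bigr => J _; rewrite (densE k I J Dz).
Qed.
Let mk0 k z : 0 <= mk k z.
Proof. by rewrite /mk; case: ifP => _ //; exact: ltW. Qed.

Let meas0 g : (forall i z, D i z -> exists h, [/\ continuous h & {in D i, g =1 h}]) ->
  (forall z, ~ Om z -> g z = 0) -> mfun g.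
Proof.
move=> H g0; have m1 : mfun_on Om g.
  apply: locally_cont_measurable => z /in_D[i Dz]; have [h [ch gh]] := H i z Dz. by exists (D i), h.
have := (measurable_restrictT _ mOm).1 m1; congr (measurable_fun _ _); apply/funext => z.
by rewrite patchE; case: ifPn => // zO; rewrite g0 //; rewrite notin_setE in zO.
Qed.
Let mk_meas k : mfun (mk k).
Proof.
apply: meas0 => [i z Dz|z nO].
  by exists (size1 (densW i k)); split; [exact: size1_cont|move=> y; rewrite inE; exact: mk_D].
by rewrite /mk memNset.
Qed.
Let bounded_on (A : set C) g : compact A -> A `<=` Om ->
  (forall i, exists2 h, continuous h & forall z, D i z -> g z = h z) -> exists B, forall z, A z -> `|g z| <= B.
Proof.
move=> cA AO H; have [i AD] := DK cA AO; have [h ch gh] := H i.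
have [r AB] : exists r : R, forall z, A z -> `|z| <= r.
  have [r [_ rP]] := compact_bounded cA; exists (r + 1) => z Az; apply: rP => //; by rewrite ltrDl.
have [B BP] := continuous_bounded_ball r ch.
by exists B => z Az; rewrite gh; [apply: BP; exact: AB|exact: AD].
Qed.
Let radon_density (m : C -> R) (mm : mfun m) (m0 : forall z, 0 <= m z) :
  (forall i, exists2 h, continuous h & forall z, D i z -> m z = h z) -> radon_on Om (density V mm m0).
Proof.
move=> H A cA AO; have [B BP] := bounded_on cA AO H.
have mA : measurable (A : set bC) by apply: closed_measurableCn; exact: compact_closedCn.
have [r [_ rP]] := compact_bounded cA.
have Vfin : (V A < +oo)%E. apply: le_lt_trans (volume_normle_lty (r + 1)); apply: le_measure; rewrite ?inE //.
    by apply: closed_measurableCn; exact: closed_normle. by move=> z Az; apply: rP => //; rewrite ltrDl.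
rewrite /density; apply: (@le_lt_trans _ _ (\int[V]_(z in A) `|B|%:E)%E). apply: ge0_le_integral => //.
  - by move=> z _; rewrite lee_fin.
  - by apply/measurable_EFinP; exact: measurable_funTS.
  - by move=> z Az; rewrite lee_fin; apply: le_trans (ler_norm _) _; apply: le_trans (BP z Az) (ler_norm _).
by rewrite integral_cst //; apply: lte_mul_pinfty.
Qed.
Let suppg_meas (A : set C) g : A `<=` Om -> good Om A g -> mfun g.
Proof.
move=> AO [mg _ g0]; have := (measurable_restrictT _ mOm).1 mg; congr (measurable_fun _ _).
apply/funext => z; rewrite patchE; case: ifPn => // zO; rewrite g0 // => /AO Oz.
by rewrite notin_setE in zO.
Qed.
Let suppg_nice (A : set C) g h : compact A -> A `<=` Om -> good Om A g ->
  mfun h -> (exists B, forall z, A z -> `|h z| <= B) -> nice (fun z => g z * h z).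
Proof.
move=> cA AO gg mh [B BP]; have mg := suppg_meas AO gg; have [_ [k kP] g0] := gg.
split; first exact: measurable_funM.
have [r [_ rP]] := compact_bounded cA; exists (`|k| * `|B|), (r + 1) => z; split.
  case: (pselect (A z)) => Az; last by rewrite g0 // mul0r normr0 mulr_ge0.
  rewrite normrM; apply: ler_pM => //; first by apply: le_trans (kP z (AO _ Az)) (ler_norm _).
  exact: le_trans (BP z Az) (ler_norm _).
move=> hz; rewrite g0 ?mul0r // => Az; have := rP (r + 1) _ z Az; rewrite ltrDl => /(_ ltr01) /=.
by rewrite leNgt hz.
Qed.
Let Rintegral_density (m : C -> R) (mm : mfun m) (m0 : forall z, 0 <= m z)
    (A : set C) g : (forall i, exists2 h, continuous h & forall z, D i z -> m z = h z) ->
  compact A -> A `<=` Om -> good Om A g -> \int[density V mm m0]_(z in Om) g z = I (fun z => g z * m z).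
Proof.
move=> Hm cA AO gg; have rad := radon_density mm m0 Hm; have bA := bounded_on cA AO Hm.
have pos h : good Om A h -> (forall z, 0 <= h z) -> \int[density V mm m0]_(z in Om) h z = I (fun z => h z * m z).
  move=> gh h0; rewrite /Rintegral ge0_integral_density //; last by case: gh.
  rewrite /I /Rintegral; congr fine; rewrite integral_mkcond; apply: eq_integral => z _.
  rewrite patchE; case: ifPn => // zO; have [_ _ ->] := gh; rewrite ?mul0r // => /AO Oz.
  by rewrite notin_setE in zO.
have gpos (e : R) : good Om A (fun z => Num.max 0 (e * g z)). have [mg [k kP] g0] := gg; split.
  - by apply: measurable_maxr => //; exact: measurable_funM.
  - exists (`|e| * k) => z Oz; rewrite ger0_norm ?le_max ?lexx // ge_max; apply/andP; split.
      by rewrite mulr_ge0 // (le_trans _ (kP z Oz)).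
    by apply: le_trans (ler_norm _) _; rewrite normrM ler_wpM2l // kP.
  - by move=> z /g0 ->; rewrite mulr0 maxxx.
have gE z : g z = Num.max 0 (1 * g z) - Num.max 0 (-1 * g z).
  by rewrite mul1r mulN1r; case: (lerP 0 (g z)) => gz; [rewrite (max_idPl _) ?oppr_le0 ?subr0|rewrite (max_idPr _) ?oppr_ge0 ?sub0r ?opprK // ltW].
have e0 e z : 0 <= Num.max 0 (e * g z) by rewrite le_max lexx.
transitivity (\int[density V mm m0]_(z in Om) (Num.max 0 (1 * g z) - Num.max 0 (-1 * g z))).
  by apply: eq_Rintegral => z _; exact: gE.
rewrite RintegralB //; [|exact: (good_integrable oOm rad cA AO (gpos _))|exact: (good_integrable oOm rad cA AO (gpos _))].
rewrite !pos // -IB; [|exact: suppg_nice (gpos _) _ _|exact: suppg_nice (gpos _) _ _].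
by apply: I_ext => z; rewrite -mulrBl -gE.
Qed.
Let mk_loc k i : exists2 h, continuous h & forall z, D i z -> mk k z = h z.
Proof. by exists (size1 (densW i k)); [exact: size1_cont|exact: mk_D]. Qed.
Let Tk k : current R n := @Current R n (density V (mk_meas k) (mk0 k))
  (fun I J z => Complex (cre (dens k I J z) / mk k z) (cim (dens k I J z) / mk k z)).

Let coef_meas k I J (p : K -> R) : (forall F, csm F -> smooth (fun z => p (F z))) ->
  mfun_on Om (fun z => p (dens k I J z) / mk k z).
Proof.
move=> Hp; apply: locally_cont_measurable => z /in_D[i Dz].
exists (D i), (fun z => p (densW i k I J z) / size1 (densW i k) z); split=> // [y|y].
  apply: cvgM; first by apply: smooth_cont; apply: Hp. by apply: cvgV; [rewrite gt_eqF|exact: size1_cont].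
by rewrite inE => Dy; rewrite (densE k I J Dy) (mk_D k Dy).
Qed.
Let current_Tk k : current_on Om (Tk k).
Proof.
split.
- exact: radon_density (mk_loc k).
- by move=> I J; apply: coef_meas => F [].
- by move=> I J; apply: coef_meas => F [].
move=> I J z Oz /=; have [i Dz] := in_D Oz; rewrite (densE k I J Dz) (mk_D k Dz).
have m0 := size1_gt0 (densW i k) z.
rewrite !expr_div_n -mulrDl ler_pdivrMr ?exprn_gt0 // mul1r.
apply: (@le_trans _ _ ((`|cre (densW i k I J z)| + `|cim (densW i k I J z)|) ^+ 2)).
  rewrite sqrrD !real_normK ?num_real //; have : 0 <= `|cre (densW i k I J z)| * `|cim (densW i k I J z)| by rewrite mulr_ge0.
  by rewrite mulr2n; lra.
have h := size1_ge (densW i k) z I J.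
have h0 : 0 <= `|cre (densW i k I J z)| + `|cim (densW i k I J z)| by rewrite addr_ge0.
by rewrite ler_pXn2r ?nnegrE // ltW.
Qed.
Let pairing_Tk k I J (A : set C) (psi : C -> K) : compact A -> A `<=` Om ->
  good Om A (fun z => cre (psi z)) -> good Om A (fun z => cim (psi z)) ->
  pairing Om (Tk k) I J psi = cI (fun z => dens k I J z * psi z).
Proof.
move=> cA AO g1 g2; have [_ mre mim bd] := current_Tk k; have [bre bim] := coef_bound I J (current_Tk k).
have out z : ~ A z -> cre (psi z) = 0 /\ cim (psi z) = 0 by case: g1 g2 => [_ _ h1] [_ _ h2] nA; split; [exact: h1|exact: h2].
have mkn z : A z -> mk k z != 0. by move=> /AO Oz; rewrite /mk mem_set // gt_eqF.
rewrite /pairing; apply: creim_eq => /=. rewrite (@Rintegral_density (mk k) (mk_meas k) (mk0 k) A) //; last first.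
  - have := goodD (goodM (mre I J) bre g1) (goodN (goodM (mim I J) bim g2)).
    by congr (good _ _ _); apply/funext => z; rewrite -/(cre (_ * _)) ReM.
  apply: I_ext => z; rewrite -/(cre (_ * _)) !ReM /=; case: (pselect (A z)) => Az. by have h := mkn z Az; field.
  by have [-> ->] := out z Az; rewrite !mulr0 subrr mul0r.
rewrite (@Rintegral_density (mk k) (mk_meas k) (mk0 k) A) //; last first.
- have := goodD (goodM (mre I J) bre g2) (goodM (mim I J) bim g1).
  by congr (good _ _ _); apply/funext => z; rewrite -/(cim (_ * _)) ImM.
apply: I_ext => z; rewrite -/(cim (_ * _)) !ImM /=; case: (pselect (A z)) => Az. by have h := mkn z Az; field.
by have [-> ->] := out z Az; rewrite !mulr0 addr0 mul0r.
Qed.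
(** A compact support lies in one D i, where w is the smooth function W i; the recursion becomes
    [cI_hmix] for W i. *)
Let ddc_Tk k : ddc_power c Om w k (Tk k).
Proof.
elim: k => [|k IH]; split; try exact: current_Tk.
  move=> phi /test_function_good[A [cA AO pA tp gp]]; have g0 := good0 Om A.
  rewrite (@pairing_Tk 0 _ _ A) //; apply: creim_eq => /=.
    rewrite /Rintegral [in RHS]integral_mkcond; congr fine; apply: eq_integral => z _.
    rewrite patchE /= expr0 !(mulr1, mulr0, subr0, mul1r); case: ifPn => // zO.
    by rewrite pA // => /AO Oz; rewrite notin_setE in zO.
  by rewrite -[RHS](@I0 R n); apply: I_ext => z /=; rewrite expr0 !(mulr1, mulr0, mul0r, addr0).
exists (Tk k) => // I J cI_ cJ phi /test_function_good[A [cA AO pA tp gp]]; have g0 := good0 Om A.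
have [i AD] := DK cA AO; have clA := compact_closedCn cA.
rewrite (@pairing_Tk k.+1 _ _ A) //.
have sW' := sW i; have shs := smooths_nseq k sW'.
have shmix := csm_hmix.
transitivity ((c ^+ k.+1)%:C%C * cI (fun z => (phi z)%:C%C * hmix (W i :: nseq k (W i)) I J z)).
  rewrite -cIZ; last by apply: ctstM; [exact: ctst_real|apply: csm_hmix; exact: smooths_consI].
  apply: cI_ext => z; case: (pselect (A z)) => Az; last by rewrite pA // mulr0 !mul0r mulr0.
  by rewrite (densE k.+1 I J (AD z Az)) /densW -mulrA [_ * (phi z)%:C%C]mulrC.
rewrite (cI_hmix I J tp sW' shs) big_distrr /=; apply: eq_bigr => a _; rewrite big_distrr /=; apply: eq_bigr => b _.
have tdd : ctst (fun z => ddbar a b phi z) by exact: ctst_ddbar.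
have tud : ctst (fun z => (W i z)%:C%C * ddbar a b phi z) by apply: ctstMr => //; exact: csm_real.
have d0 z : ~ A z -> ddbar a b phi z = 0 by exact: ddbar_supp clA pA.
have E z : (w z)%:C%C * ddbar a b phi z = (W i z)%:C%C * ddbar a b phi z.
  by case: (pselect (A z)) => Az; [rewrite (wW (AD z Az))|rewrite d0 // !mulr0].
rewrite (_ : (fun z => (w z)%:C%C * ddbar a b phi z) = fun z => (W i z)%:C%C * ddbar a b phi z); last exact/funext.
have o z : ~ A z -> (W i z)%:C%C * ddbar a b phi z = 0 by move=> /d0 ->; rewrite mulr0.
rewrite (@pairing_Tk k _ _ A) //; first last.
- by apply: tst_good; [case: tud|move=> z /o ->].
- by apply: tst_good; [case: tud|move=> z /o ->].
have -> : cI (fun z => dens k (I :\ a)%SET (J :\ b)%SET z * ((W i z)%:C%C * ddbar a b phi z)) =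
    (c ^+ k)%:C%C * cI (fun z => (W i z)%:C%C * ddbar a b phi z * hmix (nseq k (W i)) (I :\ a)%SET (J :\ b)%SET z).
  rewrite -cIZ; last by apply: ctstM => //; exact: csm_hmix.
  apply: cI_ext => z; case: (pselect (A z)) => Az; last by rewrite o // !(mul0r, mulr0).
  by rewrite (densE k _ _ (AD z Az)) /densW -mulrA [_ * (_ * ddbar _ _ _ _)]mulrC.
rewrite exprS rmorphM /= -[wedge_sign R a I]/(wsgn K a I) -[wedge_sign R b J]/(wsgn K b J).
move: (cI _) (wsgn K a I) (wsgn K b J) (c%:C%C) ((c ^+ k)%:C%C) => v1 v2 v3 v4 v5.
by rewrite -!mulrA; congr (_ * _); rewrite [LHS]mulrCA; congr (_ * _); rewrite [LHS]mulrCA.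
Qed.

Hypothesis Wpos : forall i z b, D i z -> 0 <= Lap b (W i) z.

Let md z : R := if z \in Om then 2 ^+ n * cre (dens n finset.setT finset.setT z) else 0.

Let md_D i z : D i z -> md z = (2 * c) ^+ n * mm (nseq n (W i)) z.
Proof.
move=> Dz; rewrite /md mem_set; last exact: DO Dz.
by rewrite (densE n _ _ Dz) /densW ReM /= mul0r subr0 exprMn mulrA mm_def.
Qed.
Let md0 z : 0 <= md z.
Proof.
case: (pselect (Om z)) => Oz; last by rewrite /md memNset.
have [i Dz] := in_D Oz; rewrite (md_D Dz) mulr_ge0 ?exprn_ge0 ?mulr_ge0 ?(ltW c0) //.
by apply: mm_ge0; [exact: smooths_nseq|apply: lpsd_nseq => b; exact: Wpos].
Qed.
Let md_loc i : exists2 h, continuous h & forall z, D i z -> md z = h z.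
Proof.
exists (fun z => (2 * c) ^+ n * mm (nseq n (W i)) z); last exact: md_D.
by apply: smooth_cont; apply: smoothZ; apply: smooth_mm; exact: smooths_nseq.
Qed.
Let md_meas : mfun md.
Proof.
apply: meas0 => [i z _|z nO]; last by rewrite /md memNset.
by have [h ch hE] := md_loc i; exists h; split=> // y; rewrite inE; exact: hE.
Qed.
Let dens_real z : Om z -> cim (dens n finset.setT finset.setT z) = 0.
Proof.
move=> Oz; have [i Dz] := in_D Oz; rewrite (densE n _ _ Dz) /densW ImM /= mul0r addr0.
have : 0 <= hmix (nseq n (W i)) finset.setT finset.setT z.
  rewrite /hmix map_nseq; apply: mixed_psd_ge0 => X; rewrite mem_nseq => /andP[_ /eqP ->].
  by apply: psd_Hess => // b; exact: Wpos.
by rewrite /cim; case: (hmix _ _ _ _) => x y; rewrite lecE /= => /andP[/eqP -> _]; rewrite mulr0.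
Qed.

Lemma locally_smooth_MA (f : C -> R) : mfun_on Om f -> (forall z, Om z -> 0 <= f z) ->
  (forall i z, D i z -> f z <= (2 * c) ^+ n * mm (nseq n (W i)) z) -> monge_ampere_ge c Om w f.
Proof.
move=> mf f0 fW; exists (density V md_meas md0); last first.
  move=> A mA AO; rewrite /density; apply: ge0_le_integral => //.
  - by move=> z /AO /f0; rewrite lee_fin.
  - by apply/measurable_EFinP; exact: measurable_funS mf.
  - by apply/measurable_EFinP; exact: measurable_funTS.
  - by move=> z /AO Oz; have [i Dz] := in_D Oz; rewrite lee_fin (md_D Dz); exact: fW.
split; first exact: radon_density md_loc.
exists (Tk n); first exact: ddc_Tk.
move=> phi /test_function_good[A [cA AO pA tp gp]]; have g0 := good0 Om A.
rewrite (@pairing_Tk n _ _ A) // (@Rintegral_density md md_meas md0 A) //.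
rewrite -[(2 : R[i])](rmorph_nat (real_complex R)) -rmorphXn.
have [i AD] := DK cA AO.
have nphi : nice (fun z => phi z * mm (nseq n (W i)) z) by apply: nice_tstM => //; apply: smooth_mm; exact: smooths_nseq.
apply: creim_eq. rewrite ReM /= mul0r subr0.
  transitivity (2 ^+ n * (c ^+ n * I (fun z => phi z * mm (nseq n (W i)) z))).
    rewrite mulrA -exprMn -IZ //; apply: I_ext => z; case: (pselect (A z)) => Az; last by rewrite pA // !(mul0r, mulr0).
    by rewrite (md_D (AD z Az)) mulrCA.
  congr (_ * _); rewrite -IZ //; apply: I_ext => z; case: (pselect (A z)) => Az; last by rewrite pA // ReM /= !(mul0r, mulr0) subrr.
  by rewrite (densE n _ _ (AD z Az)) /densW !ReM !ImM mm_def /=; ring.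
rewrite ImM /= mul0r addr0 (_ : I _ = 0) ?mulr0 // -[RHS](@I0 R n).
apply: I_ext => z; case: (pselect (A z)) => Az; last by rewrite pA // ImM /= !(mul0r, mulr0) addr0.
by rewrite ImM /= mulr0 add0r dens_real ?mul0r //; exact: AO.
Qed.
Let cscale_Jc p q (b : C) : cscale p q b = p *: b + q *: Jc b.
Proof.
rewrite /Jc /cscale; congr pair; rewrite /= scale0r scale1r. by rewrite sub0r scalerN.
by rewrite add0r.
Qed.
Let disc_compact (a b : C) : compact [set a + cscale p.1 p.2 b | p in [set p : R * R | p.1 ^+ 2 + p.2 ^+ 2 <= 1]].
Proof.
apply: continuous_compact. apply: continuous_subspaceT => p; apply: cvgD; first exact: cvg_cst.
  have c1 : x.1 @[x --> p] --> p.1 by exact: cvg_fst. have c2 : x.2 @[x --> p] --> p.2 by exact: cvg_snd.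
  rewrite [X in _ --> X]cscale_Jc; under eq_fun do rewrite cscale_Jc.
  by apply: cvgD; [exact: cvgZr_tmp c1|exact: cvgZr_tmp c2].
apply: (@subclosed_compact _ _ (`[-1, 1]%classic `*` `[-1, 1]%classic : set (R * R))).
- rewrite (_ : [set p : R * R | _] = (fun p : R * R => p.1 ^+ 2 + p.2 ^+ 2) @^-1` [set t | t <= 1]) //.
  apply: closed_comp => [p _|]; last exact: closed_le. have c1 : x.1 @[x --> p] --> p.1 by exact: cvg_fst.
  have c2 : x.2 @[x --> p] --> p.2 by exact: cvg_snd.
  by apply: cvgD; rewrite expr2; under eq_fun do rewrite expr2; apply: cvgM.
- by apply: compact_setX; exact: segment_compact.
have e (x y : R) : x ^+ 2 + y ^+ 2 <= 1 -> -1 <= x <= 1.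
  move=> h; rewrite -ler_norml -(expr_le1 (n := 2)) // real_normK ?num_real //.
  by apply: le_trans h; rewrite lerDl sqr_ge0.
move=> [s t] /= h; rewrite !in_itv /=; split; first exact: e h.
by apply: (e t s); rewrite addrC.
Qed.

(** A closed disc in Om is compact, hence contained in one D i, where the circle means of W i
    increase with the radius. *)
Lemma locally_smooth_psh : Om !=set0 -> psh Om (EFin \o w).
Proof.
move=> [z0 Oz0]; split=> [z _|z Oz r|/=|a b ab]; rewrite /= ?ltry //.
- rewrite lte_fin => wr; have [i Dz] := in_D Oz. have cW : continuous (W i) by exact: smooth_cont.
  have n1 : \forall y \near z, W i y < r by apply: (cvgr_lt (W i z) (cW z)); rewrite -(wW Dz).
  have n2 : nbhs z (D i) by exact: open_nbhs_nbhs. near=> y; rewrite lte_fin (@wW i); first by near: y.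
  by near: y.
- by exists z0.
have [i AD] : exists i, [set a + cscale p.1 p.2 b | p in [set p : R * R | p.1 ^+ 2 + p.2 ^+ 2 <= 1]] `<=` D i.
  by apply: (DK (disc_compact (a := a) (b := b))) => _ [p hp <-]; exact: ab.
have Dd s t : s ^+ 2 + t ^+ 2 <= 1 -> D i (a + cscale s t b) by move=> h; apply: AD; exists (s, t).
have Da : D i a by have := Dd 0 0; rewrite expr0n addr0 /cscale !scale0r subr0 addr0 => /(_ ler01); rewrite -[X in D i X -> _]/(a + 0) addr0.
have Dr t : D i (a + rot t b) by apply: Dd; rewrite cos2sin2.
have bP := bdm_P a b 1 (sW i).
have E t : P a b (W i) 1 t = w (a + rot t b). by rewrite -P_rot scale1r (wW (Dr t)).
have int := bdm_integrable bP.
have -> : (\int[@lebesgue_measure R]_(theta in `[0%R, (2 * pi)%R]%classic) (w (a + cscale (cos theta) (sin theta) b))%:E)%E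
    = (Jint (P a b (W i) 1))%:E.
  rewrite /Jint /Rintegral fineK; last exact: (integrable_fin_num measurable_circ int).
  by apply: eq_integral => t _; rewrite E.
rewrite -EFinM lee_fin (wW Da) -cmean_P -(cmean0 (W i) a) -{1}(scale0r b).
apply: smooth_cmean_mono; [exact: sW|by rewrite lexx ler01|move=> s t /andP[s0 s1]; apply: Wpos].
rewrite /rot; have -> : cscale (cos t) (sin t) (s *: b) = cscale (cos t * s) (sin t * s) b.
  by rewrite /cscale /= !scalerA.
apply: Dd; rewrite !exprMn -mulrDl cos2sin2 mul1r.
by rewrite expr_le1 ?(ltW s0) ?(ltW s1).
Unshelve. all: end_near.
Qed.

End locally_smooth.

(** * Compactness arguments for continuous functions *)

Section compact_continuity.
Context {R : realType} {n : nat}.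
Notation C := (Cn R n).
Implicit Types (A : set C) (g h : C -> R) (z y x : C) (k N : nat).

Definition wcont A g := forall z, A z -> forall e : R, 0 < e ->
  exists2 d, 0 < d & forall y, A y -> `|y - z| <= d -> `|g y - g z| <= e.

Lemma wcontP A g : {within A, continuous g} <-> wcont A g.
Proof.
split=> [/subspace_continuousP H z Az e e0|H].
  have /cvgrPdist_le/(_ e e0) := H z Az; rewrite /within /= => /nbhs_norm_le[d d0 dP].
  by exists d => // y Ay yz; rewrite distrC; exact: dP.
apply/subspace_continuousP => z Az; apply/cvgrPdist_le => e e0.
have [d d0 dP] := H z Az e e0; rewrite /within /=; apply/nbhs_ballP; exists d => //= y.
by rewrite -ball_normE /= distrC => yz Ay; rewrite distrC; apply: dP => //; exact: ltW.
Qed.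

Lemma wcont_unif A g (e : R) : compact A -> wcont A g -> 0 < e ->
  exists2 d, 0 < d & forall y z, A y -> A z -> `|y - z| <= d -> `|g y - g z| <= e.
Proof.
move=> cA cg e0; apply: contrapT => H.
have {}H k : exists p : C * C, [/\ A p.1, A p.2, `|p.1 - p.2| <= k.+1%:R^-1 & e < `|g p.1 - g p.2|].
  apply: contrapT => H'; apply: H; exists k.+1%:R^-1; first by rewrite invr_gt0.
  move=> y z Ay Az yz; rewrite leNgt; apply/negP => h; apply: H'; by exists (y, z).
have [p pP] := choice H.
have [|x Ax xP] := compact_seq (z_ := fun k => (p k).1) cA; first by move=> k; case: (pP k).
have e20 : 0 < e / 2 by rewrite divr_gt0.
have [d d0 dP] := cg x Ax _ e20; have d20 : 0 < d / 2 by rewrite divr_gt0.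
have [N NP] := inv_lt d20; have [k Nk kx] := xP _ d20 N.
have [A1 A2 h1 h2] := pP k; have hk := NP k Nk.
have d1 : `|(p k).1 - x| <= d by move: kx; lra.
have d2 : `|(p k).2 - x| <= d. rewrite -(subrK (p k).1 (p k).2) -addrA; apply: le_trans (ler_normD _ _) _.
  by rewrite distrC; have h3 := le_lt_trans h1 hk; move: h3 kx; lra.
have g1 := dP _ A1 d1; have g2 := dP _ A2 d2.
move: h2; rewrite ltNge => /negP; apply.
rewrite -(subrK (g x) (g (p k).1)) -addrA; apply: le_trans (ler_normD _ _) _.
by rewrite [`|g x - _|]distrC [e]splitr; exact: lerD.
Qed.

Lemma wcont_bounded A g : compact A -> wcont A g -> exists2 B, 0 <= B & forall z, A z -> `|g z| <= B.
Proof.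
move=> cA cg; apply: contrapT => H.
have {}H k : exists z, A z /\ k%:R < `|g z|.
  apply: contrapT => H'; apply: H; exists k%:R => // z Az; rewrite leNgt; apply/negP => h; by apply: H'; exists z.
have [p pP] := choice H.
have [|x Ax xP] := compact_seq (z_ := p) cA; first by move=> k; case: (pP k).
have [d d0 dP] := cg x Ax 1 ltr01.
pose N := (Num.truncn (`|g x| + 1)).+1.
have NP : `|g x| + 1 < N%:R by rewrite /N truncnS_gt.
have [k Nk kx] := xP d d0 N; have [Ak gk] := pP k; have h := dP _ Ak kx.
have h2 : (N%:R : R) <= k%:R by rewrite ler_nat.
have : `|g (p k)| <= `|g x| + 1.
  by rewrite -(subrK (g x) (g (p k))); apply: le_trans (ler_normD _ _) _; rewrite addrC lerD2l.
by move: gk h2 NP; lra.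
Qed.

Lemma wcontD A g h : wcont A g -> wcont A h -> wcont A (fun z => g z + h z).
Proof.
move=> cg ch z Az e e0; have e20 : 0 < e / 2 by rewrite divr_gt0.
have [d1 p1 q1] := cg z Az _ e20; have [d2 p2 q2] := ch z Az _ e20.
exists (Num.min d1 d2); first by rewrite lt_min p1.
move=> y Ay; rewrite le_min => /andP[y1 y2].
rewrite opprD addrACA; apply: le_trans (ler_normD _ _) _; rewrite [e]splitr; apply: lerD; [exact: q1|exact: q2].
Qed.

Lemma wcontZ A (c : R) g : wcont A g -> wcont A (fun z => c * g z).
Proof.
move=> cg z Az e e0; have c1 : 0 < `|c| + 1 by rewrite ltr_wpDl.
have [d1 p1 q1] := cg z Az _ (divr_gt0 e0 c1); exists d1 => // y Ay yz.
rewrite -mulrBr normrM; apply: (@le_trans _ _ (`|c| * (e / (`|c| + 1)))); first by rewrite ler_wpM2l // q1.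
by rewrite mulrCA ler_piMr ?(ltW e0) // ler_pdivrMr // mul1r lerDl.
Qed.

Lemma wcont_smooth A g : smooth g -> wcont A g.
Proof.
move=> sg z _ e e0; have /cvgrPdist_le/(_ e e0)/nbhs_norm_le[d d0 dP] := smooth_cont sg (x := z).
by exists d => // y _ /dP; rewrite distrC.
Qed.

Lemma wcontB A g h : wcont A g -> wcont A h -> wcont A (fun z => g z - h z).
Proof.
move=> cg ch; have := wcontD cg (wcontZ (-1) ch); congr (wcont A _).
by apply/funext => z; rewrite mulN1r.
Qed.

Lemma wcontS A B g : B `<=` A -> wcont A g -> wcont B g.
Proof.
move=> BA cg z Bz e e0; have [d d0 dP] := cg z (BA _ Bz) e e0.
by exists d => // y By; apply: dP; exact: BA.
Qed.

(** Otherwise points with p >= 0 and s > - 1 / (k + 1) would accumulate where p >= 0 and s >= 0. *)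
Lemma wcont_neg A (s p : C -> R) : compact A -> wcont A s -> wcont A p ->
  (forall z, A z -> 0 <= p z -> s z < 0) -> exists2 k, 0 < k & forall z, A z -> 0 <= p z -> s z <= - k.
Proof.
move=> cA cs cp H; apply: contrapT => H'.
have {}H' k : exists z, [/\ A z, 0 <= p z & - k.+1%:R^-1 < s z].
  apply: contrapT => H2; apply: H'; exists k.+1%:R^-1; first by rewrite invr_gt0.
  by move=> z Az pz; rewrite leNgt; apply/negP => h; apply: H2; exists z.
have [z_ zP] := choice H'.
have [|x Ax xP] := compact_seq (z_ := z_) cA; first by move=> k; case: (zP k).
have close (e : R) : 0 < e -> - e <= p x /\ - e <= s x. move=> e0; have e20 : 0 < e / 2 by rewrite divr_gt0.
  have [d1 p1 q1] := cp x Ax _ e20; have [d2 p2 q2] := cs x Ax _ e20; have [N NP] := inv_lt e20.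
  have d0 : 0 < Num.min d1 d2 by rewrite lt_min p1.
  have [k Nk] := xP _ d0 N; rewrite le_min => /andP[k1 k2]; have [Ak pk sk] := zP k.
  have hk : - (e / 2) < s (z_ k) by apply: lt_trans sk; rewrite ltrN2; exact: NP.
  have := q1 _ Ak k1; have := q2 _ Ak k2; rewrite !ler_norml => /andP[_ a1] /andP[_ a2].
  by split; move: a1 a2 pk hk; lra.
have px : 0 <= p x by rewrite -oppr_le0; apply/ler_addgt0Pr => e e0; have [h _] := close e e0; move: h; lra.
have sx : 0 <= s x by rewrite -oppr_le0; apply/ler_addgt0Pr => e e0; have [_ h] := close e e0; move: h; lra.
by have := H x Ax px; rewrite ltNge sx.
Qed.

Lemma room_compact (Om A : set C) (p : C -> R) : open Om -> compact A -> wcont A p ->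
  (forall z, A z -> 0 <= p z -> Om z) -> exists2 t, 0 < t & forall z, A z -> 0 <= p z -> room Om t z.
Proof.
move=> oOm cA cp H; apply: contrapT => H'.
have {}H' k : exists z, [/\ A z, 0 <= p z & exists2 y, `|y - z| <= k.+1%:R^-1 & ~ Om y].
  apply: contrapT => H2; apply: H'; exists k.+1%:R^-1; first by rewrite invr_gt0.
  by move=> z Az pz y yz; apply: contrapT => nO; apply: H2; exists z; split=> //; exists y.
have [z_ zP] := choice H'.
have [|x Ax xP] := compact_seq (z_ := z_) cA; first by move=> k; case: (zP k).
have px : 0 <= p x. rewrite -oppr_le0; apply/ler_addgt0Pr => e e0; have [d d0 dP] := cp x Ax e e0.
  have [k _ kx] := xP d d0 0%N; have [Ak pk _] := zP k; have := dP _ Ak kx.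
  by rewrite ler_norml => /andP[_ h]; move: pk h; lra.
have : nbhs x Om by apply: open_nbhs_nbhs; split=> //; exact: H.
move=> /nbhs_norm_le[d d0 dP]; have d20 : 0 < d / 2 by rewrite divr_gt0.
have [N NP] := inv_lt d20; have [k Nk kx] := xP _ d20 N; have [_ _ [y yk nO]] := zP k; have hk := NP k Nk.
apply: nO; apply: dP; rewrite -(subrK (z_ k) y) -addrA; apply: le_trans (ler_normD _ _) _.
by have h3 := le_lt_trans yk hk; move: h3 kx; lra.
Qed.

(** It compares n-th roots: lowering the density f by N tau^n lowers its root by at most tau. *)
Lemma exp_add_ge (x y : R) m : 0 <= x -> 0 <= y -> x ^+ m.+1 + y ^+ m.+1 <= (x + y) ^+ m.+1.
Proof.
move=> x0 y0; elim: m => [|m IH]; first by rewrite !expr1.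
rewrite [in leRHS]exprS; apply: (@le_trans _ _ ((x + y) * (x ^+ m.+1 + y ^+ m.+1))).
  rewrite mulrDl !mulrDr -!exprS. have h1 : 0 <= x * y ^+ m.+1 by rewrite mulr_ge0 // exprn_ge0.
  have h2 : 0 <= y * x ^+ m.+1 by rewrite mulr_ge0 // exprn_ge0. by move: h1 h2; lra.
by rewrite ler_wpM2l // addr_ge0.
Qed.

Lemma nth_root (x : R) m : 0 <= x -> exists2 r, 0 <= r & r ^+ m.+1 = x.
Proof.
move=> x0; exists (x `^ m.+1%:R^-1); first exact: powR_ge0.
by rewrite -powR_mulrn ?powR_ge0 // -powRrM mulVf ?pnatr_eq0 // powRr1.
Qed.

End compact_continuity.

(** * Extension of functions on the domain to the whole space *)

Section extension.
Context {R : realType} {n : nat}.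
Notation mR := (measurableTypeR R).
Notation C := (Cn R n).
Notation bC := (borelCn R n).
Implicit Types (h : C -> R) (z : C).
Variables (Om : set C).
Hypothesis oOm : open Om.

(** Averages require a function on all of C^n; the outside value L will be low enough not to spoil
    upper bounds. *)
Definition ext h (L : R) z : R := if z \in Om then h z else L.

Lemma ext_in h L z : Om z -> ext h L z = h z.
Proof. by move=> Oz; rewrite /ext mem_set. Qed.

Lemma ext_out h L z : ~ Om z -> ext h L z = L.
Proof. by move=> Oz; rewrite /ext memNset. Qed.
Let strict_usc h := forall z c, Om z -> h z < c ->
  exists2 d : R, 0 < d & forall w, `|w - z| <= d -> Om w /\ h w < c.

Lemma strict_usc_measurable h : strict_usc h -> mfun_on Om h.
Proof.
move=> H; apply: usc_measurable => [|r]; first exact: open_measurableCn.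
exists [set z | Om z /\ h z < r]; last by apply/seteqP; split => [z [h1 h2]|z [h1 [h2 h3]]].
rewrite openE => z [Oz hz]; have [d d0 dP] := H z r Oz hz; apply/nbhs_ballP; exists d => //= w.
by rewrite -ball_normE /= distrC => /ltW; exact: dP.
Qed.

Lemma wcont_strict_usc h : wcont Om h -> strict_usc h.
Proof.
move=> ch z c Oz hc; have e0 : 0 < (c - h z) / 2 by rewrite divr_gt0 // subr_gt0.
have [d d0 dP] := ch z Oz _ e0; have : nbhs z Om by exact: open_nbhs_nbhs.
move=> /nbhs_norm_le[d2 d20 d2P]; exists (Num.min d d2); first by rewrite lt_min d0.
move=> y; rewrite le_min => /andP[y1 /d2P Oy]; split=> //.
by have := dP y Oy y1; rewrite ler_norml => /andP[_]; move: hc; move: (h y) (h z) => p q; lra.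
Qed.

Lemma psh_strict_usc h : psh Om (EFin \o h) -> strict_usc h.
Proof.
move=> [_ usc _ _] z c Oz hc; have := usc z Oz c; rewrite /= lte_fin => /(_ hc) n1.
have n2 : nbhs z Om by exact: open_nbhs_nbhs.
have /nbhs_norm_le[d d0 dP] : nbhs z ([set w | (h w)%:E < c%:E]%E `&` Om) by exact: filterI.
by exists d => // w /dP[/=]; rewrite lte_fin.
Qed.

Lemma psh_subm h (L M : R) : psh Om (EFin \o h) -> (forall z, Om z -> `|h z| <= M) -> subm Om (ext h L).
Proof.
move=> ph hM; have [_ _ _ sub] := ph.
have mOm : measurable (Om : set bC) by exact: open_measurableCn.
have mh := strict_usc_measurable (psh_strict_usc ph).
have be : bbm (ext h L). split; last first.
    exists (Num.max M `|L|) => z; rewrite le_max; case: (pselect (Om z)) => Oz. by rewrite ext_in // hM.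
    by rewrite ext_out // lexx orbT. have m1 := (measurable_restrictT _ mOm).1 mh.
  have m2 := (measurable_restrictT _ (measurableC mOm)).1 (@measurable_cst _ _ bC mR (~` Om) L).
  have := measurable_funD m1 m2; congr (measurable_fun _ _); apply/funext => z /=.
  rewrite /ext !patchE in_setC; case: (z \in Om) => /=; by rewrite ?addr0 ?add0r.
split=> // [z Oz k|z b zb].
  rewrite ext_in // => hk; have [d d0 dP] := psh_strict_usc ph Oz hk; exists d => // w /dP[Ow]. by rewrite ext_in.
have Oz : Om z. have := zb 0 0; rewrite expr0n addr0 /cscale !scale0r subr0 addr0 => /(_ ler01).
  by rewrite -[X in Om X -> _]/(z + 0) addr0.
have E t : ext h L (z + rot t b) = h (z + rot t b) by rewrite ext_in //; apply: zb; rewrite cos2sin2.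
have int := bdm_integrable (bdm_circle z b be).
have := sub z b zb; rewrite -lee_fin /cmean EFinM ext_in //; congr (_ <= _ * _)%E.
rewrite /Jint /Rintegral fineK; last exact: (integrable_fin_num measurable_circ int).
by apply: eq_integral => t _; rewrite /= E.
Qed.

Lemma ddc_power_congr (c : R) h h' k T : {in Om, h =1 h'} -> ddc_power c Om h k T -> ddc_power c Om h' k T.
Proof.
move=> E; elim: k T => [|k IH] T //= [cT [S /IH dS H]]; split=> //; exists S => // I J cI cJ phi tphi.
rewrite (H I J cI cJ phi tphi); apply: eq_bigr => a _; apply: eq_bigr => b _; congr (_ * _).
by rewrite /pairing; congr Complex; apply: eq_Rintegral => z zO; rewrite E.
Qed.

Lemma monge_ampere_ge_congr (c : R) h h' f : {in Om, h =1 h'} ->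
  monge_ampere_ge c Om h f -> monge_ampere_ge c Om h' f.
Proof.
move=> E [mu [rmu [T dT H]] muf]; exists mu => //; split=> //; exists T => //; exact: ddc_power_congr E dT.
Qed.

End extension.

(** * The upper limit u^* as a real number *)

Section usc_extension.
Context {R : realType} {n : nat}.
Notation C := (Cn R n).
Implicit Types (u : C -> R) (z y : C).

(** Boundedness of u makes the extended upper limit finite; it is then handled only through the last
    two properties, which characterize it. *)
Lemma usc_extensionP (Om : set C) u (M : R) z : closure Om z -> (forall y, Om y -> `|u y| <= M) ->
  exists l : R, [/\ usc_extension Om u z = l%:E, - M <= l,
    forall a, l < a -> exists2 p, 0 < p & forall y, Om y -> `|y - z| <= p -> u y <= a &
    forall a p, 0 < p -> (forall y, Om y -> `|y - z| <= p -> u y <= a) -> l <= a].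
Proof.
move=> cz uM.
have up (a p : R) : 0 < p -> (forall y, Om y -> `|y - z| <= p -> u y <= a) -> (usc_extension Om u z <= a%:E)%E.
  move=> p0 H; pose V := [set y | Om y /\ `|y - z| <= p].
  apply: (@le_trans _ _ (ereal_sup [set (EFin \o u) y | y in V])).
    apply: ereal_inf_lbound; exists V => //; rewrite /within /=; apply/nbhs_ballP; exists p => //= y.
    by rewrite -ball_normE /= distrC => /ltW yp Oy; split.
  by apply: ge_ereal_sup => _ [y [Oy yp] <-]; rewrite lee_fin; exact: H.
have lo : ((- M)%:E <= usc_extension Om u z)%E.
  apply: le_ereal_inf_tmp => _ [V VF <-]; have [y [Oy Vy]] := cz _ VF.
  apply: (@le_trans _ _ (u y)%:E); last by apply: ereal_sup_ubound; exists y => //; exact: Vy.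
  by have := uM y Oy; rewrite lee_fin ler_norml => /andP[].
have hi : (usc_extension Om u z <= M%:E)%E. by apply: (up _ 1) => // y /uM h _; exact: le_trans (ler_norm _) h.
case E : (usc_extension Om u z) => [l||]; [|by rewrite E in hi|by rewrite E in lo].
exists l; split=> //; rewrite -?lee_fin -?E // => a.
- rewrite -lte_fin -E => /ereal_inf_lt[_ [V VF <-] Va].
  have /nbhs_norm_le[d d0 dP] := VF; exists d => // y Oy yd; rewrite -lee_fin; apply: le_trans (ltW Va).
  by apply: ereal_sup_ubound; exists y => //; exact: (dP y).
- by move=> p p0 H; rewrite -lee_fin -E; exact: up p0 H.
Qed.

End usc_extension.

(** * Lipschitz majorants of u *)

Section lipschitz_envelope.
Context {R : realType} {n : nat}.
Notation C := (Cn R n).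
Implicit Types (g : C -> R) (z y : C) (k : nat).
Variables (Om : set C) (u : C -> R) (M : R).
Hypotheses (Om0 : Om !=set0) (uM : forall z, Om z -> `|u z| <= M).

(** The sup-convolution of u with k |z - y|; on the closure these functions decrease to u^* as k
    grows. *)
Definition lip_env k z : R := sup [set u y - k%:R * `|z - y| | y in Om].

Lemma lip_env_ge k z y : Om y -> u y - k%:R * `|z - y| <= lip_env k z.
Proof.
move=> Oy; apply: ub_le_sup; last by exists y.
exists M => _ [x Ox <-]; apply: le_trans (le_trans (ler_norm _) (uM Ox)).
by rewrite gerBl mulr_ge0.
Qed.

Lemma lip_env_le k z a : (forall y, Om y -> u y - k%:R * `|z - y| <= a) -> lip_env k z <= a.
Proof.
move=> H; apply: ge_sup; last by move=> _ [y Oy <-]; exact: H.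
by have [y Oy] := Om0; exists (u y - k%:R * `|z - y|), y.
Qed.

Lemma lip_env_lip k z y : lip_env k y <= lip_env k z + k%:R * `|y - z|.
Proof.
apply: lip_env_le => x Ox; have := lip_env_ge k z Ox.
have : k%:R * `|z - x| <= k%:R * (`|y - z| + `|y - x|).
  rewrite ler_wpM2l // [`|y - z|]distrC; apply: le_trans _ (ler_normD _ _). by rewrite addrA subrK.
by rewrite mulrDr; move: (k%:R * _) (k%:R * _) (k%:R * _) => p q r; lra.
Qed.

Lemma wcont_lip_env A k : wcont A (lip_env k).
Proof.
move=> z _ e e0; have k1 : 0 < k%:R + 1 :> R by rewrite ltr_wpDl.
exists (e / (k%:R + 1)); first by rewrite divr_gt0.
move=> y _ yz; have h : k%:R * `|y - z| <= e. apply: le_trans (ler_wpM2l (ler0n R k) yz) _.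
  by rewrite mulrCA ler_piMr ?(ltW e0) // ler_pdivrMr // mul1r lerDl.
have h1 := lip_env_lip k z y; have h2 := lip_env_lip k y z; rewrite distrC in h2.
by rewrite ler_norml; apply/andP; split; move: h h1 h2; move: (k%:R * _) => p; lra.
Qed.

Lemma wcont_min A g h : wcont A g -> wcont A h -> wcont A (fun z => Num.min (g z) (h z)).
Proof.
move=> cg ch z Az e e0; have [d1 p1 q1] := cg z Az _ e0; have [d2 p2 q2] := ch z Az _ e0.
exists (Num.min d1 d2); first by rewrite lt_min p1.
move=> y Ay; rewrite le_min => /andP[y1 y2]; have := q1 y Ay y1; have := q2 y Ay y2.
rewrite !ler_norml => /andP[a1 a2] /andP[a3 a4].
by apply/andP; split; case: (ltrP (g y)) => h1; case: (ltrP (g z)) => h2; move: a1 a2 a3 a4 h1 h2; lra.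
Qed.

End lipschitz_envelope.

(** * Barriers from B-regularity and the construction of the sequence *)

Section decreasing_approximation.
Context {R : realType} {n' : nat}.
Local Notation n := n'.+1.
Notation C := (Cn R n).
Implicit Types (g h : C -> R) (z y x b : C) (k i j : nat).
Variables (Om : set C).
Hypotheses (oOm : open Om) (bOm : bounded_set Om).
Let X := closure Om.
Let bd := boundary Om.

Let cX : compact X.
Proof.
have [r [_ rP]] := bOm; apply: (@subclosed_compact _ _ [set z : C | `|z| <= r + 1]).
- exact: closed_closure.
- exact: normle_compact.
rewrite /X closureE => z; apply; split; first exact: closed_normle.
by move=> y Oy /=; apply: rP => //; rewrite ltrDl.
Qed.

Lemma closureP z : X z -> Om z \/ bd z.
Proof. by move=> Xz; case: (pselect (Om z)) => Oz; [left|right; split=> // /interior_subset]. Qed.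
Let XO z : Om z -> X z.
Proof. exact: subset_closure. Qed.

Lemma subm_comb g h (k : R) : 0 <= k -> subm Om g -> subm Om h -> wcont Om g -> wcont Om h ->
  subm Om (fun z => g z + k * h z).
Proof.
move=> k0 [bg _ sg] [bh _ sh] cg ch.
have bk : bbm (fun z => g z + k * h z). have [mg [c1 C1]] := bg; have [mh [c2 C2]] := bh; split.
    by apply: measurable_funD => //; exact: measurable_funM.
  exists (c1 + k * c2) => z; apply: le_trans (ler_normD _ _) _; apply: lerD => //.
  by rewrite normrM ger0_norm // ler_wpM2l.
split=> // [z Oz c hc|z b zb]. have [d d0 dP] := wcont_strict_usc oOm (wcontD cg (wcontZ k ch)) Oz hc.
  by exists d => // y /dP[].
have -> : cmean (fun y => g y + k * h y) z b = cmean g z b + k * cmean h z b.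
  rewrite /cmean JD ?JZ; [by rewrite mulrDr mulrCA|exact: bdm_circle|exact: bdm_circle|].
  by apply: bdmZ; exact: bdm_circle.
by apply: lerD; [exact: sg|rewrite ler_wpM2l // sh].
Qed.

(** A nonnegative value inside would give h + |z|^2 an interior maximum x over the closure. Then h
    lies below h x + |x|^2 - |y|^2, whose Laplacian is negative, against the sub-mean inequality at
    x. *)
Lemma eucl_add_lt0 h z : psh Om (EFin \o h) -> wcont X h -> (forall z, bd z -> h z = - eucl z) ->
  Om z -> h z + eucl z < 0.
Proof.
move=> ph ch hb Oz; rewrite ltNge; apply/negP => s0.
have cs : wcont X (fun z => h z + eucl z) by apply: wcontD => //; exact: wcont_smooth smooth_eucl.
have [B _ BP] := wcont_bounded cX ch.
have sh := psh_subm oOm 0 ph (fun z Oz => BP z (XO Oz)).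
have [x Ox xmax] : exists2 x, Om x & forall y, X y -> h y + eucl y <= h x + eucl x.
  have ic : {within X, continuous (fun z => h z + eucl z)} by apply/wcontP.
  have [x /set_mem Xx xmax] := compact_EVT_max (ex_intro _ z (XO Oz)) cX ic.
  have {}xmax y : X y -> h y + eucl y <= h x + eucl x by move=> Xy; apply: xmax; rewrite mem_set.
  have [Ox|bx] := closureP Xx; first by exists x.
  exists z => // y /xmax hy; apply: le_trans hy _; by rewrite (hb x bx) addNr.
have [be _ sub] := sh.
have /nbhs_norm_le[d d0 dP] : nbhs x Om by exact: open_nbhs_nbhs.
(* A nonzero direction, available because the dimension is n' + 1. *)
pose b : C := (const_mx 1, 0).
have b0 : b != 0. by apply/eqP => -[/matrixP/(_ 0 ord0)]; rewrite !mxE; apply/eqP; rewrite oner_eq0.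
pose m := `|b| + `|Jc b| + 1; have m0 : 0 < m by rewrite ltr_wpDl // addr_ge0.
pose r := d / m; have r0 : 0 < r by rewrite divr_gt0.
have disc p q : p ^+ 2 + q ^+ 2 <= 1 -> Om (x + cscale p q (r *: b)).
  move=> pq; apply: dP; rewrite addrC addrA addNr add0r cscaleZ normrZ gtr0_norm //.
  apply: (@le_trans _ _ (r * m)); last by rewrite /r divfK // gt_eqF.
  by rewrite ler_pM2l //; apply: le_trans (norm_cscale_le b pq) _; rewrite lerDl.
pose g y := h x + eucl x - eucl y.
have sg : smooth g by apply: smoothB smooth_eucl; exact: smooth_cst.
have := sub x (r *: b) disc; rewrite ext_in // leNgt => /negP; apply.
have h1 : cmean (ext Om h 0) x (r *: b) <= (2 * pi)^-1 * Jint (P x b g r).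
  rewrite /cmean ler_wpM2l ?invr_ge0 ?(ltW twopi_gt0) //; apply: le_J; [exact: bdm_circle|exact: bdm_P|move=> t].
  rewrite -P_rot; have Ot : Om (x + rot t (r *: b)) by apply: disc; rewrite cos2sin2.
  by rewrite ext_in // /g lerBrDr; apply: xmax; exact: XO.
apply: le_lt_trans h1 _; rewrite ltr_pdivrMl ?twopi_gt0 //.
have -> : h x = g x by rewrite /g addrK.
apply: polar_strict => // s t _; rewrite LapB ?Lap_cst ?Lap_eucl; [|exact: smooth_cst|exact: smooth_eucl].
by rewrite sub0r oppr_lt0 mulr_gt0 // eucl_gt0.
Qed.

Lemma nrs_open r : open [set z | exists2 t : R, r < t & room Om t z].
Proof.
rewrite openE => z [t rt tz]; apply/nbhs_ballP; exists ((t - r) / 2) => /=. by rewrite divr_gt0 // subr_gt0.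
move=> y; rewrite -ball_normE /= distrC => yz; exists ((t + r) / 2); first by move: rt; lra.
apply: (@room_near _ _ _ _ ((t - r) / 2) z); first exact: ltW.
by rewrite (_ : _ + _ = t) //; lra.
Qed.

(** The indicator of the points with room more than 3 r, averaged at scale r: averaging looks no
    further than r, which leaves the value 1 beyond 4 r and 0 below r. *)
Lemma cutoff (r : R) : 0 < r -> exists chi : C -> R, [/\ smooth chi, forall z, 0 <= chi z <= 1,
  forall z t, 4 * r < t -> room Om t z -> chi z = 1, forall z, ~ room Om r z -> chi z = 0 &
  exists2 k : R, 0 <= k & forall z b, `|Lap b chi z| <= k * eucl b].
Proof.
move=> r0; pose G := [set z | exists2 t : R, 3 * r < t & room Om t z].
pose g : C -> R := \1_G.
have g01 z : 0 <= g z <= 1 by rewrite /g indicE; case: (_ \in _); rewrite /= ?lexx ?ler01.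
have bg : bbm g. split; first by apply: measurable_indic; apply: open_measurableCn; exact: nrs_open.
  by exists 1 => z; have /andP[h1 h2] := g01 z; rewrite ger0_norm.
have rl := ltW r0.
have chi0 z : (forall y, `|y - z| <= r -> g y = 0) -> A r g z = 0.
  move=> H; apply/eqP; rewrite eq_le; apply/andP; split. by apply: A_near_le => // y /H ->.
  by apply: A_near_ge => // y /H ->.
have sA : smooth (A r g) by exact: smooth_A.
have tA : tst (A r g). split=> //; have [r1 [_ rP]] := bOm; exists (r1 + 1 + r) => z zr; apply: chi0 => y yz.
  rewrite /g indicE memNset // => -[t rt ty]; have Oy : Om y by apply: (room_center _ ty); move: r0 rt; lra.
  have := rP (r1 + 1) _ y Oy; rewrite ltrDl => /(_ ltr01) /= hy.
  have : `|z| <= `|y - z| + `|y| by rewrite distrC -{1}(subrK y z) ler_normD. by move: zr yz hy; lra.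
exists (A r g); split=> //.
- move=> z; apply/andP; split; [apply: A_near_ge => // y _|apply: A_near_le => // y _]; by have /andP[] := g01 y.
- move=> z t rt tz. have H y : `|y - z| <= r -> g y = 1.
    move=> yz; rewrite /g indicE mem_set //; exists (t - r); first by move: rt; lra.
    by apply: (room_near yz); rewrite subrK. apply/eqP; rewrite eq_le; apply/andP; split.
    by apply: A_near_le => // y /H ->. by apply: A_near_ge => // y /H ->.
- move=> z nr; apply: chi0 => y yz; rewrite /g indicE memNset // => -[t rt ty]; apply: nr.
  have h : room Om (t - r) z by apply: (@room_near _ _ _ _ r y); rewrite ?subrK // distrC.
  have h2 : r <= t - r by move: rt r0; lra. exact: room_le h2 h.
have [k k0 kP] := dd2_bound tA; exists (2 * k); first by rewrite mulr_ge0.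
move=> z b; rewrite Lap_def; apply: le_trans (ler_normD _ _) _.
have h1 := le_trans (kP b z) (ler_wpM2l k0 (eucl_norm b)).
have h2 := le_trans (kP (Jc b) z) (ler_wpM2l k0 (eucl_norm (Jc b))).
have e2 : eucl (Jc b) = eucl b by rewrite /Jc eucl_cscale expr0n expr1n add0r mul1r.
by rewrite e2 in h2; move: h1 h2; lra.
Qed.

(** A function h with boundary values Phi - eta / 4 - a0 |z|^2 is corrected by K (h1 + |z|^2), which
    vanishes on the boundary and is negative inside. For large K the sum lies below Phi - eta / 8
    everywhere, its boundary values are unchanged, and the coefficient of |z|^2 only increases. *)
Lemma barrier (Phi : C -> R) (a0 eta : R) : B_regular Om -> wcont X Phi -> 0 < eta -> 0 <= a0 ->
  exists h (a : R), [/\ a0 <= a, wcont X h, forall L, subm Om (ext Om h L),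
    forall z, X z -> h z + a * eucl z <= Phi z - eta / 8 & forall z, bd z -> h z + a * eucl z = Phi z - eta / 4].
Proof.
move=> Br cPhi eta0 a00.
have bX : bd `<=` X by move=> z [].
have data g : wcont X g -> exists h, [/\ psh Om (EFin \o h), wcont X h & forall z, bd z -> h z = g z].
  move=> cg; have [|h [p1 p2 p3]] := Br g; first by apply/wcontP; exact: wcontS bX cg.
  by exists h; split=> //; apply/wcontP.
have ce : wcont X eucl by exact: wcont_smooth smooth_eucl.
have [|h [ph ch hb]] := data (fun z => Phi z - (eta / 4 + a0 * eucl z)).
  by apply: wcontB => //; apply: wcontD; [exact: wcont_smooth (smooth_cst _)|exact: wcontZ].
have [|h1 [ph1 ch1 h1b]] := data (fun z => -1 * eucl z); first exact: wcontZ.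
have {}h1b z : bd z -> h1 z = - eucl z by move=> /h1b ->; rewrite mulN1r.
have cs : wcont X (fun z => h1 z + eucl z) by exact: wcontD.
pose q z := h z + a0 * eucl z - Phi z + eta / 8.
have cq : wcont X q. apply: wcontD; last exact: wcont_smooth (smooth_cst _).
  by apply: wcontB => //; apply: wcontD => //; exact: wcontZ.
have q_neg z : X z -> 0 <= q z -> h1 z + eucl z < 0.
  move=> Xz qz; apply: eucl_add_lt0 => //; have [//|/hb hz] := closureP Xz.
  by move: qz; rewrite /q hz => qz; exfalso; move: qz eta0; lra.
have [k k0 kP] := wcont_neg cX cs cq q_neg.
have [B B0 BP] := wcont_bounded cX cq.
(* Where the excess q is nonnegative it is at most B, while h1 + |z|^2 <= - k. *)
pose K := B / k; have K0 : 0 <= K by rewrite divr_ge0 // ltW.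
have bdd g : wcont X g -> exists B, forall z, Om z -> `|g z| <= B.
  by move=> cg; have [B' _ BP'] := wcont_bounded cX cg; exists B' => z /XO; exact: BP'.
exists (fun z => h z + K * h1 z), (a0 + K); split.
- by rewrite lerDl.
- by apply: wcontD => //; exact: wcontZ.
- move=> L; have [M1 HM1] := bdd h ch; have [M2 HM2] := bdd h1 ch1.
  have e g l : wcont X g -> wcont Om (ext Om g l).
    move=> /(wcontS XO) cg z Oz e e0; have [d d0 dP] := cg z Oz e e0; exists d => // y Oy yz.
    by rewrite !ext_in //; exact: dP.
  have := subm_comb K0 (psh_subm oOm L ph HM1) (psh_subm oOm 0 ph1 HM2) (e h L ch) (e h1 0 ch1).
  congr (subm _ _); apply/funext => z; case: (pselect (Om z)) => Oz; first by rewrite !ext_in.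
  by rewrite !ext_out // mulr0 addr0.
- move=> z Xz; have sz : h1 z + eucl z <= 0. have [Oz|/h1b ->] := closureP Xz; last by rewrite addNr.
    by apply: ltW; exact: eucl_add_lt0. have : q z + K * (h1 z + eucl z) <= 0.
    case: (leP 0 (q z)) => qz; last by rewrite -oppr_ge0 opprD addr_ge0 // ?oppr_ge0 ?(ltW qz) // mulr_ge0_le0.
    apply: (@le_trans _ _ (B + K * (- k))).
      by apply: lerD; [apply: le_trans (ler_norm _) (BP z Xz)|apply: ler_wpM2l => //; exact: kP].
    by rewrite mulrN /K divfK ?subrr // gt_eqF.
  rewrite /q mulrDr mulrDl; move: (K * h1 z) (K * eucl z) (a0 * eucl z) => p1 p2 p3; lra.
- move=> z bz; rewrite (hb z bz) (h1b z bz) mulrDl mulrN. by move: (K * eucl z) (a0 * eucl z) => p2 p3; lra.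
Qed.

Lemma approx_above h (e r : R) : wcont X h -> (forall L, subm Om (ext Om h L)) -> 0 < e -> 0 < r ->
  exists g, [/\ smooth g, forall z, Om z -> g z <= h z + e &
    forall z, room Om r z -> h z <= g z /\ forall b, 0 <= Lap b g z].
Proof.
move=> ch sh e0 r0; have [d d0 dP] := wcont_unif cX ch e0.
have [B B0 BP] := wcont_bounded cX ch.
pose dl := Num.min d (r / 2); have dl0 : 0 < dl by rewrite lt_min d0 divr_gt0.
have dlr : dl < r by rewrite gt_min; apply/orP; right; rewrite ltr_pdivrMr // ltr_pMr // ltr1n.
(* With outside value - B <= h, averaging across the boundary cannot exceed h + e. *)
have sb := sh (- B); have [bb _ _] := sb.
exists (A dl (ext Om h (- B))); split.
- exact: smooth_A.
- move=> z Oz; apply: A_near_le => // [|y yz]; first exact: ltW.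
  have hz := BP z (XO Oz); case: (pselect (Om y)) => Oy.
    rewrite ext_in //; have := dP y z (XO Oy) (XO Oz) (le_trans yz _).
    rewrite ge_min lexx => /(_ isT); rewrite ler_norml => /andP[_]. by rewrite lerBlDl.
  by rewrite ext_out //; move: hz e0; rewrite ler_norml => /andP[h1 _]; lra.
move=> z rz; have Oz : Om z by exact: room_center (ltW r0) rz.
split; last by move=> b; apply: Lap_A_ge0 rz => //; rewrite dl0.
rewrite -(ext_in h (- B) Oz); apply: le_A => //; first exact: ltW.
exact: room_le (ltW dlr) rz.
Qed.

Variables (c M : R) (f u : C -> R).
Hypotheses (Om0 : Om !=set0) (Br : B_regular Om) (c0 : 0 < c)
  (cf : wcont X f) (f0 : forall z, X z -> 0 <= f z) (pu : psh Om (EFin \o u))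
  (uM : forall z, Om z -> `|u z| <= M) (MA : monge_ampere_ge c Om u f).
Let N : R := n`!%:R * (2 * c) ^+ n.

Let N0 : 0 < N.
Proof. by rewrite mulr_gt0 ?ltr0n ?fact_gt0 // exprn_gt0 // mulr_gt0. Qed.
Let mf : mfun_on Om f.
Proof. by apply: strict_usc_measurable => //; apply: wcont_strict_usc => //; exact: wcontS XO cf. Qed.

Lemma density_root : exists (lam : C -> R) (L : R), 0 <= L /\ forall z, X z ->
  [/\ 0 <= lam z, lam z <= L & N * lam z ^+ n = f z].
Proof.
have [B B0 BP] := wcont_bounded cX cf.
have rt z : exists r : R, X z -> 0 <= r /\ N * r ^+ n = f z. case: (pselect (X z)) => Xz; last by exists 0.
  have [|r r0 rE] := @nth_root R (f z / N) n'; first by rewrite divr_ge0 ?f0 // ltW.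
  by exists r => _; split=> //; rewrite rE mulrC divfK // gt_eqF.
have [lam lamP] := choice rt.
have [|L L0 LE] := @nth_root R (B / N) n'; first by rewrite divr_ge0 // ltW.
exists lam, L; split=> // z Xz; have [l0 lE] := lamP z Xz; split=> //.
rewrite -(ler_pXn2r (n := n)) ?nnegrE // LE ler_pdivlMr // mulrC lE.
exact: le_trans (ler_norm _) (BP z Xz).
Qed.

(** R0 is an average of u plus tau |z|^2 and a constant. At scale eps the density drops by at most N
    tau^n, so [linear_bound] provides the root lm of the lowered density; tau |z|^2 contributes tau
    more, and lam <= lm + tau by [exp_add_ge]. *)
Lemma start (lam Phi : C -> R) (eta r t : R) : (forall z, X z -> 0 <= lam z /\ N * lam z ^+ n = f z) ->
  wcont X Phi -> 0 < eta -> 0 < r -> 0 < t -> (forall z y, X z -> Om y -> `|y - z| <= r -> u y <= Phi z - eta) ->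
  exists R0 : C -> R, [/\ smooth R0, forall z, X z -> R0 z <= Phi z - 3 / 4 * eta,
    forall z, room Om t z -> spos (4 * n%:R * lam z) R0 z &
    exists2 s : R, 0 < s & forall z y, room Om t z -> Om y -> `|y - z| <= s -> u y + eta / 16 <= R0 z].
Proof.
move=> lamP cPhi eta0 r0 t0 uPhi.
have [Be Be0 BeP] : exists2 B, 0 <= B & forall z, X z -> `|eucl z| <= B.
  by apply: wcont_bounded cX _; exact: wcont_smooth smooth_eucl.
have [Bp Bp0 BpP] := wcont_bounded cX cPhi.
pose tau := eta / 8 / (Be + 1); have tau0 : 0 < tau by rewrite !divr_gt0 // ltr_wpDl.
have tauE z : X z -> tau * eucl z <= eta / 8.
  move=> Xz; rewrite -[leRHS](@divfK _ (Be + 1)) ?gt_eqF ?ltr_wpDl // ler_wpM2l ?(ltW tau0) //.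
  by apply: le_trans (ler_norm _) _; apply: le_trans (BeP z Xz) _; rewrite lerDl.
have Nt0 : 0 < N * tau ^+ n by rewrite mulr_gt0 // exprn_gt0.
have [df df0 dfP] := wcont_unif cX cf Nt0.
pose eps := Num.min (t / 2) (Num.min (df / 2) r).
have eps0 : 0 < eps by rewrite !lt_min r0 !divr_gt0.
have [et ed er] : [/\ 2 * eps <= t, 2 * eps <= df & eps <= r]. have : eps <= eps by [].
  by rewrite {2}/eps !le_min => /and3P[h1 h2 h3]; split=> //; [move: h1; lra|move: h2; lra].
(* The outside value is at most Phi - eta, so the upper bound on the average survives. *)
pose L := - (Bp + eta); pose U := ext Om u L.
have sU : subm Om U by exact: psh_subm uM.
have [bU _ _] := sU.
have MU : monge_ampere_ge c Om U f. by apply: monge_ampere_ge_congr MA => z; rewrite inE => Oz; rewrite /U ext_in.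
have sA : smooth (A eps U) by exact: smooth_A.
exists (fun z => A eps U z + tau * eucl z + eta / 8); split.
- by apply: smoothD (smooth_cst _); apply: smoothD => //; apply: smoothZ; exact: smooth_eucl.
- move=> z Xz; have h : A eps U z <= Phi z - eta. apply: A_near_le => // [|y yz]; first exact: ltW.
    case: (pselect (Om y)) => Oy; first by rewrite /U ext_in // uPhi // (le_trans yz).
    rewrite /U ext_out // /L; have := BpP z Xz; rewrite ler_norml => /andP[h _]; move: h; lra.
  by have := tauE z Xz; move: h; move: (tau * _) => q; lra.
- move=> z tz; have rz : room Om (2 * eps) z by exact: room_le et tz.
  have e20 : 0 <= 2 * eps by rewrite mulr_ge0 // ltW.
  have Oz := room_center e20 rz; have [l0 lE] := lamP z (XO Oz). pose m0 := Num.max 0 (f z - N * tau ^+ n).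
  have [|lm lm0 lmE] := @nth_root R (m0 / N) n'; first by rewrite divr_ge0 ?(ltW N0) // le_max lexx.
  have NlE : N * lm ^+ n = m0 by rewrite lmE mulrC divfK // gt_eqF.
  apply: (@spos_le _ _ (4 * n%:R * lm + 4 * n%:R * tau)).
    rewrite -mulrDr ler_wpM2l ?mulr_ge0 // -(ler_pXn2r (n := n)) ?nnegrE // ?addr_ge0 ?(ltW tau0) //.
    apply: le_trans (exp_add_ge _ lm0 (ltW tau0)); rewrite -(ler_pM2l N0) lE mulrDr NlE -lerBlDr.
    by rewrite le_max lexx orbT. apply: sposD_eucl => // [b|Bm bs dB bsE].
    by apply: Lap_A_ge0 sU rz; rewrite eps0 ltr_pMl // ltr1n.
  have fm y : `|y - z| <= 2 * eps -> Om y /\ m0 <= f y.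
    move=> yz; have Oy := rz y yz; split=> //; rewrite ge_max f0 /=; last exact: XO.
    have := dfP y z (XO Oy) (XO Oz) (le_trans yz ed); rewrite ler_norml => /andP[h _].
    by move: h; move: (N * _) => q; lra. have NlE' : N * lm ^+ n <= m0 by rewrite NlE.
  exact: (linear_bound oOm c0 mf sU MU eps0 fm lm0 NlE' dB bsE).
have eta16 : 0 < eta / 16 by rewrite divr_gt0.
have [s s0 sP] := wcont_unif cX (wcont_smooth (A := X) sA) eta16.
exists (Num.min s eps); first by rewrite lt_min s0.
move=> z y tz Oy; rewrite le_min => /andP[y1 y2].
have Oz := room_center (ltW t0) tz.
have ry : room Om eps y. have h : room Om (eps + eps) z by apply: room_le tz; rewrite -mulr2n -mulr_natl.
  exact: room_near y2 h.
have h1 : u y <= A eps U y by rewrite -(ext_in u L Oy); apply: le_A sU (ltW eps0) ry.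
have h2 : A eps U y <= A eps U z + eta / 16.
  by have := sP y z (XO Oy) (XO Oz) y1; rewrite ler_norml => /andP[_]; rewrite lerBlDl.
have h3 : 0 <= tau * eucl z by rewrite mulr_ge0 ?(ltW tau0) // eucl_ge0.
by move: h1 h2 h3; move: (A _ _ _) (A _ _ _) (tau * _) => p q w; lra.
Qed.

(** Take h + a |z|^2 + t (2 chi - 1) with h replaced by an average g: raised by t inside, lowered by
    t near the boundary. As g <= h + t / 8, and g >= h where there is room r, the constants 7/8 and
    9/8 appear. For t <= 1 / (k + 1) the term 2 t chi costs at most 2 |b|^2 in the Laplacian, that
    is 1/2 of the coefficient a >= L + 1. *)
Lemma b_term (h : C -> R) (a L : R) (r : R) : 0 <= L -> L + 1 <= a -> wcont X h ->
  (forall B, subm Om (ext Om h B)) -> 0 < r -> exists2 t1 : R, 0 < t1 &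
  forall t, 0 < t -> t <= t1 -> exists b_ : C -> R, [/\ smooth b_,
    forall z, Om z -> b_ z <= h z + a * eucl z + 9 / 8 * t,
    forall z s, 4 * r < s -> room Om s z -> h z + a * eucl z + 7 / 8 * t <= b_ z,
    forall z, room Om r z -> h z + a * eucl z - 9 / 8 * t <= b_ z /\ forall l, l <= L -> spos (4 * n%:R * l) b_ z &
    forall z, Om z -> ~ room Om r z -> b_ z <= h z + a * eucl z - 7 / 8 * t].
Proof.
move=> L0 La ch sh r0; have [chi [schi chi01 chi1 chi0 [k k0 kP]]] := cutoff r0.
have k1 : 0 < k + 1 by rewrite ltr_wpDl.
exists (k + 1)^-1; first by rewrite invr_gt0.
move=> t t0 tk; have t80 : 0 < t / 8 by rewrite divr_gt0.
have [g [sg g_le g_room]] := approx_above ch sh t80 r0.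
have sb1 : smooth (fun z => g z + a * eucl z) by apply: smoothD => //; apply: smoothZ; exact: smooth_eucl.
have sb2 : smooth (fun z => 2 * t * chi z) by exact: smoothZ.
exists (fun z => g z + a * eucl z + 2 * t * chi z - t); split.
- by apply: smoothB (smooth_cst _); exact: smoothD.
- move=> z Oz; have := g_le z Oz; have /andP[_ /(ler_wpM2l (ltW t0))] := chi01 z.
  rewrite mulr1 -[2 * t * _]mulrA; move: (t * chi z) (a * _) => p q; lra.
- move=> z s rs sz; have rz : room Om r z. apply: room_le sz; move: rs r0; lra.
  have [h1 _] := g_room z rz; rewrite (chi1 z s) // mulr1; move: h1; move: (a * _) => q; lra.
- move=> z rz; have [h1 h2] := g_room z rz; have /andP[h3 _] := chi01 z; split.
    have := mulr_ge0 (ltW t0) h3; rewrite -[2 * t * _]mulrA; move: h1; move: (a * _) (t * chi z) => q p; lra.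
  move=> l lL; apply: (@spos_le _ _ (4 * n%:R * (a - 1 / 2))).
    by rewrite ler_wpM2l ?mulr_ge0 //; move: La lL; lra. apply: spos_of_Lap => [|b]; first by move: La L0; lra.
  rewrite LapB; [|exact: smoothD|exact: smooth_cst].
  rewrite Lap_cst subr0 LapD // LapD ?LapZ ?Lap_eucl //; [|exact: smooth_eucl|by apply: smoothZ; exact: smooth_eucl].
  have h4 : - (t * Lap b chi z) <= eucl b. rewrite -mulrN; apply: (@le_trans _ _ (t * (k * eucl b))).
      by rewrite ler_wpM2l ?(ltW t0) //; apply: le_trans (kP z b); rewrite -normrN ler_norm.
    rewrite mulrA ler_piMl ?eucl_ge0 //; apply: (@le_trans _ _ ((k + 1)^-1 * (k + 1))).
      by apply: ler_pM; rewrite ?(ltW t0) // lerDl. by rewrite mulVf // gt_eqF.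
  have := h2 b; move: h4; rewrite -[2 * t * _]mulrA [a * (4 * _)]mulrCA -mulrA [(a - _) * _]mulrBl.
  by move: (eucl b) (Lap b g z) (t * _) => e p q; move: (a * e) => ae; lra.
move=> z Oz nz; have := g_le z Oz; rewrite chi0 // mulr0; move: (a * _) => q; lra.
Qed.

(** The set where Phi - v >= eta / 2 keeps distance t1 from the complement, and there R0 has the
    required positivity. Elsewhere R0 may fail it, but is below v - eta / 4, and the levels b_ j
    take over. Near the boundary w - v is at most 2 t_i, hence w extends continuously by v. The last
    conclusion is the gap hypothesis for the next application. *)
Lemma main_step (Phi : C -> R) (eta r : R) : wcont X Phi -> 0 < eta -> 0 < r ->
  (forall z y, X z -> Om y -> `|y - z| <= r -> u y <= Phi z - eta) ->
  exists w : C -> R, [/\ psh Om (EFin \o w), wcont X w, monge_ampere_ge c Om w f, forall z, X z -> w z <= Phi z &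
    exists d s : R, [/\ 0 < d, 0 < s & forall z y, X z -> Om y -> `|y - z| <= s -> u y <= w z - d]].
Proof.
move=> cPhi eta0 r0 uPhi.
have [lam [L [L0 lamP]]] := density_root.
have lam1 z : X z -> 0 <= lam z /\ N * lam z ^+ n = f z by move=> /lamP[].
have [h [a [La ch sh v_le v_bd]]] := barrier Br cPhi eta0 (addr_ge0 L0 ler01).
pose v z := h z + a * eucl z.
have cv : wcont X v by apply: wcontD => //; apply: wcontZ; exact: wcont_smooth smooth_eucl.
have cp : wcont X (fun z => Phi z - v z - eta / 2).
  by apply: wcontB; [exact: wcontB|exact: wcont_smooth (smooth_cst _)].
have pOm z : X z -> 0 <= Phi z - v z - eta / 2 -> Om z.
  by move=> Xz; have [//|/v_bd vz] := closureP Xz; rewrite /v vz => pz; exfalso; move: pz eta0; lra.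
have [t1 t10 t1P] := room_compact oOm cX cp pOm.
have [R0 [sR0 R0_le R0_spos [s s0 sP]]] := start lam1 cPhi eta0 r0 t10 uPhi.
pose r_ j : R := j.+1%:R^-1; have rj0 j : 0 < r_ j by rewrite invr_gt0.
have r_mono i j : (i <= j)%N -> r_ j <= r_ i. by move=> ij; rewrite /r_ lef_pV2 ?posrE ?ltr0n // ler_nat ltnS.
have tj j : exists t2 : R, 0 < t2 /\ forall t, 0 < t -> t <= t2 -> exists b_ : C -> R, [/\ smooth b_,
    forall z, Om z -> b_ z <= v z + 9 / 8 * t, forall z s, 4 * r_ j < s -> room Om s z -> v z + 7 / 8 * t <= b_ z,
    forall z, room Om (r_ j) z -> v z - 9 / 8 * t <= b_ z /\ forall l, l <= L -> spos (4 * n%:R * l) b_ z &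
    forall z, Om z -> ~ room Om (r_ j) z -> b_ z <= v z - 7 / 8 * t].
  by have [t2 t20 H] := b_term L0 La ch sh (rj0 j); exists t2.
have [T_ TP] := choice tj; have T0 j := (TP j).1; have {}TP j := (TP j).2.
(* The bound t_(j-1) / 16 serves the chain, T_ j the positivity of b_ j, and 1 / (j + 1) makes t_j
   tend to 0; the initial eta / 16 keeps v + 2 t_0 below Phi and places R0 below v - 4 t_0 outside
   its good region. *)
pose t_ := fix t_ j : R := if j is j'.+1 then Num.min (t_ j' / 16) (Num.min (T_ j) (r_ j))
  else Num.min (eta / 16) (Num.min (T_ 0%N) (r_ 0%N)).
have t0 j : 0 < t_ j by elim: j => [|j IH] /=; rewrite !lt_min ?T0 ?rj0 !divr_gt0.
have tS j : t_ j.+1 <= t_ j / 16 by rewrite /= ge_min lexx.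
have tT j : t_ j <= T_ j by case: j => [|j] /=; rewrite !ge_min lexx !orbT.
have tr j : t_ j <= r_ j by case: j => [|j] /=; rewrite !ge_min lexx !orbT.
have teta : t_ 0%N <= eta / 16 by rewrite /= ge_min lexx.
have [b_ bP] := choice (fun j => TP j (t_ j) (t0 j) (tT j)).
have sb j : smooth (b_ j) by case: (bP j).
have b_le j z : Om z -> b_ j z <= v z + 9 / 8 * t_ j by case: (bP j) => _ h1 _ _ _; exact: h1.
pose D j := [set z | exists2 t : R, 4 * r_ j < t & room Om t z].
have b_D j z : D j z -> v z + 7 / 8 * t_ j <= b_ j z. by case: (bP j) => _ _ h1 _ _ [t]; exact: h1.
have b_far j z : Om z -> ~ room Om (r_ j) z -> b_ j z <= v z - 7 / 8 * t_ j.
  by case: (bP j) => _ _ _ _ h1; exact: h1.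
pose l z := 4 * n%:R * lam z.
have b_dich j z : Om z -> (spos (l z) (b_ j) z /\ v z - 9 / 8 * t_ j <= b_ j z) \/ b_ j z <= v z - 7 / 8 * t_ j.
  move=> Oz; case: (pselect (room Om (r_ j) z)) => rz; last by right; exact: b_far.
  by left; case: (bP j) => _ _ _ /(_ z rz)[h1 h2] _; split=> //; apply: h2; have [] := lamP z (XO Oz).
have R0_v z : X z -> ~ room Om t1 z -> R0 z <= v z - eta / 4.
  move=> Xz nz; have : ~ 0 <= Phi z - v z - eta / 2 by move=> pz; apply: nz; exact: t1P.
  move=> /negP; rewrite -ltNge; have := R0_le z Xz; lra.
have R0_dich z : Om z -> spos (l z) R0 z \/ R0 z <= v z - 4 * t_ 0%N.
  move=> Oz; case: (pselect (room Om t1 z)) => tz; first by left; exact: R0_spos.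
  by right; have := R0_v z (XO Oz) tz; move: teta; lra.
have DO j z : D j z -> Om z. by move=> [t rt tz]; apply: room_center tz; have := rj0 j; move: rt; lra.
have oD j : open (D j) by exact: nrs_open.
have DK (A : set C) : compact A -> A `<=` Om -> exists i, A `<=` D i.
  move=> cA AO; have c1 : wcont A (fun=> 0) by exact: wcont_smooth (smooth_cst _).
  have [t t20 tP] := room_compact oOm cA c1 (fun z Az _ => AO z Az). have t40 : 0 < t / 4 by rewrite divr_gt0.
  have [k kP] := inv_lt t40; exists k => z Az; exists t; last exact: tP.
  by have := kP k (leqnn k); rewrite -/(r_ k); move: (r_ k) => q; lra.
have in_D z : Om z -> exists i, D i z.
  by move=> Oz; have [|i H] := DK _ (@compact_set1 _ z); [by move=> _ ->|exists i; exact: H].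
pose W i := chain R0 b_ t_ i.+1.
have sW i : smooth (W i) by exact: smooth_chain.
have WE i j z : D i z -> D j z -> W i z = W j z. move=> Di Dj; rewrite /W.
  rewrite -(chain_D R0 t0 tS b_le b_D DO Di (leq_maxl _ _ : (i < maxn i.+1 j.+1)%N)).
  by rewrite -(chain_D R0 t0 tS b_le b_D DO Dj (leq_maxr _ _ : (j < maxn i.+1 j.+1)%N)).
have iz z : exists i, Om z -> D i z.
  by case: (pselect (Om z)) => Oz; [have [i Di] := in_D z Oz; exists i|exists 0%N].
have [i_ iP] := choice iz.
(* By [WE] the value is independent of the index chosen. *)
pose w := fun z => if z \in Om then W (i_ z) z else v z.
have wW i z : D i z -> w z = W i z.
  by move=> Di; have Oz := DO i z Di; rewrite /w mem_set //; apply: WE => //; exact: iP.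
have w_bd z : ~ Om z -> w z = v z by move=> nz; rewrite /w memNset.
have w_v z : v z <= w z. case: (pselect (Om z)) => Oz; last by rewrite w_bd.
  have [i Di] := in_D z Oz; rewrite (wW i z Di); apply: le_trans (glue_ger _ _ _ _); last first.
    by rewrite divr_gt0. by apply: le_trans (b_D i z Di); rewrite lerDl mulr_ge0 // ltW.
have w_R0 z : Om z -> R0 z <= w z. move=> Oz; have [i Di] := in_D z Oz; rewrite (wW i z Di).
  exact: (chain_mono R0 b_ t0 z (leq0n i.+1)).
have near_bd i y : Om y -> ~ room Om (r_ i) y -> ~ room Om t1 y -> w y <= v y + 2 * t_ i.
  move=> Oy ny n1; have [j Dj] := in_D y Oy; rewrite (wW j y Dj). apply: (chain_far t0 tS b_le j.+1 Oy).
    by have := R0_v y (XO Oy) n1; move: eta0; lra.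
  move=> k ki; apply: b_far => // rk; apply: ny; apply: room_le rk; apply: r_mono; exact: ltnW.
have Wspos i z : D i z -> spos (l z) (W i) z.
  by move=> Di; exact: (chain_spos sR0 sb t0 tS b_D b_dich R0_dich DO Di).
have Wpos i z b : D i z -> 0 <= Lap b (W i) z. by move=> Di; exact: spos_Lap_ge0 (sW i) (Wspos i z Di).
exists w; split.
- exact: (locally_smooth_psh oD DK sW wW Wpos Om0).
- move=> z Xz e e0; have [Oz|bz] := closureP Xz.
    have [i Di] := in_D z Oz; have /nbhs_norm_le[d d0 dP] : nbhs z (D i) by exact: open_nbhs_nbhs.
    have [d2 d20 d2P] := wcont_smooth (A := X) (sW i) Xz e0.
    exists (Num.min d d2); first by rewrite lt_min d20 d0. move=> y Xy; rewrite le_min => /andP[/dP Dy y2].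
    by rewrite (wW i z Di) (wW i y Dy); exact: d2P.
  have nz : ~ Om z by case: bz => _; rewrite /interior => nz Oz; apply: nz; exact: open_nbhs_nbhs.
  have e40 : 0 < e / 4 by rewrite divr_gt0.
  have [i iP2] := inv_lt e40; have ti : t_ i <= e / 4 by apply: le_trans (tr i) _; apply: ltW; exact: iP2.
  have e20 : 0 < e / 2 by rewrite divr_gt0.
  have [d d0 dP] := cv z Xz _ e20; exists (Num.min d (Num.min (r_ i) t1)). by rewrite !lt_min d0 rj0.
  move=> y Xy; rewrite !le_min => /and3P[y1 y2 y3]; have := dP y Xy y1.
  rewrite (w_bd z nz) !ler_norml => /andP[h1 h2]. have wy : w y <= v y + 2 * t_ i.
    case: (pselect (Om y)) => Oy; last by rewrite w_bd // lerDl mulr_ge0 // ltW.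
    by apply: near_bd => // H; apply: nz; apply: H; rewrite distrC.
  by have := w_v y; move: h1 h2 wy ti; move: (t_ i) (v y) (w y) (v z) => p q p2 q2; lra.
- apply: (locally_smooth_MA oOm c0 oD DO DK sW wW Wpos mf) => [z /XO|i z Di]; first exact: f0.
  have Oz := DO i z Di; have [l0 lE] := lam1 z (XO Oz); rewrite -lE /N mulrAC [leLHS]mulrC.
  rewrite ler_wpM2l ?exprn_ge0 ?mulr_ge0 ?(ltW c0) //. exact: spos_det (ltn0Sn _) (sW i) l0 (Wspos i z Di).
- move=> z Xz; have hv : v z + 2 * t_ 0%N <= Phi z by have := v_le z Xz; rewrite -/(v z); move: teta; lra.
  case: (pselect (Om z)) => Oz; last first. by rewrite w_bd //; apply: le_trans hv; rewrite lerDl mulr_ge0 // ltW.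
  have [i Di] := in_D z Oz; rewrite (wW i z Di). apply: le_trans (chain_le R0 t0 tS b_le i.+1 Oz) _.
  by rewrite ge_max hv andbT; have := R0_le z Xz; move: eta0; lra.
exists (eta / 16), (Num.min s r); rewrite divr_gt0 // lt_min s0 r0; split=> // z y Xz Oy.
rewrite le_min => /andP[y1 y2]; case: (pselect (room Om t1 z)) => tz.
  have h1 := sP z y tz Oy y1; have h2 := w_R0 z (room_center (ltW t10) tz). by move: h1 h2; lra.
(* Here w >= v > Phi - eta / 2, whereas u <= Phi - eta. *)
have : ~ 0 <= Phi z - v z - eta / 2 by move=> pz; apply: tz; exact: t1P.
by move=> /negP; rewrite -ltNge; have := uPhi z y Xz Oy y2; have := w_v z; move: eta0; lra.
Qed.

(** The invariant of the construction; its last clause is the hypothesis of [main_step] with w in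
    place of Phi. *)
Let ok w := [/\ psh Om (EFin \o w), wcont X w, monge_ampere_ge c Om w f &
  exists d s : R, [/\ 0 < d, 0 < s & forall z y, X z -> Om y -> `|y - z| <= s -> u y <= w z - d]].

(** The term 1 / (k + 1) creates the uniform gap above u. *)
Let g k z := lip_env Om u k z + k.+1%:R^-1.

Let cg k : wcont X (g k).
Proof. by apply: wcontD; [exact: (wcont_lip_env Om0 uM)|exact: wcont_smooth (smooth_cst _)]. Qed.
Let g_ge k : exists d s : R, [/\ 0 < d, 0 < s & forall z y, X z -> Om y -> `|y - z| <= s -> u y <= g k z - d].
Proof.
have i0 : 0 < k.+1%:R^-1 :> R by rewrite invr_gt0.
exists (k.+1%:R^-1 / 2), (k.+1%:R^-1 / 2 * k.+1%:R^-1); rewrite mulr_gt0 ?divr_gt0 //; split=> // z y _ Oy yz.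
have h : k%:R * `|z - y| <= k.+1%:R^-1 / 2. apply: (@le_trans _ _ (k.+1%:R * (k.+1%:R^-1 / 2 * k.+1%:R^-1))).
    by apply: ler_pM => //; [rewrite ler_nat|rewrite distrC]. by rewrite mulrC divfK // pnatr_eq0.
have := lip_env_ge uM k z Oy; rewrite /g; move: h; move: (k%:R * _) (k.+1%:R^-1) => p q; lra.
Qed.
(** The condition [ok w] sits inside the existential, so that one choice function is defined on all
    pairs and the sequence is given by plain recursion. *)
Let next w k : exists w', ok w -> [/\ ok w', forall z, X z -> w' z <= w z & forall z, X z -> w' z <= g k z].
Proof.
case: (pselect (ok w)) => [[pw cw mw [d1 [s1 [d10 s10 H1]]]]|no]; last by exists w.
have [d2 [s2 [d20 s20 H2]]] := g_ge k.
pose d := Num.min d1 d2; pose s := Num.min s1 s2.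
have dd1 : d <= d1 by rewrite ge_min lexx.
have dd2 : d <= d2 by rewrite ge_min lexx orbT.
have [|||w' [p1 p2 p3 p4 p5]] := main_step (wcont_min cw (cg k)) (eta := d) (r := s).
- by rewrite lt_min d10.
- by rewrite lt_min s10.
- move=> z y Xz Oy; rewrite le_min => /andP[y1 y2]. have h1 := H1 z y Xz Oy y1; have h2 := H2 z y Xz Oy y2.
  by rewrite lerBrDr le_min; apply/andP; split; move: h1 h2 dd1 dd2; lra.
by exists w' => _; split=> // z Xz; have := p4 z Xz; rewrite le_min => /andP[].
Qed.
Let initial : exists w, ok w.
Proof. by have [d [s [d0 s0 H]]] := g_ge 0; have [w [h1 h2 h3 _ h4]] := main_step (cg 0) d0 s0 H; exists w.
Qed.

(** The gap keeps every term above u^*, and the term of index j + 1 lies below the Lipschitz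
    envelope plus 1 / (j + 2), which tends to u^* on the closure. *)
Lemma decreasing_approximation : exists u_ : nat -> C -> R,
  [/\ forall j, [/\ psh Om (EFin \o u_ j), wcont X (u_ j) & monge_ampere_ge c Om (u_ j) f],
      forall j z, X z -> u_ j.+1 z <= u_ j z
    & forall z, X z -> (u_ j z)%:E @[j --> \oo] --> usc_extension Om u z].
Proof.
have [F FP] := choice (fun p : (C -> R) * nat => next p.1 p.2).
have [w0 ok0] := initial.
pose w := fix w j : C -> R := if j is j'.+1 then F (w j', j) else w0.
have okw j : ok (w j) by elim: j => //= j IH; have [] := FP (w j, j.+1) IH.
have w_le j z : X z -> w j.+1 z <= w j z by have [_ h _] := FP (w j, j.+1) (okw j); exact: h.
have w_g j z : X z -> w j.+1 z <= g j.+1 z by have [_ _ h] := FP (w j, j.+1) (okw j); exact: h.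
exists w; split=> // [j|z Xz]; first by have [] := okw j.
have [l [-> Ml l_up l_le]] := usc_extensionP Xz uM.
apply: cvg_EFin; first by near=> j.
apply/cvgrPdist_le => e e0; have e20 : 0 < e / 2 by rewrite divr_gt0.
have [|p p0 pP] := l_up (l + e / 2); first by rewrite ltrDl.
(* For j >= 2 M / p a point y at distance more than p from z is penalized by at least 2 M in the
   envelope, and u y - 2 M <= - M <= l; only points where u <= l + e / 2 remain. *)
have [N1 N1P] := inv_lt e20; pose N2 := (Num.truncn (2 * M / p)).+1.
have N2P : 2 * M / p < N2%:R by rewrite /N2 truncnS_gt.
exists (maxn N1 N2).+1 => // -[//|j] /= jN; rewrite ltnS geq_max in jN; move/andP: jN => [j1 j2].
have h1 : l <= w j.+1 z. have [_ _ _ [d [s [d0 s0 H]]]] := okw j.+1; apply: (l_le _ s s0) => y Oy ys.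
  by apply: le_trans (H z y Xz Oy ys) _; rewrite gerBl ltW.
have h2 : lip_env Om u j.+1 z <= l + e / 2. apply: (lip_env_le Om0) => y Oy; case: (leP `|y - z| p) => yp.
    by apply: le_trans (pP y Oy yp); rewrite gerBl mulr_ge0.
  have hu : u y <= M by apply: le_trans (ler_norm _) (uM Oy). have : 2 * M <= j.+1%:R * `|z - y|.
    apply: (@le_trans _ _ (N2%:R * p)); first by rewrite -ler_pdivrMr // ltW.
    apply: ler_pM => //; rewrite ?(ltW p0) //; last by rewrite distrC ltW.
    by rewrite ler_nat; exact: leq_trans j2 _. by move: hu Ml e0; move: (j.+1%:R * _) => q; lra.
have h3 := w_g j z Xz; rewrite /g in h3.
have h4 : j.+2%:R^-1 < e / 2 by apply: N1P; exact: leq_trans j1 _.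
have h5 : w j.+1 z <= l + e by apply: le_trans h3 _; rewrite [e]splitr addrA; apply: lerD => //; exact: ltW.
by rewrite ler_norml; apply/andP; move: h1 h5 => /=; move: (F _ z) => q h1 h5; split; move: h1 h5 e0; lra.
Unshelve. all: end_near.
Qed.

End decreasing_approximation.

Theorem theorem5p10 (R : realType) (n : nat) (c : R) (c_gt0 : 0 < c)
    (Omega : set (Cn R n)) (f u : Cn R n -> R) :
  is_domain Omega -> bounded_set Omega -> B_regular Omega ->
  {within closure Omega, continuous f} ->
  (forall z, closure Omega z -> 0 <= f z) ->
  psh Omega (EFin \o u) ->
  (exists M : R, forall z, Omega z -> `|u z| <= M) ->
  monge_ampere_ge c Omega u f ->
  exists u_ : nat -> Cn R n -> R,
    [/\ forall j, psh Omega (EFin \o u_ j),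
        forall j, {within closure Omega, continuous (u_ j)},
        forall j, monge_ampere_ge c Omega (u_ j) f,
        forall j z, closure Omega z -> u_ j.+1 z <= u_ j z
      & forall z, closure Omega z ->
          (u_ j z)%:E @[j --> \oo] --> usc_extension Omega u z].
Proof.
case: n Omega f u => [|n] Omega f u [oO _ O0] bO Br /wcontP cf f0 pu [M uM] MA; last first.
  have [w [h1 h2 h3]] := decreasing_approximation oO bO O0 Br c_gt0 cf f0 pu uM MA.
  by exists w; split=> // j; have [? /wcontP ? ?] := h1 j.
(* C^0 is a point, where the constant sequence [u] does. *)
have pt (y z : Cn R 0) : y = z by case: y z => [y1 y2] [z1 z2]; congr pair; apply/rowP => -[].
exists (fun=> u); split=> // [j|z cz].
  by apply/wcontP => z _ e e0; exists 1 => // y _ _; rewrite (pt y z) subrr normr0 ltW.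
have [l [-> _ l_up l_le]] := usc_extensionP cz uM.
have Oz : Omega z by have [y Oy] := O0; rewrite (pt z y).
have -> : l = u z; last exact: cvg_cst.
apply/eqP; rewrite eq_le (l_le _ 1) => [|//|y _ _]; last by rewrite (pt y z).
rewrite leNgt; apply/negP => /midf_lt[h1 h2]; have [p p0 pP] := l_up _ h1.
by have := pP z Oz; rewrite subrr normr0 (ltW p0) leNgt h2 => /(_ isT).
Qed.
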